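(* There is at most one classical solution $$u\in\mathcal{C}^{1,2}\big([0,T)\times(\mathbb{R}\times\mathbb{R}^*_+)\big)\cap\mathcal{C}^{1,1,1}\big([0,T)\times\mathbb{R}\times\mathbb{R}_+\big)\cap\mathcal{C}\big([0,T]\times\mathbb{R}\times\mathbb{R}_+\big)$$ of the problem $$\begin{cases}\partial_tu(t,x,y)+\mathcal{L}u(t,x,y)+\varrho u(t,x,y)=h(t,x,y),&t\in[0,T),\ (x,y)\in\mathbb{R}\times\mathbb{R}_+,\\ u(T,x,y)=f(x,y),&(x,y)\in\mathbb{R}\times\mathbb{R}_+,\end{cases}$$ that has polynomial growth in $(x,y)$ uniformly in $t$. In particular, let $\alpha\in(0,1)$ and let $f,h$ be such that, for $j=0,1$, $\partial_x^{2j}f\in\mathcal{C}^{1-j}_{\mathbf{pol}}(\mathbb{R}\times\mathbb{R}_+)$ and $\partial_x^{2j}h\in\mathcal{C}^{1-j}_{\mathbf{pol},T}(\mathbb{R}\times\mathbb{R}_+)$, and $|h|^K_{\alpha,2}<\infty$, $|\partial_yh|^K_{\alpha,2}<\infty$ for every compact set $K\subset[0,T)\times\mathbb{R}\times\mathbb{R}_+$. Then $$u(t,x,y)=\mathbb{E}\Big[e^{\varrho(T-t)}f(X^{t,x,y}_T,Y^{t,y}_T)-\int_t^Te^{\varrho(s-t)}h(s,X^{t,x,y}_s,Y^{t,y}_s)\,ds\Big]$$ is the unique such solution.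
   Context: Notation: $\mathbb{R}_+=[0,\infty)$, $\mathbb{R}_+^*=(0,\infty)$. Parameters: $T>0$, $b,c,d,\varrho\in\mathbb{R}$, $a,\lambda,\sigma>0$, $\rho\in(-1,1)$, $\bar\rho=\sqrt{1-\rho^2}$. $\mathcal{C}^{1,2}$ means once continuously differentiable in $t$ and twice in $(x,y)$; $\mathcal{C}^{1,1,1}$ means once continuously differentiable in each of $t,x,y$ (up to the boundary $y=0$). Polynomial growth in $(x,y)$ uniformly in $t$ means $\sup_t|u(t,x,y)|\le C(1+|x|^L+y^L)$ for some $C,L>0$. For $(t,x,y)\in[0,T]\times\mathbb{R}\times\mathbb{R}_+$, $(X^{t,x,y},Y^{t,y})$ is the solution started at $(x,y)$ at time $t$ of $$dX_s=(c+dY_s)ds+\lambda\sqrt{Y_s}(\rho\,dW_s+\bar\rho\,dB_s),\qquad dY_s=(a-bY_s)ds+\sigma\sqrt{Y_s}\,dW_s,$$ with $(W,B)$ a standard two-dimensional Brownian motion, and $$\mathcal{L}=\tfrac y2(\lambda^2\partial_x^2+2\rho\lambda\sigma\partial_x\partial_y+\sigma^2\partial_y^2)+(c+dy)\partial_x+(a-by)\partial_y.$$ At $y=0$ the second-order terms of $\mathcal{L}u$, which carry the factor $y$, are understood as zero, so that the equation there reads $\partial_tu(t,x,0)+(c\partial_x+a\partial_y+\varrho)u(t,x,0)=h(t,x,0)$. $\mathcal{C}^q_{\mathbf{pol}}(\mathbb{R}\times\mathbb{R}_+)$: functions $g\in\mathcal{C}^q(\mathbb{R}\times\mathbb{R}_+)$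 for which there are $C,L>0$ with $|\partial_x^{i}\partial_y^{k}g(x,y)|\le C(1+|x|^L+y^L)$ for all $(x,y)$ and $i+k\le q$. $\mathcal{C}^q_{\mathbf{pol},T}(\mathbb{R}\times\mathbb{R}_+)$: functions $v\in\mathcal{C}^{\lfloor q/2\rfloor,q}([0,T)\times(\mathbb{R}\times\mathbb{R}_+))$ for which there are $C,L>0$ with $\sup_{t\in[0,T)}|\partial_t^{m}\partial_x^{i}\partial_y^{k}v(t,x,y)|\le C(1+|x|^L+y^L)$ for all $(x,y)$ and $2m+i+k\le q$. Weighted Hölder norms: for $P_i=(t_i,z_i)\in[0,T]\times\mathbb{R}^2$ let $d_{\mathcal{P}}(P_1,P_2)=(|t_1-t_2|+|z_1-z_2|^2)^{1/2}$. For $\mathcal{D}\subset[0,T]\times\mathbb{R}^2$ let $\partial\mathcal{D}_\tau=\{(t,z)\in\partial\mathcal{D}: t\in[0,\tau]\}$; for $Q=(\tau,z)\in\mathcal{D}$ let $d_Q=\inf_{P\in\partial\mathcal{D}_\tau}d_{\mathcal{P}}(Q,P)$, and $d_{Q_1,Q_2}=\min(d_{Q_1},d_{Q_2})$. For $v:\mathcal{D}\to\mathbb{R}$ and $m\in\mathbb{N}$, $$|v|^{\mathcal{D}}_{\alpha,m}=\sup_{P\in\mathcal{D}}d_P^m|v(P)|+\sup_{P\ne Q\in\mathcal{D}}d_{P,Q}^{m+\alpha}\frac{|v(P)-v(Q)|}{d_{\mathcal{P}}(P,Q)^\alpha}.$$ *)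

(* Defs.v *)
From HB Require Import structures.
From mathcomp Require Import all_boot all_order all_algebra.
From mathcomp Require Import all_classical all_reals all_analysis.
Set Implicit Arguments.
Unset Strict Implicit.
Unset Printing Implicit Defensive.
Import Order.TTheory GRing.Theory Num.Theory.
Import numFieldNormedType.Exports.
Local Open Scope classical_set_scope.
Local Open Scope ring_scope.

(** * Partial derivatives up to the boundary *)

Section partial_derivatives.
Context {R : realType}.
Implicit Types (I : set R) (g : R -> R -> R) (u : R -> R -> R -> R).

(* Derivative relative to I: the increments are restricted to those that stay
   in I, so it is one-sided at an endpoint that belongs to I, and the usual
   derivative at an interior point of I. *)
Definition quotient_on I (k : R -> R) (x : R) : set_system R :=
  (fun h => h^-1 * (k (h + x) - k x)) @ within [set h | I (h + x)] 0^'.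
Definition derivable_on I k x := cvg (quotient_on I k x).
Definition derive_on I k x : R := lim (quotient_on I k x).

(* Functions g x y on R x R_+. *)
Definition ex_dx g x y := derivable (fun z => g z y) x 1.
Definition dx g : R -> R -> R := fun x y => derive1 (fun z => g z y) x.
Definition ex_dy g x y := derivable_on `[0, +oo[ (g x) y.
Definition dy g : R -> R -> R := fun x y => derive_on `[0, +oo[ (g x) y.

(* Functions u t x y on [0,T) x R x R_+. *)
Definition Dx u : R -> R -> R -> R := fun t => dx (u t).
Definition Dy u : R -> R -> R -> R := fun t => dy (u t).
Definition ex_dt (T : R) u t x y := derivable_on `[0, T[ (fun s => u s x y) t.
Definition Dt (T : R) u : R -> R -> R -> R :=
  fun t x y => derive_on `[0, T[ (fun s => u s x y) t.

End partial_derivatives.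

(** * Function spaces *)

Section function_spaces.
Context {R : realType}.
Implicit Types (g : R -> R -> R) (u v : R -> R -> R -> R).

Definition half_plane : set (R * R) := [set z | 0 <= z.2].

(* [0,T) x R x R_+, [0,T) x R x R_+^* and [0,T] x R x R_+ *)
Definition slab (T : R) : set (R * R * R) := [set p | 0 <= p.1.1 < T /\ 0 <= p.2].
Definition open_slab (T : R) : set (R * R * R) :=
  [set p | 0 <= p.1.1 < T /\ 0 < p.2].
Definition closed_slab (T : R) : set (R * R * R) :=
  [set p | 0 <= p.1.1 <= T /\ 0 <= p.2].

Definition continuous2_on (D : set (R * R)) g :=
  {within D, continuous (fun z : R * R => g z.1 z.2)}.
Definition continuous3_on (D : set (R * R * R)) u :=
  {within D, continuous (fun p : R * R * R => u p.1.1 p.1.2 p.2)}.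

(* C^q(R x R_+): all the iterated partial derivatives of order at most q exist
   and are continuous on R x R_+. *)
Fixpoint Cspace (q : nat) g : Prop :=
  continuous2_on half_plane g /\
  if q is q'.+1 then
    [/\ (forall x y, 0 <= y -> ex_dx g x y /\ ex_dy g x y),
        Cspace q' (dx g) & Cspace q' (dy g)]
  else True.

(* C^{floor(q/2),q}(D) in the parabolic sense: the iterated partial derivatives
   with m derivations in t and l in (x, y), 2m + l <= q, exist and are
   continuous on D, for D one of the above subsets of [0,T) x R x R_+. *)
Fixpoint Cpar (T : R) (D : set (R * R * R)) (q : nat) v {struct q} : Prop :=
  continuous3_on D v /\
  if q is q'.+1 then
    [/\ (forall t x y, D (t, x, y) -> ex_dx (v t) x y /\ ex_dy (v t) x y),
        Cpar T D q' (Dx v), Cpar T D q' (Dy v) &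
        if q' is q''.+1 then
          (forall t x y, D (t, x, y) -> ex_dt T v t x y) /\
          Cpar T D q'' (Dt T v)
        else True]
  else True.

Definition C111 (T : R) u :=
  [/\ continuous3_on (slab T) u,
      (forall t x y, slab T (t, x, y) ->
         [/\ ex_dt T u t x y, ex_dx (u t) x y & ex_dy (u t) x y]),
      continuous3_on (slab T) (Dt T u),
      continuous3_on (slab T) (Dx u) &
      continuous3_on (slab T) (Dy u)].

Definition weight (L x y : R) : R := 1 + `|x| `^ L + y `^ L.

Definition Cpol (q : nat) g :=
  Cspace q g /\
  exists C L : R, [/\ 0 < C, 0 < L &
    forall x y, 0 <= y -> forall i k : nat, (i + k <= q)%N ->
      `|iter i dx (iter k dy g) x y| <= C * weight L x y].

Definition CpolT (T : R) (q : nat) v :=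
  Cpar T (slab T) q v /\
  exists C L : R, [/\ 0 < C, 0 < L &
    forall t x y, 0 <= t < T -> 0 <= y ->
    forall m i k : nat, (2 * m + i + k <= q)%N ->
      `|iter m (Dt T) (iter i Dx (iter k Dy v)) t x y| <= C * weight L x y].

Definition poly_growth (T : R) u :=
  exists C L : R, [/\ 0 < C, 0 < L &
    forall t x y, 0 <= t <= T -> 0 <= y -> `|u t x y| <= C * weight L x y].

End function_spaces.

(** * Weighted Hoelder norms *)

Section hoelder_norms.
Context {R : realType}.
Implicit Types (D : set (R * R * R)) (P Q : R * R * R).

Definition par_dist P Q : R :=
  Num.sqrt (`|P.1.1 - Q.1.1| + ((P.1.2 - Q.1.2) ^+ 2 + (P.2 - Q.2) ^+ 2)).

(* The topological boundary is taken in R x R^2. *)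
Definition boundary_upto D (tau : R) : set (R * R * R) :=
  [set P | (closure D `\` interior D) P /\ 0 <= P.1.1 <= tau].

Definition bdry_dist D Q : R :=
  inf [set par_dist Q P | P in boundary_upto D Q.1.1].

Definition bdry_dist2 D P Q : R := Num.min (bdry_dist D P) (bdry_dist D Q).

(* [set 0] makes the supremum over an empty set equal to 0. *)
Definition hoelder_norm D (alpha : R) (m : nat) (v : R -> R -> R -> R) : \bar R :=
  let V P := v P.1.1 P.1.2 P.2 in
  (ereal_sup ([set 0] `|`
     [set (bdry_dist D P ^+ m * `|V P|)%:E | P in D]) +
   ereal_sup ([set 0] `|`
     [set (bdry_dist2 D PQ.1 PQ.2 `^ (m%:R + alpha) *
           (`|V PQ.1 - V PQ.2| / par_dist PQ.1 PQ.2 `^ alpha))%:E |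
        PQ in [set PQ | [/\ D PQ.1, D PQ.2 & PQ.1 <> PQ.2]]]))%E.

End hoelder_norms.

(** * Brownian motion, Ito integral, and the stochastic differential equation *)

Section stochastic.
Context {R : realType} {disp : measure_display} {Omega : measurableType disp}.
Variable P : probability Omega R.
Implicit Types (F : R -> set (set Omega)) (W B H I X Y : R -> Omega -> R).

Definition filtration F :=
  [/\ (forall s, 0 <= s -> sigma_algebra setT (F s)),
      (forall s, 0 <= s -> F s `<=` measurable) &
      (forall r s, 0 <= r -> r <= s -> F r `<=` F s)].

Definition measurable_wrt (G : set (set Omega)) (Z : Omega -> R) :=
  forall U : set R, measurable U -> G (Z @^-1` U).

(* (W, B) is a standard two-dimensional Brownian motion relative to F: for
   r < s the increment over [r, s] is independent of F r and has law
   N(0, s - r) (x) N(0, s - r). The second parameter of [normal_prob] is the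
   standard deviation. *)
Definition brownian_motion2 F W B :=
  [/\ {ae P, forall w, W 0 w = 0 /\ B 0 w = 0},
      (forall w, {within `[0, +oo[, continuous (W ^~ w)} /\
                 {within `[0, +oo[, continuous (B ^~ w)}),
      (forall s, 0 <= s ->
         measurable_wrt (F s) (W s) /\ measurable_wrt (F s) (B s)) &
      (forall r s : R, 0 <= r -> r < s ->
       forall (A : set Omega) (U V : set R), F r A -> measurable U -> measurable V ->
         (P (A `&` (fun w => W s w - W r w)%R @^-1` U
               `&` (fun w => B s w - B r w)%R @^-1` V) =
          P A * normal_prob 0 (Num.sqrt (s - r)%R) U
              * normal_prob 0 (Num.sqrt (s - r)%R) V)%E)].

Definition cvg_in_probability0 (Z : nat -> Omega -> \bar R) :=
  forall eps : R, 0 < eps ->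
    P [set w | (eps%:E <= Z n w)%E] @[n --> \oo] --> 0%E.

(* The simple process  \sum_(i < n) xi_i 1_{(t_i, t_(i+1)]}. *)
Record simple_process := SimpleProcess {
  sp_size : nat;
  sp_time : nat -> R;
  sp_coef : nat -> Omega -> R }.

Definition is_simple F (t T : R) (S : simple_process) :=
  [/\ (forall i, (i <= sp_size S)%N -> t <= sp_time S i <= T),
      (forall i, (i < sp_size S)%N -> sp_time S i <= sp_time S i.+1),
      (forall i, (i < sp_size S)%N -> measurable_wrt (F (sp_time S i)) (sp_coef S i)) &
      (forall i, (i < sp_size S)%N -> exists M : R, forall w, `|sp_coef S i w| <= M)].

Definition sp_eval (S : simple_process) (r : R) (w : Omega) : R :=
  \sum_(i < sp_size S) sp_coef S i w * \1_`]sp_time S i, sp_time S i.+1] r.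

Definition sp_integral (S : simple_process) W (s : R) (w : Omega) : R :=
  \sum_(i < sp_size S) sp_coef S i w *
    (W (Num.min (sp_time S i.+1) s) w - W (Num.min (sp_time S i) s) w).

(* I s = \int_t^s H_r dW_r for s in [t, T], by the extension of the integral
   from simple to locally square integrable integrands: for simple processes
   S n such that \int_t^T (S n - H)^2 dr -> 0 in probability, the integrals of
   the S n converge in probability to those of H. *)
Definition ito_integral F W (t T : R) H I :=
  [/\ (forall s, t <= s <= T -> measurable_fun setT (I s)),
      (forall w, {within `[t, T], continuous (I ^~ w)}) &
      exists S : nat -> simple_process,
        [/\ (forall n, is_simple F t T (S n)),
            cvg_in_probability0 (fun n w =>
              (\int[lebesgue_measure]_(r in `[t, T])
                 ((sp_eval (S n) r w - H r w) ^+ 2)%R%:E)%E) &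
            forall s, t <= s <= T ->
              cvg_in_probability0 (fun n w =>
                `|sp_integral (S n) W s w - I s w|%R%:E)]].

(* (X, Y) solves on [t, T], from (x, y) at time t,
     dX = (c + d Y) ds + lam sqrt(Y) (rho dW + sqrt(1 - rho^2) dB),
     dY = (a - b Y) ds + sig sqrt(Y) dW. *)
Definition heston_solution F W B (T a b c d lam sig rho t x y : R) X Y :=
  [/\ (forall s, t <= s <= T ->
         measurable_wrt (F s) (X s) /\ measurable_wrt (F s) (Y s)),
      (forall w, {within `[t, T], continuous (X ^~ w)} /\
                 {within `[t, T], continuous (Y ^~ w)}),
      (forall s w, t <= s <= T -> 0 <= Y s w) &
      exists IW IB : R -> Omega -> R,
        [/\ ito_integral F W t T (fun s w => Num.sqrt (Y s w)) IW,
            ito_integral F B t T (fun s w => Num.sqrt (Y s w)) IB &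
            {ae P, forall w, forall s, t <= s <= T ->
               X s w = x + \int[lebesgue_measure]_(r in `[t, s]) (c + d * Y r w)
                         + lam * (rho * IW s w + Num.sqrt (1 - rho ^+ 2) * IB s w) /\
               Y s w = y + \int[lebesgue_measure]_(r in `[t, s]) (a - b * Y r w)
                         + sig * IW s w}]].

(* e^{varrho (T - t)} f(X_T, Y_T) - \int_t^T e^{varrho (s - t)} h(s, X_s, Y_s) ds *)
Definition payoff (T varrho : R) (f : R -> R -> R) (h : R -> R -> R -> R)
    (t : R) X Y (w : Omega) : R :=
  expR (varrho * (T - t)) * f (X T w) (Y T w)
  - \int[lebesgue_measure]_(s in `[t, T])
      (expR (varrho * (s - t)) * h s (X s w) (Y s w)).

End stochastic.

(** * The degenerate parabolic problem *)

Section problem.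
Context {R : realType}.
Variables (T a b c d varrho lam sig rho : R).

(* At y = 0 the factor y cancels the second-order terms, whatever the values
   of the (total) second derivatives there. *)
Definition generator (u : R -> R -> R -> R) (t x y : R) : R :=
  y / 2 * (lam ^+ 2 * Dx (Dx u) t x y
           + 2 * rho * lam * sig * Dx (Dy u) t x y
           + sig ^+ 2 * Dy (Dy u) t x y)
  + (c + d * y) * Dx u t x y + (a - b * y) * Dy u t x y.

Definition classical_solution (f : R -> R -> R) (h : R -> R -> R -> R)
    (u : R -> R -> R -> R) :=
  [/\ Cpar T (open_slab T) 2 u,
      C111 T u,
      continuous3_on (closed_slab T) u,
      (forall t x y, 0 <= t < T -> 0 <= y ->
         Dt T u t x y + generator u t x y + varrho * u t x y = h t x y) &
      (forall x y, 0 <= y -> u T x y = f x y)].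

(* The hypotheses on the data; the membership of the 2j-th x-derivative in a
   space includes its existence. *)
Definition regular_data (alpha : R) (f : R -> R -> R) (h : R -> R -> R -> R) :=
  [/\ (forall j : nat, (j <= 1)%N ->
         (forall i : nat, (i < 2 * j)%N -> forall x y, 0 <= y ->
            ex_dx (iter i dx f) x y) /\
         Cpol (1 - j) (iter (2 * j) dx f)),
      (forall j : nat, (j <= 1)%N ->
         (forall i : nat, (i < 2 * j)%N -> forall t x y, slab T (t, x, y) ->
            ex_dx (iter i Dx h t) x y) /\
         CpolT T (1 - j) (iter (2 * j) Dx h)) &
      (forall K : set (R * R * R), compact K -> K `<=` slab T ->
         (hoelder_norm K alpha 2 h < +oo)%E /\
         (hoelder_norm K alpha 2 (Dy h) < +oo)%E)].

End problem.

(* Main.v *)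
Require Import Defs.
From HB Require Import structures.
From mathcomp Require Import all_boot all_order all_algebra.
From mathcomp Require Import all_classical all_reals all_analysis.
From mathcomp Require Import measurable_realfun ring lra.
Set Implicit Arguments.
Unset Strict Implicit.
Unset Printing Implicit Defensive.
Import Order.TTheory GRing.Theory Num.Theory.
Import numFieldNormedType.Exports.
Local Open Scope classical_set_scope.
Local Open Scope ring_scope.

(* Uniqueness is the maximum principle with an exponential barrier. For existence the data are
approximated, in an exponential weight, by polynomials, for which the equation is solved up to a
small error; a priori estimates (doubling of variables for the gradient) make the solutions
converge with their derivatives. Exponential moments and Dynkin's formula for polynomials
identify the limit as the expectation. *)

(** The obstacle is the degeneracy at y = 0: no boundary condition is imposed there, the square root
    of y is not Lipschitz, and the data have a single derivative in y. The estimates therefore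
    involve only u, its first two x-derivatives and its first y-derivative, which form a closed
    system: differentiation in x commutes with the operator, and differentiation in y gives an
    operator of the same kind with a shifted drift, plus x-derivatives as a source. The other second
    derivatives are controlled after multiplication by y, through a gradient bound for the
    y-derivative at the scale of y, and the time derivative through the equation. The coefficients
    being affine, the operator is triangular on monomials, which makes polynomial sources solvable.
    Quadratic terms of Riccati type allow only small exponential rates; the source is controlled on
    [0, T) only, hence it is frozen shortly before T. Dynkin's formula is proved without Ito's
    formula: for exponentials, multiplication by an exponential martingale leaves a path that
    ordinary calculus can differentiate, and polynomials arise by differentiation in the
    exponents. *)

Lemma eq_leW d (T : porderType d) (x y : T) : x = y -> (x <= y)%O.
by move=> ->. Qed.

(** * Symbolic functions and their derivatives *)

Section proof.
Context (R : realType).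
Local Notation mfun f := (measurable_fun setT f).
Local Notation fun3 := (R -> R -> R -> R)%type.
Local Notation leb := lebesgue_measure.

(** Functions are represented syntactically so that every derivative exists and is computed, and
    identities between derivatives reduce to [ring]. Exponentials serve for barriers and for factors
    in time, sine and exponential for bounded changes of variables. *)
Inductive expr : Type :=
| Cst of R | Vt | Vx | Vy
| Add of expr & expr | Mul of expr & expr
| Exp of expr | Sin of expr | Cos of expr.

Fixpoint ev (e : expr) (t x y : R) : R := match e with
 | Cst r => r | Vt => t | Vx => x | Vy => y
 | Add e1 e2 => ev e1 t x y + ev e2 t x y
 | Mul e1 e2 => ev e1 t x y * ev e2 t x y
 | Exp e1 => expR (ev e1 t x y)
 | Sin e1 => sin (ev e1 t x y)
 | Cos e1 => cos (ev e1 t x y)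
 end.

(** The derivative in the direction (p, q, r). General directions treat at once the partial
    derivatives, their commutation, and the directions of the coordinates used for the gradient
    bound. *)
Fixpoint Dv (p q r : R) (e : expr) : expr := match e with
 | Cst _ => Cst 0 | Vt => Cst p | Vx => Cst q | Vy => Cst r
 | Add e1 e2 => Add (Dv p q r e1) (Dv p q r e2)
 | Mul e1 e2 => Add (Mul (Dv p q r e1) e2) (Mul e1 (Dv p q r e2))
 | Exp e1 => Mul (Dv p q r e1) e
 | Sin e1 => Mul (Dv p q r e1) (Cos e1)
 | Cos e1 => Mul (Cst (-1)) (Mul (Dv p q r e1) (Sin e1))
 end.

Notation Et := (Dv 1 0 0).
Notation Ex := (Dv 0 1 0).
Notation Ey := (Dv 0 0 1).

Lemma Dv_chain e (X Y Z : R -> R) (s p q r : R) : is_derive s 1 X p -> is_derive s 1 Y q -> is_derive s 1 Z r ->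
 is_derive s 1 (fun s => ev e (X s) (Y s) (Z s)) (ev (Dv p q r e) (X s) (Y s) (Z s)).
move=> hX hY hZ; elim: e => [k||||e1 h1 e2 h2|e1 h1 e2 h2|e h|e h|e h] //=.
- exact: is_derive_cst.
- exact: is_deriveD.
- apply: (is_derive_eq (is_deriveM h1 h2)); rewrite /GRing.scale /=; ring.
- by apply: (is_derive_eq (is_derive1_comp (is_derive_expR _) h)); rewrite mulrC.
- by apply: (is_derive_eq (is_derive1_comp (is_derive_sin _) h)); rewrite mulrC.
- apply: (is_derive_eq (is_derive1_comp (is_derive_cos _) h)); ring.
Qed.

Lemma Dv_lin (e : expr) (t x y p q r : R) : ev (Dv p q r e) t x y
 = p * ev (Et e) t x y + q * ev (Ex e) t x y + r * ev (Ey e) t x y.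
by elim: e => [k||||e1 h1 e2 h2|e1 h1 e2 h2|e h|e h|e h] //=; rewrite ?h1 ?h2 ?h; ring.
Qed.

Lemma Dv_comm e t x y p q r p' q' r' : ev (Dv p q r (Dv p' q' r' e)) t x y = ev (Dv p' q' r' (Dv p q r e)) t x y.
by elim: e => [k||||e1 h1 e2 h2|e1 h1 e2 h2|e h|e h|e h] //=; rewrite ?h1 ?h2 ?h; ring.
Qed.

(** [Dv] is syntactic; it depends only on the function because, along a line through the point, it
    is the derivative of a function of one variable. *)
Lemma Dv_ext e e' p q r : (forall t x y, ev e t x y = ev e' t x y) ->
 forall t x y, ev (Dv p q r e) t x y = ev (Dv p q r e') t x y.
move=> h t x y.
have i1 (u v : R) : is_derive (0 : R) (1 : R) (fun s : R => u + s * v) v.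
 have H := is_deriveD (is_derive_cst u (0 : R) 1) (is_deriveM (is_derive_id (0 : R) (1 : R)) (is_derive_cst v (0 : R) 1)).
 by apply: (is_derive_eq H); rewrite /GRing.scale /=; ring.
have d (g : expr) := Dv_chain g (i1 t p) (i1 x q) (i1 y r).
have := @derive_val _ _ _ _ _ _ _ (d e); have := @derive_val _ _ _ _ _ _ _ (d e').
rewrite !mul0r !addr0 => <- <-; congr (derive _ _ _).
by apply/funext => s; rewrite h.
Qed.

Lemma Dv2_lin (e : expr) (t x y p q r p' q' r' : R) : ev (Dv p q r (Dv p' q' r' e)) t x y
 = p * p' * ev (Et (Et e)) t x y + q * q' * ev (Ex (Ex e)) t x y
  + r * r' * ev (Ey (Ey e)) t x y
  + (p * q' + q * p') * ev (Et (Ex e)) t x y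
  + (p * r' + r * p') * ev (Et (Ey e)) t x y
  + (q * r' + r * q') * ev (Ex (Ey e)) t x y.
rewrite Dv_lin 3!(Dv_comm e _ _ _ _ _ _ p' q' r') !(Dv_lin (Dv _ _ _ e) _ _ _ p').
rewrite (Dv_comm e _ _ _ 0 1 0 1 0 0) (Dv_comm e _ _ _ 0 0 1 1 0 0).
rewrite (Dv_comm e _ _ _ 0 0 1 0 1 0); ring.
Qed.

Lemma ev_continuous_comp (U : topologicalType) e (a b c : U -> R) : continuous a -> continuous b -> continuous c ->
 continuous (fun P => ev e (a P) (b P) (c P)).
move=> ha hb hc P; elim: e => [k||||e1 h1 e2 h2|e1 h1 e2 h2|e h|e h|e h] /=.
- exact: cvg_cst.
- exact: ha.
- exact: hb.
- exact: hc.
- exact: cvgD.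
- exact: cvgM.
- by have := continuous_comp h (@continuous_expR R _).
- by have := continuous_comp h (@continuous_sin R _).
- by have := continuous_comp h (@continuous_cos R _).
Qed.

Lemma ev_continuous e : continuous (fun P : R * R * R => ev e P.1.1 P.1.2 P.2).
apply: ev_continuous_comp => P.
- by apply: (@continuous_comp _ _ _ fst fst); apply: cvg_fst.
- by apply: (@continuous_comp _ _ _ fst snd); [apply: cvg_fst | apply: cvg_snd].
- exact: cvg_snd.
Qed.

(** * Derivatives relative to a set *)

Definition has_der (I : set R) (f : R -> R) (x a : R) :=
 forall e : R, 0 < e -> exists2 d : R, 0 < d & forall z, I z -> `|z - x| <= d -> `|f z - f x - a * (z - x)| <= e * `|z - x|.

Lemma near0P (Q : R -> Prop) : (\forall h \near 0^', Q h) <-> exists2 d : R, 0 < d & forall h, h != 0 -> `|h| <= d -> Q h.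
split=> [|[d d0 H]].
 rewrite near_withinE => -[d /= d0 H]; exists (d / 2); first by rewrite divr_gt0.
 move=> h h0 hd; apply: H => //=; rewrite sub0r normrN (le_lt_trans hd)//. by rewrite ltr_pdivrMr// ltr_pMr// ltr1n.
rewrite near_withinE; exists d => //= h hd h0; apply: H => //; apply: ltW.
by move: hd; rewrite /= distrC subr0.
Qed.

Lemma quotient_onP I f x a : has_der I f x a <-> quotient_on I f x --> a.
rewrite /quotient_on; split=> [H|/cvgrPdist_le H].
 apply/cvgrPdist_le => e e0; have [d d0 Hd] := H _ e0. rewrite near_withinE; apply/near0P; exists d => // h h0 hd Ih.
 have := Hd (h + x) Ih; rewrite addrK => /(_ hd) le. rewrite -(ler_pM2r (x := `|h|)) ?normr_gt0// -normrM mulrBl -mulrA.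
 by rewrite [X in _ - X]mulrC mulfK// distrC.
move=> e e0; have := H e e0; rewrite near_withinE => /near0P [d d0 Hd].
exists d => // z Iz zd; have [->|zx] := eqVneq z x.
 by rewrite !subrr mulr0 subrr normr0 mulr0.
have h0 : z - x != 0 by rewrite subr_eq0.
have := Hd (z - x) h0 zd; rewrite /= subrK => /(_ Iz).
rewrite -(ler_pM2r (x := `|z - x|)) ?normr_gt0// -normrM mulrBl -mulrA.
by rewrite [X in _ - X]mulrC mulfK// distrC.
Qed.

Lemma is_deriveP (f : R -> R) (x a : R) : is_derive x 1 f a <-> has_der setT f x a.
have E : quotient_on setT f x = (fun h => h^-1 *: ((f \o shift x) (h *: 1) - f x)) @ 0^'.
 rewrite /quotient_on. have -> : within [set h | [set: R] (h + x)] 0^' = 0^'.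
  by apply/seteqP; split=> A /=; rewrite /within /=; apply: filterS => // h; apply.
 have EE : (fun h : R => h^-1 * (f (h + x) - f x)) = (fun h : R => h^-1 *: ((f \o shift x) (h *: 1) - f x)).
  by apply/funext => h /=; rewrite /GRing.scale /= mulr1.
 by rewrite EE.
rewrite quotient_onP E; split => [[d v]|H].
 by rewrite -v; exact: d.
apply: DeriveDef; first by apply/cvg_ex; exists a.
exact: cvg_lim.
Qed.

Lemma has_der_subset I J f x a : I `<=` J -> has_der J f x a -> has_der I f x a.
by move=> IJ H e /H[d d0 Hd]; exists d => // z /IJ; apply: Hd. Qed.

Lemma has_der_interior (I : set R) f (x a d : R) :
 0 < d -> (forall z, `|z - x| <= d -> I z) -> has_der I f x a -> has_der setT f x a.
move=> d0 Hd H e /H[d' d'0 H']; exists (Num.min d d'); first by rewrite lt_min d0.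
by move=> z _; rewrite le_min => /andP[/Hd Iz]; apply: H'.
Qed.

Lemma derivable_onP I f x : derivable_on I f x -> has_der I f x (derive_on I f x).
by move=> H; apply/quotient_onP; exact: H. Qed.

(* The condition says that x is a limit point of I. *)
Lemma has_der_on (I : set R) f (x a : R) : (forall d : R, 0 < d -> exists z, [/\ I z, z != x & `|z - x| <= d]) ->
 has_der I f x a -> derivable_on I f x /\ derive_on I f x = a.
move=> lim /quotient_onP H.
suff PF : ProperFilter (quotient_on I f x).
 split; first exact: (cvgP _ H). by move: PF H; rewrite /derive_on; move: (quotient_on I f x) => G PG /cvg_lim ->.
rewrite /quotient_on; apply: fmap_proper_filter; apply: Build_ProperFilter_ex.
move=> A; rewrite /within /= => /near0P[d d0 Hd]; have [z [Iz zx zd]] := lim _ d0.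
by exists (z - x); apply: Hd => //=; rewrite ?subr_eq0// subrK.
Qed.

Lemma has_derD (I : set R) (f g : R -> R) (x a b : R) :
 has_der I f x a -> has_der I g x b -> has_der I (fun z => f z + g z) x (a + b).
move=> Hf Hg e e0; have e2 : 0 < e / 2 by rewrite divr_gt0.
have [d d0 Hd] := Hf _ e2; have [d' d'0 Hd'] := Hg _ e2.
exists (Num.min d d'); first by rewrite lt_min d0.
move=> z Iz; rewrite le_min => /andP[/(Hd _ Iz) h1 /(Hd' _ Iz) h2].
move: h1 h2; rewrite !ler_norml => /andP[? ?] /andP[? ?]; apply/andP; split; lra.
Qed.

Lemma has_derZ (I : set R) (f : R -> R) (k x a : R) : has_der I f x a -> has_der I (fun z => k * f z) x (k * a).
move=> Hf e e0.
have e2 : 0 < e / (`|k| + 1) by rewrite divr_gt0// ltr_wpDl.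
have [d d0 Hd] := Hf _ e2; exists d => // z Iz /(Hd _ Iz) h1.
have -> : k * f z - k * f x - k * a * (z - x) = k * (f z - f x - a * (z - x)) by ring.
rewrite normrM; apply: (le_trans (ler_wpM2l _ h1)) => //.
rewrite mulrA ler_wpM2r// mulrCA -[leRHS]mulr1 ler_wpM2l//; first exact: ltW.
by rewrite ler_pdivrMr ?mul1r ?lerDl// ltr_wpDl.
Qed.

Lemma has_der_continuous I f x a : has_der I f x a -> forall e : R, 0 < e ->
 exists2 d : R, 0 < d & forall z, I z -> `|z - x| <= d -> `|f z - f x| <= e.
move=> H e e0; have [d d0 Hd] := H _ ltr01.
exists (Num.min d (e / (1 + `|a|))).
 by rewrite lt_min d0 divr_gt0// ltr_wpDr.
move=> z Iz; rewrite le_min => /andP[/(Hd _ Iz) h1].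
rewrite ler_pdivlMr ?ltr_wpDr// => h2; apply: le_trans h2.
have -> : f z - f x = (f z - f x - a * (z - x)) + a * (z - x) by ring.
apply: (le_trans (ler_normD _ _)); rewrite normrM [leRHS]mulrDr [X in _ <= X + _]mulr1.
by rewrite [`|a| * _]mulrC lerD2r -[leRHS]mul1r.
Qed.

(** Only points to the right of x, as close as desired, are compared, so the test also applies at
    the initial time and at the boundary y = 0. *)
Lemma has_der_le0 (I : set R) (f : R -> R) (x a : R) : has_der I f x a ->
 (forall d : R, 0 < d -> exists z, [/\ I z, x < z, z <= x + d & f z <= f x]) -> a <= 0.
move=> H Hz; rewrite leNgt; apply/negP => a0.
have [d d0 Hd] := H (a / 2) ltac:(by rewrite divr_gt0).
have [z [Iz xz zd fz]] := Hz d d0.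
have zx : 0 < z - x by rewrite subr_gt0.
have := Hd z Iz; rewrite gtr0_norm// => /(_ ltac:(lra)); rewrite ler_norml => /andP[h _].
have := mulr_gt0 a0 zx; lra.
Qed.

Lemma has_der_ge0 I f x a : has_der I f x a ->
 (forall d : R, 0 < d -> exists z, [/\ I z, z < x, x - d <= z & f z <= f x]) -> 0 <= a.
move=> H Hz; rewrite leNgt; apply/negP => a0.
have [d d0 Hd] := H (- a / 2) ltac:(by rewrite divr_gt0// oppr_gt0).
have [z [Iz xz zd fz]] := Hz d d0.
have zx : z - x < 0 by rewrite subr_lt0.
have := Hd z Iz; rewrite ltr0_norm// => /(_ ltac:(lra)); rewrite ler_norml => /andP[h _].
have : 0 < a * (z - x) by rewrite nmulr_rgt0.
lra.
Qed.

Lemma has_der_max f (x a d : R) : has_der setT f x a -> 0 < d -> (forall z, `|z - x| <= d -> f z <= f x) -> a = 0.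
move=> H d0 Hd; apply/eqP; rewrite eq_le; apply/andP; split.
 apply: (has_der_le0 H) => r r0; exists (x + Num.min d r). have m0 : 0 < Num.min d r by rewrite lt_min d0.
 split => //; rewrite ?ltrDl// ?lerD2l ?ge_min ?lexx ?orbT//. by apply: Hd; rewrite addrC addKr gtr0_norm// ge_min lexx.
apply: (has_der_ge0 H) => r r0; exists (x - Num.min d r).
have m0 : 0 < Num.min d r by rewrite lt_min d0.
split => //; rewrite ?gtrDl ?oppr_lt0// ?lerD2l ?lerN2 ?ge_min ?lexx ?orbT//.
by apply: Hd; rewrite addrC addKr normrN gtr0_norm// ge_min lexx.
Qed.

Lemma mean_value (f f' : R -> R) (x z : R) : (forall w, `|w - x| <= `|z - x| -> has_der setT f w (f' w)) ->
 exists2 c, `|c - x| <= `|z - x| & f z - f x = f' c * (z - x).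
move=> H.
have cf (a b : R) : (forall w, w \in `[a, b] -> has_der setT f w (f' w)) -> {within `[a, b], continuous f}.
 move=> h; apply: derivable_within_continuous => w /h /is_deriveP hw. exact: ex_derive.
have [xz|zx|->] := ltgtP x z; last by exists z; rewrite ?lexx// !subrr mulr0.
- have I w : w \in `[x, z] -> has_der setT f w (f' w).
  rewrite in_itv/= => /andP[xw wz]; apply: H. by rewrite !ger0_norm ?subr_ge0 ?(ltW xz)// lerD2r.
 have [c cI ->] := MVT xz (fun w wI => proj2 (is_deriveP f w (f' w)) (I w (subset_itv_oo_cc wI))) (cf _ _ I).
 exists c => //; move: cI; rewrite in_itv/= => /andP[xc cz]. by rewrite !ger0_norm ?subr_ge0 ?(ltW xz) ?(ltW xc)// lerD2r ltW.
- have I w : w \in `[z, x] -> has_der setT f w (f' w).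
  rewrite in_itv/= => /andP[zw wx]; apply: H. by rewrite !ler0_norm ?subr_le0 ?(ltW zx)// lerN2 lerD2r.
 have [c cI e] := MVT zx (fun w wI => proj2 (is_deriveP f w (f' w)) (I w (subset_itv_oo_cc wI))) (cf _ _ I).
 exists c; last by rewrite -(opprB (f x)) e; ring. move: cI; rewrite in_itv/= => /andP[zc cx].
 by rewrite !ler0_norm ?subr_le0 ?(ltW zx) ?(ltW cx)// lerN2 lerD2r ltW.
Qed.

Lemma has_der_ext I f g x a b : (forall z, f z = g z) -> a = b -> has_der I f x a -> has_der I g x b.
by move=> fg <- H e /H[d d0 Hd]; exists d => // z; rewrite -!fg; apply: Hd. Qed.

Lemma has_der_quad (I : set R) (k l m x z : R) : has_der I (fun z => k + l * (z - x) + m / 2 * (z - x) ^+ 2) z (l + m * (z - x)).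
apply: (@has_der_subset _ setT) => //; apply/is_deriveP.
have H := is_deriveB (is_derive_id z (1 : R)) (is_derive_cst x z (1 : R)).
have H1 := is_deriveD (is_derive_cst k z (1 : R)) (is_deriveM (is_derive_cst l z (1 : R)) H).
have H2 := is_deriveM (is_derive_cst (m / 2) z (1 : R)) (is_deriveM H H).
by apply: (is_derive_eq (is_deriveD H1 H2)); rewrite /GRing.scale /= ?fctE /=; field.
Qed.

(** * Second-order jets and the maximum principle *)

Lemma peano2 (f f' : R -> R) (x d0 A : R) : 0 < d0 ->
 (forall z, `|z - x| <= d0 -> has_der setT f z (f' z)) -> has_der setT f' x A ->
 forall e : R, 0 < e -> exists2 d : R, 0 < d & forall z, `|z - x| <= d ->
  `|f z - f x - f' x * (z - x) - A / 2 * (z - x) ^+ 2| <= e * (z - x) ^+ 2.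
move=> d00 Hf Hf' e e0; have [d d1 Hd] := Hf' e e0.
exists (Num.min d d0); first by rewrite lt_min d1.
move=> z; rewrite le_min => /andP[zd zd0].
pose q (w : R) := - f x + - f' x * (w - x) + - A / 2 * (w - x) ^+ 2.
have [|c cz] := @mean_value (fun w => f w + q w) (fun w => f' w + (- f' x + - A * (w - x))) x z.
 by move=> w wz; apply: has_derD (has_der_quad _ _ _ _ _ _); apply: Hf; apply: le_trans zd0.
rewrite /q !subrr expr0n !mulr0 !addr0 subrr subr0 => E.
have -> : f z - f x - f' x * (z - x) - A / 2 * (z - x) ^+ 2 = f z + (- f x + - f' x * (z - x) + - A / 2 * (z - x) ^+ 2) by ring.
rewrite E normrM -[X in _ <= _ * X]real_normK ?num_real// expr2 mulrA ler_wpM2r//.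
have -> : f' c + (- f' x + - A * (c - x)) = f' c - f' x - A * (c - x) by ring.
by apply: (le_trans (Hd c I (le_trans cz zd))); rewrite ler_wpM2l// ltW.
Qed.

(** This is the regularity that classical solutions have for y > 0. The second x-derivative and the
    mixed derivative exist at the point alone, the second y-derivative exists nearby and is
    continuous at the point: enough for a second-order expansion made first in x and then in y. *)
Definition jet2 g x y p q A B C := exists (gx : R -> R) (gy gyy : R -> R -> R), exists2 d0 : R, 0 < d0 &
 [/\ gx x = p /\ gy x y = q, (forall z, `|z - x| <= d0 -> has_der setT (g ^~ y) z (gx z)) /\ has_der setT gx x A,
   has_der setT (gy ^~ y) x B, (forall z w, `|z - x| <= d0 -> `|w - y| <= d0 ->
     has_der setT (g z) w (gy z w) /\ has_der setT (gy z) w (gyy z w)) &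
   gyy x y = C /\ forall e : R, 0 < e -> exists2 d : R, 0 < d &
    forall z w, `|z - x| <= d -> `|w - y| <= d -> `|gyy z w - gyy x y| <= e].

Lemma jet2_lin (g g' : R -> R -> R) (k x y p q A B C p' q' A' B' C' : R) : jet2 g x y p q A B C -> jet2 g' x y p' q' A' B' C' ->
 jet2 (fun x y => g x y + k * g' x y) x y (p + k * p') (q + k * q') (A + k * A') (B + k * B') (C + k * C').
move=> [gx [gy [gyy [d d0 [[e1 e2] [h1 h2] h3 h4 [e3 h5]]]]]].
move=> [gx' [gy' [gyy' [d' d0' [[e1' e2'] [h1' h2'] h3' h4' [e3' h5']]]]]].
exists (fun z => gx z + k * gx' z), (fun z w => gy z w + k * gy' z w),
 (fun z w => gyy z w + k * gyy' z w), (Num.min d d'); first by rewrite lt_min d0.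
split; first by rewrite e1 e2 e1' e2'.
- split; last by apply: has_derD => //; apply: has_derZ.
 move=> z; rewrite le_min => /andP[zd zd']; apply: has_derD; first exact: h1. by apply: has_derZ; apply: h1'.
- by apply: has_derD => //; apply: has_derZ.
- move=> z w; rewrite !le_min => /andP[zd zd'] /andP[wd wd'].
 have [a1 a2] := h4 _ _ zd wd; have [b1 b2] := h4' _ _ zd' wd'. by split; apply: has_derD => //; apply: has_derZ.
- split; first by rewrite e3 e3'.
 move=> e e0; have [r r0 Hr] := h5 (e / 2) ltac:(by rewrite divr_gt0).
 have [r' r0' Hr'] := h5' (e / 2 / (`|k| + 1)) ltac:(by rewrite !divr_gt0// ltr_wpDl).
 exists (Num.min r r'); first by rewrite lt_min r0. move=> z w; rewrite !le_min => /andP[zd zd'] /andP[wd wd'].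
 have := Hr _ _ zd wd; have := Hr' _ _ zd' wd'; rewrite ler_pdivlMr ?ltr_wpDl// => a1 a2.
 have -> : gyy z w + k * gyy' z w - (gyy x y + k * gyy' x y) = (gyy z w - gyy x y) + k * (gyy' z w - gyy' x y) by ring.
 rewrite (le_trans (ler_normD _ _))// normrM. have := normr_ge0 k; have := normr_ge0 (gyy' z w - gyy' x y); nra.
Qed.

(** If the quadratic form had a positive value Q in the direction (xi, eta), a small step s in this
    direction would increase g by about s^2 Q / 2. *)
Lemma jet2_max (g : R -> R -> R) (x y p q A B C d1 xi eta : R) : jet2 g x y p q A B C -> 0 < d1 ->
 (forall z w, `|z - x| <= d1 -> `|w - y| <= d1 -> g z w <= g x y) ->
 [/\ p = 0, q = 0 & A * xi ^+ 2 + 2 * B * xi * eta + C * eta ^+ 2 <= 0].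
move=> [gx [gy [gyy [d d0 [[e1 e2] [h1 h2] h3 h4 [e3 h5]]]]]] d10 M.
have p0 : p = 0.
 rewrite -e1; apply: (has_der_max (h1 x _) d10); first by rewrite subrr normr0 ltW.
 by move=> z zx; apply: M => //; rewrite subrr normr0 ltW.
have q0 : q = 0.
 have dd (u : R) : `|u - u| <= d by rewrite subrr normr0 ltW. have [a1 _] := h4 x y (dd x) (dd y); rewrite -e2.
 by apply: (has_der_max a1 d10) => w wy; apply: M => //; rewrite subrr normr0 ltW.
split => //; set Q := (X in X <= 0); rewrite leNgt; apply/negP => Q0.
pose K := xi ^+ 2 + `|xi| * `|eta| + eta ^+ 2.
have K0 : 0 <= K by rewrite /K !addr_ge0// ?sqr_ge0// mulr_ge0.
(* The remainders of the expansion in x, of the expansion in y, and of the y-derivative as a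
   function of x add up to at most e K s^2, which must stay below Q s^2 / 2. *)
pose e := Q / 4 / (K + 1).
have ee0 : 0 < e by rewrite /e !divr_gt0// ltr_wpDl.
have eK : e * K <= Q / 4.
 rewrite /e mulrAC ler_pdivrMr ?ltr_wpDl// ler_wpM2l ?lerDl//. by rewrite divr_ge0// ltW.
have [r1 r10 H1] := peano2 d0 h1 h2 ee0.
have [r2 r20 H2] := h3 e ee0.
have [r3 r30 H3] := h5 e ee0.
pose r := Num.min (Num.min d d1) (Num.min r1 (Num.min r2 r3)).
have r0 : 0 < r by rewrite /r !lt_min d0 d10 r10 r20.
pose s := r / (`|xi| + `|eta| + 1).
have s0 : 0 < s by rewrite /s divr_gt0// ltr_wpDl// addr_ge0.
have sr k : `|k| <= `|xi| + `|eta| + 1 -> `|s * k| <= r.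
 move=> hk; rewrite normrM gtr0_norm// /s mulrAC ler_pdivrMr ?ltr_wpDl ?addr_ge0//. by rewrite ler_wpM2l// ltW.
have sxi : `|s * xi| <= r by apply: sr; rewrite -addrA lerDl addr_ge0.
have seta : `|s * eta| <= r by apply: sr; rewrite addrAC lerDr addr_ge0.
have [rd rd1 rr1 rr2 rr3] : [/\ r <= d, r <= d1, r <= r1, r <= r2 & r <= r3].
 by split; rewrite /r !ge_min lexx ?orbT.
pose z := x + s * xi; pose w := y + s * eta.
have zx : z - x = s * xi by rewrite /z addrC addKr.
have wy : w - y = s * eta by rewrite /w addrC addKr.
have := M z w; rewrite zx wy => /(_ (le_trans sxi rd1) (le_trans seta rd1)).
apply/negP; rewrite -ltNge.
have := H1 z; rewrite zx => /(_ (le_trans sxi rr1)); rewrite e1 p0 mul0r subr0 => a1.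
have := H2 z I; rewrite zx => /(_ (le_trans sxi rr2)); rewrite e2 q0 subr0 => a2.
pose Cz (v : R) := - g z y + - gy z y * (v - y) + - C / 2 * (v - y) ^+ 2.
have zd : `|z - x| <= d by rewrite zx (le_trans sxi).
have [|c cw] := @mean_value (fun v => g z v + Cz v) (fun v => gy z v + (- gy z y + - C * (v - y))) y w.
 move=> v vw; apply: has_derD (has_der_quad _ _ _ _ _ _).
 by apply: (proj1 (h4 z v zd _)); rewrite (le_trans vw)// wy (le_trans seta).
have [|c' cc'] := @mean_value (gy z) (gyy z) y c.
 move=> v vw; apply: (proj2 (h4 z v zd _)). by rewrite (le_trans vw)// (le_trans cw)// wy (le_trans seta).
move=> E' ; rewrite /Cz !subrr expr0n !mulr0 !addr0 subrr subr0 => E.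
have a3 : `|gyy z c' - C| <= e.
 rewrite -e3; apply: H3; rewrite ?zx ?(le_trans sxi)// (le_trans cc')//. by rewrite (le_trans cw)// wy (le_trans seta).
have a4 : `|g z w - g z y - gy z y * (s * eta) - C / 2 * (s * eta) ^+ 2| <= e * (s * eta) ^+ 2.
 have -> : g z w - g z y - gy z y * (s * eta) - C / 2 * (s * eta) ^+ 2 = (gyy z c' - C) * (c - y) * (s * eta).
  rewrite -wy. have -> : g z w - g z y - gy z y * (w - y) - C / 2 * (w - y) ^+ 2 =
   g z w + (- g z y + - gy z y * (w - y) + - C / 2 * (w - y) ^+ 2) by ring.
  by rewrite E mulrBl -E'; ring.
 rewrite -wy -[X in _ <= _ * X]real_normK ?num_real// normrM expr2 mulrA ler_wpM2r//. by rewrite normrM ler_pM.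
have a5 : `|gy z y * (s * eta) - B * (s * xi) * (s * eta)| <= e * `|s * xi| * `|s * eta|.
 by rewrite -mulrBl normrM ler_wpM2r.
move: a1 a4 a5; rewrite !(normrM s) (gtr0_norm s0) !ler_norml.
move=> /andP[a1 _] /andP[a4 _] /andP[a5 _].
have s2 : 0 < s ^+ 2 by rewrite exprn_gt0.
have : 0 < s ^+ 2 * (Q / 2 - e * K).
 by rewrite mulr_gt0// subr_gt0 (le_lt_trans eK)//; lra.
move: a1 a4 a5; rewrite /Q /K; clear; move=> a1 a4 a5 a6.
nra.
Qed.

Lemma addr_le0 (x y : R) : x <= 0 -> y <= 0 -> x + y <= 0.
by move=> ? ?; lra. Qed.

Record prm := Prm { pa : R; pb : R; pc : R; pd : R; pl : R; ps : R; pr : R }.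

Definition admissible k := [/\ 0 < pa k, 0 < pl k, 0 < ps k & -1 < pr k < 1].

Definition hop (k : prm) (y a0 p q A B C : R) : R := a0 + (y / 2 * (pl k ^+ 2 * A + 2 * pr k * pl k * ps k * B + ps k ^+ 2 * C)
    + (pc k + pd k * y) * p + (pa k - pb k * y) * q).

Definition heat k e : expr := Add (Et e) (Add (Add (Mul (Mul Vy (Cst 2^-1)) (Add (Add (Mul (Cst (pl k ^+ 2)) (Ex (Ex e)))
    (Mul (Cst (2 * pr k * pl k * ps k)) (Ex (Ey e)))) (Mul (Cst (ps k ^+ 2)) (Ey (Ey e)))))
  (Mul (Add (Cst (pc k)) (Mul (Cst (pd k)) Vy)) (Ex e))) (Mul (Add (Cst (pa k)) (Mul (Cst (- pb k)) Vy)) (Ey e))).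

Lemma ev_heat k e t x y : ev (heat k e) t x y = hop k y (ev (Et e) t x y) (ev (Ex e) t x y) (ev (Ey e) t x y)
  (ev (Ex (Ex e)) t x y) (ev (Ex (Ey e)) t x y) (ev (Ey (Ey e)) t x y).
by rewrite /= /hop; ring. Qed.

(** At y = 0 only first derivatives are recorded, since the second-order terms of the operator carry
    the factor y. *)
Definition jets (T : R) (v : fun3) (t x y a0 p q A B C : R) :=
 [/\ has_der `[0, T[ (fun s => v s x y) t a0, has_der setT (fun z => v t z y) x p,
   has_der `[0, +oo[ (v t x) y q & 0 < y -> jet2 (v t) x y p q A B C].

Lemma jets_lin (T : R) (v v' : fun3) (k t x y a0 p q A B C a0' p' q' A' B' C' : R) :
 jets T v t x y a0 p q A B C -> jets T v' t x y a0' p' q' A' B' C' ->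
 jets T (fun t x y => v t x y + k * v' t x y) t x y (a0 + k * a0') (p + k * p') (q + k * q')
  (A + k * A') (B + k * B') (C + k * C').
move=> [h1 h2 h3 h4] [h1' h2' h3' h4']; split; try by apply: has_derD => //; apply: has_derZ.
by move=> y0; apply: jet2_lin; [exact: h4 | exact: h4'].
Qed.

Lemma ev_has_derx I e t x y : has_der I (fun z => ev e t z y) x (ev (Ex e) t x y).
apply: (@has_der_subset _ setT) => //; apply/is_deriveP.
exact: Dv_chain (is_derive_cst _ _ _) (is_derive_id _ _) (is_derive_cst _ _ _).
Qed.

Lemma ev_has_dery I e t x y : has_der I (ev e t x) y (ev (Ey e) t x y).
apply: (@has_der_subset _ setT) => //; apply/is_deriveP.
exact: Dv_chain (is_derive_cst _ _ _) (is_derive_cst _ _ _) (is_derive_id _ _).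
Qed.

Lemma ev_has_dert I e t x y : has_der I (fun s => ev e s x y) t (ev (Et e) t x y).
apply: (@has_der_subset _ setT) => //; apply/is_deriveP.
exact: Dv_chain (is_derive_id _ _) (is_derive_cst _ _ _) (is_derive_cst _ _ _).
Qed.

Lemma ev_continuous_eps e (t x y eps : R) : 0 < eps ->
 exists2 d : R, 0 < d & forall s z w, `|s - t| <= d -> `|z - x| <= d -> `|w - y| <= d -> `|ev e s z w - ev e t x y| <= eps.
move=> e0; have /cvgrPdist_le /(_ eps e0) := @ev_continuous e (t, x, y).
move=> /nbhs_ballP [d /= d0 H]; exists (d / 2); first by rewrite divr_gt0.
have hd : d / 2 < d by rewrite ltr_pdivrMr// ltr_pMr// ltr1n.
move=> s z w hs hz hw; rewrite distrC.
apply: (H (s, z, w)); split; [split|]; rewrite /ball /= distrC; exact: le_lt_trans hd.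
Qed.

Lemma ev_jets T e t x y : jets T (ev e) t x y (ev (Et e) t x y) (ev (Ex e) t x y) (ev (Ey e) t x y)
  (ev (Ex (Ex e)) t x y) (ev (Ex (Ey e)) t x y) (ev (Ey (Ey e)) t x y).
split; [exact: ev_has_dert | exact: ev_has_derx | exact: ev_has_dery | move=> y0].
exists (fun z => ev (Ex e) t z y), (ev (Ey e) t), (ev (Ey (Ey e)) t), 1 => //; split => //.
- by split => [z _|]; exact: ev_has_derx.
- exact: ev_has_derx.
- by move=> z w _ _; split; exact: ev_has_dery.
- split => // eps e0; have [d d0 H] := ev_continuous_eps (Ey (Ey e)) t x y e0.
 by exists d => // z w; apply: H; rewrite subrr normr0 ltW.
Qed.

(** A maximum attained before T has a nonpositive right derivative in t. At y = 0 the derivative in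
    y is nonpositive and its coefficient a is positive, which takes the place of a boundary
    condition. For y > 0 the second-order part is a sum of second derivatives in the direction
    (lambda rho, sigma) and, with weight 1 - rho^2, in the direction (lambda, 0). *)
Lemma jets_max k (T : R) v (t x y a0 p q A B C : R) : admissible k -> 0 <= t < T -> 0 <= y -> jets T v t x y a0 p q A B C ->
 (forall s z w, 0 <= s <= T -> 0 <= w -> v s z w <= v t x y) -> hop k y a0 p q A B C <= 0.
move=> [pa0 _ _ /andP[r1 r2]] /andP[t0 tT] y0 [h1 h2 h3 h4] M.
have a00 : a0 <= 0.
 apply: (has_der_le0 h1) => d d0; exists (t + Num.min d ((T - t) / 2)).
 have m0 : 0 < Num.min d ((T - t) / 2) by rewrite lt_min d0 divr_gt0// subr_gt0.
 have m1 : Num.min d ((T - t) / 2) <= (T - t) / 2 by rewrite ge_min lexx orbT. split; rewrite ?ltrDl ?lerD2l ?ge_min ?lexx//.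
 - by rewrite /= in_itv/=; apply/andP; split; lra.
 - by apply: M => //; apply/andP; split; lra.
have p0 : p = 0.
 by apply: (has_der_max h2 ltr01) => z _; apply: M => //; rewrite t0 ltW.
move: y0; rewrite le_eqVlt => /predU1P[y0|y0].
 have q0 : q <= 0.
  apply: (has_der_le0 h3) => d d0; exists (y + d). split; rewrite ?ltrDl ?lexx//.
   by rewrite /= in_itv/= andbT -y0 add0r ltW.
  by apply: M; rewrite ?t0 ?ltW// -y0 add0r.
 rewrite /hop -y0 p0 mul0r !mul0r mulr0 !add0r mulr0 subr0. have : pa k * q <= 0 by rewrite mulr_ge0_le0// ltW. lra.
have d10 : 0 < y / 2 by rewrite divr_gt0.
have M' z w : `|z - x| <= y / 2 -> `|w - y| <= y / 2 -> v t z w <= v t x y.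
 by move=> _; rewrite ler_norml => /andP[h _]; apply: M; rewrite ?t0 ?ltW//; lra.
have [_ q0 Q1] := jet2_max (pl k * pr k) (ps k) (h4 y0) d10 M'.
have [_ _ Q2] := jet2_max (pl k) 0 (h4 y0) d10 M'.
rewrite /hop p0 q0 !mulr0 !addr0.
have r3 : 0 < 1 - pr k ^+ 2 by nra.
have E : pl k ^+ 2 * A + 2 * pr k * pl k * ps k * B + ps k ^+ 2 * C =
  (A * (pl k * pr k) ^+ 2 + 2 * B * (pl k * pr k) * ps k + C * ps k ^+ 2) +
  (1 - pr k ^+ 2) * (A * pl k ^+ 2 + 2 * B * pl k * 0 + C * 0 ^+ 2) by ring.
rewrite E; have : (1 - pr k ^+ 2) * (A * pl k ^+ 2 + 2 * B * pl k * 0 + C * 0 ^+ 2) <= 0.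
 by rewrite mulr_ge0_le0// ltW.
move=> {}Q2; have h5 : y / 2 * ((A * (pl k * pr k) ^+ 2 + 2 * B * (pl k * pr k) * ps k + C * ps k ^+ 2) +
  (1 - pr k ^+ 2) * (A * pl k ^+ 2 + 2 * B * pl k * 0 + C * 0 ^+ 2)) <= 0.
 by rewrite mulr_ge0_le0// ?(ltW d10)//; apply: addr_le0.
exact: addr_le0.
Qed.

Definition box (T N : R) : set (R * R * R) := [set P | [/\ 0 <= P.1.1 <= T, `|P.1.2| <= N & 0 <= P.2 <= N]].

Lemma box_compact T N : compact (box T N).
have -> : box T N = (`[0, T] `*` `[- N, N]) `*` `[0, N].
 apply/seteqP; split => [[[t x] y]|[[t x] y]] /=; rewrite /box /= !in_itv /= -ler_norml.
  by case.
 by case=> -[].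
by apply: compact_setX; [apply: compact_setX|]; apply: segment_compact.
Qed.

Lemma box_max (T N : R) v w : 0 <= T -> 0 <= N -> continuous3_on (closed_slab T) v -> (forall t x y, 0 < ev w t x y) ->
 exists t x y : R, box T N (t, x, y) /\ forall s z r, box T N (s, z, r) -> v s z r / ev w s z r <= v t x y / ev w t x y.
move=> T0 N0 cv w0.
pose f (P : R * R * R) := v P.1.1 P.1.2 P.2 / ev w P.1.1 P.1.2 P.2.
have cf : {within box T N, continuous f}.
 have sub : box T N `<=` closed_slab T.
  by move=> [[t x] y] [/= h1 _ /andP[h2 _]]; split.
 have c1 := continuous_subspaceW sub cv. have c2 := continuous_subspaceT (A := box T N) (@ev_continuous w).
 move=> P; apply: (cvgM (c1 P)); apply: cvgV; last exact: c2. by rewrite gt_eqF.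
have ne : box T N !=set0.
 by exists (0, 0, 0); split; rewrite /= ?lexx ?normr0.
have [[[t x] y] /set_mem PB M] := compact_EVT_max ne (@box_compact T N) cf.
by exists t, x, y; split => // s z r B; apply: (M (s, z, r)); apply/mem_set.
Qed.

(** By the growth condition the ratio v / w is at most half of its value at a bad point outside some
    box, so its maximum C over the box is global. Then C w touches v from above, which the last
    hypothesis excludes before T and the terminal condition excludes at T. *)
Lemma weighted_max (T A : R) (v : fun3) (w : expr) : 0 <= T -> 0 <= A -> continuous3_on (closed_slab T) v ->
 (forall t x y, 0 < ev w t x y) -> (forall e : R, 0 < e -> exists N, forall t x y, 0 <= t <= T -> 0 <= y -> N <= `|x| + y ->
   v t x y <= e * ev w t x y) ->
 (forall x y, 0 <= y -> v T x y <= A * ev w T x y) ->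
 (forall t x y C, 0 <= t < T -> 0 <= y -> A < C -> v t x y = C * ev w t x y ->
   (forall s z r, 0 <= s <= T -> 0 <= r -> v s z r <= C * ev w s z r) -> False) ->
 forall t x y, 0 <= t <= T -> 0 <= y -> v t x y <= A * ev w t x y.
move=> T0 A0 cv w0 G F H t x y tT y0; rewrite leNgt; apply/negP => lt.
pose r0 := v t x y / ev w t x y.
have Ar0 : A < r0 by rewrite /r0 ltr_pdivlMr.
have r00 : 0 < r0 := le_lt_trans A0 Ar0.
have [N HN] := G (r0 / 2) ltac:(by rewrite divr_gt0).
pose N' := Num.max N (`|x| + y).
have N'0 : 0 <= N' by rewrite /N' le_max addr_ge0 ?orbT.
have [t1 [x1 [y1 [[/= tT1 xN /andP[y10 yN]] M]]]] := box_max T0 N'0 cv w0.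
pose C := v t1 x1 y1 / ev w t1 x1 y1.
have r0C : r0 <= C.
 apply: M; split => //=; rewrite /N' !le_max ?lerDl ?lerDr ?y0 ?normr_ge0 ?orbT//.
have all s z r : 0 <= s <= T -> 0 <= r -> v s z r <= C * ev w s z r.
 move=> sT rr0; have [B|nB] := pselect (box T N' (s, z, r)).
  by rewrite -ler_pdivrMr//; apply: M.
 have big : N <= `|z| + r.
  rewrite leNgt; apply/negP => sm; apply: nB. have sN : `|z| + r <= N' by rewrite /N' le_max ltW.
  by split => //=; rewrite ?rr0; [have := normr_ge0 z|have := normr_ge0 z]; lra.
 apply: (le_trans (HN _ _ _ sT rr0 big)); rewrite ler_wpM2r ?ltW//.
 by apply: lt_le_trans r0C; rewrite ltr_pdivrMr// ltr_pMr// ltr1n.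
have vC : v t1 x1 y1 = C * ev w t1 x1 y1 by rewrite /C mulfVK// gt_eqF.
have AC := lt_le_trans Ar0 r0C.
move: tT1 => /andP[t10]; rewrite le_eqVlt => /predU1P[E|lt1].
 have := F x1 y1 y10; rewrite -E vC ler_pM2r//; lra.
by apply: (H t1 x1 y1 C) => //; rewrite t10.
Qed.

(** At the point where C w touches v the difference vanishes, so the zero-order term drops out
    whatever the sign of [r]; the strict inequality for w and A < C then contradict the maximum
    principle. *)
Lemma comparison (k : prm) (T r A : R) (v : fun3) (w : expr) :
 admissible k -> 0 <= T -> 0 <= A -> continuous3_on (closed_slab T) v -> (forall t x y, 0 < ev w t x y) ->
 (forall t x y, 0 <= t <= T -> 0 <= y -> ev (heat k w) t x y + r * ev w t x y < 0) ->
 (forall e : R, 0 < e -> exists N, forall t x y, 0 <= t <= T -> 0 <= y -> N <= `|x| + y -> v t x y <= e * ev w t x y) ->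
 (forall x y, 0 <= y -> v T x y <= A * ev w T x y) -> (forall t x y, 0 <= t < T -> 0 <= y -> exists a0 p q A1 B C,
   jets T v t x y a0 p q A1 B C /\ A * (ev (heat k w) t x y + r * ev w t x y) <= hop k y a0 p q A1 B C + r * v t x y) ->
 forall t x y, 0 <= t <= T -> 0 <= y -> v t x y <= A * ev w t x y.
move=> ak T0 A0 cv w0 bar G F J; apply: weighted_max => // t x y C tT y0 AC vC M.
have [a0 [p [q [A1 [B [C1 [Jv le]]]]]]] := J t x y tT y0.
have Jw := jets_lin (- C) Jv (ev_jets T w t x y).
have := jets_max ak tT y0 Jw.
have M' s z w' : 0 <= s <= T -> 0 <= w' -> v s z w' + - C * ev w s z w' <= v t x y + - C * ev w t x y.
 move=> sT w'0; have := M s z w' sT w'0; rewrite vC; lra.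
move=> /(_ M'); have tT' : 0 <= t <= T by case/andP: tT => -> /ltW.
have := bar t x y tT' y0; move: le; rewrite vC ev_heat.
move: (ev w t x y) => W.
set E := hop _ _ (ev _ _ _ _) _ _ _ _ _.
have -> : forall X0 X1 X2 X3 X4 X5 Y0 Y1 Y2 Y3 Y4 Y5, hop k y (X0 + - C * Y0) (X1 + - C * Y1) (X2 + - C * Y2) (X3 + - C * Y3)
  (X4 + - C * Y4) (X5 + - C * Y5) = hop k y X0 X1 X2 X3 X4 X5 - C * hop k y Y0 Y1 Y2 Y3 Y4 Y5.
 by rewrite /hop => *; ring.
rewrite -/E => l1 l2 l3.
have : (C - A) * (E + r * W) < 0 by rewrite pmulr_rlt0// subr_gt0.
move: l1 l3; clear; lra.
Qed.

(** * Exponential weights, growth classes and barriers *)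

Definition wt (e x y : R) : R := expR (e * (`|x| + y)).

Lemma wt_gt0 e x y : 0 < wt e x y.
exact: expR_gt0. Qed.

Lemma wt_ge1 (e x y : R) : 0 <= e -> 0 <= y -> 1 <= wt e x y.
by move=> e0 y0; rewrite -expR0 ler_expR mulr_ge0// addr_ge0. Qed.

Lemma le_wt (e e' x y : R) : e <= e' -> 0 <= y -> wt e x y <= wt e' x y.
by move=> e0 y0; rewrite ler_expR ler_wpM2r// addr_ge0. Qed.

Lemma wtD (e e' x y : R) : wt (e + e') x y = wt e x y * wt e' x y.
by rewrite /wt mulrDl expRD. Qed.

(** A bound at every rate, with a constant that depends on the rate. This makes the class stable
    under products and gives decay relative to each barrier. *)
Definition subexp (T : R) (v : fun3) := forall e : R, 0 < e -> exists2 C : R, 0 < C & forall t x y, 0 <= t <= T -> 0 <= y ->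
  `|v t x y| <= C * wt e x y.

Lemma subexpD (T : R) (u v : fun3) : subexp T u -> subexp T v -> subexp T (fun t x y => u t x y + v t x y).
move=> hu hv e e0; have [C C0 H] := hu e e0; have [C' C0' H'] := hv e e0.
exists (C + C'); first exact: addr_gt0.
by move=> t x y tT y0; rewrite mulrDl (le_trans (ler_normD _ _))// lerD// ?H ?H'.
Qed.

Lemma subexpM (T : R) (u v : fun3) : subexp T u -> subexp T v -> subexp T (fun t x y => u t x y * v t x y).
move=> hu hv e e0; have e2 : 0 < e / 2 by rewrite divr_gt0.
have [C C0 H] := hu _ e2; have [C' C0' H'] := hv _ e2.
exists (C * C'); first exact: mulr_gt0.
move=> t x y tT y0; rewrite [e]splitr wtD mulrACA normrM ler_pM//; [exact: H | exact: H'].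
Qed.

Lemma subexp_cst T k : subexp T (fun _ _ _ => k).
move=> e e0; exists (`|k| + 1); first by rewrite ltr_wpDl.
move=> t x y _ y0; have := wt_ge1 x (ltW e0) y0; have := normr_ge0 k; nra.
Qed.

Lemma subexp_le (T : R) (u v : fun3) :
 (forall t x y, 0 <= t <= T -> 0 <= y -> `|u t x y| <= `|v t x y|) -> subexp T v -> subexp T u.
move=> le hv e e0; have [C C0 H] := hv e e0; exists C => // t x y tT y0.
by apply: le_trans (H _ _ _ tT y0); apply: le.
Qed.

Lemma subexp_norm (T : R) : subexp T (fun _ x y => `|x| + y : R).
move=> e e0; exists e^-1; first by rewrite invr_gt0.
move=> t x y _ y0; rewrite ger0_norm ?addr_ge0// -ler_pdivrMl ?invr_gt0// invrK.
by apply: le_trans (expR_ge1Dx _); rewrite lerDr.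
Qed.

Lemma subexp_x T : subexp T (fun _ x _ => x : R).
apply: subexp_le (@subexp_norm T) => t x y _ y0.
by rewrite [leRHS]ger0_norm ?addr_ge0// lerDl.
Qed.

Lemma subexp_y T : subexp T (fun _ _ y => y : R).
apply: subexp_le (@subexp_norm T) => t x y _ y0.
by rewrite (ger0_norm y0) ger0_norm ?addr_ge0// lerDr.
Qed.

Lemma subexp_t T : subexp T (fun t _ _ => t : R).
apply: subexp_le (@subexp_cst T T) => t x y /andP[t0 tT] y0.
by rewrite !ger0_norm// (le_trans t0).
Qed.

Fixpoint is_poly (e : expr) : Prop := match e with
 | Cst _ | Vt | Vx | Vy => True
 | Add e1 e2 | Mul e1 e2 => is_poly e1 /\ is_poly e2
 | _ => False
 end.

Lemma poly_subexp T e : is_poly e -> subexp T (ev e).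
elim: e => //= [k||||e1 h1 e2 h2|e1 h1 e2 h2].
- by move=> _; apply: subexp_cst.
- by move=> _; apply: subexp_t.
- by move=> _; apply: subexp_x.
- by move=> _; apply: subexp_y.
- by move=> [/h1 ? /h2 ?]; apply: subexpD.
- by move=> [/h1 ? /h2 ?]; apply: subexpM.
Qed.

Lemma poly_Dv p q r e : is_poly e -> is_poly (Dv p q r e).
by elim: e => //= e1 h1 e2 h2 [p1 p2]; split; auto. Qed.

Lemma poly_heat k e : is_poly e -> is_poly (heat k e).
by move=> h /=; do !split => //; do ?apply: poly_Dv. Qed.

(** The constant comes from 1 + s <= exp s at s = e z / L, raised to the power L. *)
Lemma weight_wt (L e x y : R) : 0 < L -> 0 < e -> 0 <= y -> weight L x y <= (1 + 2 * (L / e) `^ L) * wt e x y.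
move=> L0 e0 y0; set c := (L / e) `^ L; have w1 : 1 <= wt e x y := wt_ge1 x (ltW e0) y0.
have h z : 0 <= z -> z <= `|x| + y -> z `^ L <= c * wt e x y.
 move=> z0 zxy; have Le : 0 < L / e by rewrite divr_gt0. have zL : z <= L / e * expR (e * z / L).
  rewrite -ler_pdivrMl// invf_div mulrAC; apply: le_trans (expR_ge1Dx _). by rewrite [e * z / L]mulrAC; lra.
 have le0 : 0 <= L / e * expR (e * z / L) by rewrite mulr_ge0 ?expR_ge0 ?ltW. apply: le_trans (ge0_ler_powR (ltW L0) z0 le0 zL) _.
 rewrite powRM ?expR_ge0 ?(ltW Le)// -expRM divfK ?gt_eqF// ler_wpM2l ?powR_ge0//. by rewrite ler_expR ler_pM2l.
have := h _ (normr_ge0 x) ltac:(by rewrite lerDl); have := h _ y0 ltac:(by rewrite lerDr).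
by rewrite /weight mulrDl mul1r; lra.
Qed.

(** The rate e / (1 + |x| + y) is so small that exponential moments of a process started at (x, y)
    are bounded uniformly in the starting point, and its price is only the polynomial weight at (x,
    y). Polynomial growth of the expectation is recovered in this way. *)
Lemma weight_rescale (L e x y z w : R) : 0 < L -> 0 < e -> 0 <= y -> 0 <= w ->
 weight L z w <= (1 + 2 * (3 * L / e) `^ L) * weight L x y * wt (e / (1 + `|x| + y)) z w.
move=> L0 e0 y0 w0; have S1 : 1 <= 1 + `|x| + y by rewrite -addrA lerDl addr_ge0.
have S0 := lt_le_trans ltr01 S1; set S := 1 + _ + _ in S1 S0 *.
apply: le_trans (weight_wt z L0 (divr_gt0 e0 S0) w0) _; rewrite ler_wpM2r ?(ltW (wt_gt0 _ _ _))//.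
have W1 : 1 <= weight L x y by rewrite /weight -addrA lerDl addr_ge0 ?powR_ge0.
have SW : (S / 3) `^ L <= weight L x y.
 have le m : S / 3 <= m -> (S / 3) `^ L <= m `^ L.
  by move=> Sm; have m0 := le_trans (divr_ge0 (ltW S0) (ler0n _ 3)) Sm; rewrite ge0_ler_powR ?nnegrE ?(ltW L0)// divr_ge0 ?(ltW S0).
 have p1 := powR_ge0 `|x| L; have p2 := powR_ge0 y L; rewrite /weight.
 have [h|h] := leP (S / 3) 1; first by have := le _ h; rewrite powR1; lra.
 have [h'|h'] := leP (S / 3) `|x|; first by have := le _ h'; lra.
 by have := le y ltac:(by rewrite /S; move: h h'; rewrite /S; lra); lra.
have -> : L / (e / S) = 3 * L / e * (S / 3) by field; rewrite !gt_eqF.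
rewrite powRM ?divr_ge0 ?mulr_ge0 ?(ltW L0) ?(ltW e0) ?(ltW S0)//.
by have := ler_wpM2l (powR_ge0 (3 * L / e) L) SW; move: W1; lra.
Qed.

Lemma weight_subexp (T L : R) : 0 < L -> subexp T (fun _ x y => weight L x y : R).
move=> L0 e e0; exists (1 + 2 * (L / e) `^ L) => [|t x y _ y0]; first by rewrite ltr_pwDl ?mulr_ge0 ?powR_ge0.
by rewrite ger0_norm ?weight_wt// /weight !addr_ge0 ?powR_ge0.
Qed.

Lemma poly_growth_subexp T u : poly_growth T u -> subexp T u.
move=> [C [L [C0 L0 H]]].
apply: subexp_le (subexpM (@subexp_cst T C) (@weight_subexp T L L0)) => t x y tT y0.
by apply: (le_trans (H _ _ _ tT y0)); apply: ler_norm.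
Qed.

(** The exponent in y grows at the rate K backwards in time: its time derivative absorbs all the
    terms proportional to y, provided e is so small that the quadratic terms are dominated by linear
    ones. The constant kap absorbs the terms without y, and the sum of two exponentials is a smooth
    substitute for e^(e |x|). *)
Definition barrier e K kap T : expr := Mul (Mul (Exp (Mul (Cst kap) (Add (Cst T) (Mul (Cst (-1)) Vt))))
    (Add (Exp (Mul (Cst e) Vx)) (Exp (Mul (Cst (- e)) Vx))))
   (Exp (Mul (Mul (Cst e) (Exp (Mul (Cst K) (Add (Cst T) (Mul (Cst (-1)) Vt))))) Vy)).

Lemma barrier_gt0 e K kap T t x y : 0 < ev (barrier e K kap T) t x y.
by rewrite /= !mulr_gt0 ?addr_gt0 ?expR_gt0. Qed.

Lemma barrier_ge_wt (e K kap T t x y : R) : 0 <= e -> 0 <= K -> 0 <= kap -> 0 <= t <= T -> 0 <= y ->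
 wt e x y <= ev (barrier e K kap T) t x y.
move=> e0 K0 kap0 /andP[t0 tT] y0; rewrite /wt mulrDr expRD /=.
have Tt : 0 <= T + -1 * t by rewrite mulN1r subr_ge0.
apply: ler_pM; rewrite ?expR_ge0//; last first.
 rewrite ler_expR ler_wpM2r// ler_peMr// -[leLHS]expR0 ler_expR mulr_ge0//.
rewrite -[leLHS]mul1r; apply: ler_pM; rewrite ?expR_ge0//.
 by rewrite -[leLHS]expR0 ler_expR mulr_ge0.
have [x0|x0] := leP 0 x; first by rewrite (ger0_norm x0) lerDl expR_ge0.
by rewrite (ltr0_norm x0) mulrN mulNr lerDr expR_ge0.
Qed.

Lemma barrier_le_wt (e K kap T t x y : R) : 0 <= e -> 0 <= K -> 0 <= kap -> 0 <= t <= T -> 0 <= y ->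
 ev (barrier e K kap T) t x y <= 2 * expR (kap * T) * wt (e * expR (K * T)) x y.
move=> e0 K0 kap0 /andP[t0 tT] y0 /=.
have Tt : T + -1 * t <= T by rewrite mulN1r gerDl oppr_le0.
have Tt' : 0 <= T + -1 * t by rewrite mulN1r subr_ge0.
have E1 : 1 <= expR (K * T) by rewrite -expR0 ler_expR mulr_ge0// (le_trans t0).
rewrite /wt [in leRHS]mulrDr [in leRHS]expRD mulrA; apply: ler_pM; rewrite ?mulr_ge0 ?addr_ge0 ?expR_ge0//.
 rewrite [2 * _]mulrC -[leRHS]mulrA; apply: ler_pM; rewrite ?addr_ge0 ?expR_ge0//.
  by rewrite ler_expR ler_wpM2l.
 have h z : `|z| = `|x| -> expR (e * z) <= expR (e * expR (K * T) * `|x|).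
  move=> zx; rewrite ler_expR -mulrA ler_wpM2l// (le_trans (ler_norm z))// zx. by rewrite ler_peMl.
 rewrite mulr_natl mulr2n; apply: lerD; first exact: h. by rewrite mulNr -mulrN; apply: h; rewrite normrN.
by rewrite ler_expR ler_wpM2r// ler_wpM2l// ler_expR ler_wpM2l.
Qed.

Lemma heat_barrier (k : prm) (e K kap T r t x y : R) : admissible k -> 0 < e -> `|pd k| + `|pb k| + 1 <= K ->
 (pl k + ps k) ^+ 2 * (e * expR (K * T)) <= 1 -> `|pc k| * e + pa k * (e * expR (K * T)) + `|r| + 1 <= kap ->
 0 <= t <= T -> 0 <= y -> ev (heat k (barrier e K kap T)) t x y + r * ev (barrier e K kap T) t x y
  <= - ev (barrier e K kap T) t x y.
move=> [a0 l0 s0 /andP[r1 r2]] e0 hK small hkap /andP[t0 tT] y0.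
rewrite ev_heat /hop /=.
set A := expR (kap * _); set P := expR (e * x); set N := expR (- e * x).
set B := expR (K * _); set G := expR (e * B * y).
have [A0 P0 N0 G0 B0] : [/\ 0 < A, 0 < P, 0 < N, 0 < G & 0 < B] by rewrite !expR_gt0.
have K0 : 0 <= K by apply: le_trans hK; rewrite !addr_ge0.
have B1 : 1 <= B.
 by rewrite /B -[leLHS]expR0 ler_expR mulr_ge0// mulN1r subr_ge0.
have BT : B <= expR (K * T).
 by rewrite ler_expR ler_wpM2l// mulN1r gerDl oppr_le0.
pose th := e * B.
have the : e <= th by rewrite /th ler_peMr// ltW.
have thT : th <= e * expR (K * T) by rewrite /th ler_wpM2l// ltW.
have th0 : 0 < th := lt_le_trans e0 the.
(* the y-coefficient and the constant term of heat w / w, for the factor e^(s x), s = +e or -e *)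
pose F (s : R) := - kap - K * th * y
 + y / 2 * (pl k ^+ 2 * s ^+ 2 + 2 * pr k * pl k * ps k * s * th + ps k ^+ 2 * th ^+ 2)
 + (pc k + pd k * y) * s + (pa k - pb k * y) * th + r.
have HF s : `|s| = e -> F s <= - 1.
 move=> se. have s2 : s ^+ 2 = e ^+ 2 by rewrite -se real_normK// num_real.
 have c1 : pl k ^+ 2 * s ^+ 2 + 2 * pr k * pl k * ps k * s * th + ps k ^+ 2 * th ^+ 2 <= (pl k + ps k) ^+ 2 * th * th.
  have h1 : pl k ^+ 2 * s ^+ 2 <= pl k ^+ 2 * (th * th).
   by rewrite s2 expr2 ler_wpM2l ?sqr_ge0// ler_pM// ltW.
  have h2 : 2 * pr k * pl k * ps k * s * th <= 2 * pl k * ps k * (th * th).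
   have -> : 2 * pr k * pl k * ps k * s * th = 2 * pl k * ps k * ((pr k * s) * th) by ring.
   rewrite ler_wpM2l ?mulr_ge0 ?(ltW l0) ?(ltW s0)// ler_wpM2r ?(ltW th0)//.
   apply: le_trans the; apply: (le_trans (ler_norm _)); rewrite normrM se.
   by rewrite ler_piMl ?(ltW e0)// ler_norml; apply/andP; split; apply: ltW.
  have -> : (pl k + ps k) ^+ 2 * th * th = pl k ^+ 2 * (th * th) + 2 * pl k * ps k * (th * th)
    + ps k ^+ 2 * th ^+ 2 by ring.
  by rewrite !lerD.
 have c2 : (pl k + ps k) ^+ 2 * th * th <= th.
  rewrite ler_piMl ?(ltW th0)//; apply: le_trans small. by rewrite ler_wpM2l ?sqr_ge0.
 have c3 : pd k * s <= `|pd k| * th.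
  by apply: (le_trans (ler_norm _)); rewrite normrM se ler_wpM2l.
 have c4 : - pb k * th <= `|pb k| * th.
  by rewrite ler_wpM2r ?(ltW th0)// -normrN ler_norm.
 have c5 : (`|pd k| + `|pb k| + 1) * th <= K * th by rewrite ler_wpM2r ?(ltW th0). have c6 : pc k * s <= `|pc k| * e.
  by apply: (le_trans (ler_norm _)); rewrite normrM se.
 have c7 : pa k * th <= pa k * (e * expR (K * T)) by rewrite ler_wpM2l ?(ltW a0).
 have c8 : y / 2 * (pl k ^+ 2 * s ^+ 2 + 2 * pr k * pl k * ps k * s * th + ps k ^+ 2 * th ^+ 2)
   <= y / 2 * th by rewrite ler_wpM2l ?divr_ge0// (le_trans c1).
 have c9 : y * (- (K * th) + th / 2 + pd k * s + - pb k * th) <= 0.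
  by rewrite mulr_ge0_le0//; move: c3 c4 c5 th0; clear; lra.
 have := ler_norm r; move: c6 c7 c8 c9 hkap; rewrite /F; clear; lra.
rewrite -subr_le0 opprK; set Z := (X in X <= 0).
have -> : Z = A * P * G * (F e + 1) + A * N * G * (F (- e) + 1).
 by rewrite /Z /F /th; field.
apply: addr_le0; (rewrite mulr_ge0_le0 ?mulr_ge0 ?(ltW A0) ?(ltW P0) ?(ltW N0) ?(ltW G0)//).
 by have := HF e; rewrite gtr0_norm// => /(_ erefl); clear; lra.
by have := HF (- e); rewrite normrN gtr0_norm// => /(_ erefl); clear; lra.
Qed.

(** * Continuity on slabs and jets of classical solutions *)

Lemma cont3P D v : continuous3_on D v <-> forall t x y, D (t, x, y) -> forall e : R, 0 < e ->
  exists2 d : R, 0 < d & forall s z w, D (s, z, w) ->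
   `|s - t| <= d -> `|z - x| <= d -> `|w - y| <= d -> `|v s z w - v t x y| <= e.
split.
 move=> /subspace_continuousP H t x y Dp e e0.
 have /cvgrPdist_le /(_ e e0) := H _ Dp; rewrite near_withinE => /nbhs_ballP [d /= d0 Hd].
 exists (d / 2); first by rewrite divr_gt0. have hd : d / 2 < d by rewrite ltr_pdivrMr// ltr_pMr// ltr1n.
 move=> s z w Ds hs hz hw; rewrite distrC.
 by apply: (Hd (s, z, w)) => //; split; [split|]; rewrite /ball /= distrC; exact: le_lt_trans hd.
move=> H; apply/subspace_continuousP => -[[t x] y] Dp; apply/cvgrPdist_le => e e0.
have [d d0 Hd] := H t x y Dp e e0; rewrite near_withinE; apply/nbhs_ballP; exists d => //.
move=> [[s z] w] [[/= h1 h2] h3] Ds; rewrite distrC.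
by apply: Hd => //; rewrite distrC; apply: ltW.
Qed.

Lemma cont3_lin (D : set (R * R * R)) (u v : fun3) (k : R) : continuous3_on D u -> continuous3_on D v ->
 continuous3_on D (fun t x y => u t x y + k * v t x y).
move=> cu cv P; apply: cvgD; first exact: cu.
by apply: cvgM; [exact: cvg_cst | exact: cv].
Qed.

Lemma ev_cont3 D e : continuous3_on D (ev e).
exact: continuous_subspaceT (@ev_continuous e). Qed.

(** For y > 0 the derivatives relative to the half-line are ordinary derivatives, and the second
    derivatives come from the regularity on the open slab. *)
Lemma classical_jets (T a b c d varrho lam sig rho : R) (f : R -> R -> R) (h : fun3) (u : fun3) :
 classical_solution T a b c d varrho lam sig rho f h u -> forall t x y, 0 <= t < T -> 0 <= y -> exists a0 p q A B C,
  jets T u t x y a0 p q A B C /\ hop (Prm a b c d lam sig rho) y a0 p q A B C + varrho * u t x y = h t x y.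
move=> [C2 [_ C11 _ _ _] _ eqn _] t x y tT y0.
have Ps : slab T (t, x, y) by split.
have [e1 e2 e3] := C11 t x y Ps.
exists (Dt T u t x y), (Dx u t x y), (Dy u t x y), (Dx (Dx u) t x y), (Dx (Dy u) t x y), (Dy (Dy u) t x y); split; last first.
 by rewrite -(eqn t x y tT y0) /hop /generator /=.
have dxP (g : R -> R -> R) z w : ex_dx g z w -> has_der setT (fun r => g r w) z (dx g z w).
 by move=> hd; apply/is_deriveP; rewrite /dx derive1E; apply: derivableP.
have dyP (g : R -> R -> R) z w : 0 < w -> ex_dy g z w -> has_der setT (g z) w (dy g z w).
 move=> w0 /derivable_onP hd; apply: has_der_interior hd; first exact: w0.
 by move=> r; rewrite ler_norml => /andP[h1 _]; rewrite /= in_itv/= andbT; lra.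
split; [exact: (derivable_onP e1) | exact: (dxP _ _ _ e2) | exact: (derivable_onP e3) | move=> y1].
have [_ [C2a [_ [C2c _ _ _]] C2e _]] := C2.
have [_ [C3a _ [C3b _] _]] := C2e.
exists (fun z => Dx u t z y), (Dy u t), (Dy (Dy u) t), (y / 2); first by rewrite divr_gt0.
have Dz z w : `|w - y| <= y / 2 -> open_slab T (t, z, w) /\ 0 < w.
 by rewrite ler_norml => /andP[h1 _]; have w0 : 0 < w by lra.
have yy : `|y - y| <= y / 2 by rewrite subrr normr0 divr_ge0.
have DD z : open_slab T (t, z, y) by have [] := Dz z y yy.
split => //.
- split => [z _|]; apply: dxP; first exact: (proj1 (C2a _ _ _ (DD z))).
 exact: (proj1 (C2c _ _ _ (DD x))).
- by apply: dxP; exact: (proj1 (C3a _ _ _ (DD x))).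
- move=> z w _ /Dz -/(_ z) [Dw w0]; split; apply: (dyP _ _ _ w0).
  exact: (proj2 (C2a _ _ _ Dw)).
 exact: (proj2 (C3a _ _ _ Dw)).
- split => // e e0; have /cont3P /(_ _ _ _ (DD x) e e0) [r r0 Hr] := C3b.
 exists (Num.min r (y / 2)); first by rewrite lt_min r0 divr_gt0. move=> z w; rewrite !le_min => /andP[zr _] /andP[wr wy].
 by apply: Hr => //; [have [] := Dz z w wy | rewrite subrr normr0 ltW].
Qed.

(** * Comparison with barriers: uniqueness and a priori estimates *)

Lemma subexp_small (T : R) (v : fun3) (w : expr) (e : R) :
 0 < e -> subexp T v -> (forall t x y, 0 <= t <= T -> 0 <= y -> wt e x y <= ev w t x y) ->
 forall eta : R, 0 < eta -> exists N, forall t x y, 0 <= t <= T -> 0 <= y -> N <= `|x| + y -> v t x y <= eta * ev w t x y.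
move=> e0 sv hw eta eta0; have e2 : 0 < e / 2 by rewrite divr_gt0.
have [C C0 H] := sv _ e2; exists (C / eta / (e / 2)) => t x y tT y0 N.
apply: (le_trans (ler_norm _)); apply: (le_trans (H _ _ _ tT y0)).
apply: le_trans (ler_wpM2l (ltW eta0) (hw _ _ _ tT y0)).
rewrite [in leRHS](splitr e) wtD mulrA ler_wpM2r ?(ltW (wt_gt0 _ _ _))//.
rewrite mulrC -ler_pdivrMr//; apply: le_trans (expR_ge1Dx _).
move: N; rewrite ler_pdivrMr// => N; apply: (le_trans N).
by rewrite mulrC lerDr.
Qed.

(** The factor by which the rate of the barrier in y increases over [0, T]; each use of a barrier
    multiplies the rate of the estimate by it. *)
Definition gain (k : prm) (T : R) : R := expR ((`|pd k| + `|pb k| + 1) * T).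

Lemma gain_ge1 k (T : R) : 0 <= T -> 1 <= gain k T.
by move=> T0; rewrite /gain -expR0 ler_expR mulr_ge0// !addr_ge0. Qed.

(** The largest rate that the smallness condition of [heat_barrier] admits, with the exponent K that
    defines [gain]. *)
Definition small_rate k T : R := ((pl k + ps k) ^+ 2 * gain k T)^-1.

Lemma small_rate_gt0 k T : admissible k -> 0 < small_rate k T.
move=> [_ l0 s0 _].
by rewrite /small_rate invr_gt0 mulr_gt0 ?expR_gt0// exprn_gt0// addr_gt0.
Qed.

Lemma barrierP (k : prm) (T r e : R) : admissible k -> 0 <= T -> 0 < e -> e <= small_rate k T ->
 exists (w : expr) (C : R), [/\ 0 < C, (forall t x y, 0 < ev w t x y), (forall t x y, 0 <= t <= T -> 0 <= y ->
    ev (heat k w) t x y + r * ev w t x y <= - ev w t x y),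
  (forall t x y, 0 <= t <= T -> 0 <= y -> wt e x y <= ev w t x y) &
  (forall t x y, 0 <= t <= T -> 0 <= y -> ev w t x y <= C * wt (e * gain k T) x y)].
move=> ak T0 e0 es; have [a0 l0 s0 _] := ak.
pose kap := `|pc k| * e + pa k * (e * gain k T) + `|r| + 1.
have K0 : 0 <= `|pd k| + `|pb k| + 1 by rewrite !addr_ge0.
have g0 : 0 < gain k T by rewrite expR_gt0.
have kap0 : 0 <= kap.
 by rewrite /kap !addr_ge0// mulr_ge0// ?ltW// mulr_gt0.
exists (barrier e (`|pd k| + `|pb k| + 1) kap T), (2 * expR (kap * T)); split.
- by rewrite mulr_gt0// expR_gt0.
- exact: barrier_gt0.
- move=> t x y tT y0; apply: heat_barrier => //.
 have q0 : 0 < (pl k + ps k) ^+ 2 by rewrite exprn_gt0// addr_gt0. have : e * ((pl k + ps k) ^+ 2 * gain k T) <= 1.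
  by rewrite -ler_pdivlMr ?div1r// mulr_gt0.
 by rewrite mulrCA.
- by move=> t x y tT y0; apply: barrier_ge_wt => //; apply: ltW.
- by move=> t x y tT y0; apply: barrier_le_wt => //; apply: ltW.
Qed.

Lemma hop_lin (k : prm) (m y X0 X1 X2 X3 X4 X5 Y0 Y1 Y2 Y3 Y4 Y5 : R) :
 hop k y (X0 + m * Y0) (X1 + m * Y1) (X2 + m * Y2) (X3 + m * Y3) (X4 + m * Y4) (X5 + m * Y5)
 = hop k y X0 X1 X2 X3 X4 X5 + m * hop k y Y0 Y1 Y2 Y3 Y4 Y5.
by rewrite /hop; ring. Qed.

(** This is [comparison] with A = 0: the difference has zero source and zero terminal value, and it
    grows more slowly than the barrier. *)
Lemma classical_le (T a b c d varrho lam sig rho : R) f h u v : 0 < T -> admissible (Prm a b c d lam sig rho) ->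
 classical_solution T a b c d varrho lam sig rho f h u -> poly_growth T u ->
 classical_solution T a b c d varrho lam sig rho f h v -> poly_growth T v ->
 forall t x y, 0 <= t <= T -> 0 <= y -> u t x y <= v t x y.
move=> T0 ak su gu sv gv t x y tT y0; set k := Prm _ _ _ _ _ _ _ in ak.
have [w [C [_ w0 bar ge _]]] := barrierP varrho ak (ltW T0) (small_rate_gt0 T ak) (lexx _).
pose D t x y := u t x y + -1 * v t x y.
suff : D t x y <= 0 * ev w t x y by rewrite /D mul0r; lra.
have [_ _ cu _ uT] := su; have [_ _ cv _ vT] := sv.
have bar' s z r : 0 <= s <= T -> 0 <= r -> ev (heat k w) s z r + varrho * ev w s z r < 0.
 by move=> sT r0; apply: (le_lt_trans (bar s z r sT r0)); rewrite oppr_lt0.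
apply: (comparison ak (ltW T0) (lexx _) _ w0 bar') => //.
- exact: cont3_lin.
- apply: subexp_small ge; first exact: small_rate_gt0.
 apply: subexpD; first exact: poly_growth_subexp. by apply: (subexpM (@subexp_cst T (-1))); apply: poly_growth_subexp.
- by move=> z r r0; rewrite /D uT// vT// mul0r; lra.
- move=> s z r sT r0.
 have [a0 [p [q [A [B [C1 [J E]]]]]]] := classical_jets su z sT r0.
 have [a0' [p' [q' [A' [B' [C1' [J' E']]]]]]] := classical_jets sv z sT r0. do 6 eexists; split; first exact: jets_lin J J'.
 rewrite hop_lin /D mul0r; move: E E'; rewrite -/k; set H1 := hop _ _ _ _ _ _ _ _. by set H2 := hop _ _ _ _ _ _ _ _; clear; lra.
Qed.

(* For small [del] the profile is close to [eps] except near [T], where it is of order [C / del];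
  its time integral is at most of order [eps + C]. *)
Definition profile (T eps C del t : R) : R := eps + C / del * (expR ((t - T) / del) * expR (- expR ((t - T) / del))).

(** Up to sign, the time derivative of the second factor is the singular part of [profile], while
    the factor itself stays between eps and eps + C for every del. *)
Definition profile_barrier (T eps C del : R) (w : expr) : expr := Mul w (Add (Cst eps) (Mul (Cst C)
  (Exp (Mul (Cst (-1)) (Exp (Mul (Add Vt (Cst (- T))) (Cst del^-1))))))).

Lemma profile_barrierE (T eps C del : R) (w : expr) (t x y : R) : ev (profile_barrier T eps C del w) t x y
 = ev w t x y * (eps + C * expR (- expR ((t - T) / del))).
by rewrite /= mulN1r. Qed.

Lemma heat_profile_barrier k T eps C del w t x y : ev (heat k (profile_barrier T eps C del w)) t x y
 = ev (heat k w) t x y * (eps + C * expR (- expR ((t - T) / del)))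
  - ev w t x y * (C / del * (expR ((t - T) / del) * expR (- expR ((t - T) / del)))).
by rewrite /= mulN1r; ring. Qed.

Lemma profile_gt0 (T eps C del t : R) : 0 < eps -> 0 <= C -> 0 < del -> 0 < profile T eps C del t.
move=> e0 C0 d0; rewrite /profile ltr_wpDr// mulr_ge0//; by rewrite divr_ge0// ltW.
Qed.

Lemma apriori_sup (k : prm) (T r e : R) : admissible k -> 0 <= T -> 0 < e -> e <= small_rate k T ->
 exists2 C0 : R, 0 < C0 & forall (v : fun3) (eps C del : R), 0 < eps -> 0 <= C -> 0 < del ->
  continuous3_on (closed_slab T) v -> subexp T v -> (forall x y, 0 <= y -> `|v T x y| <= eps * wt e x y) ->
  (forall t x y, 0 <= t < T -> 0 <= y -> exists a0 p q A1 B1 C1, jets T v t x y a0 p q A1 B1 C1 /\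
    `|hop k y a0 p q A1 B1 C1 + r * v t x y| <= profile T eps C del t * wt e x y) ->
  forall t x y, 0 <= t <= T -> 0 <= y -> `|v t x y| <= (eps + C) * (C0 * wt (e * gain k T) x y).
move=> ak T0 e0 es; have [w [C0 [C00 w0 bar ge le]]] := barrierP r ak T0 e0 es.
exists C0 => // v eps C del eps0 CC0 del0 cv sv F J.
pose W := profile_barrier T eps C del w.
pose g (t : R) := expR (- expR ((t - T) / del)).
have g0 t : 0 < g t by exact: expR_gt0.
have g1 t : g t <= 1 by rewrite /g -[leRHS]expR0 ler_expR oppr_le0 expR_ge0.
have WE t x y : ev W t x y = ev w t x y * (eps + C * g t) by exact: profile_barrierE.
have Cg t : 0 <= C * g t by rewrite mulr_ge0// ltW.
have Wle t x y : ev W t x y <= (eps + C) * ev w t x y.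
 rewrite WE mulrC ler_wpM2r ?(ltW (w0 _ _ _))// lerD2l. by rewrite ler_piMr.
have Wge t x y : eps * ev w t x y <= ev W t x y.
 by rewrite WE mulrC ler_wpM2l ?(ltW (w0 _ _ _))// lerDl.
have W0 t x y : 0 < ev W t x y by rewrite WE mulr_gt0// ltr_wpDr.
have barW t x y : 0 <= t <= T -> 0 <= y -> ev (heat k W) t x y + r * ev W t x y <= - (profile T eps C del t * ev w t x y).
 move=> tT y0; rewrite heat_profile_barrier WE /profile -/(g t); set z := C / del * _.
 have -> : forall H V : R, H * (eps + C * g t) - V * z + r * (V * (eps + C * g t))
   = (H + r * V) * (eps + C * g t) - V * z by move=> *; ring.
 have : (ev (heat k w) t x y + r * ev w t x y) * (eps + C * g t) <= - ev w t x y * (eps + C * g t).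
  by rewrite ler_wpM2r ?addr_ge0 ?(ltW eps0)//; apply: bar.
 have := mulr_ge0 (ltW (w0 t x y)) (Cg t); clear.
 move: (ev w t x y) ((ev (heat k w) t x y + r * ev w t x y) * (eps + C * g t)) => V Z. by move: (C * g t) => G; lra.
have pr0 t := profile_gt0 T t eps0 CC0 del0.
have barW' t x y : 0 <= t <= T -> 0 <= y -> ev (heat k W) t x y + r * ev W t x y < 0.
 by move=> tT y0; apply: (le_lt_trans (barW t x y tT y0)); rewrite oppr_lt0 mulr_gt0.
have side (s : R) : `|s| = 1 -> forall t x y, 0 <= t <= T -> 0 <= y -> 0 + s * v t x y <= 1 * ev W t x y.
 move=> s1; apply: (@comparison k T r 1 (fun t x y => 0 + s * v t x y) W ak T0 ler01 _ W0 barW').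
 - by apply: cont3_lin => // P; apply: cvg_cst.
 - move=> eta eta0; have su : subexp T (fun t x y => 0 + s * v t x y).
   exact: (subexpD (@subexp_cst T 0) (subexpM (@subexp_cst T s) sv)).
  have [N H] := subexp_small e0 su ge (mulr_gt0 eta0 eps0). exists N => t x y tT y0 /(H t x y tT y0) h; apply: (le_trans h).
  by rewrite -mulrA ler_wpM2l ?(ltW eta0).
 - move=> x y y0; rewrite add0r mul1r; apply: (le_trans (ler_norm _)).
  rewrite normrM s1 mul1r; apply: (le_trans (F _ _ y0)); apply: le_trans (Wge _ _ _).
  by rewrite ler_wpM2l ?(ltW eps0)// ge// lexx T0.
 - move=> t x y tT y0; have [a0 [p [q' [A1 [B1 [C1 [Jv le1]]]]]]] := J t x y tT y0.
  have tT' : 0 <= t <= T by case/andP: tT => -> /ltW. do 6 eexists; split; first exact: jets_lin (ev_jets T (Cst 0) t x y) Jv.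
  rewrite hop_lin mul1r; apply: (le_trans (barW t x y tT' y0)).
  have -> : hop k y (ev (Et (Cst 0)) t x y) (ev (Ex (Cst 0)) t x y) (ev (Ey (Cst 0)) t x y)
   (ev (Ex (Ex (Cst 0))) t x y) (ev (Ex (Ey (Cst 0))) t x y) (ev (Ey (Ey (Cst 0))) t x y) = 0. by rewrite /hop /=; ring.
  rewrite !add0r [r * _]mulrCA -mulrDr lerNl; apply: (le_trans (ler_norm _)).
  rewrite normrN normrM s1 mul1r; apply: (le_trans le1). by rewrite ler_wpM2l ?(ltW (pr0 t))// ge.
move=> t x y tT y0.
have h1 := side 1 (normr1 _) t x y tT y0; have h2 := side (-1) ltac:(by rewrite normrN normr1) t x y tT y0.
have h3 : ev W t x y <= (eps + C) * (C0 * wt (e * gain k T) x y).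
 by apply: (le_trans (Wle _ _ _)); rewrite ler_wpM2l ?addr_ge0 ?(ltW eps0)// le.
apply: le_trans h3; rewrite ler_norml; move: h1 h2; clear.
by move: (ev W _ _ _) => Z h1 h2; apply/andP; split; lra.
Qed.

(** These four functions satisfy a closed system of estimates: the y-derivative of the equation
    involves, besides the y-derivative of u, only the first two x-derivatives as a source. *)
Definition bd4 (e : expr) (t x y B : R) := [/\ `|ev e t x y| <= B, `|ev (Ex e) t x y| <= B, `|ev (Ex (Ex e)) t x y| <= B
  & `|ev (Ey e) t x y| <= B].

Lemma bd4_le e (t x y B B' : R) : B <= B' -> bd4 e t x y B -> bd4 e t x y B'.
by move=> le [*]; split; apply: le_trans le. Qed.

(** The operator for the y-derivative: differentiating the factor y of the second-order terms adds
    sigma^2 / 2 to a and rho lambda sigma to c. *)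
Definition pshift k : prm := Prm (pa k + ps k ^+ 2 / 2) (pb k) (pc k + pr k * pl k * ps k) (pd k) (pl k) (ps k) (pr k).

Lemma admissible_shift k : admissible k -> admissible (pshift k).
by move=> [*]; split => //=; rewrite ltr_wpDr// divr_ge0// sqr_ge0. Qed.

Lemma ev_heat_Ex k u t x y : ev (Ex (heat k u)) t x y = ev (heat k (Ex u)) t x y.
have E1 := Dv_comm u t x y 0 1 0 1 0 0.
have E2 := Dv_comm u t x y 0 0 1 0 1 0.
have E3 : ev (Ex (Ey (Ex u))) t x y = ev (Ex (Ex (Ey u))) t x y.
 by apply: Dv_ext => *; rewrite Dv_comm.
have E4 : ev (Ey (Ey (Ex u))) t x y = ev (Ex (Ey (Ey u))) t x y.
 rewrite -(Dv_comm (Ey u) _ _ _ 0 0 1); apply: Dv_ext => *; exact: Dv_comm.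
by rewrite /= E1 E2 E3 E4; ring.
Qed.

Lemma ev_heat_Ey k u t x y : ev (Ey (heat k u)) t x y = ev (heat (pshift k) (Ey u)) t x y
  + pl k ^+ 2 / 2 * ev (Ex (Ex u)) t x y + pd k * ev (Ex u) t x y - pb k * ev (Ey u) t x y.
have E1 := Dv_comm u t x y 0 0 1 1 0 0.
have E2 := Dv_comm u t x y 0 0 1 0 1 0.
have E3 : ev (Ey (Ex (Ex u))) t x y = ev (Ex (Ex (Ey u))) t x y.
 rewrite (Dv_comm (Ex u)); apply: Dv_ext => *; exact: Dv_comm.
have E4 : ev (Ey (Ex (Ey u))) t x y = ev (Ex (Ey (Ey u))) t x y.
 exact: (Dv_comm (Ey u)).
by rewrite /= E1 E2 E3 E4; field.
Qed.

Definition heatr k r u : expr := Add (heat k u) (Mul (Cst r) u).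

Lemma apriori_poly (k : prm) (T r e : R) : admissible k -> 0 <= T -> 0 < e -> e <= small_rate k T ->
 exists2 C0 : R, 0 < C0 & forall (u : expr) (eps C del : R), is_poly u -> 0 < eps -> 0 <= C -> 0 < del ->
  (forall x y, 0 <= y -> `|ev u T x y| <= eps * wt e x y) -> (forall t x y, 0 <= t < T -> 0 <= y ->
    `|ev (heatr k r u) t x y| <= profile T eps C del t * wt e x y) ->
  forall t x y, 0 <= t <= T -> 0 <= y -> `|ev u t x y| <= (eps + C) * (C0 * wt (e * gain k T) x y).
move=> ak T0 e0 es; have [C0 C00 H] := apriori_sup r ak T0 e0 es.
exists C0 => // u eps C del pu eps0 CC0 del0 F S; apply: (H _ eps C del) => //; first exact: ev_cont3.
 exact: poly_subexp.
move=> t x y tT y0; do 6 eexists; split; first exact: ev_jets.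
by rewrite -ev_heat; apply: S.
Qed.

(** The x-derivatives satisfy the same equation as u. They enter the source of the equation for the
    y-derivative, whose estimate therefore starts at a rate already multiplied by [gain] and
    multiplies it once more. *)
Lemma apriori4 (k : prm) (T r e : R) : admissible k -> 0 <= T -> 0 < e -> e * gain k T <= small_rate k T ->
 exists2 C0 : R, 0 < C0 & forall (u : expr) (eps C del : R), is_poly u -> 0 < eps -> 0 <= C -> 0 < del ->
  (forall x y, 0 <= y -> bd4 u T x y (eps * wt e x y)) ->
  (forall t x y, 0 <= t < T -> 0 <= y -> bd4 (heatr k r u) t x y (profile T eps C del t * wt e x y)) ->
  forall t x y, 0 <= t <= T -> 0 <= y -> bd4 u t x y ((eps + C) * (C0 * wt (e * gain k T ^+ 2) x y)).
move=> ak T0 e0 es.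
have g1 := gain_ge1 k T0; have g0 : 0 < gain k T by rewrite expR_gt0.
have es' : e <= small_rate k T by apply: le_trans es; rewrite ler_peMr// ltW.
have eg0 : 0 < e * gain k T by rewrite mulr_gt0.
have [C1 C10 H1] := apriori_poly r ak T0 e0 es'.
have [C2 C20 H2] := apriori_poly (r - pb k) (admissible_shift ak) T0 eg0 es.
pose m := pl k ^+ 2 / 2 + `|pd k|.
have m0 : 0 <= m by rewrite addr_ge0// divr_ge0// sqr_ge0.
have mC : 0 <= m * C1 by rewrite mulr_ge0// ltW.
pose C3 := (1 + m * C1) * C2.
have m1 : 0 < 1 + m * C1 by rewrite ltr_wpDr.
have C30 : 0 < C3 by apply: mulr_gt0.
exists (C1 + C3); first exact: addr_gt0.
move=> u eps C del pu eps0 CC0 del0 F S.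
have lw x y : 0 <= y -> wt e x y <= wt (e * gain k T) x y.
 by move=> y0; apply: le_wt => //; rewrite ler_peMr// ltW.
have lw2 x y : 0 <= y -> wt (e * gain k T) x y <= wt (e * gain k T ^+ 2) x y.
 by move=> y0; apply: le_wt => //; rewrite expr2 mulrA ler_peMr// ltW.
have A0 : 0 < eps + C by rewrite ltr_wpDr.
have B0 : forall t x y, 0 <= t <= T -> 0 <= y -> `|ev u t x y| <= (eps + C) * (C1 * wt (e * gain k T) x y).
 apply: (H1 u eps C del pu eps0 CC0 del0); first by move=> x y y0; have [] := F x y y0.
 by move=> t x y tT y0; have [] := S t x y tT y0.
have Hx (v : expr) t x y : ev (heatr k r (Ex v)) t x y = ev (Ex (heatr k r v)) t x y.
 transitivity (ev (heat k (Ex v)) t x y + r * ev (Ex v) t x y); first by []. by rewrite -ev_heat_Ex /=; ring.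
have Hxx t x y : ev (heatr k r (Ex (Ex u))) t x y = ev (Ex (Ex (heatr k r u))) t x y.
 by rewrite Hx; apply: Dv_ext => *; rewrite Hx.
have B1 : forall t x y, 0 <= t <= T -> 0 <= y -> `|ev (Ex u) t x y| <= (eps + C) * (C1 * wt (e * gain k T) x y).
 apply: (H1 (Ex u) eps C del (poly_Dv 0 1 0 pu) eps0 CC0 del0).
  by move=> x y y0; have [] := F x y y0.
 by move=> t x y tT y0; rewrite Hx; have [] := S t x y tT y0.
have B2 : forall t x y, 0 <= t <= T -> 0 <= y -> `|ev (Ex (Ex u)) t x y| <= (eps + C) * (C1 * wt (e * gain k T) x y).
 apply: (H1 (Ex (Ex u)) eps C del (poly_Dv 0 1 0 (poly_Dv 0 1 0 pu)) eps0 CC0 del0).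
  by move=> x y y0; have [] := F x y y0.
 by move=> t x y tT y0; rewrite Hxx; have [] := S t x y tT y0.
(* [eps'] adds to the bound of the source the contribution of the x-derivatives, already estimated
   by a multiple of eps + C. *)
pose eps' := eps + m * C1 * (eps + C).
have eps'0 : 0 < eps' by rewrite ltr_wpDr// mulr_ge0// ltW.
have eps'1 : eps' + C = (eps + C) * (1 + m * C1) by rewrite /eps'; ring.
have prE t : profile T eps' C del t = profile T eps C del t + m * C1 * (eps + C).
 by rewrite /profile /eps'; ring.
have B3 : forall t x y, 0 <= t <= T -> 0 <= y ->
  `|ev (Ey u) t x y| <= (eps' + C) * (C2 * wt (e * gain k T * gain (pshift k) T) x y).
 apply: (H2 (Ey u) eps' C del (poly_Dv 0 0 1 pu) eps'0 CC0 del0).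
  move=> x y y0; have [_ _ _ h] := F x y y0; apply: (le_trans h). apply: ler_pM; rewrite ?(ltW eps0) ?(ltW (wt_gt0 _ _ _)) ?lw//.
  by rewrite lerDl mulr_ge0// ltW.
 move=> t x y tT y0; have tT' : 0 <= t <= T by case/andP: tT => -> /ltW.
 have -> : ev (heatr (pshift k) (r - pb k) (Ey u)) t x y = ev (Ey (heatr k r u)) t x y
   - (pl k ^+ 2 / 2 * ev (Ex (Ex u)) t x y + pd k * ev (Ex u) t x y).
  transitivity (ev (heat (pshift k) (Ey u)) t x y + (r - pb k) * ev (Ey u) t x y); first by [].
  have := ev_heat_Ey k u t x y; move: (ev (heat _ _) t x y) => Z EZ. transitivity (ev (Ey (heat k u)) t x y + r * ev (Ey u) t x y
   - (pl k ^+ 2 / 2 * ev (Ex (Ex u)) t x y + pd k * ev (Ex u) t x y)).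
   by rewrite EZ; ring.
  by rewrite /=; ring.
 have [_ _ _ h] := S t x y tT y0; have b1 := B1 t x y tT' y0; have b2 := B2 t x y tT' y0. apply: (le_trans (ler_normB _ _)).
 have h2 : `|pl k ^+ 2 / 2 * ev (Ex (Ex u)) t x y + pd k * ev (Ex u) t x y| <= m * ((eps + C) * (C1 * wt (e * gain k T) x y)).
  apply: (le_trans (ler_normD _ _)); rewrite /m mulrDl !(normrM (_ / _)) (normrM (pd k)) lerD//.
   by apply: ler_pM => //; rewrite ger0_norm// divr_ge0// sqr_ge0.
  by apply: ler_pM.
 have h3 : profile T eps C del t * wt e x y <= profile T eps C del t * wt (e * gain k T) x y.
  by rewrite ler_wpM2l ?lw// ltW// profile_gt0.
 apply: (le_trans (lerD h h2)); rewrite prE [leRHS]mulrDl; apply: lerD; first exact: h3. by apply: eq_leW; ring.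
move=> t x y tT y0.
have W0 : 0 < wt (e * gain k T ^+ 2) x y by exact: wt_gt0.
have lA : (eps + C) * (C1 * wt (e * gain k T) x y) <= (eps + C) * ((C1 + C3) * wt (e * gain k T ^+ 2) x y).
 rewrite ler_wpM2l ?(ltW A0)//; apply: ler_pM; rewrite ?(ltW C10) ?(ltW (wt_gt0 _ _ _))//.
  by rewrite lerDl ltW.
 exact: lw2.
split.
- by apply: le_trans lA; exact: B0.
- by apply: le_trans lA; exact: B1.
- by apply: le_trans lA; exact: B2.
apply: (le_trans (B3 t x y tT y0)); rewrite eps'1 -[leLHS]mulrA ler_wpM2l ?(ltW A0)//.
(* [pshift] leaves b and d unchanged, and [gain] depends on the parameters only through them. *)
have -> : gain (pshift k) T = gain k T by [].
by rewrite -(mulrA e) -expr2 mulrA -/C3 ler_wpM2r ?(ltW W0)// lerDr ltW.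
Qed.

(** * Interior gradient bound by doubling of variables *)

Lemma second_test F F' (F2 d : R) : 0 < d -> (forall s, has_der setT F s (F' s)) -> has_der setT F' 0 F2 ->
 (forall s, `|s| <= d -> F s <= F 0) -> F' 0 = 0 /\ F2 <= 0.
move=> d0 H1 H2 M.
have Fp : F' 0 = 0 by apply: (has_der_max (H1 0) d0) => s; rewrite subr0; exact: M.
split => //; rewrite leNgt; apply/negP => F20.
have [r r0 Hr] := peano2 ltr01 (fun z _ => H1 z) H2 (divr_gt0 F20 (ltr0Sn R 3)).
pose s := Num.min d r; have s0 : 0 < s by rewrite lt_min d0.
have sd : `|s| <= d by rewrite gtr0_norm// ge_min lexx.
have := Hr s; rewrite subr0 => /(_ ltac:(by rewrite gtr0_norm// ge_min lexx orbT)).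
rewrite Fp mul0r subr0 ler_norml => /andP[h _]; have := M s sd.
have : 0 < F2 * s ^+ 2 by rewrite mulr_gt0// exprn_gt0.
move: h; clear; lra.
Qed.

Section coordinates.
Variables (k : prm).

(* Coordinates in which the second order part of the operator is y/2 times the Laplacian. *)
Definition rbar : R := Num.sqrt (1 - pr k ^+ 2).
Definition crdx (p q : R) : R := pl k * pr k * p + pl k * rbar * q.
Definition gv g t p q : R := ev g t (crdx p q) (ps k * p).
Definition Dd g v1 v2 : expr := Dv 0 (crdx v1 v2) (ps k * v1) g.

Lemma gv_line g (t p q v1 v2 s : R) : has_der setT (fun s => gv g t (p + s * v1) (q + s * v2)) s
  (gv (Dd g v1 v2) t (p + s * v1) (q + s * v2)).
apply/is_deriveP; rewrite /gv /Dd.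
have line (u v : R) : is_derive s (1 : R) (fun s : R => u + s * v) v.
 have H := is_deriveD (is_derive_cst u s 1) (is_deriveM (is_derive_id s (1 : R)) (is_derive_cst v s 1)).
 by apply: (is_derive_eq H); rewrite /GRing.scale /=; ring.
have H1 : is_derive s 1 (fun s => crdx (p + s * v1) (q + s * v2)) (crdx v1 v2).
 have -> : (fun s => crdx (p + s * v1) (q + s * v2)) = (fun s => crdx p q + s * crdx v1 v2).
  by apply/funext => z; rewrite /crdx; ring.
 exact: line.
have H2 : is_derive s 1 (fun s => ps k * (p + s * v1)) (ps k * v1).
 have -> : (fun s => ps k * (p + s * v1)) = (fun s => ps k * p + s * (ps k * v1)).
  by apply/funext => z; ring.
 exact: line.
exact: (Dv_chain g (is_derive_cst t s 1) H1 H2).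
Qed.

Lemma gv_continuous (U : topologicalType) g (t p q : U -> R) :
 continuous t -> continuous p -> continuous q -> continuous (fun P => gv g (t P) (p P) (q P)).
move=> ct cp cq; apply: ev_continuous_comp => // P.
 by apply: cvgD; apply: cvgM; try exact: cvg_cst; [exact: cp | exact: cq].
by apply: cvgM; [exact: cvg_cst | exact: cp].
Qed.

(** An increment of g, minus the concave modulus A r - B r^2 of its length r, minus penalties that
    localize around (t0, p0, q0). Where it is nonpositive, g grows by at most A r along small
    vectors at the centre, so the gradient there is at most A. *)
Definition dbl (g : expr) (t0 p0 q0 A B A1 A2 t p q w1 w2 : R) : R := gv g t p q - gv g t (p - w1) (q - w2)
 - (A * Num.sqrt (w1 ^+ 2 + w2 ^+ 2) - B * (w1 ^+ 2 + w2 ^+ 2))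
 - A1 * ((p - p0) ^+ 2 + (q - q0) ^+ 2) - A2 * (t - t0).

Definition dbox (t0 p0 q0 tau eta t p q w1 w2 : R) :=
 [/\ t0 <= t <= t0 + tau, `|p - p0| <= eta, `|q - q0| <= eta, `|w1| <= eta & `|w2| <= eta].

Local Notation V5 := (R * R * R * R * R)%type.

Lemma dbl_attains g (t0 p0 q0 A B A1 A2 tau eta : R) : 0 <= tau -> 0 <= eta ->
 exists t p q w1 w2, dbox t0 p0 q0 tau eta t p q w1 w2 /\ forall s p' q' v1 v2, dbox t0 p0 q0 tau eta s p' q' v1 v2 ->
  dbl g t0 p0 q0 A B A1 A2 s p' q' v1 v2 <= dbl g t0 p0 q0 A B A1 A2 t p q w1 w2.
move=> tau0 eta0.
pose K : set V5 := ((((`[t0, t0 + tau] `*` `[p0 - eta, p0 + eta])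
 `*` `[q0 - eta, q0 + eta]) `*` `[- eta, eta]) `*` `[- eta, eta]).
have cK : compact K by do 4 (apply: compact_setX; last exact: segment_compact); exact: segment_compact.
have KP t p q w1 w2 : K (t, p, q, w1, w2) <-> dbox t0 p0 q0 tau eta t p q w1 w2.
 have e (u v : R) : (u \in `[v - eta, v + eta]) = (`|u - v| <= eta).
  by rewrite in_itv/= ler_distl.
 rewrite /K /dbox /= !e !in_itv/= -!ler_norml; split; first by move=> [[[[]]]]. by case.
pose f (P : V5) := dbl g t0 p0 q0 A B A1 A2 P.1.1.1.1 P.1.1.1.2 P.1.1.2 P.1.2 P.2.
have fs (U : topologicalType) (u : V5 -> U * R) : continuous u -> continuous (fun P => (u P).1) /\ continuous (fun P => (u P).2).
 by move=> cu; split=> P; apply: (continuous_comp (cu P)); [exact: cvg_fst|exact: cvg_snd].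
have [c1 c5] := fs _ id (fun P => cvg_id); have [c11 c4] := fs _ _ c1; have [c111 c3] := fs _ _ c11; have [c0 c2] := fs _ _ c111.
have cf : continuous f.
 have sub (u v : V5 -> R) : continuous u -> continuous v ->
   continuous (fun P => u P - v P) by move=> cu cv P; apply: cvgB; [exact: cu | exact: cv].
 have mul (u v : V5 -> R) : continuous u -> continuous v ->
   continuous (fun P => u P * v P) by move=> cu cv P; apply: cvgM; [exact: cu | exact: cv].
 have add (u v : V5 -> R) : continuous u -> continuous v ->
   continuous (fun P => u P + v P) by move=> cu cv P; apply: cvgD; [exact: cu | exact: cv].
 have cst (c : R) : continuous (fun _ : V5 => c) by move=> P; exact: cvg_cst.
 have sq (u : V5 -> R) : continuous u -> continuous (fun P => u P ^+ 2).
  by move=> cu; under eq_fun do rewrite expr2; apply: (mul _ _).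
 have sw : continuous (fun P : V5 => P.1.2 ^+ 2 + P.2 ^+ 2).
  by apply: (add _ _); exact: (sq _).
 rewrite /f /dbl; apply: (sub _ _); last by apply: (mul _ _); [exact: cst | apply: (sub _ _) => //; exact: cst].
 apply: (sub _ _); last first.
  by apply: (mul _ _); [exact: cst | apply: (add _ _); apply: (sq _); apply: (sub _ _) => //; exact: cst].
 apply: (sub _ _); last first.
  apply: (sub _ _); last by apply: (mul _ _); [exact: cst | exact: sw]. apply: (mul _ _); first exact: cst.
  by move=> P; apply: (continuous_comp (sw P)); exact: sqrt_continuous.
 by apply: (sub _ _); apply: gv_continuous => //; exact: (sub _ _).
have ne : K !=set0.
 exists (t0, p0, q0, 0, 0); apply/KP; rewrite /dbox !subrr normr0 lexx; split => //. by rewrite lerDl.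
have [[[[[t p] q] w1] w2] /set_mem PK M] := compact_EVT_max ne cK (continuous_subspaceT cf).
exists t, p, q, w1, w2; split; first exact/KP.
by move=> s p' q' v1 v2 B'; apply: (M (s, p', q', v1, v2)); apply/mem_set/KP.
Qed.

(** The test is made along curves on which the first point moves with velocity v and the second with
    v', so that the increment w moves with velocity v - v'. The numbers c1 and c2 belong to a
    quadratic bound of the modulus from above that touches it at s = 0. *)
Lemma dbl_test (g : expr) (t0 p0 q0 A B A1 A2 tau eta t p q w1 w2 v1 v2 v1' v2' c1 c2 s0 : R) :
 t0 <= t <= t0 + tau -> `|p - p0| < eta -> `|q - q0| < eta -> `|w1| < eta -> `|w2| < eta ->
 (forall s p' q' u1 u2, dbox t0 p0 q0 tau eta s p' q' u1 u2 ->
  dbl g t0 p0 q0 A B A1 A2 s p' q' u1 u2 <= dbl g t0 p0 q0 A B A1 A2 t p q w1 w2) ->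
 0 < s0 -> (forall s, `|s| <= s0 -> A * Num.sqrt ((w1 + s * (v1 - v1')) ^+ 2 + (w2 + s * (v2 - v2')) ^+ 2)
  - B * ((w1 + s * (v1 - v1')) ^+ 2 + (w2 + s * (v2 - v2')) ^+ 2)
  <= A * Num.sqrt (w1 ^+ 2 + w2 ^+ 2) - B * (w1 ^+ 2 + w2 ^+ 2) + c1 * s + c2 / 2 * s ^+ 2) ->
 gv (Dd g v1 v2) t p q - gv (Dd g v1' v2') t (p - w1) (q - w2) - c1
  - 2 * A1 * ((p - p0) * v1 + (q - q0) * v2) = 0 /\
 gv (Dd (Dd g v1 v2) v1 v2) t p q - gv (Dd (Dd g v1' v2') v1' v2') t (p - w1) (q - w2) - c2
  - 2 * A1 * (v1 ^+ 2 + v2 ^+ 2) <= 0.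
move=> tB pB qB wB1 wB2 M s00 Hs.
pose l := - (c1 + 2 * A1 * ((p - p0) * v1 + (q - q0) * v2)).
pose m := - (c2 + 2 * A1 * (v1 ^+ 2 + v2 ^+ 2)).
pose F s := gv g t (p + s * v1) (q + s * v2)
 + -1 * gv g t ((p - w1) + s * v1') ((q - w2) + s * v2') + (0 + l * (s - 0) + m / 2 * (s - 0) ^+ 2).
pose F' s := gv (Dd g v1 v2) t (p + s * v1) (q + s * v2)
 + -1 * gv (Dd g v1' v2') t ((p - w1) + s * v1') ((q - w2) + s * v2') + (l + m * (s - 0)).
pose F2 := gv (Dd (Dd g v1 v2) v1 v2) t (p + 0 * v1) (q + 0 * v2)
 + -1 * gv (Dd (Dd g v1' v2') v1' v2') t ((p - w1) + 0 * v1') ((q - w2) + 0 * v2') + (m + 0 * (0 - 0)).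
have room (u v : R) : `|u| < eta -> exists2 d : R, 0 < d & forall s, `|s| <= d -> `|u + s * v| <= eta.
 move=> ue; exists ((eta - `|u|) / (`|v| + 1)).
  by rewrite divr_gt0 ?subr_gt0// ltr_wpDl.
 move=> s; rewrite ler_pdivlMr ?ltr_wpDl// => h. apply: (le_trans (ler_normD _ _)); rewrite normrM.
 have : `|s| * `|v| <= `|s| * (`|v| + 1) by rewrite ler_wpM2l// lerDl. move: h; clear; lra.
have [d1 d10 H1] := room _ v1 pB; have [d2 d20 H2] := room _ v2 qB.
have [d3 d30 H3] := room _ (v1 - v1') wB1; have [d4 d40 H4] := room _ (v2 - v2') wB2.
pose d := Num.min (Num.min (Num.min d1 d2) (Num.min d3 d4)) s0.
have d0 : 0 < d by rewrite !lt_min d10 d20 d30 d40.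
have [||| E1 E2] := @second_test F F' F2 d d0.
- move=> s; apply: has_derD; last exact: has_der_quad.
 by apply: has_derD; [exact: gv_line | apply: has_derZ; exact: gv_line].
- apply: has_derD.
  by apply: has_derD; [exact: gv_line | apply: has_derZ; exact: gv_line].
 have := @has_der_quad setT l m 0 0 0; apply: has_der_ext => [z|]; by ring.
- move=> s; rewrite !le_min => /andP[/andP[/andP[s1 s2] /andP[s3 s4]] s5].
 have := M t (p + s * v1) (q + s * v2) (w1 + s * (v1 - v1')) (w2 + s * (v2 - v2')).
 have DB : dbox t0 p0 q0 tau eta t (p + s * v1) (q + s * v2) (w1 + s * (v1 - v1')) (w2 + s * (v2 - v2')).
  by split => //; [rewrite addrAC H1 | rewrite addrAC H2 | exact: H3 | exact: H4].
 move=> /(_ DB). rewrite /dbl /F; have := Hs s s5. have -> : p + s * v1 - (w1 + s * (v1 - v1')) = p - w1 + s * v1' by ring.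
 have -> : q + s * v2 - (w2 + s * (v2 - v2')) = q - w2 + s * v2' by ring. rewrite !mul0r !addr0 /l /m.
 move: (gv g _ _ _) (gv g _ _ _) (gv g _ _ _) (gv g _ _ _) => G1 G2 G3 G4. move: (A * _ - _) (A * _ - _) => X1 X2; clear; lra.
move: E1 E2; rewrite /F' /F2 /l /m !mul0r !addr0 !subr0 mulr0 => E1 E2.
by split; [rewrite -E1; ring | apply: le_trans E2; apply: eq_leW; ring].
Qed.

(** Near s = 0 the norm satisfies |w + s W| <= r + s al + s^2 |W|^2 / (2 r). Writing rr^2 = r^2 + 2
    r (rr - r) + (rr - r)^2, the last square has the favourable sign in the modulus. *)
Lemma psi_general (A B w1 w2 W1 W2 r al : R) : r = Num.sqrt (w1 ^+ 2 + w2 ^+ 2) -> 0 < r -> 0 <= B -> 2 * B * r <= A ->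
 al = (w1 * W1 + w2 * W2) / r -> exists2 s0 : R, 0 < s0 & forall s, `|s| <= s0 ->
  A * Num.sqrt ((w1 + s * W1) ^+ 2 + (w2 + s * W2) ^+ 2)
  - B * ((w1 + s * W1) ^+ 2 + (w2 + s * W2) ^+ 2)
  <= A * Num.sqrt (w1 ^+ 2 + w2 ^+ 2) - B * (w1 ^+ 2 + w2 ^+ 2)
    + (A - 2 * B * r) * al * s + ((A - 2 * B * r) * (W1 ^+ 2 + W2 ^+ 2) / r) / 2 * s ^+ 2.
move=> er r0 B0 BA eal.
have r2 : r ^+ 2 = w1 ^+ 2 + w2 ^+ 2 by rewrite er sqr_sqrtr// addr_ge0// sqr_ge0.
have ralpha : r * al = w1 * W1 + w2 * W2 by rewrite eal mulrC divfK// gt_eqF.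
exists (r / (`|al| + 1)); first by rewrite divr_gt0// ltr_wpDl.
move=> s; rewrite ler_pdivlMr ?ltr_wpDl// => hs.
set Z := (w1 + s * W1) ^+ 2 + (w2 + s * W2) ^+ 2.
have Z0 : 0 <= Z by rewrite addr_ge0// sqr_ge0.
pose rr := Num.sqrt Z; have rr2 : rr ^+ 2 = Z by rewrite sqr_sqrtr.
pose n := (W1 ^+ 2 + W2 ^+ 2) / r; have n0 : 0 <= n.
 by rewrite divr_ge0 ?addr_ge0 ?sqr_ge0// ltW.
have rn : r * n = W1 ^+ 2 + W2 ^+ 2 by rewrite /n mulrC divfK// gt_eqF.
have u0 : 0 <= r + s * al.
 have : - (s * al) <= `|s| * (`|al| + 1).
  apply: le_trans (ler_norm _) _; rewrite normrN normrM ler_wpM2l//. by rewrite lerDl.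
 move: hs; clear; lra.
have le : rr <= r + s * al + n / 2 * s ^+ 2.
 have n20 : 0 <= n / 2 * s ^+ 2 by rewrite mulr_ge0 ?sqr_ge0// divr_ge0.
 have u1 : 0 <= r + s * al + n / 2 * s ^+ 2 by apply: addr_ge0. rewrite -(@ler_pXn2r _ 2)// ?nnegrE ?sqrtr_ge0//.
 rewrite rr2; have -> : Z = r ^+ 2 + 2 * s * (r * al) + s ^+ 2 * (r * n).
  by rewrite r2 ralpha rn /Z; ring.
 have : 0 <= (s * al + n / 2 * s ^+ 2) ^+ 2 by apply: sqr_ge0. clear; nra.
rewrite -/rr -rr2 -er -r2.
have Br : 0 <= B * (rr - r) ^+ 2 by rewrite mulr_ge0// sqr_ge0.
have : (A - 2 * B * r) * rr <= (A - 2 * B * r) * (r + s * al + n / 2 * s ^+ 2).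
 by rewrite ler_wpM2l// subr_ge0.
have -> : (A - 2 * B * r) * (W1 ^+ 2 + W2 ^+ 2) / r = (A - 2 * B * r) * n by rewrite mulrA.
move: Br; clear; nra.
Qed.

(** Along w itself the norm is affine and only the concavity of the modulus remains; this is the
    origin of the decisive negative term. *)
Lemma psi_radial (A B w1 w2 r om : R) : r = Num.sqrt (w1 ^+ 2 + w2 ^+ 2) -> 0 < r ->
 exists2 s0 : R, 0 < s0 & forall s, `|s| <= s0 -> A * Num.sqrt ((w1 + s * (om * (w1 / r))) ^+ 2 + (w2 + s * (om * (w2 / r))) ^+ 2)
  - B * ((w1 + s * (om * (w1 / r))) ^+ 2 + (w2 + s * (om * (w2 / r))) ^+ 2)
  <= A * Num.sqrt (w1 ^+ 2 + w2 ^+ 2) - B * (w1 ^+ 2 + w2 ^+ 2)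
    + (A - 2 * B * r) * om * s + (- (2 * B * om ^+ 2)) / 2 * s ^+ 2.
move=> er r0.
have r2 : r ^+ 2 = w1 ^+ 2 + w2 ^+ 2 by rewrite er sqr_sqrtr// addr_ge0// sqr_ge0.
exists (r / (`|om| + 1)); first by rewrite divr_gt0// ltr_wpDl.
move=> s; rewrite ler_pdivlMr ?ltr_wpDl// => hs.
have u0 : 0 <= r + s * om.
 have : - (s * om) <= `|s| * (`|om| + 1).
  apply: le_trans (ler_norm _) _; rewrite normrN normrM ler_wpM2l//. by rewrite lerDl.
 move: hs; clear; lra.
have -> : (w1 + s * (om * (w1 / r))) ^+ 2 + (w2 + s * (om * (w2 / r))) ^+ 2 = (r + s * om) ^+ 2.
 transitivity ((w1 ^+ 2 + w2 ^+ 2) * (1 + s * om / r) ^+ 2).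
  by field; rewrite gt_eqF.
 by rewrite -r2; field; rewrite gt_eqF.
rewrite sqrtr_sqr ger0_norm// -er -r2; apply: eq_leW.
by field.
Qed.

End coordinates.

Section gradient.
Variables (k : prm).

Lemma gvD1 (g : expr) (t p q v1 v2 : R) : gv k (Dd k g v1 v2) t p q
 = crdx k v1 v2 * gv k (Ex g) t p q + ps k * v1 * gv k (Ey g) t p q.
by rewrite /gv /Dd Dv_lin mul0r add0r. Qed.

Lemma gvD2 (g : expr) (t p q v1 v2 : R) : gv k (Dd k (Dd k g v1 v2) v1 v2) t p q
 = crdx k v1 v2 ^+ 2 * gv k (Ex (Ex g)) t p q + (ps k * v1) ^+ 2 * gv k (Ey (Ey g)) t p q
  + 2 * (crdx k v1 v2 * (ps k * v1)) * gv k (Ex (Ey g)) t p q.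
by rewrite /gv /Dd Dv2_lin !mul0r mulr0; ring. Qed.

(** In these coordinates the second-order part is a multiple of the Laplacian, so it can be computed
    in the rotated frame (e1, e2), (- e2, e1). *)
Lemma trace_id (u e1 e2 : R) : e1 ^+ 2 + e2 ^+ 2 = 1 -> rbar k ^+ 2 = 1 - pr k ^+ 2 ->
 [/\ crdx k (u * e1) (u * e2) ^+ 2 + crdx k (- (u * e2)) (u * e1) ^+ 2 = u ^+ 2 * pl k ^+ 2,
   (ps k * (u * e1)) ^+ 2 + (ps k * - (u * e2)) ^+ 2 = u ^+ 2 * ps k ^+ 2 & crdx k (u * e1) (u * e2) * (ps k * (u * e1))
    + crdx k (- (u * e2)) (u * e1) * (ps k * - (u * e2))
    = u ^+ 2 * (pl k * pr k * ps k)].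
move=> h1 h2; rewrite /crdx; split.
- transitivity (u ^+ 2 * pl k ^+ 2 * (e1 ^+ 2 + e2 ^+ 2) * (pr k ^+ 2 + rbar k ^+ 2)); first by ring.
 by rewrite h1 h2; ring.
- transitivity (u ^+ 2 * ps k ^+ 2 * (e1 ^+ 2 + e2 ^+ 2)); first by ring.
 by rewrite h1 mulr1.
- transitivity (u ^+ 2 * (pl k * pr k * ps k) * (e1 ^+ 2 + e2 ^+ 2)); first by ring.
 by rewrite h1 mulr1.
Qed.

(** [bp] and [bq] are the components of the drift in the coordinates (p, q). *)
Definition bp (y : R) : R := (pa k - pb k * y) / ps k.
Definition bq (y : R) : R := (pc k + pd k * y - pl k * pr k * bp y) / (pl k * rbar k).

Lemma rbar_gt0 : admissible k -> 0 < rbar k.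
by move=> [_ _ _ /andP[r1 r2]]; rewrite sqrtr_gt0; nra. Qed.

Lemma rbar2 : admissible k -> rbar k ^+ 2 = 1 - pr k ^+ 2.
by move=> [_ _ _ /andP[r1 r2]]; rewrite sqr_sqrtr//; nra. Qed.

Lemma gv_heat (g : expr) (t p q : R) : admissible k -> gv k (heat k g) t p q = gv k (Et g) t p q
  + ps k * p / 2 * (pl k ^+ 2 * gv k (Ex (Ex g)) t p q
    + 2 * (pl k * pr k * ps k) * gv k (Ex (Ey g)) t p q + ps k ^+ 2 * gv k (Ey (Ey g)) t p q)
  + (bp (ps k * p) * gv k (Dd k g 1 0) t p q + bq (ps k * p) * gv k (Dd k g 0 1) t p q).
move=> ak; have rb0 := rbar_gt0 ak; have [_ l0 s0 _] := ak.
rewrite !gvD1 /bq /bp /crdx {1}/gv ev_heat /hop -!/(gv _ _ _ _ _); field.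
by rewrite !gt_eqF.
Qed.

(** The two points are moved oppositely along w, with amplitudes sqrt y and sqrt y', and in parallel
    across w. The reflected motion exploits the concavity of the modulus and yields the squared sum
    of the roots; the parallel motion costs only their squared difference. The first-order
    conditions give the gradients at both points. *)
Lemma dbl_core (g : expr) (t0 p0 q0 A B A1 A2 tau eta t p q w1 w2 r y y' : R) : admissible k -> t0 <= t < t0 + tau ->
 `|p - p0| < eta -> `|q - q0| < eta -> `|w1| < eta -> `|w2| < eta -> (forall s p' q' u1 u2, dbox t0 p0 q0 tau eta s p' q' u1 u2 ->
  dbl k g t0 p0 q0 A B A1 A2 s p' q' u1 u2 <= dbl k g t0 p0 q0 A B A1 A2 t p q w1 w2) ->
 r = Num.sqrt (w1 ^+ 2 + w2 ^+ 2) -> 0 < r -> 0 <= B -> 2 * B * r <= A -> 0 < p -> 0 < p - w1 ->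
 y = ps k * p -> y' = ps k * (p - w1) -> gv k (heat k g) t p q - gv k (heat k g) t (p - w1) (q - w2) <=
 A2 + (- (2 * B * (Num.sqrt y + Num.sqrt y') ^+ 2)
    + (A - 2 * B * r) * (Num.sqrt y - Num.sqrt y') ^+ 2 / r + 4 * A1 * y) / 2
 + (A - 2 * B * r) * ((bp y - bp y') * (w1 / r) + (bq y - bq y') * (w2 / r))
 + 2 * A1 * ((p - p0) * bp y + (q - q0) * bq y).
move=> ak /andP[tt0 ttau] pB qB wB1 wB2 M er r0 B0 BA pp0 pp0' -> ->.
clear y y'; pose y := ps k * p; pose y' := ps k * (p - w1); rewrite -/y -/y'.
have rb2 := rbar2 ak; have [_ l0 s0 _] := ak.
have tB : t0 <= t <= t0 + tau by rewrite tt0 ltW.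
have r2 : r ^+ 2 = w1 ^+ 2 + w2 ^+ 2 by rewrite er sqr_sqrtr// addr_ge0// sqr_ge0.
pose e1 := w1 / r; pose e2 := w2 / r.
have e12 : e1 ^+ 2 + e2 ^+ 2 = 1.
 by rewrite /e1 /e2 !expr_div_n -mulrDl -r2 divff// gt_eqF// exprn_gt0.
have yy : 0 < y by rewrite mulr_gt0.
have yy' : 0 < y' by rewrite mulr_gt0.
pose sy := Num.sqrt y; pose sy' := Num.sqrt y'.
have sy2 : sy ^+ 2 = y by rewrite sqr_sqrtr// ltW.
have sy2' : sy' ^+ 2 = y' by rewrite sqr_sqrtr// ltW.
pose al (W1 W2 : R) := (w1 * W1 + w2 * W2) / r.
have test v1 v2 v1' v2' := let: ex_intro2 s0 s00 H := psi_general (W1 := v1 - v1') (W2 := v2 - v2') er r0 B0 BA erefl in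
 @dbl_test k g t0 p0 q0 A B A1 A2 tau eta t p q w1 w2 v1 v2 v1' v2' _ _ s0 tB pB qB wB1 wB2 M s00 H.
(* Moving one point at a time along an axis determines the gradients at the two points. *)
have [T1 _] := test 1 0 0 0; have [T2 _] := test 0 1 0 0.
have [T3 _] := test 0 0 1 0; have [T4 _] := test 0 0 0 1.
have [_ T6] := test (- (sy * e2)) (sy * e1) (- (sy' * e2)) (sy' * e1).
have [_ T5] : gv k (Dd k g (sy * e1) (sy * e2)) t p q
  - gv k (Dd k g (- sy' * e1) (- sy' * e2)) t (p - w1) (q - w2)
  - ((A - 2 * B * r) * (sy + sy')) - 2 * A1 * ((p - p0) * (sy * e1) + (q - q0) * (sy * e2)) = 0 /\
 gv k (Dd k (Dd k g (sy * e1) (sy * e2)) (sy * e1) (sy * e2)) t p q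
  - gv k (Dd k (Dd k g (- sy' * e1) (- sy' * e2)) (- sy' * e1) (- sy' * e2)) t (p - w1) (q - w2)
  - (- (2 * B * (sy + sy') ^+ 2)) - 2 * A1 * ((sy * e1) ^+ 2 + (sy * e2) ^+ 2) <= 0.
 have [z z0 H] := psi_radial A B (sy + sy') er r0.
 apply: (@dbl_test k g t0 p0 q0 A B A1 A2 tau eta t p q w1 w2 _ _ _ _ _ _ z tB pB qB wB1 wB2 M z0).
 move=> s sz; have := H s sz; rewrite -/e1 -/e2. have -> : sy * e1 - - sy' * e1 = (sy + sy') * e1 by ring.
 by have -> : sy * e2 - - sy' * e2 = (sy + sy') * e2 by ring.
(* The maximum may sit at the initial time t0, so only the right derivative in time is tested. *)
have T0 : gv k (Et g) t p q - gv k (Et g) t (p - w1) (q - w2) - A2 <= 0.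
 have hd : has_der setT (fun s => gv k g s p q + -1 * gv k g s (p - w1) (q - w2)
   + (0 + - A2 * (s - t0) + 0 / 2 * (s - t0) ^+ 2)) t
   (gv k (Et g) t p q + -1 * gv k (Et g) t (p - w1) (q - w2) + (- A2 + 0 * (t - t0))).
  apply: has_derD; last exact: has_der_quad. by apply: has_derD; [exact: ev_has_dert | apply: has_derZ; exact: ev_has_dert].
 suff : gv k (Et g) t p q + -1 * gv k (Et g) t (p - w1) (q - w2) + (- A2 + 0 * (t - t0)) <= 0.
  by clear; lra.
 apply: (has_der_le0 hd) => d d0; exists (t + Num.min d (t0 + tau - t)).
 have m0 : 0 < Num.min d (t0 + tau - t) by rewrite lt_min d0 subr_gt0.
 have m1 : Num.min d (t0 + tau - t) <= t0 + tau - t by rewrite ge_min lexx orbT.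
 split => //; rewrite ?ltrDl// ?lerD2l ?ge_min ?lexx//. have := M (t + Num.min d (t0 + tau - t)) p q w1 w2.
 have : dbox t0 p0 q0 tau eta (t + Num.min d (t0 + tau - t)) p q w1 w2.
  split; [apply/andP; split; move: tt0 m0 m1; clear; lra | exact: ltW | exact: ltW | exact: ltW | exact: ltW].
 move=> DB /(_ DB); rewrite /dbl; move: (_ - B * _) (A1 * _) => X Y.
 move: (gv k g _ _ _) (gv k g _ _ _) (gv k g _ _ _) (gv k g _ _ _) => G1 G2 G3 G4. by rewrite !mul0r; clear; lra.
rewrite !(gv_heat _ _ _ _ ak) -/y -/y'.
have psi1 : A - 2 * B * r >= 0 by rewrite subr_ge0.
set psi := A - 2 * B * r in T1 T2 T3 T4 T5 T6 psi1 *.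
have z0 (t' p' q' : R) : gv k (Dd k g 0 0) t' p' q' = 0.
 by rewrite gvD1 /crdx !mulr0 addr0 !mul0r addr0.
have E x1 x2 : (w1 * x1 + w2 * x2) / r = e1 * x1 + e2 * x2.
 by rewrite /e1 /e2; field; exact: lt0r_neq0.
rewrite !E ?(z0 t p q) ?(z0 t (p - w1) (q - w2)) in T1 T2 T3 T4.
have F1 : gv k (Dd k g 1 0) t p q = psi * e1 + 2 * A1 * (p - p0).
 by move: T1; clear; move: (gv _ _ _ _ _) => X; lra.
have F2 : gv k (Dd k g 0 1) t p q = psi * e2 + 2 * A1 * (q - q0).
 by move: T2; clear; move: (gv _ _ _ _ _) => X; lra.
have F3 : gv k (Dd k g 1 0) t (p - w1) (q - w2) = psi * e1.
 by move: T3; clear; move: (gv _ _ _ _ _) => X; lra.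
have F4 : gv k (Dd k g 0 1) t (p - w1) (q - w2) = psi * e2.
 by move: T4; clear; move: (gv _ _ _ _ _) => X; lra.
rewrite F1 F2 F3 F4 -/sy -/sy' -/e1 -/e2.
move: T5 T6; rewrite !gvD2.
have [I1 I2 I3] := trace_id sy e12 rb2; have [J1 J2 J3] := trace_id sy' e12 rb2.
have -> : crdx k (- sy' * e1) (- sy' * e2) = - crdx k (sy' * e1) (sy' * e2).
 by rewrite /crdx; ring.
have -> : (sy * e1) ^+ 2 + (sy * e2) ^+ 2 = y.
 transitivity (sy ^+ 2 * (e1 ^+ 2 + e2 ^+ 2)); first by ring. by rewrite e12 mulr1.
have -> : (- (sy * e2)) ^+ 2 + (sy * e1) ^+ 2 = y.
 transitivity (sy ^+ 2 * (e1 ^+ 2 + e2 ^+ 2)); first by ring. by rewrite e12 mulr1.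
have -> : (- (sy * e2) - - (sy' * e2)) ^+ 2 + (sy * e1 - sy' * e1) ^+ 2 = (sy - sy') ^+ 2.
 transitivity ((sy - sy') ^+ 2 * (e1 ^+ 2 + e2 ^+ 2)); first by ring. by rewrite e12 mulr1.
rewrite sy2 in I1 I2 I3; rewrite sy2' in J1 J2 J3.
move: I1 I2 I3 J1 J2 J3 T0.
move: (gv k (Ex (Ex g)) t p q) (gv k (Ex (Ey g)) t p q) (gv k (Ey (Ey g)) t p q) (gv k (Et g) t p q) => a1 a2 a3 a0.
move: (gv k (Ex (Ex g)) _ _ _) (gv k (Ex (Ey g)) _ _ _) (gv k (Ey (Ey g)) _ _ _) (gv k (Et g) _ _ _) => b1 b2 b3 b0.
move: (psi * _ / r) => n.
move: (crdx k _ _) (crdx k _ _) (crdx k _ _) (crdx k _ _) => x1 x2 x3 x4.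
move=> I1 I2 I3 J1 J2 J3 T0 T5 T6.
have K1 := congr1 ( *%R a1) I1; have K2 := congr1 ( *%R a3) I2; have K3 := congr1 ( *%R a2) I3.
have L1 := congr1 ( *%R b1) J1; have L2 := congr1 ( *%R b3) J2; have L3 := congr1 ( *%R b2) J3.
rewrite /= in K1 K2 K3 L1 L2 L3.
rewrite -/y -/y'; move: K1 K2 K3 L1 L2 L3 T0 T5 T6; clear.
set P1 := _ * (psi * _ + _); set P2 := _ * (psi * _ + _); set P3 := bp _ * _; set P4 := bq _ * _.
move=> K1 K2 K3 L1 L2 L3 T0 T5 T6.
suff : P1 + P2 - P3 - P4 <= psi * ((bp y - bp y') * e1 + (bq y - bq y') * e2)
  + 2 * A1 * ((p - p0) * bp y + (q - q0) * bq y).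
 move: P1 P2 P3 P4 (psi * _) (2 * A1 * _) => X1 X2 X3 X4 Y1 Y2; move: K1 K2 K3 L1 L2 L3 T0 T5 T6; clear. nra.
by rewrite /P1 /P2 /P3 /P4; apply: eq_leW; ring.
Qed.

End gradient.

Section gradient_bound.
Variables (k : prm) (Y tau : R).
Hypotheses (ak : admissible k) (Y0 : 0 < Y) (tau0 : 0 < tau).

Let rb := rbar k.
(** Constants of the gradient bound. [Lf] is a Lipschitz constant of the drift, [Df] bounds its
    components for 0 <= y <= 2 Y, [eta1] is a radius at which the variation of the drift costs at
    most half of sigma, [M1] bounds p0 / eta, and [Kf] collects all the remaining terms in units of
    S / eta. *)
Definition Lf : R := `|pb k| + `|(pd k * ps k + pl k * pr k * pb k) / (pl k * rb)|.
Definition Df1 : R := (pa k + `|pb k| * (2 * Y)) / ps k.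
Definition Df : R := Df1 + (`|pc k| + `|pd k| * (2 * Y) + `|pl k * pr k| * Df1) / (pl k * rb).
Definition eta1 : R := Num.min 1 (ps k / (2 * (Lf + 1))).
Definition M1 : R := 4 + Y / ps k / eta1.
Definition Kf : R := 13 + (2 + 3 / tau + 6 * ps k * (M1 + 1) + 6 * Df) / ps k.

Let s0 : 0 < ps k. by case: ak. Qed.
Let l0 : 0 < pl k. by case: ak. Qed.
Let rb0 : 0 < rb. exact: rbar_gt0. Qed.

Lemma Lf_ge0 : 0 <= Lf. by rewrite addr_ge0. Qed.
Lemma Df1_ge0 : 0 <= Df1.
have [a0 _ _ _] := ak.
by rewrite divr_ge0 ?(ltW s0)// addr_ge0 ?(ltW a0)// mulr_ge0// mulr_ge0// ltW.
Qed.
Lemma Df_ge0 : 0 <= Df.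
rewrite addr_ge0 ?Df1_ge0// divr_ge0 ?mulr_ge0 ?(ltW l0) ?(ltW rb0)//.
have d0 := Df1_ge0; have y0 := ltW Y0.
by apply: addr_ge0; [apply: addr_ge0 => //; apply: mulr_ge0 => //; apply: mulr_ge0 | apply: mulr_ge0].
Qed.
Lemma eta1_gt0 : 0 < eta1.
rewrite lt_min ltr01 divr_gt0// mulr_gt0// ltr_wpDl//; exact: Lf_ge0.
Qed.
Lemma eta1_le1 : eta1 <= 1. by rewrite ge_min lexx. Qed.
Lemma Lf_eta1 : Lf * eta1 <= ps k / 2.
have L0 := Lf_ge0; have : eta1 <= ps k / (2 * (Lf + 1)) by rewrite ge_min lexx orbT.
rewrite ler_pdivlMr; last by rewrite mulr_gt0// ltr_wpDl.
have := eta1_gt0; move: L0; move: Lf eta1 (ps k) => L e s; nra.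
Qed.
Lemma M1_ge4 : 4 <= M1.
by rewrite /M1 lerDl !divr_ge0 ?(ltW Y0) ?(ltW s0) ?(ltW eta1_gt0). Qed.
Lemma Kf_ge13 : 13 <= Kf.
rewrite /Kf lerDl divr_ge0 ?(ltW s0)// !addr_ge0//.
- by rewrite divr_ge0// ltW.
- rewrite !mulr_ge0 ?(ltW s0)// addr_ge0//; apply: le_trans M1_ge4; exact: ler0n.
- by rewrite mulr_ge0// Df_ge0.
Qed.

Lemma bp_bound (y : R) : 0 <= y <= 2 * Y -> `|bp k y| <= Df1.
have [a0 _ _ _] := ak; move=> /andP[y0 y2]; rewrite /bp /Df1 normrM (gtr0_norm (x := (ps k)^-1)) ?invr_gt0//.
rewrite ler_pM2r ?invr_gt0//; apply: (le_trans (ler_normB _ _)).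
by rewrite gtr0_norm// lerD2l normrM ler_wpM2l// ger0_norm.
Qed.

Lemma bq_bound (y : R) : 0 <= y <= 2 * Y -> `|bq k y| <= (`|pc k| + `|pd k| * (2 * Y) + `|pl k * pr k| * Df1) / (pl k * rb).
move=> yy; have b := bp_bound yy; case/andP: yy => y0 y2.
have p0 : 0 < pl k * rb by rewrite mulr_gt0.
rewrite /bq normrM (gtr0_norm (x := (_ * _)^-1)) ?invr_gt0//.
rewrite ler_pM2r ?invr_gt0//; apply: (le_trans (ler_normB _ _)); apply: lerD; last first.
 by rewrite normrM ler_wpM2l.
apply: (le_trans (ler_normD _ _)); rewrite lerD2l normrM ler_wpM2l//.
by rewrite ger0_norm.
Qed.

Lemma drift_lip (p w1 e1 e2 : R) : `|e1| <= 1 -> `|e2| <= 1 -> (bp k (ps k * p) - bp k (ps k * (p - w1))) * e1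
 + (bq k (ps k * p) - bq k (ps k * (p - w1))) * e2 <= Lf * `|w1|.
move=> h1 h2.
have -> : bp k (ps k * p) - bp k (ps k * (p - w1)) = - pb k * w1.
 by rewrite /bp; field; exact: lt0r_neq0.
have -> : bq k (ps k * p) - bq k (ps k * (p - w1)) = (pd k * ps k + pl k * pr k * pb k) / (pl k * rb) * w1.
 rewrite /bq /bp -/rb; field; rewrite !lt0r_neq0//.
apply: (le_trans (ler_norm _)); apply: (le_trans (ler_normD _ _)).
have -> : Lf * `|w1| = `|pb k| * `|w1| + `|(pd k * ps k + pl k * pr k * pb k) / (pl k * rb)| * `|w1|.
 by rewrite /Lf mulrDl.
apply: lerD; rewrite normrM -[leRHS]mulr1.
 by apply: ler_pM => //; rewrite normrM normrN.
by apply: ler_pM => //; rewrite normrM.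
Qed.

Lemma sqrt_diff (y y' : R) : 0 < y -> 0 < y' -> y + y' <= (Num.sqrt y + Num.sqrt y') ^+ 2 /\
 (Num.sqrt y - Num.sqrt y') ^+ 2 * (y + y') <= (y - y') ^+ 2.
move=> y0 y0'.
have e1 : Num.sqrt y ^+ 2 = y by rewrite sqr_sqrtr// ltW.
have e2 : Num.sqrt y' ^+ 2 = y' by rewrite sqr_sqrtr// ltW.
have s1 : 0 <= Num.sqrt y by exact: sqrtr_ge0.
have s2 : 0 <= Num.sqrt y' by exact: sqrtr_ge0.
have h : y + y' <= (Num.sqrt y + Num.sqrt y') ^+ 2.
 by rewrite sqrrD e1 e2; have := mulr_ge0 s1 s2; lra.
split => //.
have -> : (y - y') ^+ 2 = (Num.sqrt y - Num.sqrt y') ^+ 2 * (Num.sqrt y + Num.sqrt y') ^+ 2.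
 by rewrite -exprMn -subr_sqr e1 e2.
by rewrite ler_wpM2l// sqr_ge0.
Qed.

End gradient_bound.

(** Since eta is at most p0 / 4, both points stay away from the degeneracy at a distance comparable
    with eta. The penalties exceed the oscillation 2 S at distance eta and at time tau, and so does
    the modulus at r = eta. A positive maximum is thus interior with 0 < r < eta, which [dbl_core]
    contradicts. *)
Lemma doubling (k : prm) (Y tau : R) (g : expr) (S t0 p0 q0 eta : R) :
 admissible k -> 0 < Y -> 0 < tau -> 0 < S -> 0 < eta -> eta <= eta1 k -> 4 * eta <= p0 -> p0 <= M1 k Y * eta -> 2 * (ps k * p0) <= 2 * Y ->
 (forall t p q, t0 <= t <= t0 + tau -> `|p - p0| <= 2 * eta -> `|q - q0| <= 2 * eta ->
   `|gv k g t p q| <= S /\ `|gv k (heat k g) t p q| <= S) ->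
 forall t p q w1 w2, dbox t0 p0 q0 tau eta t p q w1 w2 ->
  dbl k g t0 p0 q0 (Kf k Y tau * S / eta) (Kf k Y tau * S / eta / (2 * eta)) (3 * S / eta ^+ 2) (3 * S / tau) t p q w1 w2 <= 0.
move=> ak Y0 tau0 S0 eta0 le1 p04 p0M pY H.
have [_ l0 s0 _] := ak; have rb0 := rbar_gt0 ak.
set A := Kf k Y tau * S / eta; set B := A / (2 * eta); set A1 := 3 * S / eta ^+ 2; set A2 := 3 * S / tau.
have K0 : 0 < Kf k Y tau by apply: lt_le_trans (Kf_ge13 ak Y0 tau0).
have A0 : 0 < A by rewrite divr_gt0// mulr_gt0.
have B0 : 0 < B by rewrite divr_gt0// mulr_gt0.
have A10 : 0 < A1 by rewrite divr_gt0 ?exprn_gt0// mulr_gt0.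
have A20 : 0 < A2 by rewrite divr_gt0// mulr_gt0.
have [t [p [q [w1 [w2 [DB M]]]]]] := dbl_attains k g t0 p0 q0 A B A1 A2 (ltW tau0) (ltW eta0).
suff le : dbl k g t0 p0 q0 A B A1 A2 t p q w1 w2 <= 0.
 by move=> t' p' q' w1' w2' /M h; apply: le_trans le.
rewrite leNgt; apply/negP => pos.
have [/andP[tt0 ttau] pe qe w1e w2e] := DB.
have tB : t0 <= t <= t0 + tau by rewrite tt0.
have ee : eta <= 2 * eta by move: eta0; clear; lra.
have [g1 h1] := H t p q tB (le_trans pe ee) (le_trans qe ee).
have pw : `|p - w1 - p0| <= 2 * eta.
 by rewrite addrAC (le_trans (ler_normB _ _))//; move: pe w1e; clear; lra.
have qw : `|q - w2 - q0| <= 2 * eta.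
 by rewrite addrAC (le_trans (ler_normB _ _))//; move: qe w2e; clear; lra.
have [g2 h2] := H t (p - w1) (q - w2) tB pw qw.
have dg : gv k g t p q - gv k g t (p - w1) (q - w2) <= 2 * S.
 by move: g1 g2; rewrite !ler_norml => /andP[_ u1] /andP[u2 _]; move: u1 u2; clear; lra.
have dh : - (2 * S) <= gv k (heat k g) t p q - gv k (heat k g) t (p - w1) (q - w2).
 by move: h1 h2; rewrite !ler_norml => /andP[u1 _] /andP[_ u2]; move: u1 u2; clear; lra.
pose r := Num.sqrt (w1 ^+ 2 + w2 ^+ 2).
have w20 : 0 <= w1 ^+ 2 + w2 ^+ 2 by rewrite addr_ge0// sqr_ge0.
have r2 : r ^+ 2 = w1 ^+ 2 + w2 ^+ 2 by rewrite sqr_sqrtr.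
have rge : 0 <= r by exact: sqrtr_ge0.
have sqe (u : R) : `|u| <= eta -> u ^+ 2 <= eta ^+ 2.
 by move=> ue; rewrite -real_normK ?num_real// lerXn2r ?nnegrE// ltW.
have r32 : r <= 3 / 2 * eta.
 rewrite -(@ler_pXn2r _ 2)// ?nnegrE ?mulr_ge0 ?divr_ge0// ?(ltW eta0)//.
 by rewrite r2; have := sqe _ w1e; have := sqe _ w2e; move: (exprn_gt0 2 eta0); clear; nra.
have psiE : A * r - B * r ^+ 2 = A * r * (1 - r / (2 * eta)).
 by rewrite /B; field; rewrite lt0r_neq0.
have half : r / (2 * eta) <= 3 / 4.
 by rewrite ler_pdivrMr ?mulr_gt0//; move: r32; clear; lra.
have psi0 : 0 <= A * r - B * r ^+ 2.
 rewrite psiE; apply: mulr_ge0; first by apply: mulr_ge0; rewrite ?(ltW A0). by move: half; clear; lra.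
have quad0 : 0 <= A1 * ((p - p0) ^+ 2 + (q - q0) ^+ 2).
 by rewrite mulr_ge0 ?(ltW A10)// addr_ge0// sqr_ge0.
have time0 : 0 <= A2 * (t - t0) by rewrite mulr_ge0 ?(ltW A20)// subr_ge0.
move: pos; rewrite /dbl -/r -r2 => pos.
have A1e : A1 * eta ^+ 2 = 3 * S by rewrite /A1 divfK// gt_eqF// exprn_gt0.
have nearq (u v : R) : `|u| <= eta -> A1 * (u ^+ 2 + v ^+ 2) < 3 * S -> `|u| < eta.
 move=> ue lt; rewrite lt_neqAle ue andbT; apply/eqP => E. move: lt; rewrite -A1e -E real_normK ?num_real// ltr_pM2l//.
 by rewrite ltNge lerDl sqr_ge0.
have quad3 : A1 * ((p - p0) ^+ 2 + (q - q0) ^+ 2) < 3 * S.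
 by move: pos dg psi0 time0 S0; move: (gv k g t p q - _) (A * r - _) (A1 * _) (A2 * _) => ? ? ? ?; clear; lra.
have pe' : `|p - p0| < eta by apply: nearq pe quad3.
have qe' : `|q - q0| < eta by apply: (nearq _ (p - p0) qe); rewrite addrC.
have time3 : A2 * (t - t0) < A2 * tau.
 rewrite /A2 [in ltRHS]divfK ?gt_eqF//.
 rewrite -/A2; move: pos dg psi0 quad0 S0; move: (gv k g t p q - _) (A * r - _) (A1 * _) (A2 * _) => ? ? ? ?; clear; lra.
have tlt : t < t0 + tau by move: time3; rewrite ltr_pM2l// ltrBlDl.
(* For r >= eta the modulus is at least A eta / 4 >= 13 S / 4, more than the increment of g can
   be. *)
have rlt : r < eta.
 rewrite ltNge; apply/negP => er. have : A * eta * (1 / 4) <= A * r - B * r ^+ 2.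
  rewrite psiE; apply: ler_pM => //; first by apply: mulr_ge0; apply: ltW.
   by apply: ler_wpM2l => //; apply: ltW.
  by move: half; clear; lra.
 have -> : A * eta = Kf k Y tau * S by rewrite /A divfK// gt_eqF.
 have : 13 * S <= Kf k Y tau * S by rewrite ler_wpM2r ?(ltW S0)// (Kf_ge13 ak Y0 tau0).
 by move: pos dg quad0 time0 S0; move: (gv k g t p q - _) (A * r - _) (A1 * _) (A2 * _) (Kf k Y tau * S) => ? ? ? ? ?; clear; lra.
have wr (u v : R) : u ^+ 2 + v ^+ 2 = r ^+ 2 -> `|u| <= r.
 by move=> E; rewrite -(@ler_pXn2r _ 2)// ?nnegrE// real_normK ?num_real// -E lerDl sqr_ge0.
have w1r : `|w1| <= r by apply: (wr _ w2).
have w2r : `|w2| <= r by apply: (wr _ w1); rewrite addrC.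
(* At w = 0 the doubled function consists of the penalties alone and is not positive. *)
have r0 : 0 < r.
 rewrite lt_def rge andbT; apply/eqP => r00. move: w1r w2r; rewrite r00 !normr_le0 => /eqP e1 /eqP e2.
 move: pos; rewrite r00 e1 e2 !subr0 subrr mulr0 expr0n mulr0 subrr.
 by move: quad0 time0; move: (A1 * _) (A2 * _) => ? ?; clear; lra.
have BA : 2 * B * r <= A.
 have -> : 2 * B * r = A * (r / eta) by rewrite /B; field; rewrite lt0r_neq0. by rewrite ger_pMr// ler_pdivrMr// mul1r ltW.
have psile : A - 2 * B * r <= A.
 by rewrite gerDl oppr_le0; apply: mulr_ge0 => //; apply: mulr_ge0 => //; exact: ltW.
have pe1 : `|p - p0| <= eta := ltW pe'.
have pge : 3 * eta <= p by move: pe1 p04; rewrite ler_norml => /andP[u1 _]; move: u1 eta0; clear; lra.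
have pwge : 2 * eta <= p - w1.
 by move: pw w1r rlt pge; rewrite !ler_norml => _ /andP[_ u1]; move: u1 eta0; clear; lra.
have pp0 : 0 < p by move: pge eta0; clear; lra.
have pp0' : 0 < p - w1 by move: pwge eta0; clear; lra.
have tt1 : t0 <= t < t0 + tau by rewrite tt0.
have core := dbl_core ak tt1 pe' qe' (le_lt_trans w1r rlt) (le_lt_trans w2r rlt) M erefl r0 (ltW B0) BA pp0 pp0' erefl erefl.
pose y := ps k * p; pose y' := ps k * (p - w1).
have [om dif] := sqrt_diff (mulr_gt0 s0 pp0 : 0 < y) (mulr_gt0 s0 pp0' : 0 < y').
have yy : 5 * (ps k * eta) <= y + y'.
 rewrite /y /y' -mulrDr mulrCA ler_wpM2l ?(ltW s0)//; move: pge pwge; clear; lra.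
pose Q := S / eta; have Q0 : 0 < Q by rewrite divr_gt0.
(* This gain of 5/2 A sigma outweighs the parallel motion, at most A sigma / 10, and the variation
   of the drift, at most A sigma / 2; what is left pays for the terms gathered in [Kf]. *)
have f1 : 5 / 2 * (A * ps k) <= B * (Num.sqrt y + Num.sqrt y') ^+ 2.
 apply: le_trans (ler_wpM2l (ltW B0) (le_trans yy om)). by apply: eq_leW; rewrite /B; field; rewrite lt0r_neq0.
have f2 : (A - 2 * B * r) * (Num.sqrt y - Num.sqrt y') ^+ 2 / r <= A * ps k / 5.
 have d5 : (Num.sqrt y - Num.sqrt y') ^+ 2 * (5 * (ps k * eta)) <= (ps k * r) ^+ 2.
  apply: le_trans (ler_wpM2l (sqr_ge0 _) yy) _; apply: (le_trans dif). have -> : y - y' = ps k * w1 by rewrite /y /y'; ring.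
  by rewrite !exprMn ler_wpM2l ?sqr_ge0// r2 lerDl sqr_ge0.
 have d6 : (Num.sqrt y - Num.sqrt y') ^+ 2 <= ps k * r / 5.
  rewrite -(ler_pM2r (x := 5 * (ps k * eta))) ?mulr_gt0//; apply: (le_trans d5).
  have -> : ps k * r / 5 * (5 * (ps k * eta)) = (ps k) ^+ 2 * r * eta by field.
  by rewrite exprMn expr2 (expr2 r) mulrA ler_wpM2l ?(ltW rlt)// mulr_ge0 ?sqr_ge0// ltW.
 rewrite ler_pdivrMr//. have -> : A * ps k / 5 * r = A * (ps k * r / 5) by ring.
 by apply: ler_pM => //; rewrite ?sqr_ge0 ?subr_ge0.
have er1 (u : R) : `|u| <= r -> `|u / r| <= 1.
 by move=> ur; rewrite normrM normfV (gtr0_norm r0) ler_pdivrMr// mul1r.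
have f3 : (A - 2 * B * r) * ((bp k y - bp k y') * (w1 / r) + (bq k y - bq k y') * (w2 / r)) <= A * ps k / 2.
 have psi1 : 0 <= A - 2 * B * r by rewrite subr_ge0.
 apply: (le_trans (ler_wpM2l psi1 (drift_lip ak p w1 (er1 _ w1r) (er1 _ w2r)))).
 rewrite -[leRHS]mulrA; apply: ler_pM => //; first by apply: mulr_ge0 => //; exact: Lf_ge0.
 apply: le_trans (Lf_eta1 ak); apply: ler_wpM2l; first exact: Lf_ge0. by apply: (le_trans w1r); apply: (le_trans (ltW rlt)).
have yb : 0 <= y <= 2 * Y.
 rewrite /y mulr_ge0 ?(ltW s0) ?(ltW pp0)//=; apply: le_trans pY. rewrite mulrCA ler_wpM2l ?(ltW s0)//.
 by move: pe1 p04; rewrite ler_norml => /andP[_ u1]; move: u1 eta0; clear; lra.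
have f4 : 2 * A1 * ((p - p0) * bp k y + (q - q0) * bq k y) <= 6 * Df k Y * Q.
 have h3 : (p - p0) * bp k y + (q - q0) * bq k y <= eta * Df k Y.
  rewrite /Df mulrDr; apply: lerD; apply: (le_trans (ler_norm _)); rewrite normrM.
   by apply: ler_pM => //; exact: bp_bound.
  by apply: ler_pM => //; exact: bq_bound.
 apply: (le_trans (ler_wpM2l _ h3)); first by rewrite mulr_ge0// ltW. by apply: eq_leW; rewrite /A1 /Q; field; rewrite lt0r_neq0.
have f5 : A1 * y <= 3 * ps k * (M1 k Y + 1) * Q.
 have : y <= ps k * ((M1 k Y + 1) * eta).
  rewrite /y ler_wpM2l ?(ltW s0)// mulrDl mul1r.
  by move: pe1 p0M; rewrite ler_norml => /andP[_ u1]; move: u1; clear; move: (M1 k Y * eta) => Z; lra.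
 move=> h3; apply: (le_trans (ler_wpM2l (ltW A10) h3)). by apply: eq_leW; rewrite /A1 /Q; field; rewrite lt0r_neq0.
have SQ : S <= Q.
 by rewrite /Q ler_pdivlMr// ler_piMr ?(ltW S0)// (le_trans le1)// eta1_le1.
have f6 : A2 <= 3 / tau * Q by rewrite /A2 mulrAC ler_wpM2l// divr_ge0// ltW.
have f7 : A * ps k = (13 * ps k + (2 + 3 / tau + 6 * ps k * (M1 k Y + 1) + 6 * Df k Y)) * Q.
 by rewrite /A /Kf /Q; field; rewrite !lt0r_neq0.
have f8 : 0 < ps k * Q by rewrite mulr_gt0.
have f9 : 0 <= A * ps k by rewrite mulr_ge0// ltW.
move: core dh f1 f2 f3 f4 f5 SQ f6 f7 f8 f9; rewrite -/r -/y -/y'.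
rewrite -[2 * B * _]mulrA -[4 * A1 * y]mulrA.
move: (gv k (heat k g) t p q - _) (B * _) (2 * A1 * _) (A1 * y) ((A - _) * _) (_ * _ / r) (A * ps k).
move=> H1 H2 H3 H4 H5 H6 H7; move: (Df k Y) (M1 k Y) (ps k) (3 / tau) (Q) (S) (A2) => D' M' s T' Q' S' A2'.
clear; lra.
Qed.

(** Near the degeneracy the admissible radius is proportional to y0, so the gradient is of order S /
    y0; hence the factor y0 on the left. *)
Lemma gradient_bound (k : prm) (Y tau : R) : admissible k -> 0 < Y -> 0 < tau ->
 exists2 C : R, 0 < C & forall (g : expr) (S t0 x0 y0 : R), 0 < S -> 0 < y0 -> y0 <= Y ->
  (forall t x y, t0 <= t <= t0 + tau -> `|x - x0| <= 4 * pl k -> 0 <= y <= 2 * Y ->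
    `|ev g t x y| <= S /\ `|ev (heat k g) t x y| <= S) ->
  y0 * `|ev (Ex g) t0 x0 y0| <= C * S /\ y0 * `|ev (Ey g) t0 x0 y0| <= C * S.
move=> ak Y0 tau0; have [_ l0 s0 rr] := ak; have rb0 := rbar_gt0 ak; have rb2 := rbar2 ak.
have e10 := eta1_gt0 ak; have M4 := M1_ge4 ak Y0; have K13 := Kf_ge13 ak Y0 tau0.
have M0 : 0 < M1 k Y by apply: lt_le_trans M4.
have K0 : 0 < Kf k Y tau by apply: lt_le_trans K13.
pose D := ps k * M1 k Y * Kf k Y tau.
have D0 : 0 < D by rewrite !mulr_gt0.
have lr0 : 0 < pl k * rbar k by rewrite mulr_gt0.
pose C1 := (pl k * rbar k)^-1; pose C2 := (1 + `|pl k * pr k| * C1) / ps k.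
have C10 : 0 < C1 by rewrite invr_gt0.
have C20 : 0 < C2 by rewrite divr_gt0// ltr_wpDr// mulr_ge0// ltW.
exists (D * (C1 + C2)); first by rewrite mulr_gt0// addr_gt0.
move=> g S t0 x0 y0 S0 y00 yY H.
pose p0 := y0 / ps k; pose q0 := (x0 - pl k * pr k * p0) / (pl k * rbar k).
have sp : ps k * p0 = y0 by rewrite /p0 mulrC divfK// gt_eqF.
have cx : crdx k p0 q0 = x0.
 by rewrite /crdx /q0; field; rewrite !lt0r_neq0.
have p00 : 0 < p0 by rewrite divr_gt0.
pose eta := Num.min (p0 / 4) (eta1 k).
have eta0 : 0 < eta by rewrite lt_min e10 divr_gt0.
have le1 : eta <= eta1 k by rewrite ge_min lexx orbT.
have p04 : 4 * eta <= p0.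
 by rewrite mulrC -ler_pdivlMr// ge_min lexx.
have p0M : p0 <= M1 k Y * eta.
 rewrite /eta; case: (leP (p0 / 4) (eta1 k)) => _.
  by rewrite mulrA ler_pdivlMr// mulrC ler_wpM2r// ltW.
 rewrite /M1 mulrDl divfK ?gt_eqF//. have : p0 <= Y / ps k by rewrite ler_pM2r ?invr_gt0.
 by move: e10; clear; move: p0 (Y / ps k) (eta1 k) => ? ? ?; lra.
have pY : 2 * (ps k * p0) <= 2 * Y by rewrite sp ler_wpM2l.
have H' t p q : t0 <= t <= t0 + tau -> `|p - p0| <= 2 * eta -> `|q - q0| <= 2 * eta ->
  `|gv k g t p q| <= S /\ `|gv k (heat k g) t p q| <= S.
 move=> tt hp hq; apply: H => //.
  rewrite -cx; have -> : crdx k p q - crdx k p0 q0 = pl k * (pr k * (p - p0) + rbar k * (q - q0)) by rewrite /crdx; ring.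
  rewrite normrM gtr0_norm// mulrC ler_wpM2r ?(ltW l0)//. have e1 : eta <= 1 by apply: (le_trans le1); exact: eta1_le1.
  have h1 : `|pr k * (p - p0)| <= 2 * eta.
   rewrite normrM; apply: le_trans hp; rewrite ler_piMl// ler_norml. by case/andP: rr => r1 r2; rewrite !ltW.
  have h2 : `|rbar k * (q - q0)| <= 2 * eta.
   rewrite normrM; apply: le_trans hq; rewrite ler_piMl// gtr0_norm//.
   rewrite -(@ler_pXn2r _ 2)// ?nnegrE ?(ltW rb0)// rb2 expr1n gerDl oppr_le0 sqr_ge0//.
  by apply: (le_trans (ler_normD _ _)); move: h1 h2 e1; clear; lra.
 move: hp; rewrite ler_norml => /andP[u1 u2]; apply/andP; split.
  by rewrite mulr_ge0 ?(ltW s0)//; move: u1 p04 eta0; clear; lra.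
 apply: le_trans pY; rewrite mulrCA ler_wpM2l ?(ltW s0)//. by move: u2 p04 eta0; clear; lra.
have dbl0 := doubling ak Y0 tau0 S0 eta0 le1 p04 p0M pY H'.
set A := Kf k Y tau * S / eta in dbl0.
have A0 : 0 < A by rewrite divr_gt0// mulr_gt0.
have yA : y0 * A <= D * S.
 rewrite -sp /A /D; have -> : ps k * p0 * (Kf k Y tau * S / eta) = (ps k * Kf k Y tau * S) * (p0 / eta).
  by ring.
 have -> : ps k * M1 k Y * Kf k Y tau * S = (ps k * Kf k Y tau * S) * M1 k Y by ring.
 apply: ler_wpM2l; first by apply/ltW; rewrite !mulr_gt0. by rewrite ler_pdivrMr.
(* At the centre the doubled function is 0 for w = 0 and nonpositive for w along (e1, e2), so its
   right derivative there is nonpositive. *)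
have dir e1 e2 : `|e1| <= 1 -> `|e2| <= 1 -> e1 ^+ 2 + e2 ^+ 2 = 1 -> gv k (Dd k g e1 e2) t0 p0 q0 <= A.
 move=> n1 n2 e12. have hd : has_der setT (fun s => -1 * gv k g t0 (p0 + s * - e1) (q0 + s * - e2)
   + (gv k g t0 p0 q0 + - A * (s - 0) + 0 / 2 * (s - 0) ^+ 2)) 0
   (-1 * gv k (Dd k g (- e1) (- e2)) t0 (p0 + 0 * - e1) (q0 + 0 * - e2) + (- A + 0 * (0 - 0))).
  by apply: has_derD; [apply: has_derZ; exact: gv_line | exact: has_der_quad].
 have E : gv k (Dd k g (- e1) (- e2)) t0 (p0 + 0 * - e1) (q0 + 0 * - e2) = - gv k (Dd k g e1 e2) t0 p0 q0.
  by rewrite !mul0r !addr0 !gvD1 /crdx; ring.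
 suff : -1 * gv k (Dd k g (- e1) (- e2)) t0 (p0 + 0 * - e1) (q0 + 0 * - e2) + (- A + 0 * (0 - 0)) <= 0.
  by rewrite E; clear; lra.
 apply: (has_der_le0 hd) => d d0; exists (Num.min d eta). have m0 : 0 < Num.min d eta by rewrite lt_min d0.
 have me : Num.min d eta <= eta by rewrite ge_min lexx orbT. split => //; first by rewrite add0r ge_min lexx.
 set s := Num.min d eta in m0 me *. have ns e : `|e| <= 1 -> `|s * e| <= eta.
  move=> he; rewrite normrM gtr0_norm//; apply: le_trans me; by rewrite ler_piMr// ltW.
 have : dbox t0 p0 q0 tau eta t0 p0 q0 (s * e1) (s * e2).
  by split; rewrite ?lexx ?lerDl ?(ltW tau0) ?subrr ?normr0 ?(ltW eta0) ?ns.
 move=> /dbl0; rewrite /dbl !subrr expr0n !mulr0 addr0 !mulr0 !subr0. have -> : (s * e1) ^+ 2 + (s * e2) ^+ 2 = s ^+ 2.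
  by transitivity (s ^+ 2 * (e1 ^+ 2 + e2 ^+ 2)); [ring | rewrite e12 mulr1].
 rewrite sqrtr_sqr gtr0_norm// !mul0r !addr0 !mulrN. have Bs : 0 <= A / (2 * eta) * s ^+ 2.
  apply: mulr_ge0; last exact: sqr_ge0. by apply: divr_ge0; [exact: ltW | apply: mulr_ge0 => //; exact: ltW].
 move: Bs; move: (_ * s ^+ 2) (gv k g t0 (p0 - _) _) (gv k g _ _ _) => b G1 G2; clear. by rewrite mulN1r; lra.
have Dp : `|gv k (Dd k g 1 0) t0 p0 q0| <= A.
 rewrite ler_norml; apply/andP; split; last by apply: dir; rewrite ?normr0 ?normr1// expr1n expr0n addr0.
 have := dir (-1) 0; rewrite normrN normr0 normr1 lexx sqrrN expr1n expr0n addr0 => /(_ erefl ler01 erefl).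
 by rewrite !gvD1 /crdx; clear; move: (gv _ _ _ _ _) (gv _ _ _ _ _) => ? ?; lra.
have Dq : `|gv k (Dd k g 0 1) t0 p0 q0| <= A.
 rewrite ler_norml; apply/andP; split; last by apply: dir; rewrite ?normr0 ?normr1// expr1n expr0n add0r.
 have := dir 0 (-1); rewrite normrN normr0 normr1 lexx sqrrN expr1n expr0n add0r => /(_ ler01 erefl erefl).
 by rewrite !gvD1 /crdx; clear; move: (gv _ _ _ _ _) (gv _ _ _ _ _) => ? ?; lra.
move: Dp Dq; rewrite !gvD1.
have -> : gv k (Ex g) t0 p0 q0 = ev (Ex g) t0 x0 y0 by rewrite /gv cx sp.
have -> : gv k (Ey g) t0 p0 q0 = ev (Ey g) t0 x0 y0 by rewrite /gv cx sp.
move: (ev (Ex g) _ _ _) (ev (Ey g) _ _ _) => gx gy Dp Dq.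
have bx : `|gx| <= C1 * A.
 have -> : gx = C1 * (crdx k 0 1 * gx + ps k * 0 * gy).
  by rewrite /C1 /crdx; field; rewrite !lt0r_neq0.
 by rewrite normrM (gtr0_norm C10) ler_wpM2l// ltW.
have by' : `|gy| <= C2 * A.
 have -> : gy = ((crdx k 1 0 * gx + ps k * 1 * gy) - pl k * pr k * gx) / ps k.
  by rewrite /crdx; field; rewrite !lt0r_neq0.
 rewrite normrM normfV (gtr0_norm s0) /C2 [leRHS]mulrAC ler_pM2r ?invr_gt0//.
 apply: (le_trans (ler_normB _ _)); rewrite [leRHS]mulrDl mul1r; apply: lerD => //. by rewrite normrM -mulrA ler_wpM2l.
have fin c gg : 0 < c -> `|gg| <= c * A -> c <= C1 + C2 -> y0 * `|gg| <= D * (C1 + C2) * S.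
 move=> c0 hg hc; apply: (le_trans (ler_wpM2l (ltW y00) hg)).
 rewrite mulrCA; have -> : D * (C1 + C2) * S = (C1 + C2) * (D * S) by ring.
 by apply: ler_pM => //; [exact: ltW | rewrite mulr_ge0// ltW].
by split; [apply: fin bx _ | apply: fin by' _] => //; rewrite ?lerDl ?lerDr ltW.
Qed.

(** * Simultaneous approximation of derivatives by Bernstein polynomials *)

Lemma mvt_on (I : set R) (f f' : R -> R) (a b : R) : a < b -> (forall w, a <= w <= b -> I w /\ has_der I f w (f' w)) ->
 exists2 c, a <= c <= b & f b - f a = f' c * (b - a).
move=> ab H.
have der w : w \in `]a, b[ -> is_derive w 1 f (f' w).
 rewrite in_itv/= => /andP[aw wb]. have [_ hw] := H w ltac:(by rewrite !ltW); apply/is_deriveP.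
 apply: (has_der_interior (d := Num.min (w - a) (b - w)) _ _ hw).
  by rewrite lt_min !subr_gt0 aw.
 move=> z; rewrite le_min !ler_norml => /andP[/andP[h1 _] /andP[_ h2]].
 by apply: (proj1 (H z _)); apply/andP; split; [move: h1 | move: h2]; clear; lra.
have cf : {within `[a, b], continuous f}.
 apply/subspace_continuousP => w; rewrite /= in_itv/= => wab.
 have [_ /has_der_continuous hw] := H w wab; apply/cvgrPdist_le => e e0.
 have [d d0 Hd] := hw e e0; rewrite near_withinE; apply/nbhs_ballP; exists d => //.
 move=> z /= zd; rewrite in_itv/= => zab; rewrite distrC; apply: Hd.
  by have [] := H z zab.
 by rewrite distrC ltW.
have [c cI E] := MVT ab der cf; exists c => //.
by move: cI; rewrite in_itv/= => /andP[c1 c2]; rewrite !ltW.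
Qed.

Definition sqd (t x y s z w : R) : R := (s - t) ^+ 2 + (z - x) ^+ 2 + (w - y) ^+ 2.

Lemma box_bounded (T M : R) v : 0 <= T -> 0 <= M -> continuous3_on (closed_slab T) v ->
 exists2 S : R, 0 < S & forall t x y, box T M (t, x, y) -> `|v t x y| <= S.
move=> T0 M0 cv.
have w0 t x y : 0 < ev (Cst (1 : R)) t x y by rewrite /= ltr01.
have [t1 [x1 [y1 [_ H1]]]] := box_max T0 M0 cv w0.
have cv' : continuous3_on (closed_slab T) (fun t x y => 0 + -1 * v t x y).
 by apply: cont3_lin => // P; apply: cvg_cst.
have [t2 [x2 [y2 [_ H2]]]] := box_max T0 M0 cv' w0.
exists (`|v t1 x1 y1| + `|v t2 x2 y2| + 1); first by rewrite ltr_wpDl// addr_ge0.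
move=> t x y B; have := H1 t x y B; have := H2 t x y B; rewrite /= !divr1 !add0r !mulN1r.
move=> h2 h1; rewrite ler_norml; have := ler_norm (v t1 x1 y1).
have := ler_norm (- v t2 x2 y2); rewrite normrN.
have := normr_ge0 (v t1 x1 y1); have := normr_ge0 (v t2 x2 y2).
by move=> ? ? ? ?; apply/andP; split; lra.
Qed.

(** Uniform continuity with a quadratic error in place of a radius: Bernstein polynomials average
    such an error exactly, their variance being explicit. *)
Lemma unif_modulus (T M : R) (v : fun3) : 0 <= T -> 0 <= M -> continuous3_on (closed_slab T) v ->
 forall e : R, 0 < e -> exists2 c : R, 0 <= c & forall t x y s z w,
  box T M (t, x, y) -> box T M (s, z, w) -> `|v s z w - v t x y| <= e + c * sqd t x y s z w.
move=> T0 M0 cv e e0; have [S S0 HS] := box_bounded T0 M0 cv.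
pose Q (n : nat) (P : R * R * R) := box T M P -> forall s z w, box T M (s, z, w) ->
 `|v s z w - v P.1.1 P.1.2 P.2| <= e + n%:R * sqd P.1.1 P.1.2 P.2 s z w.
have /compact_near_coveringP /(_ nat \oo Q _) := @box_compact T M.
case=> [[[t x] y] [/= tT xM /andP[y0 yM]]|N _ HN]; last first.
 by exists N%:R => // t x y s z w B1 B2; exact: (HN N (leqnn N) (t, x, y) B1 B1 s z w B2).
have [d d0 Hd] := (cont3P _ _).1 cv t x y (conj tT y0) (e / 2) ltac:(by rewrite divr_gt0).
have d2 : 0 < (d / 2) ^+ 2 by rewrite exprn_gt0// divr_gt0.
exists (ball (t, x, y) (d / 2), [set n | (Num.truncn (2 * S / (d / 2) ^+ 2) < n)%N]).
 by split; [apply: nbhsx_ballx; rewrite divr_gt0|exists (Num.truncn (2 * S / (d / 2) ^+ 2)).+1].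
move=> [[[t' x'] y'] n] [/= [[/= b1 b2] b3] /= Nn] B1 s z w B2 /=; rewrite /ball /= in b1 b2 b3.
have [/= h1 h2 /andP[h3 h4]] := B1; have [/= k1 k2 /andP[k3 k4]] := B2.
have le : `|v s z w - v t' x' y'| <= 2 * S.
 by rewrite (le_trans (ler_normB _ _))// mulr_natl mulr2n lerD// HS.
have q0 := sqr_ge0 (s - t'); have q1 := sqr_ge0 (z - x'); have q2 := sqr_ge0 (w - y').
have far (u u' p : R) : `|u' - u| < d / 2 -> d < `|p - u'| -> (d / 2) ^+ 2 <= (p - u) ^+ 2.
 move=> a1 a2; rewrite -[leRHS]real_normK ?num_real// lerXn2r ?nnegrE ?divr_ge0 ?(ltW d0)//.
 by have := ler_normB (p - u) (u' - u); rewrite opprB addrA subrK; move: a1 a2; clear; lra.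
(* For distant points the quadratic term alone exceeds the oscillation 2 S, because n is large. *)
have out : (d / 2) ^+ 2 <= sqd t' x' y' s z w -> `|v s z w - v t' x' y'| <= e + n%:R * sqd t' x' y' s z w.
 move=> dq; apply: (le_trans le); rewrite ler_wpDl ?(ltW e0)//.
 apply: le_trans (ler_wpM2l (ler0n _ n) dq); rewrite -ler_pdivrMr// ltW//. by rewrite (lt_le_trans (truncnS_gt _))// ler_nat.
have [s1|s1] := leP `|s - t| d; last by apply: out; rewrite /sqd -addrA ler_wpDr ?addr_ge0// (far _ t).
have [z1|z1] := leP `|z - x| d; last by apply: out; rewrite /sqd addrAC ler_wpDl ?addr_ge0// (far _ x).
have [w1|w1] := leP `|w - y| d; last by apply: out; rewrite /sqd ler_wpDl ?addr_ge0// (far _ y).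
rewrite ler_wpDr ?mulr_ge0 ?addr_ge0//.
have dd : d / 2 <= d by rewrite ler_pdivrMr// ler_peMr ?ler1n// ltW.
have a1 := Hd s z w (conj k1 k3) s1 z1 w1.
have := Hd t' x' y' (conj h1 h3); rewrite !(distrC _ t) !(distrC _ x) !(distrC _ y).
move=> /(_ (le_trans (ltW b1) dd) (le_trans (ltW b2) dd) (le_trans (ltW b3) dd)).
by move: a1; rewrite !ler_norml; clear; lra.
Qed.

(** The Bernstein polynomial of degree n with coefficients F, by de Casteljau's recursion, so that
    its properties are inductions without binomial coefficients. *)
Fixpoint bn (n : nat) (F : nat -> R) (s : R) : R :=
 if n is m.+1 then (1 - s) * bn m F s + s * bn m (fun i => F i.+1) s else F 0%N.

Lemma bn_le n (F G : nat -> R) (s : R) : 0 <= s <= 1 -> (forall i, (i <= n)%N -> F i <= G i) -> bn n F s <= bn n G s.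
move=> /andP[s0 s1]; elim: n F G => [|n IH] F G le /=; first exact: le.
apply: lerD; apply: ler_wpM2l; rewrite ?subr_ge0//; apply: IH => i ni; apply: le => //.
exact: leqW.
Qed.

Lemma bn_lin (n : nat) (F G : nat -> R) (k s : R) : bn n (fun i => F i + k * G i) s = bn n F s + k * bn n G s.
by elim: n F G => [//|n IH] F G /=; rewrite !IH; ring. Qed.

Lemma bn_ext n F G s : (forall i, (i <= n)%N -> F i = G i) -> bn n F s = bn n G s.
elim: n F G => [|n IH] F G e /=; first exact: e.
by congr (_ * _ + _ * _); apply: IH => i ni; apply: e => //; exact: leqW.
Qed.

Lemma bn_cst n k s : bn n (fun _ => k) s = k.
by elim: n => [//|n IH] /=; rewrite !IH; ring. Qed.

(** The second moment about c of a binomial variable with parameters n and s. *)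
Lemma bn_sq (n : nat) (c s : R) : bn n (fun i => (i%:R - c) ^+ 2) s = (n%:R * s - c) ^+ 2 + n%:R * s * (1 - s).
elim: n c => [|n IH] c /=; first by ring.
rewrite IH (@bn_ext _ _ (fun i => (i%:R - (c - 1)) ^+ 2)); last by move=> i _; rewrite -natr1; ring.
by rewrite IH -natr1; ring.
Qed.

Lemma bn_der I n F s : has_der I (bn n.+1 F) s (n.+1%:R * bn n (fun i => F i.+1 - F i) s).
apply: (@has_der_subset _ setT) => //; apply/is_deriveP.
have diff m (G : nat -> R) z : bn m (fun i => G i.+1 - G i) z = bn m (fun i => G i.+1) z - bn m G z.
 rewrite -mulN1r -bn_lin; apply: bn_ext => i _; by rewrite mulN1r.
have lin (f : R -> R) (z a : R) : is_derive z (1 : R) f a -> is_derive z (1 : R) (fun z => (1 - z) * f z) (- f z + (1 - z) * a).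
 move=> hf; have h1 := is_deriveB (is_derive_cst (1 : R) z (1 : R)) (is_derive_id z (1 : R)).
 by apply: (is_derive_eq (is_deriveM h1 hf)); rewrite /GRing.scale /= ?fctE; ring.
have lin' (f : R -> R) (z a : R) : is_derive z (1 : R) f a -> is_derive z (1 : R) (fun z => z * f z) (f z + z * a).
 move=> hf; have h1 := is_derive_id z (1 : R). by apply: (is_derive_eq (is_deriveM h1 hf)); rewrite /GRing.scale /= ?fctE; ring.
have D0 (z k : R) : is_derive z (1 : R) (fun _ : R => k) 0 by exact: is_derive_cst.
elim: n F => [|n IH] F.
 apply: (is_derive_eq (is_deriveD (lin _ _ _ (D0 s (F 0%N))) (lin' _ _ _ (D0 s (F 1%N))))). by rewrite /=; ring.
have h := is_deriveD (lin _ _ _ (IH F)) (lin' _ _ _ (IH (fun i => F i.+1))).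
apply: (is_derive_eq h).
rewrite (diff n.+1 F) [RHS]/= (diff n F) (diff n (fun i => F i.+1)).
rewrite [bn n.+1 _ _]/= [bn n.+1 _ _]/= -(natr1 n.+1).
by move: (bn n _ _) (bn n _ _) (bn n _ _) => a b c; ring.
Qed.

Lemma bn_param_der I n F F' s x : (forall i, (i <= n)%N -> has_der I (F i) x (F' i)) ->
 has_der I (fun z => bn n (fun i => F i z) s) x (bn n F' s).
elim: n F F' => [|n IH] F F' h /=; first exact: h.
by apply: has_derD; apply: has_derZ; apply: IH => i ni; apply: h => //; exact: leqW.
Qed.

Lemma bnZ (n : nat) (F : nat -> R) (k s : R) : bn n (fun i => k * F i) s = k * bn n F s.
rewrite -[RHS]add0r -{1}(bn_cst n 0 s) -bn_lin; apply: bn_ext => i _; by rewrite add0r.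
Qed.

Lemma bnB n (F G : nat -> R) s : bn n (fun i => F i - G i) s = bn n F s - bn n G s.
by rewrite -mulN1r -bn_lin; apply: bn_ext => i _; rewrite mulN1r. Qed.

(** The quadratic error is averaged to c times the variance s (1 - s) / n. *)
Lemma bn_close (n : nat) (G : nat -> R) (K e c s : R) : (0 < n)%N -> 0 <= s <= 1 ->
 0 <= c -> (forall i, (i <= n)%N -> `|G i - K| <= e + c * (i%:R / n%:R - s) ^+ 2) -> `|bn n G s - K| <= e + c / n%:R.
move=> n0 s01 c0 H; have n0' : (0 : R) < n%:R by rewrite ltr0n.
have M : bn n (fun i => e + c * (i%:R / n%:R - s) ^+ 2) s <= e + c / n%:R.
 rewrite (bn_lin n (fun _ => e) (fun i => (i%:R / n%:R - s) ^+ 2)) bn_cst lerD2l ler_wpM2l//.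
 have -> : bn n (fun i => (i%:R / n%:R - s) ^+ 2) s = 0 + n%:R^-2 * bn n (fun i => (i%:R - n%:R * s) ^+ 2) s.
  rewrite -(bn_cst n 0 s) -bn_lin; apply: bn_ext => i _; field. by rewrite gt_eqF.
 rewrite bn_sq subrr expr0n !add0r. have -> : n%:R^-2 * (n%:R * s * (1 - s)) = n%:R^-1 * (s * (1 - s)).
  by field; rewrite gt_eqF.
 case/andP: s01 => s0 s1. rewrite ler_piMr ?invr_ge0 ?(ltW n0')//. rewrite mulr_ile1 ?subr_ge0//; move: s0 s1; clear; lra.
have E : bn n (fun i => G i - K) s = bn n G s - K.
 by rewrite bnB bn_cst.
rewrite -E ler_norml; apply/andP; split; last first.
 apply: le_trans M; apply: bn_le => // i ni; exact: (le_trans (ler_norm _) (H i ni)).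
rewrite lerNl; apply: le_trans M.
rewrite -[leLHS]mulN1r -[leLHS]add0r -(bn_cst n 0 s) -bn_lin; apply: bn_le => // i ni.
by rewrite add0r mulN1r; apply: le_trans (H i ni); rewrite -normrN ler_norm.
Qed.

Definition BB n1 n2 n3 G t x y : R := bn n1 (fun i => bn n2 (fun j => bn n3 (G i j) y) x) t.

Lemma BB_close (n1 n2 n3 : nat) (G : nat -> nat -> nat -> R) (K e c t x y : R) :
 (0 < n1)%N -> (0 < n2)%N -> (0 < n3)%N -> 0 <= t <= 1 -> 0 <= x <= 1 -> 0 <= y <= 1 -> 0 <= c ->
 (forall i j k, (i <= n1)%N -> (j <= n2)%N -> (k <= n3)%N ->
  `|G i j k - K| <= e + c * ((i%:R / n1%:R - t) ^+ 2 + (j%:R / n2%:R - x) ^+ 2 + (k%:R / n3%:R - y) ^+ 2)) ->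
 `|BB n1 n2 n3 G t x y - K| <= e + c / n3%:R + c / n2%:R + c / n1%:R.
move=> n10 n20 n30 t01 x01 y01 c0 H; apply: bn_close => // i ni.
have := @bn_close n2 (fun j => bn n3 (G i j) y) K (e + c / n3%:R + c * (i%:R / n1%:R - t) ^+ 2) c x n20 x01 c0.
have -> : e + c / n3%:R + c * (i%:R / n1%:R - t) ^+ 2 + c / n2%:R
 = e + c / n3%:R + c / n2%:R + c * (i%:R / n1%:R - t) ^+ 2 by ring.
apply => j nj.
have := @bn_close n3 (G i j) K (e + c * (i%:R / n1%:R - t) ^+ 2 + c * (j%:R / n2%:R - x) ^+ 2) c y n30 y01 c0.
have -> : e + c * (i%:R / n1%:R - t) ^+ 2 + c * (j%:R / n2%:R - x) ^+ 2 + c / n3%:R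
 = e + c / n3%:R + c * (i%:R / n1%:R - t) ^+ 2 + c * (j%:R / n2%:R - x) ^+ 2 by ring.
apply => k nk; apply: (le_trans (H i j k ni nj nk)); apply: eq_leW; ring.
Qed.

Lemma has_der_affine (f : R -> R) (al be x a : R) :
 has_der setT f (al * x + be) a -> has_der setT (fun z => f (al * z + be)) x (al * a).
move=> /is_deriveP hf; apply/is_deriveP.
have h : is_derive x (1 : R) (fun z => al * z + be) al.
 have h := is_deriveD (is_deriveM (is_derive_cst al x (1 : R)) (is_derive_id x (1 : R))) (is_derive_cst be x (1 : R)).
 by apply: (is_derive_eq h); rewrite /GRing.scale /= ?fctE; ring.
have -> : (fun z => f (al * z + be)) = f \o (fun z => al * z + be) by [].
by apply: (is_derive_eq (is_derive1_comp (g := fun z => al * z + be) hf h)); rewrite mulrC.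
Qed.

Lemma has_der_unique f x a b : has_der setT f x a -> has_der setT f x b -> a = b.
move=> /is_deriveP ha /is_deriveP hb.
by rewrite -(@derive_val _ _ _ _ _ _ _ ha) -(@derive_val _ _ _ _ _ _ _ hb).
Qed.

Section grid.
Variables (M : R).

(** The affine maps of [- M, M] and of [0, M] onto [0, 1], in the form that [has_der_affine]
    expects. *)
Definition sx (x : R) : R := (2 * M)^-1 * x + 2^-1.
Definition sy (y : R) : R := M^-1 * y + 0.

Lemma BBx (n1 m n3 : nat) (G : nat -> nat -> nat -> R) (t x y : R) : has_der setT (fun z => BB n1 m.+1 n3 G t (sx z) y) x
  (BB n1 m n3 (fun i j k => m.+1%:R / (2 * M) * (G i j.+1 k - G i j k)) t (sx x) y).
apply: bn_param_der => i _.
have := has_der_affine (al := (2 * M)^-1) (be := 2^-1) (bn_der setT m (fun j => bn n3 (G i j) y) (sx x)).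
apply: has_der_ext => [//|].
rewrite mulrCA mulrA -bnZ; apply: bn_ext => j _.
by rewrite -bnB -bnZ.
Qed.

Lemma BBy (n1 n2 m : nat) (G : nat -> nat -> nat -> R) (t x y : R) : has_der setT (fun z => BB n1 n2 m.+1 G t x (sy z)) y
  (BB n1 n2 m (fun i j k => m.+1%:R / M * (G i j k.+1 - G i j k)) t x (sy y)).
apply: bn_param_der => i _; apply: bn_param_der => j _.
have := has_der_affine (al := M^-1) (be := 0) (bn_der setT m (G i j) (sy y)).
apply: has_der_ext => [//|].
by rewrite mulrCA mulrA -bnZ.
Qed.

End grid.

(** The coefficients need only be close to values of psi at points near the nodes. This covers the
    derivatives of Bernstein polynomials, whose coefficients are divided differences and hence
    derivatives at intermediate points. *)
Lemma grid_close (T M : R) (psi : fun3) (e c d gam : R) (n1 m2 m3 : nat) (H : nat -> nat -> nat -> R) (t x y : R) :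
 0 < T -> 0 < M -> 0 <= c -> (0 < n1)%N -> (0 < m2)%N -> (0 < m3)%N ->
 (forall t x y s z w, box T M (t, x, y) -> box T M (s, z, w) -> `|psi s z w - psi t x y| <= e + c * sqd t x y s z w) ->
 box T M (t, x, y) -> (forall i j k, (i <= n1)%N -> (j <= m2)%N -> (k <= m3)%N -> exists x' y',
   [/\ box T M (T * (i%:R / n1%:R), x', y'), `|x' - M * (2 * (j%:R / m2%:R) - 1)| <= d, `|y' - M * (k%:R / m3%:R)| <= d &
     `|H i j k - psi (T * (i%:R / n1%:R)) x' y'| <= gam]) ->
 `|BB n1 m2 m3 H (t / T) (sx M x) (sy M y) - psi t x y| <=
 gam + e + c * (4 * d ^+ 2) + c * (T ^+ 2 + 8 * M ^+ 2) * (m3%:R^-1 + m2%:R^-1 + n1%:R^-1).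
move=> T0 M0 c0 n10 m20 m30 mod B Hg; have [/= /andP[t0 tT] xM /andP[y0 yM]] := B.
have C0 : 0 <= c * (T ^+ 2 + 8 * M ^+ 2).
 by rewrite mulr_ge0// addr_ge0 ?sqr_ge0// mulr_ge0 ?sqr_ge0.
have sx01 : 0 <= sx M x <= 1.
 move: xM; rewrite ler_norml => /andP[x1 x2]. have -> : sx M x = (x + M) / (2 * M) by rewrite /sx; field; rewrite gt_eqF.
 have M2 : 0 < 2 * M by rewrite mulr_gt0. apply/andP; split; first by rewrite divr_ge0 ?(ltW M2)//; move: x1; clear; lra.
 by rewrite ler_pdivrMr// mul1r; move: x2; clear; lra.
have sy01 : 0 <= sy M y <= 1.
 rewrite /sy addr0 mulrC; apply/andP; split; first by rewrite divr_ge0// ltW. by rewrite ler_pdivrMr// mul1r.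
have t01 : 0 <= t / T <= 1.
 by rewrite divr_ge0 ?(ltW T0)//= ler_pdivrMr// mul1r.
have := @BB_close n1 m2 m3 H (psi t x y) (gam + e + c * (4 * d ^+ 2)) _ (t / T) (sx M x) (sy M y) n10 m20 m30 t01 sx01 sy01 C0.
set W := c * (T ^+ 2 + _).
have -> : gam + e + c * (4 * d ^+ 2) + W * (m3%:R^-1 + m2%:R^-1 + n1%:R^-1)
 = gam + e + c * (4 * d ^+ 2) + W / m3%:R + W / m2%:R + W / n1%:R by ring.
apply => i j k ni nj nk; rewrite {}/W.
have [x' [y' [B' hx hy hH]]] := Hg i j k ni nj nk.
have -> : H i j k - psi t x y = (H i j k - psi (T * (i%:R / n1%:R)) x' y')
 + (psi (T * (i%:R / n1%:R)) x' y' - psi t x y) by ring.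
apply: (le_trans (ler_normD _ _)).
rewrite -!addrA lerD//; apply: (le_trans (mod _ _ _ _ _ _ B B')).
rewrite lerD2l -[c * _ * _]mulrA -mulrDr ler_wpM2l//.
have sq (u v : R) : (u + v) ^+ 2 <= 2 * u ^+ 2 + 2 * v ^+ 2 by have := sqr_ge0 (u - v); nra.
have dd (u : R) : `|u| <= d -> u ^+ 2 <= d ^+ 2.
 move=> ud; rewrite -[X in X <= _]real_normK ?num_real// lerXn2r ?nnegrE//. exact: le_trans ud.
set I1 := i%:R / n1%:R; set J1 := j%:R / m2%:R; set K1 := k%:R / m3%:R.
rewrite -/I1 -/J1 -/K1 in hx hy.
have Et' : T * I1 - t = T * (I1 - t / T) by field; rewrite gt_eqF.
have Ex' : x' - x = (x' - M * (2 * J1 - 1)) + 2 * M * (J1 - sx M x).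
 by rewrite /sx; field; rewrite gt_eqF.
have Ey' : y' - y = (y' - M * K1) + M * (K1 - sy M y).
 by rewrite /sy; field; rewrite gt_eqF.
rewrite /sqd Et' Ex' Ey'.
have a1 := sq (x' - M * (2 * J1 - 1)) (2 * M * (J1 - sx M x)).
have a2 := sq (y' - M * K1) (M * (K1 - sy M y)).
have b1 := dd _ hx; have b2 := dd _ hy.
have pos1 := mulr_ge0 (sqr_ge0 T) (sqr_ge0 (J1 - sx M x)).
have pos2 := mulr_ge0 (sqr_ge0 T) (sqr_ge0 (K1 - sy M y)).
have pos3 := mulr_ge0 (sqr_ge0 M) (sqr_ge0 (I1 - t / T)).
have pos4 := mulr_ge0 (sqr_ge0 M) (sqr_ge0 (K1 - sy M y)).
have pos5 := mulr_ge0 (sqr_ge0 M) (sqr_ge0 (J1 - sx M x)).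
move: a1 a2 b1 b2 pos1 pos2 pos3 pos4 pos5; rewrite !exprMn.
move: ((x' - M * (2 * J1 - 1) + 2 * M * (J1 - sx M x)) ^+ 2) ((y' - M * K1 + M * (K1 - sy M y)) ^+ 2)
 ((x' - M * (2 * J1 - 1)) ^+ 2) ((y' - M * K1) ^+ 2) ((J1 - sx M x) ^+ 2) ((K1 - sy M y) ^+ 2)
 ((I1 - t / T) ^+ 2) => q1 q2 q3 q4 q5 q6 q7.
move: (T ^+ 2) (M ^+ 2) (d ^+ 2) => T2 M2 d2; lra.
Qed.

Fixpoint bnE (n : nat) (a : expr) (F : nat -> expr) : expr := if n is m.+1 then
  Add (Mul (Add (Cst 1) (Mul (Cst (-1)) a)) (bnE m a F)) (Mul a (bnE m a (fun i => F i.+1)))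
 else F 0%N.

Lemma ev_bnE n a F t x y : ev (bnE n a F) t x y = bn n (fun i => ev (F i) t x y) (ev a t x y).
by elim: n F => [//|n IH] F /=; rewrite !IH mulN1r. Qed.

Lemma poly_bnE n a F : is_poly a -> (forall i, is_poly (F i)) -> is_poly (bnE n a F).
move=> pa; elim: n F => [F pF|n IH F pF]; first exact: pF.
exact: (conj (conj (conj I (conj I pa)) (IH _ pF)) (conj pa (IH _ (fun i => pF i.+1)))). Qed.

(* A function with the derivatives that the a priori estimates involve. *)
Definition data4 T v v1 v2 v3 := [/\ continuous3_on (closed_slab T) v /\ continuous3_on (closed_slab T) v1,
   continuous3_on (closed_slab T) v2 /\ continuous3_on (closed_slab T) v3,
   (forall t x y, 0 <= t <= T -> 0 <= y -> has_der setT (fun z => v t z y) x (v1 t x y)),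
   (forall t x y, 0 <= t <= T -> 0 <= y -> has_der setT (fun z => v1 t z y) x (v2 t x y)) &
   (forall t x y, 0 <= t <= T -> 0 <= y -> has_der `[0, +oo[ (v t x) y (v3 t x y))].

Definition dist4 (P : expr) (v v1 v2 v3 : fun3) (t x y B : R) :=
 [/\ `|ev P t x y - v t x y| <= B, `|ev (Ex P) t x y - v1 t x y| <= B,
   `|ev (Ex (Ex P)) t x y - v2 t x y| <= B & `|ev (Ey P) t x y - v3 t x y| <= B].

Lemma second_difference (f f1 f2 : R -> R) (a del : R) : 0 < del ->
 (forall w, has_der setT f w (f1 w)) -> (forall w, has_der setT f1 w (f2 w)) -> exists2 c, a <= c <= a + del + del &
  f (a + del + del) - f (a + del) - (f (a + del) - f a) = del ^+ 2 * f2 c.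
move=> d0 h1 h2.
have hz w : has_der setT (fun z => f (1 * z + del) + -1 * f z) w (1 * f1 (1 * w + del) + -1 * f1 w).
 by apply: has_derD; [apply: has_der_affine; exact: h1 | apply: has_derZ; exact: h1].
have ad : a < a + del by rewrite ltrDl.
have [c /andP[c1 c2] E1] := mvt_on ad (fun w _ => conj I (hz w)).
have cd : c < c + del by rewrite ltrDl.
have [c' /andP[c3 c4] E2] := mvt_on cd (fun w _ => conj I (h2 w)).
exists c'; first by rewrite (le_trans c1 c3)/= (le_trans c4)// lerD2r.
have s1 : c + del - c = del by ring.
have s2 : a + del - a = del by ring.
move: E1; rewrite !mul1r !mulN1r E2 s1 s2 => E1.
by transitivity (f2 c' * del * del); [rewrite -E1; ring | ring].
Qed.

(** After p differentiations a Bernstein polynomial of degree m + p has degree m; its node j / m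
    lies between the original nodes of indices j and j + p, which enter its coefficient. *)
Lemma frac_between j m p : (0 < m)%N -> (j <= m)%N -> (j%:R / (m + p)%:R : R) <= j%:R / m%:R <= ((j + p)%:R / (m + p)%:R : R).
move=> m0 jm; have m0' : (0 : R) < m%:R by rewrite ltr0n.
have mp0 : (0 : R) < (m + p)%:R by rewrite ltr0n addn_gt0 m0.
apply/andP; split; rewrite ler_pdivrMr// mulrAC ler_pdivlMr//.
 by rewrite ler_wpM2l// ler_nat leq_addr.
rewrite -!natrM ler_nat !mulnDl !mulnDr leq_add2l mulnC leq_mul//.
Qed.

(** One Bernstein polynomial serves v and all its derivatives, each derivative being again of
    Bernstein form. The degrees n + 3 in x and n + 2 in y leave at least n + 1 after two
    x-derivatives or one y-derivative. *)
Lemma box_approx (T M eta : R) v v1 v2 v3 : 0 < T -> 0 < M -> 0 < eta -> data4 T v v1 v2 v3 -> exists2 P : expr, is_poly P &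
  forall t x y, box T M (t, x, y) -> dist4 P v v1 v2 v3 t x y eta.
move=> T0 M0 eta0 [[c0 c1] [c2 c3] d1 d2 d3].
have e0 : 0 < eta / 4 by rewrite divr_gt0.
have T0' := ltW T0; have M0' := ltW M0.
have [k0 k00 m0] := unif_modulus T0' M0' c0 e0.
have [k1 k10 m1] := unif_modulus T0' M0' c1 e0.
have [k2 k20 m2] := unif_modulus T0' M0' c2 e0.
have [k3 k30 m3] := unif_modulus T0' M0' c3 e0.
pose c := k0 + k1 + k2 + k3.
have cc0 : 0 <= c by rewrite /c !addr_ge0.
have widen (psi : fun3) k : k <= c -> (forall t x y s z w, box T M (t, x, y) ->
  box T M (s, z, w) -> `|psi s z w - psi t x y| <= eta / 4 + k * sqd t x y s z w) ->
 forall t x y s z w, box T M (t, x, y) -> box T M (s, z, w) -> `|psi s z w - psi t x y| <= eta / 4 + c * sqd t x y s z w.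
 move=> kc h t x y s z w B1 B2; apply: (le_trans (h _ _ _ _ _ _ B1 B2)). by rewrite lerD2l ler_wpM2r// /sqd !addr_ge0// sqr_ge0.
have {}m0 := widen v k0 ltac:(by rewrite /c -!addrA lerDl !addr_ge0) m0.
have {}m1 := widen v1 k1 ltac:(by rewrite /c -!addrA addrCA lerDl !addr_ge0) m1.
have {}m2 := widen v2 k2 ltac:(by rewrite /c addrAC lerDr !addr_ge0) m2.
have {}m3 := widen v3 k3 ltac:(by rewrite /c lerDr !addr_ge0) m3.
have [S S0 HS] := box_bounded T0' M0' c2.
(* Z / N bounds the errors that vanish with the mesh: the mismatch of the second difference, the
   displacement from the nodes, and the variances. *)
pose Z := S + c * (4 * (6 * M) ^+ 2) + 3 * (c * (T ^+ 2 + 8 * M ^+ 2)).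
have Z0 : 0 <= Z.
 apply: addr_ge0; first by apply: addr_ge0; [exact: ltW | rewrite !mulr_ge0// sqr_ge0].
 by apply: mulr_ge0 => //; apply: mulr_ge0 => //; rewrite addr_ge0 ?sqr_ge0// mulr_ge0// sqr_ge0.
pose n := Num.truncn (Z / (eta / 4)).
pose N : R := n.+1%:R.
have N0 : 0 < N by rewrite ltr0n.
have N1 : 1 <= N by rewrite /N ler1n.
have ZN : Z / N <= eta / 4.
 by rewrite ler_pdivrMr// mulrC -ler_pdivrMr// ltW// truncnS_gt.
have inv m : (n.+1 <= m)%N -> (m%:R : R)^-1 <= N^-1.
 move=> nm; rewrite lef_pV2 ?posrE ?ltr0n ?ler_nat//; exact: leq_trans nm.
pose d := 6 * M / N.
have d0 : 0 < d by rewrite divr_gt0// mulr_gt0.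
have fin m2' m3' gam : (n.+1 <= m2')%N -> (n.+1 <= m3')%N -> gam <= S / N ->
  gam + eta / 4 + c * (4 * d ^+ 2) + c * (T ^+ 2 + 8 * M ^+ 2) * (m3'%:R^-1 + m2'%:R^-1 + (n.+1)%:R^-1) <= eta.
 move=> h2 h3 hg. have C0 : 0 <= c * (T ^+ 2 + 8 * M ^+ 2).
  by rewrite mulr_ge0// addr_ge0 ?sqr_ge0// mulr_ge0 ?sqr_ge0.
 have b1 : c * (4 * d ^+ 2) <= c * (4 * (6 * M) ^+ 2) / N.
  have -> : c * (4 * d ^+ 2) = c * (4 * (6 * M) ^+ 2) / N / N.
   by rewrite /d; field; rewrite gt_eqF.
  rewrite ler_pdivrMr// ler_peMr// divr_ge0 ?(ltW N0)//. by rewrite mulr_ge0// mulr_ge0// sqr_ge0.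
 have b2 : c * (T ^+ 2 + 8 * M ^+ 2) * (m3'%:R^-1 + m2'%:R^-1 + (n.+1)%:R^-1) <= c * (T ^+ 2 + 8 * M ^+ 2) * (3 / N).
  rewrite ler_wpM2l//; have := inv _ h2; have := inv _ h3; rewrite -/N. by move: (m2'%:R^-1) (m3'%:R^-1) (N^-1) => ? ? ?; lra.
 have : Z / N = S / N + c * (4 * (6 * M) ^+ 2) / N + c * (T ^+ 2 + 8 * M ^+ 2) * (3 / N).
  by rewrite /Z; ring.
 move: hg b1 b2 ZN e0; move: (Z / N) (S / N) (c * (4 * d ^+ 2)) (_ / N) (c * _ * _) (c * _ * _). clear; move=> ? ? ? ? ? ?; lra.
pose tg i : R := T * (i%:R / (n.+1)%:R).
pose xg j : R := M * (2 * (j%:R / (n.+3)%:R) - 1).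
pose yg k : R := M * (k%:R / (n.+2)%:R).
pose G i j k := v (tg i) (xg j) (yg k).
pose P := bnE n.+1 (Mul (Cst T^-1) Vt) (fun i => bnE n.+3 (Add (Mul (Cst (2 * M)^-1) Vx) (Cst 2^-1))
 (fun j => bnE n.+2 (Add (Mul (Cst M^-1) Vy) (Cst 0)) (fun k => Cst (G i j k)))).
have pP : is_poly P.
 by apply: poly_bnE => // i; apply: poly_bnE => // j; apply: poly_bnE.
have PE t x y : ev P t x y = BB n.+1 n.+3 n.+2 G (t / T) (sx M x) (sy M y).
 rewrite /P ev_bnE -[ev _ t x y]/(T^-1 * t) [T^-1 * t]mulrC; apply: bn_ext => i _.
 by rewrite ev_bnE; apply: bn_ext => j _; rewrite ev_bnE.
pose G1 i j k := (n.+3)%:R / (2 * M) * (G i j.+1 k - G i j k).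
have PxE t x y : ev (Ex P) t x y = BB n.+1 n.+2 n.+2 G1 (t / T) (sx M x) (sy M y).
 apply: (has_der_unique (ev_has_derx setT P t x y)).
 by apply: has_der_ext (BBx M n.+1 n.+2 n.+2 G (t / T) x (sy M y)) => // z; rewrite PE.
pose G2 i j k := (n.+2)%:R / (2 * M) * (G1 i j.+1 k - G1 i j k).
have PxxE t x y : ev (Ex (Ex P)) t x y = BB n.+1 n.+1 n.+2 G2 (t / T) (sx M x) (sy M y).
 apply: (has_der_unique (ev_has_derx setT (Ex P) t x y)).
 by apply: has_der_ext (BBx M n.+1 n.+1 n.+2 G1 (t / T) x (sy M y)) => // z; rewrite PxE.
pose G3 i j k := (n.+2)%:R / M * (G i j k.+1 - G i j k).
have PyE t x y : ev (Ey P) t x y = BB n.+1 n.+3 n.+1 G3 (t / T) (sx M x) (sy M y).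
 apply: (has_der_unique (ev_has_dery setT P t x y)).
 by apply: has_der_ext (BBy M n.+1 n.+3 n.+1 G (t / T) (sx M x) y) => // z; rewrite PE.
have p1 : (n.+1)%:R = N by [].
have p2 : (n.+2)%:R = N + 1 :> R by rewrite -natr1.
have p3 : (n.+3)%:R = N + 2 :> R by rewrite /N -!natr1; ring.
have n1 : (0 : R) < (n.+1)%:R by rewrite ltr0n.
have n2 : (0 : R) < (n.+2)%:R by rewrite ltr0n.
have n3 : (0 : R) < (n.+3)%:R by rewrite ltr0n.
have frac i m : (i <= m)%N -> (0 < m)%N -> 0 <= (i%:R / m%:R : R) <= 1.
 by move=> im m0'; rewrite divr_ge0//= ler_pdivrMr ?ltr0n// mul1r ler_nat.
have tgB i : (i <= n.+1)%N -> 0 <= tg i <= T.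
 move=> ni; have /andP[f0 f1] := frac i n.+1 ni isT. by rewrite /tg mulr_ge0//= ler_piMr.
have ygB i : (i <= n.+2)%N -> 0 <= yg i <= M.
 move=> ni; have /andP[f0 f1] := frac i n.+2 ni isT. by rewrite /yg mulr_ge0//= ler_piMr.
have xgB i : (i <= n.+3)%N -> - M <= xg i <= M.
 move=> ni; have /andP[f0 f1] := frac i n.+3 ni isT; rewrite /xg.
 have h0 := mulr_ge0 M0' f0; have h1 : M * (i%:R / (n.+3)%:R) <= M by rewrite ler_piMr.
 by rewrite mulrBr mulrCA mulr1; apply/andP; split; move: h0 h1; move: (M * _) => q; clear -q; lra.
have xgS j : xg j.+1 - xg j = 2 * M / (n.+3)%:R.
 by rewrite /xg -natr1; field; rewrite gt_eqF.
have ygS j : yg j.+1 - yg j = M / (n.+2)%:R.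
 by rewrite /yg -natr1; field; rewrite gt_eqF.
have dx0 : 0 < 2 * M / (n.+3)%:R by rewrite divr_gt0// mulr_gt0.
have dy0 : 0 < M / (n.+2)%:R by rewrite divr_gt0.
have smallx : 2 * (2 * M / (n.+3)%:R) <= d.
 have h1 : 2 * M / (n.+3)%:R <= 2 * M / N by apply: ler_wpM2l; [exact: mulr_ge0 | exact: (inv _ (leqW (leqnSn _)))].
 apply: (le_trans (ler_wpM2l _ h1)) => //; rewrite /d !mulrA ler_wpM2r ?invr_ge0 ?(ltW N0)//.
 by rewrite ler_wpM2r// -natrM ler_nat.
have smally : M / (n.+2)%:R <= d.
 rewrite /d; apply: le_trans (_ : M / N <= _); first by rewrite ler_wpM2l// inv.
 by rewrite ler_wpM2r ?invr_ge0 ?(ltW N0)// ler_peMl// ler1n.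
have boxI t' x' y' : 0 <= t' <= T -> `|x'| <= M -> 0 <= y' <= M -> box T M (t', x', y') by split.
have L1 : (n.+1 <= n.+1)%N by exact: leqnn.
have L2 : (n.+1 <= n.+2)%N by exact: leqnSn.
have L3 : (n.+1 <= n.+3)%N by exact: leqW L2.
have hg0 : 0 <= S / N by rewrite divr_ge0// ltW.
have hgS : S / (n.+3)%:R <= S / N by rewrite ler_wpM2l ?inv// ltW.
exists P => // t x y B; split.
- rewrite PE; apply: le_trans (grid_close (gam := 0) (d := d) T0 M0 cc0 _ _ _ m0 B _) _ => //; last first.
  exact: (fin _ _ _ L3 L2 hg0).
 move=> i j k ni nj nk; exists (xg j), (yg k); split.
 + by apply: boxI; [exact: tgB | rewrite ler_norml; exact: xgB | exact: ygB].
 + by rewrite /xg subrr normr0 ltW.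
 + by rewrite /yg subrr normr0 ltW.
 + by rewrite /G /tg subrr normr0.
- rewrite PxE; apply: le_trans (grid_close (gam := 0) (d := d) T0 M0 cc0 _ _ _ m1 B _) _ => //; last first.
  exact: (fin _ _ _ L2 L2 hg0).
 move=> i j k ni nj nk. have jlt : xg j < xg j.+1 by rewrite -subr_gt0 xgS.
 have [xi xiB E] := @mvt_on setT (fun z => v (tg i) z (yg k)) (fun z => v1 (tg i) z (yg k)) _ _ jlt
  (fun w _ => conj I (d1 (tg i) w (yg k) (tgB i ni) (proj1 (andP (ygB k nk))))).
 have /andP[xi1 xi2] := xiB. have xiM : `|xi| <= M.
  rewrite ler_norml; case/andP: (xgB j (leqW nj)) => a1 _; case/andP: (xgB j.+1 nj) => _ a2.
  by rewrite (le_trans a1)// (le_trans xi2).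
 exists xi, (yg k); split.
 + by apply: boxI; [exact: tgB | | exact: ygB].
 + have /andP[f1 f2] := @frac_between j n.+2 1 isT nj; rewrite !addn1 in f1 f2.
  have g1 : xg j <= M * (2 * (j%:R / n.+2%:R) - 1) by rewrite ler_wpM2l// lerD2r ler_wpM2l.
  have g2 : M * (2 * (j%:R / n.+2%:R) - 1) <= xg j.+1 by rewrite ler_wpM2l// lerD2r ler_wpM2l.
  rewrite ler_norml; move: (xgS j) smallx dx0 xi1 xi2 g1 g2; clear.
  move: (2 * M / _) (xg j) (xg j.+1) (M * _) => ? ? ? ?; move=> *; apply/andP; split; lra.
 + by rewrite /yg subrr normr0 ltW.
 + rewrite /G1 /G E xgS; set q := v1 _ _ _; rewrite (_ : _ - q = 0) ?normr0//.
  by field; rewrite !gt_eqF.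
- rewrite PxxE; apply: le_trans (grid_close (gam := S / (n.+3)%:R) (d := d) T0 M0 cc0 _ _ _ m2 B _) _ => //; last first.
  exact: (fin _ _ _ L1 L2 hgS).
 move=> i j k ni nj nk. have yk := proj1 (andP (ygB k nk)).
 have [xi /andP[xi1 xi2] E] := @second_difference (fun z => v (tg i) z (yg k))
  (fun z => v1 (tg i) z (yg k)) (fun z => v2 (tg i) z (yg k)) (xg j) _ dx0
  (fun w => d1 (tg i) w (yg k) (tgB i ni) yk) (fun w => d2 (tg i) w (yg k) (tgB i ni) yk).
 have e1 : xg j + 2 * M / (n.+3)%:R = xg j.+1 by rewrite -(xgS j) addrC subrK.
 have e2 : xg j.+1 + 2 * M / (n.+3)%:R = xg j.+2 by rewrite -(xgS j.+1) addrC subrK. rewrite e1 e2 in E xi2.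
 have xiM : `|xi| <= M.
  rewrite ler_norml; case/andP: (xgB j (leq_trans nj (leqW (leqW (leqnn _))))) => a1 _. case/andP: (xgB j.+2 nj) => _ a2.
  by rewrite (le_trans a1)// (le_trans xi2).
 have Bx : box T M (tg i, xi, yg k) by apply: boxI; [exact: tgB | | exact: ygB]. exists xi, (yg k); split => //.
 + have /andP[f1 f2] := @frac_between j n.+1 2 isT nj; rewrite !addn2 in f1 f2.
  have g1 : xg j <= M * (2 * (j%:R / n.+1%:R) - 1) by rewrite ler_wpM2l// lerD2r ler_wpM2l.
  have g2 : M * (2 * (j%:R / n.+1%:R) - 1) <= xg j.+2 by rewrite ler_wpM2l// lerD2r ler_wpM2l.
  rewrite ler_norml; move: (xgS j) (xgS j.+1) smallx dx0 xi1 xi2 g1 g2; clear.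
  move: (2 * M / _) (xg j) (xg j.+1) (xg j.+2) (M * _) => ? ? ? ? ?; move=> *; apply/andP; split; lra.
 + by rewrite /yg subrr normr0 ltW.
 + have -> : G2 i j k = (n.+2)%:R / (2 * M) * ((n.+3)%:R / (2 * M)) * (v (tg i) (xg j.+2) (yg k) - v (tg i) (xg j.+1) (yg k)
     - (v (tg i) (xg j.+1) (yg k) - v (tg i) (xg j) (yg k))).
   by rewrite /G2 /G1 /G; ring.
  (* The degrees n + 3 and n + 2 of the two differentiations leave a factor (n + 2) / (n + 3) in
     place of 1, an error of |v2| / (n + 3). *)
  rewrite E; have := HS _ _ _ Bx; rewrite -/(tg i); set q := v2 _ _ _ => hq. rewrite (_ : _ - q = - (q / (n.+3)%:R)).
   by rewrite normrN normrM (gtr0_norm (x := _^-1)) ?invr_gt0// ler_wpM2r// invr_ge0 ltW.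
  rewrite p3 p2; field. by rewrite !lt0r_neq0// addr_gt0.
- rewrite PyE; apply: le_trans (grid_close (gam := 0) (d := d) T0 M0 cc0 _ _ _ m3 B _) _ => //; last first.
  exact: (fin _ _ _ L3 L1 hg0).
 move=> i j k ni nj nk. have klt : yg k < yg k.+1 by rewrite -subr_gt0 ygS. have yk0 := proj1 (andP (ygB k (leqW nk))).
 have HH w : yg k <= w <= yg k.+1 -> `[0, +oo[%classic w /\ has_der `[0, +oo[ (v (tg i) (xg j)) w (v3 (tg i) (xg j) w).
  move=> /andP[w1 w2]; have w0 := le_trans yk0 w1. by split; [rewrite /= in_itv/= andbT | apply: d3 => //; exact: tgB].
 have [xi /andP[xi1 xi2] E] := mvt_on klt HH. have xiM : 0 <= xi <= M.
  by rewrite (le_trans yk0)//= (le_trans xi2)//; case/andP: (ygB k.+1 nk).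
 exists (xg j), xi; split.
 + by apply: boxI; [exact: tgB | rewrite ler_norml; exact: xgB |].
 + by rewrite /xg subrr normr0 ltW.
 + have /andP[f1 f2] := @frac_between k n.+1 1 isT nk; rewrite !addn1 in f1 f2.
  have g1 : yg k <= M * (k%:R / n.+1%:R) by rewrite ler_wpM2l. have g2 : M * (k%:R / n.+1%:R) <= yg k.+1 by rewrite ler_wpM2l.
  rewrite ler_norml; move: (ygS k) smally dy0 xi1 xi2 g1 g2; clear.
  move: (yg k) (yg k.+1) (M * _) (M / _) => ? ? ? ?; move=> *; apply/andP; split; lra.
 + rewrite /G3 /G E ygS; set q := v3 _ _ _; rewrite (_ : _ - q = 0) ?normr0//.
  by field; rewrite !gt_eqF.
Qed.

(** * Weighted approximation by polynomials on the half-plane *)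

Definition Minus a b : expr := Add a (Mul (Cst (-1)) b).

Lemma ev_Minus a b t x y : ev (Minus a b) t x y = ev a t x y - ev b t x y.
by rewrite /= mulN1r. Qed.

Lemma bd4_ext a b t x y B : (forall t x y, ev a t x y = ev b t x y) -> bd4 a t x y B -> bd4 b t x y B.
move=> e [h1 h2 h3 h4]; split.
- by rewrite -e.
- by rewrite -(Dv_ext _ _ _ e).
- by rewrite -(Dv_ext _ _ _ (Dv_ext _ _ _ e)).
- by rewrite -(Dv_ext _ _ _ e).
Qed.

Lemma bd4_add a b t x y A B : bd4 a t x y A -> bd4 b t x y B -> bd4 (Add a b) t x y (A + B).
by move=> [h1 h2 h3 h4] [k1 k2 k3 k4]; split => /=; apply: (le_trans (ler_normD _ _)); apply: lerD.
Qed.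

Lemma bd4_mul a b t x y A B : bd4 a t x y A -> bd4 b t x y B -> bd4 (Mul a b) t x y (4 * (A * B)).
move=> [h1 h2 h3 h4] [k1 k2 k3 k4].
have A0 : 0 <= A := le_trans (normr_ge0 _) h1.
have B0 : 0 <= B := le_trans (normr_ge0 _) k1.
have AB : 0 <= A * B by exact: mulr_ge0.
have m (u v : R) : `|u| <= A -> `|v| <= B -> `|u * v| <= A * B.
 by move=> hu hv; rewrite normrM ler_pM.
split => /=.
- by have := m _ _ h1 k1; move: AB; clear; lra.
- apply: (le_trans (ler_normD _ _)); have := m _ _ h2 k1; have := m _ _ h1 k2.
 by move: AB; clear; lra.
- apply: (le_trans (ler_normD _ _)).
 have e1 := ler_normD (ev (Ex (Ex a)) t x y * ev b t x y) (ev (Ex a) t x y * ev (Ex b) t x y).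
 have e2 := ler_normD (ev (Ex a) t x y * ev (Ex b) t x y) (ev a t x y * ev (Ex (Ex b)) t x y).
 have := m _ _ h3 k1; have := m _ _ h2 k2; have := m _ _ h1 k3. by move: e1 e2 AB; clear; lra.
- apply: (le_trans (ler_normD _ _)); have := m _ _ h4 k1; have := m _ _ h1 k4.
 by move: AB; clear; lra.
Qed.

Definition appr (T e : R) (g : expr) := forall eta : R, 0 < eta -> exists2 p, is_poly p & forall t x y, 0 <= t <= T -> 0 <= y ->
  bd4 (Minus g p) t x y (eta * wt e x y).

Lemma appr_ext T e a b : (forall t x y, ev a t x y = ev b t x y) -> appr T e a -> appr T e b.
move=> ab h eta /h[p pp H]; exists p => // t x y tT y0.
by apply: bd4_ext (H t x y tT y0) => *; rewrite !ev_Minus ab.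
Qed.

Lemma bd4_0 (t x y B : R) : 0 <= B -> bd4 (Cst 0) t x y B.
by move=> B0; split; rewrite /= normr0. Qed.

Lemma appr_poly T e p : is_poly p -> appr T e p.
move=> pp eta eta0; exists p => // t x y _ _; apply: (@bd4_ext (Cst 0)) => [*|].
 by rewrite ev_Minus subrr.
by apply: bd4_0; rewrite mulr_ge0 ?ltW// wt_gt0.
Qed.

Lemma appr_add T e a b : appr T e a -> appr T e b -> appr T e (Add a b).
move=> ha hb eta eta0; have e2 : 0 < eta / 2 by rewrite divr_gt0.
have [p pp Hp] := ha _ e2; have [q pq Hq] := hb _ e2.
exists (Add p q) => // t x y tT y0.
apply: (@bd4_ext (Add (Minus a p) (Minus b q))) => [*|]; first by rewrite /=; ring.
by rewrite [eta]splitr mulrDl; apply: bd4_add; [exact: Hp | exact: Hq].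
Qed.

(** Approximability alone is not stable under products, for the weights would multiply; a bounded
    factor preserves it. Factors are therefore applied to polynomials one after the other. *)
Definition multiplier (T e : R) (G : expr) := (exists C, forall t x y, 0 <= t <= T -> 0 <= y -> bd4 G t x y C) /\
 forall p, is_poly p -> appr T e (Mul p G).

Lemma multiplier_add T e G H : multiplier T e G -> multiplier T e H -> multiplier T e (Add G H).
move=> [[C hC] hG] [[D hD] hH]; split.
 by exists (C + D) => t x y tT y0; apply: bd4_add; [exact: hC | exact: hD].
move=> p pp; apply: (@appr_ext _ _ (Add (Mul p G) (Mul p H))) => [*|].
 by rewrite /=; ring.
by apply: appr_add; [exact: hG | exact: hH].
Qed.

Lemma multiplier_mul T e G H : multiplier T e G -> multiplier T e H -> multiplier T e (Mul G H).
move=> [[C hC] hG] [[D hD] hH]; split.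
 by exists (4 * (C * D)) => t x y tT y0; apply: bd4_mul; [exact: hC | exact: hD].
move=> p pp eta eta0.
pose D' := `|D| + 1; have D'0 : 0 < D' by rewrite ltr_wpDl.
have e1 : 0 < eta / (8 * D') by rewrite divr_gt0// mulr_gt0.
have [q pq Hq] := hG p pp _ e1.
have [q' pq' Hq'] := hH q pq (eta / 2) ltac:(by rewrite divr_gt0).
exists q' => // t x y tT y0.
apply: (@bd4_ext (Add (Mul (Minus (Mul p G) q) H) (Minus (Mul q H) q'))) => [*|].
 by rewrite /=; ring.
rewrite [eta]splitr mulrDl; apply: bd4_add; last exact: Hq'.
have HD : bd4 H t x y D'.
 by apply: bd4_le (hD t x y tT y0); rewrite (le_trans (ler_norm _))// lerDl.
apply: bd4_le (bd4_mul (Hq t x y tT y0) HD).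
by apply: eq_leW; field; rewrite gt_eqF.
Qed.

Lemma multiplier_cst T e k : multiplier T e (Cst k).
split; last by move=> p pp; apply: appr_poly.
by exists `|k| => t x y _ _; split; rewrite /= ?normr0.
Qed.

Lemma multiplier_t T e : multiplier T e Vt.
split; last by move=> p pp; apply: appr_poly.
exists T => t x y /andP[t0 tT] _; have T0 := le_trans t0 tT.
by split; rewrite /= ?normr0// ger0_norm.
Qed.

(** The Taylor polynomial at 0 of [f 0], where [f j] stands for the j-th derivative. *)
Definition tayr (f : nat -> R -> R) (n : nat) (z : R) : R := \sum_(k < n.+1) f k 0 / k`!%:R * z ^+ k.

Lemma tayr_der f n z : has_der setT (tayr f n.+1) z (tayr (fun j => f j.+1) n z).
have hpow (c : R) k : has_der setT (fun z : R => c / k.+1`!%:R * z ^+ k.+1) z (c / k`!%:R * z ^+ k).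
 apply/is_deriveP. have h : is_derive z (1 : R) (fun z : R => z ^+ k.+1) (k.+1%:R * z ^+ k).
  elim: k => [|k IH].
   have h : is_derive z (1 : R) id 1 by exact: is_derive_id.
   have -> : (fun z : R => z ^+ 1) = id by apply/funext => w; rewrite expr1. by rewrite expr0 mulr1.
  have -> : (fun z : R => z ^+ k.+2) = id * (fun z : R => z ^+ k.+1).
   by apply/funext => w; rewrite exprS.
  apply: (is_derive_eq (is_deriveM (is_derive_id z (1 : R)) IH)). by rewrite /GRing.scale /= mulr1 -natr1 !exprS; ring.
 apply: (is_derive_eq (is_deriveM (is_derive_cst (c / k.+1`!%:R) z (1 : R)) h)).
 rewrite /GRing.scale /= ?fctE mulr0 addr0 factS natrM; field. by rewrite nat1r !pnatr_eq0 -lt0n fact_gt0.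
have step m (g : nat -> R -> R) : (fun z => tayr g m z + g m.+1 0 / m.+1`!%:R * z ^+ m.+1) = tayr g m.+1.
 by apply/funext => w; rewrite /tayr [RHS]big_ord_recr.
elim: n => [|n IH].
 have -> : tayr f 1 = (fun w => f 0%N 0 + f 1%N 0 * w).
  apply/funext => w; rewrite /tayr !big_ord_recr big_ord0 /= add0r !fact0 !factS !fact0.
  by rewrite !mul1n !divr1 expr0 expr1 mulr1.
 rewrite /tayr big_ord_recr big_ord0 /= add0r fact0 divr1 expr0 mulr1.
 apply/is_deriveP; apply: (is_derive_eq (is_deriveD (is_derive_cst (f 0%N 0) z (1 : R))
  (is_deriveM (is_derive_cst (f 1%N 0) z (1 : R)) (is_derive_id z (1 : R))))).
 by rewrite /GRing.scale /= ?fctE mulr0 addr0 add0r mulr1.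
rewrite -step; apply: has_der_ext (has_derD IH (hpow (f n.+2 0) n.+1)) => //.
by rewrite -(step n (fun j => f j.+1)).
Qed.

Lemma tayr0 f n : tayr f n 0 = f 0%N 0.
rewrite /tayr big_ord_recl big1 ?addr0 => [|i _]; first by rewrite fact0 divr1 expr0 mulr1.
by rewrite lift0 expr0n /= mulr0.
Qed.

(** The derivative of the remainder of order n + 1 is the remainder of order n of the next function,
    and integrating e^(2 z) gains a factor 1/2. The result decays geometrically in n, with an
    exponential growth in z that the weights can absorb. *)
Lemma taylor_remainder (f : nat -> R -> R) (B : R) (n : nat) (z : R) : 0 <= z ->
 (forall j w, has_der setT (f j) w (f j.+1 w)) -> (forall j w, 0 <= w -> `|f j w| <= B) ->
 `|f 0%N z - tayr f n z| <= 2 * B / 2 ^+ n * expR (2 * z).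
move=> z0 hd hB; have B0 : 0 <= B := le_trans (normr_ge0 _) (hB 0%N 0 (lexx _)).
elim: n f z z0 hd hB => [|n IH] f z z0 hd hB.
 rewrite /tayr big_ord_recr big_ord0 /= add0r fact0 divr1 expr0 !mulr1 expr0 divr1.
 apply: (le_trans (ler_normB _ _)); apply: (@le_trans _ _ (2 * B)).
  by rewrite mulr_natl mulr2n lerD// hB.
 by rewrite ler_peMr ?mulr_ge0// -expR0 ler_expR mulr_ge0.
have [->|zn0] := eqVneq z 0.
 by rewrite tayr0 subrr normr0 mulr_ge0 ?expR_ge0// mulr_ge0 ?mulr_ge0// invr_ge0 exprn_ge0.
have zp : 0 < z by rewrite lt_def zn0.
pose K := 2 * B / 2 ^+ n.+1.
have K0 : 0 <= K by rewrite mulr_ge0 ?mulr_ge0// invr_ge0 exprn_ge0.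
have KE : 2 * K = 2 * B / 2 ^+ n by rewrite /K exprS; field; rewrite expf_neq0.
have dE (w : R) : has_der setT (fun w => expR (2 * w)) w (2 * expR (2 * w)).
 apply/is_deriveP; have h : is_derive w (1 : R) (fun z => 2 * z) 2.
  have h := is_deriveM (is_derive_cst (2 : R) w (1 : R)) (is_derive_id w (1 : R)).
  by apply: (is_derive_eq h); rewrite /GRing.scale /= ?fctE; ring.
 have -> : (fun z : R => expR (2 * z)) = expR \o (fun z => 2 * z) by [].
 by apply: (is_derive_eq (is_derive1_comp (g := fun z => 2 * z) (is_derive_expR _) h)); rewrite mulrC.
have mono (s : R) : `|s| = 1 -> s * (f 0%N z - tayr f n.+1 z) <= K * expR (2 * z).
 move=> s1. have dh w : has_der setT (fun w => K * expR (2 * w) + - s * (f 0%N w + -1 * tayr f n.+1 w)) w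
   (K * (2 * expR (2 * w)) + - s * (f 1%N w + -1 * tayr (fun j => f j.+1) n w)).
  apply: has_derD; first by apply: has_derZ; exact: dE.
  by apply: has_derZ; apply: has_derD; [exact: hd | apply: has_derZ; exact: tayr_der].
 have [c /andP[c0 cz] E] := mvt_on zp (fun w _ => conj I (dh w)).
 have hc := IH (fun j => f j.+1) c c0 (fun j w => hd j.+1 w) (fun j w w0 => hB j.+1 w w0).
 have : 0 <= (K * (2 * expR (2 * c)) + - s * (f 1%N c + -1 * tayr (fun j => f j.+1) n c)) * (z - 0).
  rewrite subr0 mulr_ge0//. have -> : K * (2 * expR (2 * c)) = 2 * K * expR (2 * c) by ring.
  have : s * (f 1%N c - tayr (fun j => f j.+1) n c) <= 2 * K * expR (2 * c).
   by rewrite KE; apply: le_trans hc; apply: (le_trans (ler_norm _)); rewrite normrM s1 mul1r.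
  by clear; lra.
 rewrite -E mulr0 expR0 tayr0 => h; move: h K0. by move: (expR _) (f 0%N z) (tayr _ _ _) => u v w; clear; nra.
have h1 := mono 1 (normr1 _); have h2 := mono (-1) ltac:(by rewrite normrN normr1).
by rewrite ler_norml -/K; move: h1 h2; clear; rewrite mul1r mulN1r => h1 h2; apply/andP; split; lra.
Qed.

Fixpoint pw (a : expr) (n : nat) : expr := if n is m.+1 then Mul a (pw a m) else Cst 1.

Lemma ev_pw a n t x y : ev (pw a n) t x y = ev a t x y ^+ n.
by elim: n => [|n /= ->]; rewrite ?expr0 ?exprS. Qed.

Lemma ev_Dv_pw (a : expr) (n : nat) (p q r t x y : R) :
 ev (Dv p q r (pw a n)) t x y = n%:R * ev a t x y ^+ n.-1 * ev (Dv p q r a) t x y.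
case: n => [|n]; first by rewrite /= !mul0r.
elim: n => [|n IH]; first by rewrite /=; ring.
rewrite -[LHS]/(ev (Dv p q r a) t x y * ev (pw a n.+1) t x y
 + ev a t x y * ev (Dv p q r (pw a n.+1)) t x y).
by rewrite IH ev_pw -[n.+2%:R]natr1 /= exprS; ring.
Qed.

Lemma poly_pw a n : is_poly a -> is_poly (pw a n).
by move=> pa; elim: n => [//|n IH]; split. Qed.

Fixpoint taye (f : nat -> R -> R) (a : expr) (n : nat) : expr :=
 if n is m.+1 then Add (taye f a m) (Mul (Cst (f n 0 / n`!%:R)) (pw a n)) else Cst (f 0%N 0).

Lemma ev_taye f a n t x y : ev (taye f a n) t x y = tayr f n (ev a t x y).
elim: n => [|n IH]; first by rewrite /tayr big_ord_recr big_ord0 /= add0r fact0 divr1 expr0 mulr1.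
rewrite /tayr big_ord_recr -/(tayr f n _) -IH [LHS]/=; congr (_ + _ * _).
by rewrite /= ev_pw exprS.
Qed.

Lemma poly_taye f a n : is_poly a -> is_poly (taye f a n).
move=> pa; elim: n => [//|n IH]; split => //; split => //; exact: (poly_pw n.+1).
Qed.

Lemma taylor_remainder_abs (f : nat -> R -> R) (B : R) (n : nat) (z : R) :
 (forall j w, has_der setT (f j) w (f j.+1 w)) -> (forall j w, `|f j w| <= B) ->
 `|f 0%N z - tayr f n z| <= 2 * B / 2 ^+ n * expR (2 * `|z|).
move=> hd hB; have [z0|z0] := leP 0 z.
 by rewrite (ger0_norm z0); apply: taylor_remainder.
rewrite (ltr0_norm z0); pose g j w := (-1) ^+ j * f j (- w).
have -> : f 0%N z = g 0%N (- z) by rewrite /g opprK mul1r.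
have -> : tayr f n z = tayr g n (- z).
 apply: eq_bigr => k _; rewrite /g oppr0 [(- z) ^+ k]exprNn mulrACA -mulrA.
 have : ((-1) ^+ k * (-1) ^+ k : R) = 1 by rewrite -exprD addnn -mul2n exprM sqrrN expr1n expr1n.
 by move: ((-1) ^+ k) (f k 0) (k`!%:R^-1) (z ^+ k) => s u v w h; ring: h.
apply: taylor_remainder; first by rewrite oppr_ge0 ltW.
- move=> j w; rewrite /g exprS mulN1r mulNr -mulrN; apply: has_derZ.
 rewrite -mulN1r. apply: (@has_der_ext _ (fun z => f j (-1 * z + 0)) _ _ (-1 * f j.+1 (- w))) => [v|//|].
  by rewrite addr0 mulN1r.
 by apply: has_der_affine; rewrite addr0 mulN1r; exact: hd.
- by move=> j w _; rewrite normrM normrX normrN1 expr1n mul1r.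
Qed.

Lemma ev_Dv_taye (f : nat -> R -> R) (a : expr) (n : nat) (p q r t x y : R) : ev (Dv p q r (taye f a n.+1)) t x y
 = ev (Dv p q r a) t x y * tayr (fun j => f j.+1) n (ev a t x y).
elim: n => [|n IH].
 rewrite /tayr big_ord_recr big_ord0 /= add0r fact0 !factS fact0; ring.
have -> : taye f a n.+2 = Add (taye f a n.+1) (Mul (Cst (f n.+2 0 / n.+2`!%:R)) (pw a n.+2)) by [].
rewrite -[LHS]/(ev (Dv p q r (taye f a n.+1)) t x y + (0 * ev (pw a n.+2) t x y
 + f n.+2 0 / n.+2`!%:R * ev (Dv p q r (pw a n.+2)) t x y)) IH ev_Dv_pw mul0r add0r.
have -> : tayr (fun j => f j.+1) n.+1 (ev a t x y) = tayr (fun j => f j.+1) n (ev a t x y)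
 + f n.+2 0 / n.+1`!%:R * ev a t x y ^+ n.+1 by rewrite /tayr big_ord_recr.
rewrite (factS n.+1) natrM -[n.+2%:R]nat1r; field.
by rewrite !nat1r !pnatr_eq0 -lt0n fact_gt0.
Qed.

(** Common frame for the sine in x and the exponential in y: A is linear and [f j] is the j-th
    derivative of the outer function, controlled on the values of A for y >= 0. Half of the rate is
    spent on the Taylor remainder and half on the polynomial factor. *)
Lemma multiplier_family (T e : R) (f : nat -> R -> R) (G A : expr) : 0 < e -> is_poly A ->
 (forall t x y, ev G t x y = f 0%N (ev A t x y)) -> (forall t x y, ev (Ex G) t x y = ev (Ex A) t x y * f 1%N (ev A t x y)) ->
 (forall t x y, ev (Ex (Ex G)) t x y = ev (Ex A) t x y * (ev (Ex A) t x y * f 2%N (ev A t x y))) ->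
 (forall t x y, ev (Ey G) t x y = ev (Ey A) t x y * f 1%N (ev A t x y)) ->
 (forall t x y, `|ev (Ex A) t x y| <= 1) -> (forall t x y, `|ev (Ey A) t x y| <= 1) -> (forall t x y, ev (Ex (Ex A)) t x y = 0) ->
 (forall j t x y, 0 <= y -> `|f j (ev A t x y)| <= 1) -> (forall j n t x y, 0 <= y ->
   `|f j (ev A t x y) - tayr (fun k => f (j + k)%N) n (ev A t x y)| <= 2 / 2 ^+ n * wt (e / 2) x y) ->
 multiplier T e G.
move=> e0 pA G0 G1 G2 G3 A1 A3 A2 fb fr.
have m1 (u v B : R) : `|u| <= 1 -> `|v| <= B -> `|u * v| <= B.
 by move=> hu hv; rewrite normrM -[B]mul1r; apply: ler_pM.
split.
 exists 1 => t x y _ y0; split.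
 - by rewrite G0 fb.
 - by rewrite G1 m1 ?fb.
 - by rewrite G2 !m1 ?fb.
 - by rewrite G3 m1 ?fb.
have rem n t x y : 0 <= y -> bd4 (Minus G (taye f A n.+2)) t x y (2 / 2 ^+ n * wt (e / 2) x y).
 move=> y0; have le4 m : (n <= m)%N -> 2 / 2 ^+ m * wt (e / 2) x y <= 2 / 2 ^+ n * wt (e / 2) x y.
  move=> nm; apply: ler_wpM2r; first by apply: ltW; exact: wt_gt0. apply: ler_wpM2l => //; rewrite lef_pV2 ?posrE ?exprn_gt0//.
  by rewrite ler_eXn2l ?ltr1n.
 have D p q r (u : expr) : ev (Dv p q r (Minus G u)) t x y = ev (Dv p q r G) t x y - ev (Dv p q r u) t x y.
  by rewrite /=; ring.
 split.
 - by rewrite ev_Minus G0 ev_taye; apply: le_trans (fr 0%N n.+2 t x y y0) (le4 _ _); rewrite -addn2 leq_addr.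
 - rewrite D G1 ev_Dv_taye -mulrBr m1//.
  by apply: le_trans (fr 1%N n.+1 t x y y0) (le4 _ _); rewrite leqnSn.
 - have -> : ev (Ex (Ex (Minus G (taye f A n.+2)))) t x y
    = ev (Ex (Ex G)) t x y - ev (Ex (Ex (taye f A n.+2))) t x y by rewrite /=; ring.
  have Ee : forall t x y, ev (Ex (taye f A n.+2)) t x y = ev (Mul (Ex A) (taye (fun j => f j.+1) A n.+1)) t x y.
   by move=> ? ? ?; rewrite ev_Dv_taye /= -ev_taye.
  rewrite G2 (Dv_ext _ _ _ Ee) -[ev (Ex (Mul _ _)) _ _ _]/(ev (Ex (Ex A)) t x y * _ + _ * ev (Ex (taye _ A n.+1)) t x y).
  rewrite A2 mul0r add0r ev_Dv_taye -!mulrBr !m1//; exact: (fr 2%N n).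
 - rewrite D G3 ev_Dv_taye -mulrBr m1//.
  by apply: le_trans (fr 1%N n.+1 t x y y0) (le4 _ _); rewrite leqnSn.
move=> p pp eta eta0; have e2 : 0 < e / 2 by rewrite divr_gt0.
have [C C0 HC] : exists2 C, 0 < C & forall t x y, 0 <= t <= T -> 0 <= y -> bd4 p t x y (C * wt (e / 2) x y).
 have [C0 C00 H0] := poly_subexp T pp e2. have [C1 C10 H1] := poly_subexp T (poly_Dv 0 1 0 pp) e2.
 have [C2 C20 H2] := poly_subexp T (poly_Dv 0 1 0 (poly_Dv 0 1 0 pp)) e2. have [C3 C30 H3] := poly_subexp T (poly_Dv 0 0 1 pp) e2.
 exists (C0 + C1 + C2 + C3); first by rewrite !addr_gt0. move=> t x y tT y0; have w0 := wt_gt0 (e / 2) x y.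
 split; [apply: (le_trans (H0 _ _ _ tT y0))|apply: (le_trans (H1 _ _ _ tT y0))
  |apply: (le_trans (H2 _ _ _ tT y0))|apply: (le_trans (H3 _ _ _ tT y0))]; rewrite ler_pM2r//;
  move: C00 C10 C20 C30; clear; lra.
pose n := (Num.truncn (8 * C / eta)).+1.
have hn : 8 * C / 2 ^+ n <= eta.
 rewrite ler_pdivrMr ?exprn_gt0// [leRHS]mulrC -ler_pdivrMr//. apply: (@le_trans _ _ n%:R); first by rewrite ltW// truncnS_gt.
 by rewrite -natrX ler_nat ltnW// ltn_expl.
exists (Mul p (taye f A n.+2)); first by split => //; apply: poly_taye.
move=> t x y tT y0; apply: (@bd4_ext (Mul p (Minus G (taye f A n.+2)))) => [*|].
 by rewrite /=; ring.
apply: bd4_le (bd4_mul (HC t x y tT y0) (rem n t x y y0)).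
rewrite [in leRHS](splitr e) wtD; move: (wt_gt0 (e / 2) x y) hn; rewrite -!mulrA.
move: (wt _ _ _) ((2 ^+ n)^-1) => w i w0 hn.
have -> : 4 * (C * (w * (2 * (i * w)))) = (8 * (C * i)) * (w * w) by ring.
by rewrite ler_pM2r ?mulr_gt0.
Qed.

(** Writing the j-th derivative as a sine with phase j pi / 2 gives the family one formula. The
    condition del <= e / 4 brings the growth e^(2 del |x|) of the remainder below the weight of rate
    e / 2. *)
Lemma multiplier_sin (T e del : R) : 0 < e -> 0 <= del -> del <= 1 -> del <= e / 4 -> multiplier T e (Sin (Mul (Cst del) Vx)).
move=> e0 d0 d1 de; pose f (j : nat) (z : R) := sin (1 * z + j%:R * (pi / 2)).
have fE j z : f j z = sin (z + j%:R * (pi / 2)) by rewrite /f mul1r.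
have f1 z : f 1%N z = cos z by rewrite fE mul1r sinDpihalf.
have f2 z : f 2%N z = - sin z by rewrite fE mulrC divfK// sinDpi.
have fb j z : `|f j z| <= 1 by rewrite ler_norml sin_le1 sin_geN1.
have fd j (w : R) : has_der setT (f j) w (f j.+1 w).
 rewrite -[f j.+1 w]mul1r; apply: has_der_affine; apply/is_deriveP.
 apply: (is_derive_eq (is_derive_sin _)); rewrite mul1r fE -sinDpihalf; congr sin. by rewrite -natr1; ring.
apply: (@multiplier_family _ _ f _ (Mul (Cst del) Vx)) => //=.
- by move=> t x y; rewrite fE mul0r addr0.
- by move=> t x y; rewrite f1.
- by move=> t x y; rewrite f2; ring.
- by move=> t x y; rewrite f1.
- by move=> t x y; rewrite mul0r add0r mulr1 ger0_norm.
- by move=> t x y; rewrite mul0r mulr0 addr0 normr0.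
- by move=> t x y; ring.
- move=> j n t x y y0.
 have := @taylor_remainder_abs (fun k => f (j + k)%N) 1 n (del * x). rewrite /= addn0 mulr1 => /(_ (fun k w => _)) H.
 have {}H := H (fun k w => eq_ind_r (fun m => has_der setT (f (j + k)%N) w (f m w)) (fd (j + k)%N w) (addnS j k)) (fun k w => fb _ w).
 apply: (le_trans H); rewrite ler_wpM2l ?divr_ge0 ?exprn_ge0// ler_expR normrM (ger0_norm d0).
 by have := normr_ge0 x; move: de y0 d0; clear; nra.
Qed.

Lemma multiplier_exp (T e del : R) : 0 < e -> 0 <= del -> del <= 1 -> del <= e / 4 -> multiplier T e (Exp (Mul (Cst (- del)) Vy)).
move=> e0 d0 d1 de; pose f (j : nat) (z : R) := (-1) ^+ j * expR (-1 * z + 0).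
have fE j z : f j z = (-1) ^+ j * expR (- z) by rewrite /f mulN1r addr0.
have fb j z : 0 <= z -> `|f j z| <= 1.
 move=> z0; rewrite fE normrM normrX normrN1 expr1n mul1r ger0_norm ?expR_ge0//. by rewrite -expR0 ler_expR oppr_le0.
have fd j (w : R) : has_der setT (f j) w (f j.+1 w).
 rewrite /f exprS -mulrA mulrCA; apply: has_derZ. by apply: has_der_affine; apply/is_deriveP; exact: is_derive_expR.
apply: (@multiplier_family _ _ f _ (Mul (Cst del) Vy)) => //=.
- by move=> t x y; rewrite fE mul1r mulNr.
- by move=> t x y; ring.
- by move=> t x y; ring.
- by move=> t x y; rewrite fE expr1 !mulNr; ring.
- by move=> t x y; rewrite mul0r mulr0 addr0 normr0.
- by move=> t x y; rewrite mul0r add0r mulr1 ger0_norm.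
- by move=> t x y; ring.
- by move=> j t x y y0; rewrite fb// mulr_ge0.
- move=> j n t x y y0.
 have H := @taylor_remainder (fun k => f (j + k)%N) 1 n (del * y) (mulr_ge0 d0 y0)
  (fun k w => eq_ind_r (fun m => has_der setT (f (j + k)%N) w (f m w)) (fd (j + k)%N w) (addnS j k)) (fun k w w0 => fb _ w w0).
 rewrite /= addn0 mulr1 in H. apply: (le_trans H); rewrite ler_wpM2l ?divr_ge0 ?exprn_ge0// ler_expR.
 by have := normr_ge0 x; move: de y0 d0; clear; nra.
Qed.

Fixpoint subst (P A B : expr) : expr := match P with
 | Cst r => Cst r | Vt => Vt | Vx => A | Vy => B
 | Add e1 e2 => Add (subst e1 A B) (subst e2 A B)
 | Mul e1 e2 => Mul (subst e1 A B) (subst e2 A B)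
 | Exp e1 => Exp (subst e1 A B)
 | Sin e1 => Sin (subst e1 A B)
 | Cos e1 => Cos (subst e1 A B)
 end.

Lemma ev_subst P A B t x y : ev (subst P A B) t x y = ev P t (ev A t x y) (ev B t x y).
by elim: P => //= [e1 -> e2 ->|e1 -> e2 ->|e ->|e ->|e ->]. Qed.

Lemma ev_Dv_subst P A B p q r t x y : ev (Dv p q r (subst P A B)) t x y
 = ev (Dv p (ev (Dv p q r A) t x y) (ev (Dv p q r B) t x y) P) t (ev A t x y) (ev B t x y).
by elim: P => //= [e1 -> e2 ->|e1 -> e2 ->|e ->|e ->|e ->]; rewrite ?ev_subst. Qed.

Lemma multiplier_subst T e P A B : is_poly P -> multiplier T e A -> multiplier T e B -> multiplier T e (subst P A B).
move=> pP mA mB; elim: P pP => //= [k _|_|e1 h1 e2 h2 [p1 p2]|e1 h1 e2 h2 [p1 p2]].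
- exact: multiplier_cst.
- exact: multiplier_t.
- by apply: multiplier_add; [exact: h1 | exact: h2].
- by apply: multiplier_mul; [exact: h1 | exact: h2].
Qed.

Lemma sin_bounds (z : R) : [/\ `|sin z| <= `|z|, `|cos z - 1| <= `|z| & `|sin z - z| <= z ^+ 2].
have pos (w : R) : 0 < w -> [/\ `|sin w| <= w, `|cos w - 1| <= w & `|sin w - w| <= w ^+ 2].
 move=> w0. have ds (v : R) : has_der setT sin v (cos v) by apply/is_deriveP; exact: is_derive_sin.
 have dc (v : R) : has_der setT cos v (- sin v) by apply/is_deriveP; exact: is_derive_cos.
 have hc (v : R) : 0 < v -> `|cos v - 1| <= v.
  move=> v0; have [c _ E] := mvt_on v0 (fun w _ => conj I (dc w)).
  rewrite cos0 subr0 in E; rewrite E normrM normrN (gtr0_norm v0) ler_piMl ?(ltW v0)//. by rewrite ler_norml sin_le1 sin_geN1.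
 have [c /andP[c0 cw] E] := mvt_on w0 (fun w _ => conj I (ds w)). rewrite sin0 !subr0 in E; split; last first.
 - have -> : sin w - w = (cos c - 1) * w by rewrite E; ring.
  rewrite normrM (gtr0_norm w0) expr2 ler_pM2r//. have [->|cn] := eqVneq c 0; first by rewrite cos0 subrr normr0 ltW.
  by apply: le_trans cw; apply: hc; rewrite lt_def cn.
 - exact: hc.
 - by rewrite E normrM (gtr0_norm w0) ler_piMl ?(ltW w0)// ler_norml cos_le1 cos_geN1.
have [z0|z0|->] := ltgtP z 0.
- have [] := pos (- z); first by rewrite oppr_gt0.
 rewrite sinN cosN normrN sqrrN (ltr0_norm z0) => h1 h2 h3; split => //. have -> : sin z - z = - (- sin z - - z) by ring.
 by rewrite normrN.
- by have := pos z z0; rewrite (gtr0_norm z0).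
- by rewrite sin0 cos0 !subrr normr0 expr0n.
Qed.

Lemma expRN_bounds (z : R) : 0 <= z -> 1 - z <= expR (- z) <= 1 - z + z ^+ 2.
move=> z0; apply/andP; split; first exact: expR_ge1Dx.
rewrite expRN; have h : 1 + z <= expR z by exact: expR_ge1Dx.
have z1 : 0 < 1 + z by rewrite ltr_pwDl.
apply: (@le_trans _ _ (1 + z)^-1); first by rewrite lef_pV2 ?posrE ?expR_gt0.
rewrite -[leLHS]mul1r ler_pdivrMr//.
have -> : (1 - z + z ^+ 2) * (1 + z) = 1 + z ^+ 3 by ring.
by rewrite lerDl exprn_ge0.
Qed.

(* |x| + y <= N is handled by the modulus of continuity, the rest by the weight. *)
Lemma compress_one (T e eta : R) (v : fun3) : 0 <= T -> 0 < e -> 0 < eta -> continuous3_on (closed_slab T) v -> subexp T v ->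
 exists2 M0, 1 <= M0 & forall M t x y A B m, M0 <= M -> 0 <= t <= T -> 0 <= y ->
  `|A| <= `|x| -> 0 <= B <= y -> `|A - x| <= x ^+ 2 / M -> `|B - y| <= y ^+ 2 / M ->
  `|m| <= 1 -> `|m - 1| <= 2 * (`|x| + y) / M -> `|m * v t A B - v t x y| <= eta * wt e x y.
move=> T0 e0 eta0 cv sv; have e2 : 0 < e / 2 by rewrite divr_gt0.
have [C C0 HC] := sv _ e2.
have [N N0 NE] : exists2 N, 0 < N & e / 2 * N = 2 * C / eta.
 exists (4 * C / (eta * e)); first by rewrite divr_gt0 ?mulr_gt0. by field; rewrite !gt_eqF.
have N4 : 0 <= N ^+ 4 by rewrite exprn_ge0 ?ltW.
have [c c0 Hc] := unif_modulus T0 (ltW N0) cv (e := eta / 2) ltac:(by rewrite divr_gt0).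
pose K := c * (2 * N ^+ 4) + 2 * N * C.
have K0 : 0 <= K.
 apply: addr_ge0; first by apply: mulr_ge0 => //; apply: mulr_ge0. by apply: mulr_ge0; [apply: mulr_ge0 => //|]; exact: ltW.
exists (1 + K * 2 / eta); first by rewrite lerDl divr_ge0 ?mulr_ge0// ltW.
move=> M t x y A B m MK tT y0 Ax /andP[B0 By] Adx Bdy m1 m1'.
have M1 : 1 <= M by apply: le_trans MK; rewrite lerDl divr_ge0 ?mulr_ge0// ltW.
have M0 : 0 < M by exact: lt_le_trans M1.
have w1 := wt_ge1 x (ltW e2) y0.
have wAB : wt (e / 2) A B <= wt (e / 2) x y by rewrite ler_expR ler_pM2l// lerD.
have vAB : `|v t A B| <= C * wt (e / 2) x y.
 by apply: (le_trans (HC _ _ _ tT B0)); rewrite ler_pM2l.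
have vxy := HC _ _ _ tT y0.
have ww : wt e x y = wt (e / 2) x y * wt (e / 2) x y by rewrite -wtD -splitr.
have [far|near] := leP N (`|x| + y).
 apply: (le_trans (ler_normB _ _)); rewrite normrM. apply: (@le_trans _ _ (C * wt (e / 2) x y + C * wt (e / 2) x y)).
  by apply: lerD => //; apply: le_trans vAB; rewrite ler_piMl.
 have h : 2 * C / eta <= wt (e / 2) x y.
  apply: le_trans (expR_ge1Dx _); apply: (@le_trans _ _ (e / 2 * (`|x| + y))).
   by rewrite -NE ler_pM2l.
  by rewrite lerDr.
 rewrite ler_pdivrMr// in h. rewrite ww -mulrDl mulrA ler_pM2r; last exact: wt_gt0.
 by move: h; clear; rewrite [wt _ _ _ * _]mulrC; lra.
have xN : `|x| <= N by move: near y0; clear; lra.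
have yN : y <= N by move: near (normr_ge0 x); clear; lra.
have b1 : box T N (t, x, y) by split => //=; rewrite y0.
have b2 : box T N (t, A, B).
 by split => //=; [exact: le_trans Ax xN | rewrite B0 (le_trans By yN)].
have h1 := Hc _ _ _ _ _ _ b1 b2.
have dd (u w : R) : `|u| <= N -> `|w - u| <= u ^+ 2 / M -> (w - u) ^+ 2 <= N ^+ 4 / M.
 move=> uN wu; rewrite -[(w - u) ^+ 2]real_normK ?num_real//.
 have h0 : u ^+ 2 <= N ^+ 2 by rewrite -[u ^+ 2]real_normK ?num_real// ler_pXn2r ?nnegrE ?normr_ge0// ltW.
 have h2 : `|w - u| <= N ^+ 2 / M by apply: le_trans wu _; rewrite ler_pM2r ?invr_gt0. apply: (@le_trans _ _ ((N ^+ 2 / M) ^+ 2)).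
  by rewrite ler_pXn2r ?nnegrE ?normr_ge0// divr_ge0 ?exprn_ge0// ltW.
 rewrite expr_div_n -exprM ler_pM2l ?exprn_gt0// lef_pV2 ?posrE ?exprn_gt0//. by rewrite expr2 ler_peMl// ltW.
have sq : sqd t x y t A B <= 2 * N ^+ 4 / M.
 rewrite /sqd subrr expr0n add0r; have := dd _ _ xN Adx. have := dd y B; rewrite ger0_norm// => /(_ yN Bdy); clear; lra.
have -> : m * v t A B - v t x y = (m - 1) * v t A B + (v t A B - v t x y) by ring.
apply: (le_trans (ler_normD _ _)); rewrite normrM.
have q1 : `|m - 1| * `|v t A B| <= 2 * N / M * (C * wt (e / 2) x y).
 apply: ler_pM => //; apply: (le_trans m1'); rewrite ler_pM2r ?invr_gt0// ler_pM2l// ltW//.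
have q2 : `|v t A B - v t x y| <= eta / 2 + c * (2 * N ^+ 4 / M).
 by apply: (le_trans h1); rewrite lerD2l ler_wpM2l.
have KM : K / M <= eta / 2.
 rewrite ler_pdivrMr// mulrC -ler_pdivrMr ?divr_gt0// invf_div mulrA. by apply: le_trans MK; rewrite lerDr.
apply: (le_trans (lerD q1 q2)).
have w2 : wt (e / 2) x y <= wt e x y by rewrite ww ler_peMl// (le_trans ler01).
apply: (@le_trans _ _ ((K / M + eta / 2) * wt (e / 2) x y)).
 have p : 0 <= c * (2 * N ^+ 4 / M) by rewrite mulr_ge0// divr_ge0 ?mulr_ge0// ltW.
 rewrite /K; move: w1 p eta0; rewrite !(mulrDl _ _ (wt _ _ _)) !(mulrDl _ _ (M^-1)).
 have -> : 2 * N / M * (C * wt (e / 2) x y) = 2 * N * C / M * wt (e / 2) x y by ring.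
 have -> : c * (2 * N ^+ 4) / M = c * (2 * N ^+ 4 / M) by ring. rewrite !(mulrDl _ _ (wt _ _ _)).
 by move: (wt _ _ _) (c * _) (2 * N * C / M) => w q s; clear; nra.
have : (K / M + eta / 2) * wt (e / 2) x y <= eta * wt (e / 2) x y.
 by rewrite ler_pM2r ?wt_gt0//; move: KM; clear; lra.
by move=> h; apply: (le_trans h); rewrite ler_pM2l.
Qed.

(** The map (x, y) -> (M sin (x / M), M (1 - e^(- y / M))) sends the half-plane into the box of
    [box_approx] and is close to the identity on bounded sets. The composition is not polynomial,
    but it is built from multipliers and is approximated once more by polynomials, now in the
    weighted sense. *)
Lemma poly_density (T e eta : R) v v1 v2 v3 : 0 < T -> 0 < e -> 0 < eta -> data4 T v v1 v2 v3 ->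
 subexp T v -> subexp T v1 -> subexp T v2 -> subexp T v3 -> exists2 P : expr, is_poly P & forall t x y, 0 <= t <= T -> 0 <= y ->
  dist4 P v v1 v2 v3 t x y (eta * wt e x y).
move=> T0 e0 eta0 dv s0 s1 s2 s3; have [[c0 c1] [c2 c3] _ _ _] := dv.
have e4 : 0 < eta / 4 by rewrite divr_gt0.
have [M0 M01 H0] := compress_one (ltW T0) e0 e4 c0 s0.
have [M1 M11 H1] := compress_one (ltW T0) e0 e4 c1 s1.
have [M2 M21 H2] := compress_one (ltW T0) e0 e4 c2 s2.
have [M3 M31 H3] := compress_one (ltW T0) e0 e4 c3 s3.
have [C C0 HC] := s1 _ e0.
(* The first four terms make the compression harmless for v and its derivatives, 4 / e makes 1 / M
   an admissible parameter of the multipliers, and 8 C / eta makes the extra term of the second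
   x-derivative small. *)
pose M := M0 + M1 + M2 + M3 + 4 / e + 8 * C / eta.
have p1 : 0 < 4 / e by rewrite divr_gt0.
have p2 : 0 < 8 * C / eta by rewrite divr_gt0 ?mulr_gt0.
have [MM0 MM1 MM2 MM3] : [/\ M0 <= M, M1 <= M, M2 <= M & M3 <= M].
 by rewrite /M; move: p1 p2 M01 M11 M21 M31; clear; split; lra.
have [M1' Me MC] : [/\ 2 <= M, 4 / e <= M & 8 * C / eta <= M].
 by rewrite /M; move: p1 p2 M01 M11 M21 M31; clear; split; lra.
have Mp : 0 < M by apply: lt_le_trans M1'.
have M1s : 1 <= M by apply: le_trans M1'; rewrite ler1n.
clearbody M; have [P pP HP] := box_approx T0 Mp e4 dv.
pose del := M^-1; have del0 : 0 <= del by rewrite invr_ge0 ltW.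
have del1 : del <= 1 by rewrite invf_le1.
have dele : del <= e / 4 by rewrite -[e / 4]invf_div lef_pV2 ?posrE.
have Mdel : M * del = 1 by rewrite divff// gt_eqF.
pose A : expr := Mul (Cst M) (Sin (Mul (Cst del) Vx)).
pose B : expr := Mul (Cst M) (Add (Cst 1) (Mul (Cst (-1)) (Exp (Mul (Cst (- del)) Vy)))).
pose Q := subst P A B.
have mA : multiplier T e A by apply: multiplier_mul; [exact: multiplier_cst | exact: multiplier_sin].
have mB : multiplier T e B.
 apply: multiplier_mul; first exact: multiplier_cst. apply: multiplier_add; first exact: multiplier_cst.
 by apply: multiplier_mul; [exact: multiplier_cst | exact: multiplier_exp].
have [_ /(_ (Cst 1) I)/(_ _ e4)[p pp Hp]] := multiplier_subst pP mA mB.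
exists p => // t x y tT y0.
have {}Hp : bd4 (Minus Q p) t x y (eta / 4 * wt e x y).
 by apply: bd4_ext (Hp t x y tT y0) => *; rewrite !ev_Minus /= mul1r.
set a := M * sin (del * x); set b := M * (1 - expR (- (del * y))).
set cs := cos (del * x); set eb := expR (- (del * y)).
have evA : ev A t x y = a by [].
have evB : ev B t x y = b by rewrite /= /b mulN1r mulNr.
have EAx s z w : ev (Ex A) s z w = cos (del * z).
 by rewrite /= mul0r !add0r mulr1 mul0r add0r mulrA Mdel mul1r.
have EBx s z w : ev (Ex B) s z w = 0 by rewrite /=; ring.
have EAy s z w : ev (Ey A) s z w = 0 by rewrite /=; ring.
have EBy : ev (Ey B) t x y = eb.
 have -> : ev (Ey B) t x y = M * del * eb by rewrite /= (mulNr del y) -/eb; ring. by rewrite Mdel mul1r.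
have Q0 : ev Q t x y = ev P t a b by rewrite ev_subst evA evB.
have Qx (S : expr) s z w : ev (Ex (subst S A B)) s z w = cos (del * z) * ev (subst (Ex S) A B) s z w.
 by rewrite ev_Dv_subst EAx EBx Dv_lin ev_subst; ring.
have Q1 : ev (Ex Q) t x y = cs * ev (Ex P) t a b by rewrite Qx ev_subst evA evB.
(* The second derivative of the sine contributes a first-order term with the factor del = 1 / M. *)
have Q2 : ev (Ex (Ex Q)) t x y = cs * (cs * ev (Ex (Ex P)) t a b) - del * sin (del * x) * ev (Ex P) t a b.
 have E s z w : ev (Ex Q) s z w = ev (Mul (Cos (Mul (Cst del) Vx)) (subst (Ex P) A B)) s z w by exact: Qx.
 rewrite (Dv_ext _ _ _ E) -[ev (Ex (Mul _ _)) _ _ _]/(ev (Ex (Cos (Mul (Cst del) Vx))) t x y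
  * ev (subst (Ex P) A B) t x y + cs * ev (Ex (subst (Ex P) A B)) t x y).
 by rewrite Qx !ev_subst evA evB /= -/cs; ring.
have Q3 : ev (Ey Q) t x y = eb * ev (Ey P) t a b by rewrite ev_Dv_subst EAy EBy Dv_lin evA evB; ring.
have dy0 : 0 <= del * y by rewrite mulr_ge0.
have /andP[ex1 ex2] := expRN_bounds dy0; rewrite -/eb in ex1 ex2.
have eb0 : 0 <= eb := expR_ge0 _.
have eb1 : eb <= 1 by rewrite -expR0 ler_expR oppr_le0.
have [sn1 sn2 sn3] := sin_bounds (del * x); rewrite -/cs in sn2.
have ndx : `|del * x| = del * `|x| by rewrite normrM ger0_norm.
have cs1 : `|cs| <= 1 by rewrite ler_norml cos_le1 cos_geN1.
have ax : `|a| <= `|x|.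
 by rewrite /a normrM (gtr0_norm Mp) -ler_pdivlMl// -ndx.
have byy : 0 <= b <= y.
 apply/andP; split; first by rewrite mulr_ge0 ?subr_ge0// ltW.
 by rewrite /b -ler_pdivlMl// -/del; move: ex1; clear; rewrite -/eb; lra.
have bM : b <= M by rewrite /b ler_piMr ?(ltW Mp)// -/eb; move: eb0; clear; lra.
have aM : `|a| <= M.
 by rewrite /a normrM (gtr0_norm Mp) ler_piMr ?(ltW Mp)// ler_norml sin_le1 sin_geN1.
have adx : `|a - x| <= x ^+ 2 / M.
 have -> : a - x = M * (sin (del * x) - del * x).
  by rewrite /a mulrBr [M * (del * x)]mulrA Mdel mul1r.
 rewrite normrM (gtr0_norm Mp) -ler_pdivlMl//; apply: (le_trans sn3). by rewrite -/del; apply: eq_leW; ring.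
have bdy : `|b - y| <= y ^+ 2 / M.
 have -> : b - y = - (M * (eb - 1 + del * y)).
  by rewrite /b -/eb -[X in _ - X]mul1r -Mdel; ring.
 rewrite normrN normrM (gtr0_norm Mp) -ler_pdivlMl// -/del ger0_norm; last by move: ex1; clear; lra.
 by move: ex2; clear; rewrite exprMn; lra.
have /HP[P0 P1 P2 P3] : box T M (t, a, b) by split => //=; case/andP: byy => -> _.
have w1 : 1 <= wt e x y by exact: wt_ge1 (ltW e0) y0.
have small (u : R) : u <= eta / 4 -> u <= eta / 4 * wt e x y.
 by move=> h; apply: (le_trans h); rewrite ler_peMr// ltW.
have c1m : `|cs - 1| <= 2 * (`|x| + y) / M.
 apply: (le_trans sn2); rewrite ndx -/del mulrC; move: (normr_ge0 x) y0 del0; clear; nra.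
have c2m : `|cs * cs - 1| <= 2 * (`|x| + y) / M.
 have -> : cs * cs - 1 = (cs - 1) * (cs + 1) by ring.
 rewrite normrM; have h : `|cs + 1| <= 2 by move: cs1; rewrite !ler_norml; clear; lra.
 apply: (@le_trans _ _ (del * `|x| * 2)); first by rewrite ler_pM// -ndx.
 by rewrite -/del; move: (normr_ge0 x) y0 del0; clear; nra.
have c3m : `|eb - 1| <= 2 * (`|x| + y) / M.
 rewrite -/del distrC ger0_norm ?subr_ge0//. by move: ex1 (normr_ge0 x) y0 del0; clear; nra.
have m1 (u w D : R) : `|u| <= 1 -> `|w| <= D -> `|u * w| <= D.
 by move=> hu hw; rewrite normrM -[D]mul1r; apply: ler_pM.
have tri (q0 q1 q2 q3 W : R) : `|q1 - q0| <= eta / 4 * W -> `|q1 - q2| <= 2 * (eta / 4 * W) ->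
  `|q2 - q3| <= eta / 4 * W -> `|q0 - q3| <= eta * W.
 by rewrite !ler_norml; clear; lra.
have W0 : 0 <= eta / 4 * wt e x y by rewrite mulr_ge0 ?ltW// wt_gt0.
have dbl2 (u : R) : u <= eta / 4 * wt e x y -> u <= 2 * (eta / 4 * wt e x y).
 by move: W0; clear; lra.
case: Hp => p0 p1' p2' p3; split.
- apply: (tri _ (ev Q t x y) (1 * v t a b)); first by rewrite -ev_Minus.
  by rewrite Q0 mul1r; apply/dbl2/small.
 by apply: (H0 M) => //; rewrite ?normr1 ?subrr ?normr0 ?divr_ge0 ?mulr_ge0 ?addr_ge0// ltW.
- apply: (tri _ (ev (Ex Q) t x y) (cs * v1 t a b)).
 + by have -> : ev (Ex Q) t x y - ev (Ex p) t x y = ev (Ex (Minus Q p)) t x y by rewrite /=; ring.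
 + by rewrite Q1 -mulrBr; apply/dbl2/small; apply: m1.
 + exact: (H1 M).
- apply: (tri _ (ev (Ex (Ex Q)) t x y) (cs * cs * v2 t a b)).
 + by have -> : ev (Ex (Ex Q)) t x y - ev (Ex (Ex p)) t x y = ev (Ex (Ex (Minus Q p))) t x y by rewrite /=; ring.
 + rewrite Q2; have -> : cs * (cs * ev (Ex (Ex P)) t a b) - del * sin (del * x) * ev (Ex P) t a b - cs * cs * v2 t a b
   = cs * (cs * (ev (Ex (Ex P)) t a b - v2 t a b)) + - (sin (del * x) * (del * ev (Ex P) t a b)) by ring.
  apply: (le_trans (ler_normD _ _)); rewrite [2 * _]mulr_natl mulr2n; apply: lerD.
   by apply/small; do 2!apply: (m1 _) => //.
  rewrite normrN; apply: m1; first by rewrite ler_norml sin_le1 sin_geN1. have v1C : `|v1 t a b| <= C * wt e x y.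
   have /andP[b0 by'] := byy. apply: (le_trans (HC _ _ _ tT b0)); rewrite ler_pM2l// ler_expR ler_pM2l//. by rewrite lerD.
  have PC : `|ev (Ex P) t a b| <= C * wt e x y + eta / 4.
   by rewrite -[ev (Ex P) t a b](subrK (v1 t a b)) addrC (le_trans (ler_normD _ _))// lerD.
  have dC : del * C <= eta / 8.
   by rewrite /del mulrC ler_pdivrMr// mulrC -ler_pdivrMr ?divr_gt0// invf_div mulrCA mulrA.
  have d2 : del <= 1 / 2 by rewrite -[1 / 2]invf_div divr1 lef_pV2 ?posrE.
  rewrite normrM (ger0_norm del0); apply: (le_trans (ler_wpM2l del0 PC)).
  by move: dC d2 w1 eta0; move: (wt _ _ _) => w; clear; nra.
 + by apply: (H2 M) => //; rewrite normrM mulr_ile1.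
- apply: (tri _ (ev (Ey Q) t x y) (eb * v3 t a b)).
 + by have -> : ev (Ey Q) t x y - ev (Ey p) t x y = ev (Ey (Minus Q p)) t x y by rewrite /=; ring.
 + by rewrite Q3 -mulrBr; apply/dbl2/small; apply: m1 => //; rewrite ger0_norm.
 + by apply: (H3 M) => //; rewrite ger0_norm.
Qed.

(** * Polynomial sources: approximate solutions that are polynomials *)

Definition mono c i j : expr := Mul (Cst c) (Mul (pw Vx i) (pw Vy j)).

Lemma ev_mono (c : R) (i j : nat) (t x y : R) : ev (mono c i j) t x y = c * (x ^+ i * y ^+ j).
by rewrite /= !ev_pw. Qed.

Lemma ev_Dv_mono (c : R) (i j : nat) (p q r t x y : R) : ev (Dv p q r (mono c i j)) t x y
 = q * ev (mono (c * i%:R) i.-1 j) t x y + r * ev (mono (c * j%:R) i j.-1) t x y.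
by rewrite !ev_mono /= !ev_Dv_pw !ev_pw /=; ring. Qed.

Lemma heat_ext k e e' : (forall s z y, ev e s z y = ev e' s z y) -> forall s z y, ev (heat k e) s z y = ev (heat k e') s z y.
move=> h s z y; have h1 := @Dv_ext e e' _ _ _ h.
by rewrite !ev_heat /Et /Ex /Ey !h1 !(Dv_ext _ _ _ (h1 _ _ _)).
Qed.

(** Apart from its diagonal term, the operator lowers the degree in x, or keeps it and lowers the
    degree in y. The degree in y may rise when the degree in x falls, so inductions must be
    lexicographic. *)
Lemma heatr_mono (k : prm) (r : R) (u : expr) (i j : nat) (t x y : R) : (forall p q t x y, ev (Dv 0 p q u) t x y = 0) ->
 ev (heatr k r (Mul u (mono 1 i j))) t x y = (ev (Et u) t x y + (r - pb k * j%:R) * ev u t x y) * (x ^+ i * y ^+ j)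
  + ev u t x y * (pl k ^+ 2 / 2 * i%:R * i.-1%:R * (x ^+ i.-2 * y ^+ j.+1)
   + i%:R * (pr k * pl k * ps k * j%:R + pc k) * (x ^+ i.-1 * y ^+ j) + pd k * i%:R * (x ^+ i.-1 * y ^+ j.+1)
   + j%:R * (ps k ^+ 2 / 2 * j.-1%:R + pa k) * (x ^+ i * y ^+ j.-1)).
move=> u0; have D1 p q s z w : ev (Dv 0 p q (Mul u (mono 1 i j))) s z w = ev (Mul u (Add (mono (p * i%:R) i.-1 j) (mono (q * j%:R) i j.-1))) s z w.
 rewrite -[LHS]/(ev (Dv 0 p q u) s z w * ev (mono 1 i j) s z w + ev u s z w * ev (Dv 0 p q (mono 1 i j)) s z w).
 by rewrite u0 ev_Dv_mono [RHS]/= !ev_mono /= !ev_pw; ring.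
have D2 p q p' q' : ev (Dv 0 p q (Dv 0 p' q' (Mul u (mono 1 i j)))) t x y
  = ev u t x y * (ev (Dv 0 p q (mono (p' * i%:R) i.-1 j)) t x y + ev (Dv 0 p q (mono (q' * j%:R) i j.-1)) t x y).
 by rewrite (Dv_ext _ _ _ (D1 p' q')) -[LHS]/(ev (Dv 0 p q u) t x y * _ + ev u t x y * _) u0 mul0r add0r.
have Dt : ev (Et (Mul u (mono 1 i j))) t x y = ev (Et u) t x y * (x ^+ i * y ^+ j).
 rewrite -[LHS]/(ev (Et u) t x y * ev (mono 1 i j) t x y + ev u t x y * ev (Et (mono 1 i j)) t x y).
 by rewrite ev_Dv_mono ev_mono; ring.
rewrite -[LHS]/(ev (heat k (Mul u (mono 1 i j))) t x y + r * (ev u t x y * ev (mono 1 i j) t x y)) ev_heat /hop.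
rewrite !D2 !D1 Dt !ev_Dv_mono [ev (Mul u _) t x y]/= [ev (Mul u _) t x y]/= !ev_mono /= !ev_pw /=.
by case: j {D1 D2 Dt} => [|[|j]]; rewrite /= ?exprS; field.
Qed.

Definition back T : expr := Add (Cst T) (Mul (Cst (-1)) Vt).

(** The factor T - t imposes the terminal value zero, so that the approximation concerns the source
    alone. *)
Definition solvable (T r e : R) (k : prm) (H : expr) :=
 forall eta : R, 0 < eta -> exists2 w, is_poly w & forall t x y, 0 <= t <= T -> 0 <= y ->
  bd4 (Minus (heatr k r (Mul (back T) w)) H) t x y (eta * wt e x y).

Lemma solvable_ext T r e k H H' : (forall t x y, ev H t x y = ev H' t x y) -> solvable T r e k H -> solvable T r e k H'.
move=> E h eta /h[w pw' Hw]; exists w => // t x y tT y0.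
by apply: bd4_ext (Hw t x y tT y0) => s z v; rewrite !ev_Minus E.
Qed.

Lemma solvable_lin T r e c k H H' : solvable T r e k H -> solvable T r e k H' -> solvable T r e k (Add H (Mul (Cst c) H')).
move=> h h' eta eta0; have e1 : 0 < eta / 2 by rewrite divr_gt0.
have c1 : 0 < 8 * (`|c| + 1) by rewrite mulr_gt0// ltr_wpDl.
have [w pw' Hw] := h _ e1; have [w' pw'' Hw'] := h' (eta / (8 * (`|c| + 1))) ltac:(by rewrite divr_gt0).
exists (Add w (Mul (Cst c) w')) => [|t x y tT y0]; first by do !split.
have W := wt_gt0 e x y.
apply: (@bd4_ext (Add (Minus (heatr k r (Mul (back T) w)) H) (Mul (Cst c) (Minus (heatr k r (Mul (back T) w')) H')))) => [s z v|].
 by rewrite /=; ring.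
apply: (bd4_le _ (bd4_add (Hw t x y tT y0) (bd4_mul (A := `|c| + 1) _ (Hw' t x y tT y0)))).
 apply: eq_leW; field. by rewrite gt_eqF// ltr_wpDl.
by split; rewrite /= ?normr0 ?addr_ge0 ?lerDl.
Qed.

(** An index equal to 0 has no smaller predecessor, hence no induction hypothesis; the coefficient
    is then 0, the case set apart here. *)
Lemma solvable_add (T r e c : R) k H w i j :
 (forall i j, (forall m, solvable T r e k (Mul (pw (back T) m) (mono 1 i j))) -> solvable T r e k (Mul w (mono 1 i j))) ->
 solvable T r e k H -> (c != 0 -> forall m, solvable T r e k (Mul (pw (back T) m) (mono 1 i j))) ->
 solvable T r e k (Add H (Mul (Cst c) (Mul w (mono 1 i j)))).
move=> hw sH; have [->|c0] := eqVneq c 0; last by move=> /(_ isT) h; apply: solvable_lin => //; exact: hw.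
by move=> _; apply: solvable_ext sH => t x y; rewrite /= !ev_pw; ring.
Qed.

(* Truncated solution of the equation [- w' + kap w = s ^ m], [w(0) = 0], in powers of [s = T - t]. *)
Lemma back_solve (T r e kap : R) (k : prm) (K m : nat) : exists w, [/\ is_poly w, forall p q t x y, ev (Dv 0 p q w) t x y = 0,
  (forall i j, (forall m, solvable T r e k (Mul (pw (back T) m) (mono 1 i j))) -> solvable T r e k (Mul (Mul (back T) w) (mono 1 i j))) &
  forall t x y, ev (Et (Mul (back T) w)) t x y + kap * ev (Mul (back T) w) t x y =
   (T - t) ^+ m - m`!%:R / (m + K)`!%:R * kap ^+ K * (T - t) ^+ (m + K)].
elim: K m => [|K IH] m.
 exists (Cst 0); split => // [i j h|t x y].
  by apply: (solvable_ext _ (solvable_lin (-1) (h 0%N) (h 0%N))) => t x y; rewrite /= !ev_pw; ring.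
 by rewrite addn0 divff ?pnatr_eq0 -?lt0n ?fact_gt0// expr0 /=; ring.
have [w [pw' w0 hw E]] := IH m.+1; have m0 : m.+1%:R != 0 :> R by rewrite pnatr_eq0.
exists (Add (Mul (Cst (- m.+1%:R^-1)) (pw (back T) m)) (Mul (Cst (kap / m.+1%:R)) w)); split.
- by do !split => //; apply: poly_pw; do !split.
- by move=> p q t x y; rewrite /= w0 ev_Dv_pw /=; ring.
- move=> i j h; have h0 := solvable_lin (-1) (h 0%N) (h 0%N).
 apply: (solvable_ext _ (solvable_lin (kap / m.+1%:R) (solvable_lin (- m.+1%:R^-1) h0 (h m.+1)) (hw i j h))) => t x y.
 by rewrite /= !ev_pw /=; ring.
move=> t x y; have sm : (T - t) * (m%:R * (T - t) ^+ m.-1) = m%:R * (T - t) ^+ m.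
 by case: (m) => [|n]; rewrite ?mul0r ?mulr0// mulrCA -exprS.
transitivity (- m.+1%:R^-1 * (- (T - t) ^+ m - (T - t) * (m%:R * (T - t) ^+ m.-1) + kap * (T - t) ^+ m.+1)
 + kap / m.+1%:R * (ev (Et (Mul (back T) w)) t x y + kap * ev (Mul (back T) w) t x y)).
 by rewrite /= !ev_pw ev_Dv_pw /= !mulN1r [_ ^+ m.+1]exprS; ring.
rewrite E sm addnS addSn (factS m) (exprS kap) natrM; move: (_ ^+ (m + K).+1) (kap ^+ K) (_ ^+ m.+1) ((m + K).+1)`! (fact_gt0 (m + K).+1) => a b c n n0.
by rewrite -natr1 in m0 *; field; rewrite m0 pnatr_eq0 -lt0n n0.
Qed.

(** Lexicographic induction on (i, j). The diagonal part is an ordinary differential equation in T -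
    t, solved by a truncated series; the other monomials that this produces fall under the induction
    hypotheses. *)
Lemma solvable_mono (T r e : R) k m i j : 0 < T -> 0 < e -> solvable T r e k (Mul (pw (back T) m) (mono 1 i j)).
move=> T0 e0; elim/ltn_ind: i j m => i IHi; elim/ltn_ind => j IHj m eta eta0.
have [C C0 HC] : exists2 C, 0 < C & forall t x y, 0 <= t <= T -> 0 <= y -> bd4 (mono 1 i j) t x y (C * wt e x y).
 have pm : is_poly (mono (1 : R) i j) by do !split => //; apply: poly_pw. have [C1 C10 H1] := poly_subexp T pm e0.
 have [C2 C20 H2] := poly_subexp T (poly_Dv 0 1 0 pm) e0. have [C3 C30 H3] := poly_subexp T (poly_Dv 0 1 0 (poly_Dv 0 1 0 pm)) e0.
 have [C4 C40 H4] := poly_subexp T (poly_Dv 0 0 1 pm) e0.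
 exists (C1 + C2 + C3 + C4) => [|t x y tT y0]; first by rewrite !addr_gt0. have w0 := wt_gt0 e x y.
 split; [apply: (le_trans (H1 _ _ _ tT y0))|apply: (le_trans (H2 _ _ _ tT y0))
  |apply: (le_trans (H3 _ _ _ tT y0))|apply: (le_trans (H4 _ _ _ tT y0))]; rewrite ler_pM2r//; lra.
pose kap := r - pb k * j%:R; pose Z := `|kap| * T.
have Z0 : 0 <= Z by rewrite mulr_ge0// ltW.
(* The truncation error is at most a multiple of the K-th term of the exponential series of |kap|
   T. *)
have [K HK] : exists K, 4 * (m`!%:R * T ^+ m) * C * (Z ^+ K / K`!%:R) <= eta / 2.
 have /cvgrPdist_le/(_ (eta / 2 / (4 * (m`!%:R * T ^+ m) * C))) := cvg_series_cvg_0 (@is_cvg_series_exp_coeff R Z).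
 have p0 : 0 < 4 * (m`!%:R * T ^+ m) * C by rewrite !mulr_gt0 ?exprn_gt0// ltr0n fact_gt0.
 rewrite !divr_gt0// => /(_ isT)[K _ /(_ K (leqnn K))] /=. rewrite sub0r normrN => h; exists K; rewrite mulrC -ler_pdivlMr//.
 by apply: le_trans h; exact: ler_norm.
have [w [pw' w0 hw E]] := @back_solve T r e kap k K m.
pose S := Mul (back T) w.
have S0 p q t x y : ev (Dv 0 p q S) t x y = 0 by rewrite /= w0; ring.
have z0 : solvable T r e k (Cst 0).
 move=> et et0; exists (Cst 0) => // t x y _ _; apply: (@bd4_ext (Cst 0)) => [*|]; first by rewrite /=; ring.
 by apply: bd4_0; rewrite mulr_ge0// ltW// wt_gt0.
have p1 (l : nat) : (l != 0)%N -> (l.-1 < l)%N by rewrite ltn_predL lt0n.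
have nz (c : R) (l : nat) : c * l%:R != 0 -> (l != 0)%N by apply: contraNN => /eqP ->; rewrite mulr0.
have s1 := solvable_add (c := - (pl k ^+ 2 / 2 * i.-1%:R) * i%:R) (i := i.-2) (j := j.+1) hw z0
 (fun h m => IHi _ (leq_ltn_trans (leq_pred _) (p1 _ (nz _ _ h))) _ m).
have s2 := solvable_add (c := - (pr k * pl k * ps k * j%:R + pc k) * i%:R) (i := i.-1) (j := j) hw s1 (fun h m => IHi _ (p1 _ (nz _ _ h)) _ m).
have s3 := solvable_add (c := - pd k * i%:R) (i := i.-1) (j := j.+1) hw s2 (fun h m => IHi _ (p1 _ (nz _ _ h)) _ m).
have s4 := solvable_add (c := - (ps k ^+ 2 / 2 * j.-1%:R + pa k) * j%:R) (i := i) (j := j.-1) hw s3 (fun h m => IHj _ (p1 _ (nz _ _ h)) m).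
have [v pv Hv] := s4 (eta / 2) ltac:(by rewrite divr_gt0).
set H := Add (Add _ _) _ in Hv.
exists (Add (Mul w (mono 1 i j)) v) => [|t x y tT y0]; first by do !split => //; apply: poly_pw.
pose c := m`!%:R / (m + K)`!%:R * kap ^+ K.
apply: (@bd4_ext (Add (Mul (Mul (Cst (- c)) (pw (back T) (m + K))) (mono 1 i j))
  (Minus (heatr k r (Mul (back T) v)) H))) => [s z q|].
 have hE (u : expr) : ev (heatr k r u) s z q = ev (heat k u) s z q + r * ev u s z q by [].
 have -> : ev (Minus (heatr k r (Mul (back T) (Add (Mul w (mono 1 i j)) v))) (Mul (pw (back T) m) (mono 1 i j))) s z q
  = ev (heatr k r (Mul S (mono 1 i j))) s z q + ev (heatr k r (Mul (back T) v)) s z q - (T - s) ^+ m * (z ^+ i * q ^+ j).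
  rewrite ev_Minus; congr (_ - _); last by rewrite /= !ev_pw /= mulN1r; ring.
  have A s' z' q' : ev (Mul (back T) (Add (Mul w (mono 1 i j)) v)) s' z' q' = ev (Add (Mul S (mono 1 i j)) (Mul (back T) v)) s' z' q'.
   by rewrite /S; move: (back T) (mono _ _ _) => u u'; rewrite /=; ring.
  by rewrite !hE A (heat_ext k A); move: (Mul S _) (Mul (back T) v) => u u'; rewrite !ev_heat /hop /=; ring.
 rewrite -[LHS]/(- c * ev (pw (back T) (m + K)) s z q * ev (mono 1 i j) s z q + ev (Minus (heatr k r (Mul (back T) v)) H) s z q).
 rewrite ev_Minus (heatr_mono _ _ _ _ _ _ _ S0) -/kap E -/c; move: (ev (heatr _ _ _) _ _ _) => g.
 by rewrite /= !ev_pw /= mulN1r [q ^+ _.+1]exprS; ring.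
have c0 : `|- c| = m`!%:R / (m + K)`!%:R * `|kap| ^+ K by rewrite normrN normrM normrX ger0_norm// divr_ge0.
have Tt : 0 <= T - t by rewrite subr_ge0; case/andP: tT.
have tb : bd4 (Mul (Cst (- c)) (pw (back T) (m + K))) t x y (`|- c| * T ^+ (m + K)).
 have B0 : 0 <= `|- c| * T ^+ (m + K) by rewrite mulr_ge0// exprn_ge0// ltW.
 have Sx u v' s z a : ev (Dv 0 u v' (Mul (Cst (- c)) (pw (back T) (m + K)))) s z a = ev (Cst 0) s z a.
  by rewrite /= ev_Dv_pw /=; ring.
 split; last 3 first; rewrite ?(Dv_ext _ _ _ (Sx _ _)) ?Sx ?normr0//. rewrite /= ev_pw /= mulN1r normrM ler_wpM2l//.
 by rewrite ger0_norm ?exprn_ge0// lerXn2r ?nnegrE// ?(ltW T0)// lerBlDr lerDl; case/andP: tT.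
apply: bd4_le (bd4_add (bd4_mul tb (HC t x y tT y0)) (Hv t x y tT y0)); have W := wt_gt0 e x y.
have -> : 4 * (`|- c| * T ^+ (m + K) * (C * wt e x y)) + eta / 2 * wt e x y
  = (4 * T ^+ m * C * (m`!%:R / (m + K)`!%:R * Z ^+ K) + eta / 2) * wt e x y by rewrite c0 exprD exprMn; ring.
rewrite ler_pM2r// [leRHS](splitr eta) lerD2r; apply: le_trans HK.
have -> : 4 * (m`!%:R * T ^+ m) * C * (Z ^+ K / K`!%:R) = 4 * T ^+ m * C * (m`!%:R / K`!%:R * Z ^+ K) by ring.
apply: ler_wpM2l; first by rewrite !mulr_ge0 ?exprn_ge0// ltW.
rewrite ler_wpM2r ?exprn_ge0// ler_pM2l ?ltr0n ?fact_gt0// lef_pV2 ?posrE ?ltr0n ?fact_gt0// ler_nat.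
by elim: (m) => [//|l IH]; rewrite addSn factS (leq_trans IH)// leq_pmull.
Qed.

(* Multiplication of the source by each factor of a polynomial preserves solvability. *)
Lemma poly_solvable (T r e : R) k H : 0 < T -> 0 < e -> is_poly H -> solvable T r e k H.
move=> T0 e0 pH.
pose Q G := forall m i j, solvable T r e k (Mul (Mul (pw (back T) m) (mono 1 i j)) G).
suff h : forall G, Q G -> Q (Mul G H).
 have Q1 : Q (Cst 1).
  move=> m i j; apply: (solvable_ext _ (@solvable_mono T r e k m i j T0 e0)) => t x y. by rewrite /=; ring.
 by apply: (solvable_ext _ (h _ Q1 0%N 0%N 0%N)) => t x y; rewrite /=; ring.
have Qlin c G G' : Q G -> Q G' -> Q (Add G (Mul (Cst c) G')).
 move=> h h' m i j; apply: (solvable_ext _ (solvable_lin c (h m i j) (h' m i j))) => t x y.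
 by move: (pw _ _) (mono _ _ _) => u v; rewrite /=; ring.
have Qext G G' : (forall t x y, ev G t x y = ev G' t x y) -> Q G -> Q G'.
 move=> E h m i j; apply: (solvable_ext _ (h m i j)) => t x y.
 by rewrite -[LHS]/(ev (Mul (pw (back T) m) (mono 1 i j)) t x y * ev G t x y) E.
have Qx G : Q G -> Q (Mul G Vx).
 move=> h m i j; apply: (solvable_ext _ (h m i.+1 j)) => t x y. by move: (pw _ m) => u; rewrite /=; ring.
have Qy G : Q G -> Q (Mul G Vy).
 move=> h m i j; apply: (solvable_ext _ (h m i j.+1)) => t x y. by move: (pw _ m) => u; rewrite /=; ring.
have Qs G : Q G -> Q (Mul G (back T)).
 move=> h m i j; apply: (solvable_ext _ (h m.+1 i j)) => t x y. by move: (mono _ _ _) => u; rewrite /=; ring.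
have Q0 c G : Q G -> Q (Mul G (Cst c)).
 move=> h; apply: (Qext (Add G (Mul (Cst (c - 1)) G))); last exact: Qlin. by move=> t x y; rewrite /=; ring.
elim: H pH => //= [c||e1 h1 e2 h2|e1 h1 e2 h2].
- by move=> _ G; apply: Q0.
- move=> _ G h; apply: (Qext (Add (Mul G (Cst T)) (Mul (Cst (-1)) (Mul G (back T))))).
  by move=> t x y; rewrite /=; ring.
 by apply: Qlin; [exact: Q0 | exact: Qs].
- move=> [p1 p2] G h; apply: (Qext (Add (Mul G e1) (Mul (Cst 1) (Mul G e2)))).
  by move=> t x y; rewrite /=; ring.
 by apply: Qlin; [exact: h1 | exact: h2].
- move=> [p1 p2] G h; apply: (Qext (Mul (Mul G e1) e2)).
  by move=> t x y; rewrite /=; ring.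
 by apply: h2 => //; apply: h1.
Qed.

(** * Locally uniform limits and their derivatives *)

Section limits.
Implicit Types (V : nat -> fun3) (K : R -> set (R * R * R)) (D : set (R * R * R)).

Definition cau K V := forall X e : R, 0 < X -> 0 < e -> exists N, forall n m, (N <= n)%N -> (N <= m)%N ->
 forall t x y, K X (t, x, y) -> `|V n t x y - V m t x y| <= e.

Definition vlim V : fun3 := fun t x y => lim (V n t x y @[n --> \oo]).

Lemma cau_cvg K V X t x y : 0 < X -> cau K V -> K X (t, x, y) -> V n t x y @[n --> \oo] --> vlim V t x y.
move=> X0 c KX; suff : cvg (V n t x y @[n --> \oo]) by [].
apply/cauchy_cvgP/cauchyP; rewrite /cauchy_ex => e e0.
have [N HN] := c X (e / 2) X0 ltac:(by rewrite divr_gt0).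
exists (V N t x y); exists N => // n /= Nn.
rewrite /ball /=; apply: (@le_lt_trans _ _ (e / 2)); first exact: HN.
by rewrite ltr_pdivrMr// ltr_pMr// ltr1n.
Qed.

Lemma seq_le u (l e : R) N : u n @[n --> \oo] --> l -> (forall n, (N <= n)%N -> u n <= e) -> l <= e.
by move=> cv H; rewrite -(cvg_lim _ cv)//; apply: limr_le; [exact: cvgP cv | exists N].
Qed.

Lemma cau_lim K V (X e : R) : 0 < X -> 0 < e -> cau K V -> exists N, forall n, (N <= n)%N ->
 forall t x y, K X (t, x, y) -> `|V n t x y - vlim V t x y| <= e.
move=> X0 e0 c; have [N HN] := c X e X0 e0; exists N => n Nn t x y KX.
have cv := cau_cvg X0 c KX.
have cv' : `|V n t x y - V m t x y| @[m --> \oo] --> `|V n t x y - vlim V t x y|.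
 by apply: cvg_norm; apply: cvgB cv; exact: cvg_cst.
by apply: (seq_le (N := N) cv') => m Nm; exact: HN.
Qed.

(** Each point has a whole relative neighbourhood inside one member. Continuity and derivatives are
    local, so they pass to limits that are uniform on each member. *)
Definition exhausts K D := forall t x y, D (t, x, y) -> exists X d, [/\ 0 < X, 0 < d &
 forall s z w, D (s, z, w) -> `|s - t| <= d -> `|z - x| <= d -> `|w - y| <= d -> K X (s, z, w)].

Lemma cau_cont K D V : exhausts K D -> cau K V -> (forall n, continuous3_on D (V n)) -> continuous3_on D (vlim V).
move=> ex c cV; apply/cont3P => t x y Dp e e0.
have [X [d [X0 d0 HX]]] := ex t x y Dp.
have e3 : 0 < e / 3 by rewrite divr_gt0.
have [N HN] := cau_lim X0 e3 c.
have [d' d'0 Hd'] := (cont3P _ _).1 (cV N) t x y Dp _ e3.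
exists (Num.min d d'); first by rewrite lt_min d0.
move=> s z w Dq; rewrite !le_min => /andP[s1 s2] /andP[z1 z2] /andP[w1 w2].
have h1 := HN N (leqnn N) s z w (HX s z w Dq s1 z1 w1).
have K0 : K X (t, x, y) by apply: HX; rewrite ?subrr ?normr0// ltW.
have h2 := HN N (leqnn N) t x y K0; have h3 := Hd' s z w Dq s2 z2 w2.
by move: h1 h2 h3; rewrite !ler_norml; clear; lra.
Qed.

(* The increments of f n - f m are bounded by the mean value inequality. *)
Lemma lim_has_der (I : set R) f g (F G : R -> R) (x d : R) : (forall a b z, I a -> I b -> a <= z <= b -> I z) -> 0 < d -> I x ->
 (forall n z, I z -> has_der I (f n) z (g n z)) -> (forall z, I z -> `|z - x| <= d -> f n z @[n --> \oo] --> F z) ->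
 (forall e, 0 < e -> exists N, forall n, (N <= n)%N -> forall z, I z -> `|z - x| <= d -> `|g n z - G z| <= e) ->
 has_der I F x (G x).
move=> conv d0 Ix fg fF gG e e0.
have e8 : 0 < e / 8 by rewrite divr_gt0.
have [N HN] := gG _ e8; have [d' d'0 Hd'] := fg N x Ix _ e8.
have inc n a b : (N <= n)%N -> I a -> I b -> `|a - x| <= d -> `|b - x| <= d -> a < b ->
  `|(f n b - f N b) - (f n a - f N a)| <= e / 4 * (b - a).
 move=> Nn Ia Ib ad bd ab.
 have [|c /andP[ac cb] E] := @mvt_on I (fun z => f n z + -1 * f N z) (fun z => g n z + -1 * g N z) a b ab.
  by move=> w awb; have Iw := conv a b w Ia Ib awb; split => //; apply: has_derD; [|apply: has_derZ]; exact: fg.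
 have -> : f n b - f N b - (f n a - f N a) = f n b + -1 * f N b - (f n a + -1 * f N a) by ring.
 rewrite E normrM [`|b - a|]gtr0_norm ?subr_gt0// ler_pM2r ?subr_gt0//. have Ic : I c by apply: (conv a b) => //; rewrite ac cb.
 have cd : `|c - x| <= d by move: ad bd ac cb; rewrite !ler_norml; clear; lra.
 have h1 := HN n Nn c Ic cd; have h2 := HN N (leqnn N) c Ic cd. by move: h1 h2; rewrite !ler_norml; clear; lra.
exists (Num.min d d'); first by rewrite lt_min d0.
move=> z Iz; rewrite le_min => /andP[zd zd'].
have incz n : (N <= n)%N -> `|(f n z - f N z) - (f n x - f N x)| <= e / 4 * `|z - x|.
 move=> Nn; have xd : `|x - x| <= d by rewrite subrr normr0 ltW.
 have [zx|zx|->] := ltgtP z x; last by rewrite !subrr normr0 mulr0.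
  by rewrite distrC (distrC z) (gtr0_norm (x := x - z)) ?subr_gt0//; exact: inc.
 by rewrite (gtr0_norm (x := z - x)) ?subr_gt0//; exact: inc.
have xd : `|x - x| <= d by rewrite subrr normr0 ltW.
have incF : `|(F z - f N z) - (F x - f N x)| <= e / 4 * `|z - x|.
 have cv : `|(f n z - f N z) - (f n x - f N x)| @[n --> \oo] --> `|(F z - f N z) - (F x - f N x)|.
  by apply: cvg_norm; apply: cvgB; apply: cvgB; [exact: fF|exact: cvg_cst|exact: fF|exact: cvg_cst].
 by apply: (seq_le (N := N) cv) => n; exact: incz.
have h1 := Hd' z Iz zd'; have h2 := HN N (leqnn N) x Ix xd.
have h3 : `|(g N x - G x) * (z - x)| <= e / 8 * `|z - x| by rewrite normrM ler_wpM2r.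
have -> : F z - F x - G x * (z - x) = ((F z - f N z) - (F x - f N x))
 + ((f N z - f N x - g N x * (z - x)) + (g N x - G x) * (z - x)) by ring.
apply: (le_trans (ler_normD _ _)); have := ler_normD (f N z - f N x - g N x * (z - x)) ((g N x - G x) * (z - x)).
have := mulr_ge0 (ltW e0) (normr_ge0 (z - x)); move: incF h1 h3; clear; lra.
Qed.

(** The single parameter X bounds x and y; in [Kslab] it also keeps t at distance 1 / X from T, and
    in [Kopen] moreover y at distance 1 / X from 0. *)
Definition Kclos (T X : R) : set (R * R * R) := [set P | [/\ 0 <= P.1.1 <= T, `|P.1.2| <= X & 0 <= P.2 <= X]].
Definition Kslab (T X : R) : set (R * R * R) := [set P | [/\ 0 <= P.1.1 <= T - X^-1, `|P.1.2| <= X & 0 <= P.2 <= X]].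
Definition Kopen (T X : R) : set (R * R * R) := [set P | [/\ 0 <= P.1.1 <= T - X^-1, `|P.1.2| <= X & X^-1 <= P.2 <= X]].

Lemma exhausts_closed T : exhausts (Kclos T) (closed_slab T).
move=> t x y [/= tT y0]; exists (`|x| + y + 1), 1; split => //.
 by rewrite ltr_wpDl// addr_ge0.
move=> s z w [/= sT w0] _ hz hw; split => //=.
 have := ler_normD (z - x) x; rewrite subrK; move: hz y0; clear; lra.
by rewrite w0 /=; move: hw (normr_ge0 x); rewrite ler_norml; clear; lra.
Qed.

Lemma exhausts_slab T : exhausts (Kslab T) (slab T).
move=> t x y [/= /andP[t0 tT] y0].
have Tt : 0 < T - t by rewrite subr_gt0.
pose X := `|x| + y + 1 + 2 / (T - t).
have q0 : 0 < 2 / (T - t) by rewrite divr_gt0.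
have n0 := normr_ge0 x.
have X0 : 0 < X by rewrite /X; move: q0 n0 y0; clear; lra.
have iX : X^-1 <= (T - t) / 2.
 rewrite -[(T - t) / 2]invf_div lef_pV2 ?posrE// /X; move: n0 y0; clear; lra.
exists X, (Num.min 1 ((T - t) / 2)); split => //; first by rewrite lt_min ltr01 divr_gt0.
move=> s z w [/= /andP[s0 sT] w0]; rewrite !le_min => /andP[_ hs] /andP[hz _] /andP[hw _]; split => /=.
- by rewrite s0 /=; move: hs iX; rewrite ler_norml; clear; lra.
- by have := ler_normD (z - x) x; rewrite subrK /X; move: hz y0 q0; clear; lra.
- by rewrite w0 /= /X; move: hw n0 q0; rewrite ler_norml; clear; lra.
Qed.

Lemma exhausts_open T : exhausts (Kopen T) (open_slab T).
move=> t x y [/= tT y0].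
have [X [d [X0 d0 H]]] := @exhausts_slab T t x y (conj tT (ltW y0)).
have y2 : 0 < 2 / y by rewrite divr_gt0.
exists (X + 2 / y), (Num.min d (y / 2)); split; first exact: addr_gt0.
 by rewrite lt_min d0 divr_gt0.
move=> s z w [/= sT w0]; rewrite !le_min => /andP[hs _] /andP[hz _] /andP[hw hw'].
have [/= /andP[s0 sX] zX /andP[_ wX]] := H s z w (conj sT (ltW w0)) hs hz hw.
have iX : (X + 2 / y)^-1 <= X^-1 by rewrite lef_pV2 ?posrE ?addr_gt0// lerDl ltW.
have iy : (X + 2 / y)^-1 <= y / 2 by rewrite -[y / 2]invf_div lef_pV2 ?posrE ?addr_gt0// lerDr ltW.
split => /=.
- by rewrite s0 /=; move: sX iX; clear; lra.
- by move: zX y2; clear; lra.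
- by move: hw' iy wX y2; rewrite ler_norml => /andP[]; clear => *; apply/andP; split; lra.
Qed.

End limits.

(** * Regular data and the approximating sequence *)

Lemma ex_dxP g (x y : R) : ex_dx g x y -> has_der setT (fun z => g z y) x (dx g x y).
by move=> hd; apply/is_deriveP; rewrite /dx derive1E; apply: derivableP. Qed.

Lemma cont2_cont3 (T : R) (g : R -> R -> R) : continuous2_on half_plane g -> continuous3_on (closed_slab T) (fun _ => g).
move=> /subspace_continuousP H; apply/cont3P => t x y [/= tT y0] e e0.
have /cvgrPdist_le /(_ e e0) := H (x, y) y0.
rewrite near_withinE => /nbhs_ballP [d /= d0 Hd].
exists (d / 2); first by rewrite divr_gt0.
have hd : d / 2 < d by rewrite ltr_pdivrMr// ltr_pMr// ltr1n.
move=> s z w [/= sT w0] hs hz hw; rewrite distrC.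
by apply: (Hd (z, w)) => //; split; rewrite /ball /= distrC; exact: le_lt_trans hd.
Qed.

(** The source is given before T only; stopping its time argument at tau < T makes it continuous up
    to T. *)
Lemma cont3_freeze (T tau : R) v : 0 <= tau < T -> continuous3_on (slab T) v ->
 continuous3_on (closed_slab T) (fun t => v (Num.min t tau)).
move=> /andP[tau0 tauT] /cont3P H.
have inS t : 0 <= t -> 0 <= Num.min t tau < T by move=> t0; rewrite le_min t0 tau0 gt_min tauT orbT.
apply/cont3P => t x y [/= /andP[t0 tT] y0] e e0.
have [d d0 Hd] := H _ x y (conj (inS t t0) y0) e e0.
exists d => // s z w [/= /andP[s0 sT] w0] hs; apply: Hd; first by split => //; exact: inS.
apply: le_trans hs; rewrite !minEle; case: (leP s tau) => [sl|sl]; case: (leP t tau) => tl //;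
 rewrite !ler_norml; have := ler_norm (s - t); have := ler_norm (t - s); rewrite (distrC t s);
 have := normr_ge0 (s - t); move: sl tl; clear; move: (`|s - t|) => q *; lra.
Qed.

Lemma weight_le (L L' x y : R) : 0 < L -> L <= L' -> 0 <= y -> weight L x y <= 3 * weight L' x y.
move=> L0 LL y0.
have h (z : R) : 0 <= z -> z `^ L <= 1 + z `^ L'.
 move=> z0; have [z1|z1] := leP 1 z.
  by apply: (le_trans (ler_powR z1 LL)); rewrite lerDr.
 have : z `^ L <= 1 `^ L by apply: ge0_ler_powR; rewrite ?nnegrE ?(ltW L0) ?(ltW z1).
 by rewrite powR1 => h; apply: (le_trans h); rewrite lerDl powR_ge0.
have h1 := h `|x| (normr_ge0 x); have h2 := h y y0.
have := powR_ge0 `|x| L'; have := powR_ge0 y L'; rewrite /weight; move: h1 h2; clear.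
by move: (_ `^ _) (_ `^ _) (_ `^ _) (_ `^ _) => p q s u *; lra.
Qed.

Definition growth4 (Q : R -> Prop) (v v1 v2 v3 : fun3) := exists C L : R, [/\ 0 < C, 0 < L & forall t x y, Q t -> 0 <= y ->
  [/\ `|v t x y| <= C * weight L x y, `|v1 t x y| <= C * weight L x y,
    `|v2 t x y| <= C * weight L x y & `|v3 t x y| <= C * weight L x y]].

Lemma growth4_of (Q : R -> Prop) (v v1 v2 v3 : fun3) (C L C' L' : R) : 0 < C -> 0 < L -> 0 < C' -> 0 < L' ->
 (forall t x y, Q t -> 0 <= y -> [/\ `|v t x y| <= C * weight L x y,
   `|v1 t x y| <= C * weight L x y & `|v3 t x y| <= C * weight L x y]) ->
 (forall t x y, Q t -> 0 <= y -> `|v2 t x y| <= C' * weight L' x y) -> growth4 Q v v1 v2 v3.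
move=> C0 L0 C'0 L'0 H H'; pose M := L + L'.
exists (3 * (C + C')), M; split => [||t x y Qt y0]; [by rewrite mulr_gt0 ?addr_gt0|exact: addr_gt0|].
have w1 : weight L x y <= 3 * weight M x y by apply: weight_le => //; rewrite lerDl ltW.
have w2 : weight L' x y <= 3 * weight M x y by apply: weight_le => //; rewrite lerDr ltW.
have w0 : 0 <= weight M x y by rewrite /weight !addr_ge0 ?powR_ge0.
have e1 : C * weight L x y <= 3 * (C + C') * weight M x y.
 by move: w1 w0 C0 C'0; move: (weight _ _ _) (weight _ _ _) => u w; clear; nra.
have e2 : C' * weight L' x y <= 3 * (C + C') * weight M x y.
 by move: w2 w0 C0 C'0; move: (weight _ _ _) (weight _ _ _) => u w; clear; nra.
have [h0 h1 h3] := H t x y Qt y0; have h2 := H' t x y Qt y0.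
by split; [exact: le_trans e1|exact: le_trans e1|exact: le_trans e2|exact: le_trans e1].
Qed.

(** The case j = 0 of the hypotheses supplies the function and its first derivatives, the case j = 1
    its second x-derivative. *)
Lemma regular_terminal T alpha f h : regular_data T alpha f h ->
 data4 T (fun _ => f) (fun _ => dx f) (fun _ => dx (dx f)) (fun _ => dy f) /\
 growth4 (fun _ => True) (fun _ => f) (fun _ => dx f) (fun _ => dx (dx f)) (fun _ => dy f).
move=> [hf _ _]; have [_ [S0 [C [L [C0 L0 G]]]]] := hf 0%N isT.
have [ex [S1 [C' [L' [C'0 L'0 G']]]]] := hf 1%N isT.
case: S0 => c0 [e1 [c1 _] [c3 _]]; case: S1 => c2 _.
split.
 split; [split|split|..]; try exact: cont2_cont3.
 - by move=> t x y _ y0; apply: ex_dxP; exact: (ex 0%N).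
 - by move=> t x y _ y0; apply: ex_dxP; exact: (ex 1%N).
 - by move=> t x y _ y0; apply: derivable_onP; exact: (e1 x y y0).2.
apply: (growth4_of C0 L0 C'0 L'0) => t x y _ y0.
- by split; [exact: (G x y y0 0%N 0%N)|exact: (G x y y0 1%N 0%N)|exact: (G x y y0 0%N 1%N)].
- exact: (G' x y y0 0%N 0%N).
Qed.

Lemma regular_source T alpha f h : regular_data T alpha f h -> (forall tau, 0 <= tau < T -> data4 T (fun t => h (Num.min t tau))
   (fun t => Dx h (Num.min t tau)) (fun t => Dx (Dx h) (Num.min t tau)) (fun t => Dy h (Num.min t tau))) /\
 continuous3_on (slab T) h /\ growth4 (fun t => 0 <= t < T) h (Dx h) (Dx (Dx h)) (Dy h).
move=> [_ hh _]; have [_ [S0 [C [L [C0 L0 G]]]]] := hh 0%N isT.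
have [ex [S1 [C' [L' [C'0 L'0 G']]]]] := hh 1%N isT.
case: S0 => c0 [e1 [c1 _] [c3 _] _]; case: S1 => c2 _.
split; [|split => //].
 move=> tau tt; split; [split|split|..]; try exact: cont3_freeze.
 - move=> t x y /andP[t0 _] y0; apply: ex_dxP; apply: (ex 0%N) => //; split => //=.
  by case/andP: tt => ? ?; rewrite le_min t0 gt_min; apply/andP; split; [|apply/orP; right].
 - move=> t x y /andP[t0 _] y0; apply: ex_dxP; apply: (ex 1%N) => //; split => //=.
  by case/andP: tt => ? ?; rewrite le_min t0 gt_min; apply/andP; split; [|apply/orP; right].
 - move=> t x y /andP[t0 _] y0; apply: derivable_onP; apply: (e1 _ x y _).2; split => //=.
  by case/andP: tt => ? ?; rewrite le_min t0 gt_min; apply/andP; split; [|apply/orP; right].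
apply: (growth4_of C0 L0 C'0 L'0) => t x y tT y0.
- by split; [exact: (G t x y tT y0 0%N 0%N 0%N)|exact: (G t x y tT y0 0%N 1%N 0%N)|exact: (G t x y tT y0 0%N 0%N 1%N)].
- exact: (G' t x y tT y0 0%N 0%N 0%N).
Qed.

Lemma growth4_wt (Q : R -> Prop) (v v1 v2 v3 : fun3) (e : R) :
 0 < e -> growth4 Q v v1 v2 v3 -> exists2 C, 0 < C & forall t x y, Q t -> 0 <= y ->
  [/\ `|v t x y| <= C * wt e x y, `|v1 t x y| <= C * wt e x y, `|v2 t x y| <= C * wt e x y & `|v3 t x y| <= C * wt e x y].
move=> e0 [C [L [C0 L0 H]]]; have [C' C'0 H'] := @weight_subexp 0 L L0 e e0.
exists (C * C'); first exact: mulr_gt0.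
move=> t x y Qt y0.
have h : C * weight L x y <= C * C' * wt e x y.
 rewrite -mulrA ler_pM2l//; apply: le_trans (H' 0 x y _ y0); last by rewrite lexx. exact: ler_norm.
by have [h0 h1 h2 h3] := H t x y Qt y0; split; exact: le_trans h.
Qed.

Lemma dist4_bd4 P Q v v1 v2 v3 t x y A B :
 bd4 (Minus P Q) t x y A -> dist4 Q v v1 v2 v3 t x y B -> dist4 P v v1 v2 v3 t x y (A + B).
move=> [h0 h1 h2 h3] [k0 k1 k2 k3].
have tri (p q w : R) : `|p + -1 * q| <= A -> `|q - w| <= B -> `|p - w| <= A + B.
 by rewrite !ler_norml; clear; lra.
split; [apply: tri k0 => //|apply: tri k1|apply: tri k2|apply: tri k3].
- by have -> : ev (Ex P) t x y + -1 * ev (Ex Q) t x y = ev (Ex (Minus P Q)) t x y by rewrite /=; ring.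
- by have -> : ev (Ex (Ex P)) t x y + -1 * ev (Ex (Ex Q)) t x y = ev (Ex (Ex (Minus P Q))) t x y by rewrite /=; ring.
- by have -> : ev (Ey P) t x y + -1 * ev (Ey Q) t x y = ev (Ey (Minus P Q)) t x y by rewrite /=; ring.
Qed.

Lemma bd4_dist4 P Q v v1 v2 v3 w w1 w2 w3 (t x y A B D : R) : dist4 P v v1 v2 v3 t x y A -> dist4 Q w w1 w2 w3 t x y B ->
 `|v t x y - w t x y| <= D -> `|v1 t x y - w1 t x y| <= D -> `|v2 t x y - w2 t x y| <= D -> `|v3 t x y - w3 t x y| <= D ->
 bd4 (Minus P Q) t x y (A + B + D).
move=> [h0 h1 h2 h3] [k0 k1 k2 k3] d0 d1 d2 d3.
have tri (p q s z : R) : `|p - s| <= A -> `|q - z| <= B -> `|s - z| <= D -> `|p - q| <= A + B + D.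
 by rewrite !ler_norml; clear; lra.
split.
- by rewrite ev_Minus; apply: tri h0 k0 d0.
- have -> : ev (Ex (Minus P Q)) t x y = ev (Ex P) t x y - ev (Ex Q) t x y by rewrite /=; ring.
 exact: tri h1 k1 d1.
- have -> : ev (Ex (Ex (Minus P Q))) t x y = ev (Ex (Ex P)) t x y - ev (Ex (Ex Q)) t x y by rewrite /=; ring.
 exact: tri h2 k2 d2.
- have -> : ev (Ey (Minus P Q)) t x y = ev (Ey P) t x y - ev (Ey Q) t x y by rewrite /=; ring.
 exact: tri h3 k3 d3.
Qed.

(* On the last stretch of length del the profile dominates C / (e^2 del). *)
Lemma profile_ge (T eps C del t : R) : 0 <= C -> 0 < del -> T - del <= t -> t <= T ->
 eps + C / (expR 2 * del) <= profile T eps C del t.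
move=> C0 d0 tl tT; rewrite /profile lerD2l -expRD.
have -> : C / (expR 2 * del) = C / del * expR (- 2).
 by rewrite expRN; field; rewrite !gt_eqF ?expR_gt0.
rewrite ler_wpM2l ?divr_ge0 ?(ltW d0)// ler_expR.
have s1 : - 1 <= (t - T) / del by rewrite ler_pdivlMr// mulN1r; move: tl; clear; lra.
have s2 : expR ((t - T) / del) <= 1.
 by rewrite -expR0 ler_expR ler_pdivrMr// mul0r subr_le0.
by move: s1 s2; clear; lra.
Qed.

Definition tcut (T : R) (n : nat) : R := T - T / n.+1%:R.

Lemma tcutP (T : R) n : 0 < T -> 0 <= tcut T n < T.
move=> T0; have n0 : 0 < n.+1%:R :> R by rewrite ltr0n.
rewrite /tcut subr_ge0 ler_pdivrMr// ler_peMr ?ler1n ?(ltW T0)//=.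
by rewrite ltrBlDr ltrDl divr_gt0.
Qed.

Lemma tcut_le (T : R) n m : 0 < T -> (n <= m)%N -> tcut T n <= tcut T m.
move=> T0 nm; rewrite /tcut lerB// ler_wpM2l ?(ltW T0)// lef_pV2 ?posrE ?ltr0n//.
by rewrite ler_nat ltnS.
Qed.

Lemma approximant k (T r alpha : R) f h (e : R) n : 0 < T -> regular_data T alpha f h -> 0 < e -> exists U : expr, [/\ is_poly U,
 (forall x y, 0 <= y -> dist4 U (fun _ => f) (fun _ => dx f) (fun _ => dx (dx f)) (fun _ => dy f) T x y (n.+1%:R^-1 * wt e x y)) &
 forall t x y, 0 <= t <= T -> 0 <= y -> dist4 (heatr k r U) (fun t => h (Num.min t (tcut T n)))
   (fun t => Dx h (Num.min t (tcut T n))) (fun t => Dx (Dx h) (Num.min t (tcut T n)))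
   (fun t => Dy h (Num.min t (tcut T n))) t x y (n.+1%:R^-1 * wt e x y)].
move=> T0 rd e0; have [df gf] := regular_terminal rd; have [dh [_ gh]] := regular_source rd.
have n0 : 0 < n.+1%:R^-1 :> R by rewrite invr_gt0 ltr0n.
have sub (v v1 v2 v3 : fun3) (Q : R -> Prop) tau : (forall t, 0 <= t <= T -> Q (tau t)) -> growth4 Q v v1 v2 v3 ->
  [/\ subexp T (fun t => v (tau t)), subexp T (fun t => v1 (tau t)),
    subexp T (fun t => v2 (tau t)) & subexp T (fun t => v3 (tau t))].
 move=> Qt g; split => e' e'0; have [C C0 H] := growth4_wt e'0 g; exists C => // t x y tT y0;
  by case: (H (tau t) x y (Qt t tT) y0).
have [s0 s1 s2 s3] := sub _ _ _ _ _ id (fun _ _ => I) gf.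
have [|s0' s1' s2' s3'] := sub _ _ _ _ _ (fun t => Num.min t (tcut T n)) _ gh.
 by move=> t /andP[t0 tT]; have /andP[c0 c1] := tcutP n T0; rewrite le_min t0 c0 gt_min c1 orbT.
have [F pF HF] := poly_density T0 e0 n0 df s0 s1 s2 s3.
have n2 : 0 < n.+1%:R^-1 / 2 :> R by rewrite divr_gt0.
have [H pH HH] := poly_density T0 e0 n2 (dh _ (tcutP n T0)) s0' s1' s2' s3'.
have pS : is_poly (Minus H (heatr k r F)).
 exact: (conj pH (conj I (conj (poly_heat k pF) (conj I pF)))).
have [w pw' Hw] := poly_solvable r k T0 e0 pS n2.
have hE (u : expr) s z v : ev (heatr k r u) s z v = ev (heat k u) s z v + r * ev u s z v by [].
exists (Add F (Mul (back T) w)); split=> [|x y y0|t x y tT y0]; first by do !split.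
 have [|h0 h1 h2 h3] := HF T x y _ y0; first by rewrite lexx ltW. split.
 - by have -> : ev (Add F (Mul (back T) w)) T x y = ev F T x y by rewrite /=; ring.
 - by have -> : ev (Ex (Add F (Mul (back T) w))) T x y = ev (Ex F) T x y by rewrite /=; ring.
 - by have -> : ev (Ex (Ex (Add F (Mul (back T) w)))) T x y = ev (Ex (Ex F)) T x y by rewrite /=; ring.
 - by have -> : ev (Ey (Add F (Mul (back T) w))) T x y = ev (Ey F) T x y by rewrite /=; ring.
rewrite [_^-1]splitr mulrDl; apply: dist4_bd4 (HH t x y tT y0).
apply: bd4_ext (Hw t x y tT y0) => s z v; rewrite !ev_Minus.
have -> : ev (heatr k r (Add F (Mul (back T) w))) s z v = ev (heatr k r F) s z v + ev (heatr k r (Mul (back T) w)) s z v.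
 by move: (Mul (back T) w) => u; rewrite !hE !ev_heat /hop /=; ring.
by ring.
Qed.

(** Two frozen sources agree up to the smaller freezing time; afterwards their difference is merely
    bounded, on an interval of length T / (N + 1). A profile with del equal to this length turns
    that into a difference of order 1 / N between the solutions. *)
Lemma approximants (k : prm) (T r alpha : R) (f : R -> R -> R) (h : fun3)
  (e : R) : admissible k -> 0 < T -> regular_data T alpha f h -> 0 < e -> e * gain k T <= small_rate k T ->
 exists (U : nat -> expr) (C : R), [/\ 0 < C, (forall n, is_poly (U n)),
  (forall n x y, 0 <= y -> `|ev (U n) T x y - f x y| <= n.+1%:R^-1 * wt e x y) &
  (forall n t x y, 0 <= t < T -> 0 <= y -> `|ev (heatr k r (U n)) t x y - h t x y|
    <= (n.+1%:R^-1 + (if t <= tcut T n then 0 else C)) * wt e x y)] /\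
 forall N n m, (N <= n)%N -> (N <= m)%N -> (forall t x y, 0 <= t <= T -> 0 <= y ->
    bd4 (Minus (U n) (U m)) t x y (C / N.+1%:R * wt (e * gain k T ^+ 2) x y)) /\
  (forall t x y, 0 <= t <= tcut T N -> 0 <= y -> bd4 (heatr k r (Minus (U n) (U m))) t x y (2 / N.+1%:R * wt e x y)).
move=> ak T0 rd e0 es; have [U HU] := choice (fun n => approximant k r n T0 rd e0).
have [_ [_ gh]] := regular_source rd; have [Ch Ch0 HCh] := growth4_wt e0 gh.
have [C0 C00 HC0] := @apriori4 k T r e ak (ltW T0) e0 es.
have E2 : 0 < expR 2 :> R by exact: expR_gt0.
pose C := (2 + 2 * Ch * expR 2 * T) * C0 + 2 * Ch.
have C0' : 0 < C by rewrite addr_gt0 ?mulr_gt0// addr_gt0 ?mulr_gt0.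
have inv0 n : 0 < n.+1%:R^-1 :> R by rewrite invr_gt0 ltr0n.
have inv_le (N n : nat) : (N <= n)%N -> n.+1%:R^-1 <= N.+1%:R^-1 :> R.
 by move=> Nn; rewrite lef_pV2 ?posrE ?ltr0n// ler_nat ltnS.
have minT t n : 0 <= t <= T -> 0 <= Num.min t (tcut T n) < T.
 by move=> /andP[t0 _]; have /andP[c0 c1] := tcutP n T0; rewrite le_min t0 c0 gt_min c1 orbT.
have W x y := wt_gt0 e x y.
exists U, C; split; first split => //.
- by move=> n; case: (HU n).
- by move=> n x y y0; case: (HU n) => _ /(_ x y y0) [].
- move=> n t x y /andP[t0 tT] y0; have tT' : 0 <= t <= T by rewrite t0 ltW.
 case: (HU n) => _ _ /(_ t x y tT' y0) [q0 _ _ _].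
 have [tc|ct] := leP t (tcut T n); first by rewrite addr0; rewrite (min_l tc) in q0.
 have [p0 _ _ _] := HCh (Num.min t (tcut T n)) x y (minT t n tT') y0. have [p1 _ _ _] := HCh t x y ltac:(by rewrite t0) y0.
 have : `|ev (heatr k r (U n)) t x y - h t x y| <= n.+1%:R^-1 * wt e x y + (Ch * wt e x y + Ch * wt e x y).
  have tri (u v w A B : R) : `|u - v| <= A -> `|v| <= B -> `|w| <= B -> `|u - w| <= A + (B + B).
   by rewrite !ler_norml; clear; lra.
  exact: tri q0 p0 p1.
 move=> hh; apply: (le_trans hh); rewrite -!mulrDl ler_wpM2r ?(ltW (W x y))// lerD2l.
 have P0 : 0 <= (2 + 2 * Ch * expR 2 * T) * C0 by rewrite ltW// mulr_gt0// addr_gt0// !mulr_gt0.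
 by rewrite /C; move: P0; clear; lra.
have src N n m t x y D : (N <= n)%N -> (N <= m)%N -> 0 <= t <= T -> 0 <= y ->
  `|h (Num.min t (tcut T n)) x y - h (Num.min t (tcut T m)) x y| <= D ->
  `|Dx h (Num.min t (tcut T n)) x y - Dx h (Num.min t (tcut T m)) x y| <= D ->
  `|Dx (Dx h) (Num.min t (tcut T n)) x y - Dx (Dx h) (Num.min t (tcut T m)) x y| <= D ->
  `|Dy h (Num.min t (tcut T n)) x y - Dy h (Num.min t (tcut T m)) x y| <= D ->
  bd4 (heatr k r (Minus (U n) (U m))) t x y (2 / N.+1%:R * wt e x y + D).
 move=> Nn Nm tT y0 d0 d1 d2 d3. have [_ _ /(_ t x y tT y0) h1] := HU n; have [_ _ /(_ t x y tT y0) h2] := HU m.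
 apply: (@bd4_ext (Minus (heatr k r (U n)) (heatr k r (U m)))) => [s z v|].
  by move: (U n) (U m) => u u'; rewrite /=; ring.
 apply: bd4_le (bd4_dist4 h1 h2 d0 d1 d2 d3); rewrite lerD2r -mulrDl ler_wpM2r ?(ltW (W x y))//.
 by have := inv_le _ _ Nn; have := inv_le _ _ Nm; clear; move: (n.+1%:R^-1) (m.+1%:R^-1) (N.+1%:R^-1) => a b c; lra.
have src0 N n m t x y : (N <= n)%N -> (N <= m)%N -> 0 <= t <= tcut T N -> 0 <= y ->
  bd4 (heatr k r (Minus (U n) (U m))) t x y (2 / N.+1%:R * wt e x y).
 move=> Nn Nm /andP[t0 tc] y0; have /andP[_ cT] := tcutP N T0.
 have tn : Num.min t (tcut T n) = t by apply: min_l; apply: le_trans tc _; exact: tcut_le.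
 have tm : Num.min t (tcut T m) = t by apply: min_l; apply: le_trans tc _; exact: tcut_le. rewrite -[_ * wt _ _ _]addr0.
 by apply: src => //; rewrite ?tn ?tm ?subrr ?normr0// t0 (le_trans tc)// ltW.
move=> N n m Nn Nm; split; last by move=> t x y; exact: src0.
have del0 : 0 < T / N.+1%:R by rewrite divr_gt0.
have pU j : is_poly (U j) by case: (HU j).
move=> t x y tT y0.
have eps0 : 0 < 2 / N.+1%:R :> R by rewrite divr_gt0.
(* By [profile_ge] the profile then exceeds 2 Ch on the last interval, where this is the bound for
   the difference of the sources. *)
pose Cc := 2 * Ch * (expR 2 * (T / N.+1%:R)).
have Cc0 : 0 <= Cc by rewrite /Cc ltW// !mulr_gt0.
have pm : is_poly (Minus (U n) (U m)) by do !split.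
apply: bd4_le (HC0 _ _ _ _ pm eps0 Cc0 del0 _ _ t x y tT y0).
- have -> : (2 / N.+1%:R + Cc) * (C0 * wt (e * gain k T ^+ 2) x y)
  = (2 + 2 * Ch * expR 2 * T) * C0 / N.+1%:R * wt (e * gain k T ^+ 2) x y by rewrite /Cc; ring.
 rewrite ler_pM2r ?wt_gt0// ler_pM2r// /C lerDl. by rewrite mulr_ge0 ?(ltW Ch0).
- move=> x' y' y'0; have [_ h1 _] := HU n; have [_ h2 _] := HU m.
 rewrite -[_ * wt _ _ _]addr0. have b := bd4_dist4 (D := 0) (h1 x' y' y'0) (h2 x' y' y'0).
 apply: bd4_le (b _ _ _ _); rewrite ?subrr ?normr0//. rewrite !addr0 -mulrDl ler_wpM2r ?(ltW (W _ _))//.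
 by have := inv_le _ _ Nn; have := inv_le _ _ Nm; clear; move: (n.+1%:R^-1) (m.+1%:R^-1) (N.+1%:R^-1) => a b c; lra.
- move=> s x' y' /andP[s0 sT] y'0; have [sc|cs] := leP s (tcut T N).
  apply: bd4_le (src0 N n m s x' y' Nn Nm _ y'0); last by rewrite s0. rewrite ler_wpM2r ?(ltW (W _ _))// /profile lerDl.
  apply: mulr_ge0; first by apply: divr_ge0 => //; exact: ltW. by apply: mulr_ge0; exact: expR_ge0.
 have sT' : 0 <= s <= T by rewrite s0 ltW. have [p0 p1 p2 p3] := HCh (Num.min s (tcut T n)) x' y' (minT s n sT') y'0.
 have [q0 q1 q2 q3] := HCh (Num.min s (tcut T m)) x' y' (minT s m sT') y'0.
 have dd (u v : R) : `|u| <= Ch * wt e x' y' -> `|v| <= Ch * wt e x' y' -> `|u - v| <= 2 * Ch * wt e x' y'.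
  by rewrite !ler_norml; clear; lra.
 apply: bd4_le (src N n m s x' y' _ Nn Nm sT' y'0 (dd _ _ p0 q0) (dd _ _ p1 q1) (dd _ _ p2 q2) (dd _ _ p3 q3)).
 rewrite -mulrDl ler_wpM2r ?(ltW (W _ _))//. apply: le_trans (profile_ge _ Cc0 del0 (ltW cs) (ltW sT)); rewrite lerD2l /Cc.
 by rewrite mulfK// gt_eqF// mulr_gt0.
Qed.

(** * Convergence of the derivatives and the limit solution *)

Lemma inv_le (e : R) : 0 < e -> exists N, forall n, (N <= n)%N -> n.+1%:R^-1 <= e.
move=> e0; exists (Num.truncn e^-1) => n Nn.
rewrite -[e]invrK lef_pV2 ?posrE ?invr_gt0 ?ltr0n// ltW// (lt_le_trans (truncnS_gt _))//.
by rewrite ler_nat.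
Qed.

(** The curves p, q, s let one statement serve for the derivatives in t, in x and in y. *)
Lemma lim_der K V V' (I : set R) (X x d : R) p q s :
 (forall a b z, I a -> I b -> a <= z <= b -> I z) -> 0 < X -> 0 < d -> I x -> cau K V -> cau K V' ->
 (forall z, I z -> `|z - x| <= d -> K X (p z, q z, s z)) ->
 (forall n z, I z -> has_der I (fun z => V n (p z) (q z) (s z)) z (V' n (p z) (q z) (s z))) ->
 has_der I (fun z => vlim V (p z) (q z) (s z)) x (vlim V' (p x) (q x) (s x)).
move=> conv X0 d0 Ix c c' KX hd.
apply: (@lim_has_der I (fun n z => V n (p z) (q z) (s z)) (fun n z => V' n (p z) (q z) (s z))
  _ (fun z => vlim V' (p z) (q z) (s z)) x d conv d0 Ix hd).
 by move=> z Iz zd; apply: cau_cvg X0 c (KX z Iz zd).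
move=> e e0; have [N HN] := cau_lim X0 e0 c'; exists N => n Nn z Iz zd.
exact: HN n Nn _ _ _ (KX z Iz zd).
Qed.

Section cauchy_derivatives.
Variables (k : prm) (T r : R) (U : nat -> expr).
Let V D n := ev (D (U n)).
Hypotheses (ak : admissible k) (small : forall X e : R, 0 < X -> 0 < e -> exists N, forall n m, (N <= n)%N -> (N <= m)%N ->
  (forall t x y, Kclos T X (t, x, y) -> bd4 (Minus (U n) (U m)) t x y e) /\
  forall t x y, Kslab T X (t, x, y) -> bd4 (heatr k r (Minus (U n) (U m))) t x y e).

Lemma slab_closed X : 0 < X -> Kslab T X `<=` Kclos T X.
move=> X0 [[t x] y] [/= /andP[t0 tX] xX yX]; split => //=; rewrite t0 (le_trans tX)// gerBl.
by rewrite invr_ge0 ltW.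
Qed.

Lemma cau_slab v : cau (Kclos T) v -> cau (Kslab T) v.
by move=> c X e X0 e0; have [N H] := c X e X0 e0; exists N => n m Nn Nm t x y /(slab_closed X0); exact: H.
Qed.

(** On [Kopen] the factor y is at least 1 / X. *)
Lemma cau_open v : cau (Kslab T) (fun n t x y => y * v n t x y) -> cau (Kopen T) v.
move=> c X e X0 e0; have [N H] := c X (X^-1 * e) X0 ltac:(by rewrite mulr_gt0 ?invr_gt0).
exists N => n m Nn Nm t x y [/= tX xX /andP[Xy yX]]; have iX : 0 < X^-1 by rewrite invr_gt0.
have y0 := lt_le_trans iX Xy; have := H n m Nn Nm t x y; rewrite -mulrBr normrM (gtr0_norm y0) => h.
rewrite -(ler_pM2l iX); apply: le_trans (ler_wpM2r (normr_ge0 _) Xy) (h _).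
by split; rewrite //= ltW.
Qed.

Lemma cauD K (v v' : nat -> fun3) : cau K v -> cau K v' -> cau K (fun n t x y => v n t x y + v' n t x y).
move=> c c' X e X0 e0; have e2 : 0 < e / 2 by rewrite divr_gt0.
have [N H] := c X _ X0 e2; have [N' H'] := c' X _ X0 e2; exists (maxn N N') => n m.
rewrite !geq_max => /andP[n1 n2] /andP[m1 m2] t x y KX; rewrite opprD addrACA [e]splitr.
by apply: le_trans (ler_normD _ _) (lerD (H n m n1 m1 t x y KX) (H' n m n2 m2 t x y KX)).
Qed.

Lemma cau_affine (c1 c2 : R) v : cau (Kslab T) v -> cau (Kslab T) (fun n t x y => (c1 + c2 * y) * v n t x y).
move=> c X e X0 e0; pose B := `|c1| + `|c2| * X + 1.
have B0 : 0 < B by rewrite ltr_wpDl// addr_ge0// mulr_ge0// ltW.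
have [N H] := c X (e / B) X0 ltac:(by rewrite divr_gt0); exists N => n m Nn Nm t x y KX.
rewrite -mulrBr normrM -(divfK (lt0r_neq0 B0) e) mulrC ler_pM ?H//.
case: KX => /= _ _ /andP[y0 yX]; apply: le_trans (ler_normD _ _) _.
by rewrite /B normrM (ger0_norm y0) -addrA lerD2l ler_wpDr// ler_wpM2l.
Qed.

Lemma cau_first : [/\ cau (Kclos T) (V id), cau (Kclos T) (V Ex), cau (Kclos T) (V (fun e => Ex (Ex e))) &
 cau (Kclos T) (V Ey)] /\ cau (Kslab T) (fun n => ev (heatr k r (U n))).
split; [split|]; move=> X e X0 e0; have [N H] := small X0 e0; exists N => n m Nn Nm t x y KX; have [H1 H2] := H n m Nn Nm.
- by have [q _ _ _] := H1 t x y KX; move: q; congr (`|_| <= _); rewrite /V /=; ring.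
- by have [_ q _ _] := H1 t x y KX; move: q; congr (`|_| <= _); rewrite /V /=; ring.
- by have [_ _ q _] := H1 t x y KX; move: q; congr (`|_| <= _); rewrite /V /=; ring.
- by have [_ _ _ q] := H1 t x y KX; move: q; congr (`|_| <= _); rewrite /V /=; ring.
- by have [q _ _ _] := H2 t x y KX; move: q; congr (`|_| <= _); rewrite /=; ring.
Qed.

(** The y-derivative of a difference solves the equation of [pshift] with a source controlled
    through [bd4], so [gradient_bound] controls y times its gradient. *)
Lemma cau_degenerate : cau (Kslab T) (fun n t x y => y * V (fun e => Ex (Ey e)) n t x y) /\
 cau (Kslab T) (fun n t x y => y * V (fun e => Ey (Ey e)) n t x y).
have l0 : 0 < pl k by case: ak.
suff h (X e : R) : 0 < X -> 0 < e -> exists N, forall n m, (N <= n)%N -> (N <= m)%N -> forall t x y, Kslab T X (t, x, y) ->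
  y * `|ev (Ex (Ey (Minus (U n) (U m)))) t x y| <= e /\ y * `|ev (Ey (Ey (Minus (U n) (U m)))) t x y| <= e.
 split=> X e X0 e0; have [N H] := h X e X0 e0; exists N => n m Nn Nm t x y KX;
  have y0 : 0 <= y by [case: KX => _ _ /andP[]]; have [q1 q2] := H n m Nn Nm t x y KX.
 + by move: q1; rewrite -{1}(ger0_norm y0) -normrM; congr (`|_| <= _); rewrite /V /=; ring.
 + by move: q2; rewrite -{1}(ger0_norm y0) -normrM; congr (`|_| <= _); rewrite /V /=; ring.
(* With these X1 and tau the cylinder on which [gradient_bound] requires its hypotheses lies inside
   [Kslab T X1]. *)
move=> X0 e0; pose X1 := 2 * X + 4 * pl k; pose tau := (2 * X)^-1.
have tau0 : 0 < tau by rewrite invr_gt0 mulr_gt0.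
have [G G0 HG] := gradient_bound (admissible_shift ak) X0 tau0.
pose Q := 1 + `|r| + pl k ^+ 2 / 2 + `|pd k| + `|pb k|.
have sq0 : 0 <= pl k ^+ 2 / 2 by rewrite divr_ge0 ?sqr_ge0.
have Q1 : 1 <= Q by rewrite /Q -!addrA lerDl !addr_ge0.
have Q0 : 0 < Q by exact: lt_le_trans Q1.
have X10 : 0 < X1 by rewrite /X1; lra.
pose e' := e / (G * Q); have e'0 : 0 < e' by rewrite divr_gt0// mulr_gt0.
have [N H] := small X10 e'0.
exists N => n m Nn Nm; move: (H n m Nn Nm); move: (Minus _ _) => D [H1 H2] t x y [/= /andP[t0 tX] xX /andP[y0 yX]].
have [yp|y0'] := ltP 0 y; last first.
 by have -> : y = 0 by [apply/le_anti; rewrite y0 y0']; rewrite !mul0r ltW.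
have eE : e = G * (Q * e') by rewrite /e'; field; rewrite !gt_eqF.
rewrite eE; apply: HG => // [|s z w hs hz hw]; first exact: mulr_gt0.
have K1 : Kslab T X1 (s, z, w).
 have iX : X1^-1 <= tau by rewrite lef_pV2 ?posrE ?mulr_gt0// /X1; lra.
 have Xt : X^-1 = tau + tau by rewrite /tau; field; rewrite gt_eqF.
 move: hs hz hw xX; rewrite /X1 /= => /andP[h1 h2] h3 /andP[h4 h5] h6; split => /=.
 - by rewrite (le_trans t0 h1) /=; move: tX; rewrite Xt; lra.
 - by have := ler_normD (z - x) x; rewrite subrK /=; lra.
 - by rewrite h4 /=; lra.
have [a0 a1 a2 a3] := H1 s z w (slab_closed X10 K1); have [b0 b1 b2 b3] := H2 s z w K1.
split; first by apply: le_trans a3 _; rewrite ler_peMl// ltW.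
have -> : ev (heat (pshift k) (Ey D)) s z w = ev (Ey (heatr k r D)) s z w + - (r * ev (Ey D) s z w)
 + - (pl k ^+ 2 / 2 * ev (Ex (Ex D)) s z w) + - (pd k * ev (Ex D) s z w) + pb k * ev (Ey D) s z w.
 have -> : ev (Ey (heatr k r D)) s z w = ev (Ey (heat k D)) s z w + r * ev (Ey D) s z w.
  by rewrite -[LHS]/(ev (Ey (heat k D)) s z w + (0 * ev D s z w + r * ev (Ey D) s z w)); ring.
 by rewrite ev_heat_Ey; ring.
have m1 (u v : R) : `|v| <= e' -> `|u * v| <= `|u| * e' by move=> hv; rewrite normrM ler_wpM2l.
have h1 := m1 r _ a3; have h2 := m1 (pl k ^+ 2 / 2) _ a2; have h3 := m1 (pd k) _ a1; have h4 := m1 (pb k) _ a3.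
rewrite (ger0_norm sq0) in h2.
rewrite /Q !mulrDl mul1r.
by do ![apply: le_trans (ler_normD _ _) _; apply: lerD; rewrite ?normrN //].
Qed.

(** The equation expresses the time derivative through sequences already known to converge, the
    mixed and the second y-derivative occurring with the factor y. *)
Lemma cau_time : cau (Kslab T) (V Et).
have [[c0 c1 c2 c3] c4] := cau_first; have [c5 c6] := cau_degenerate.
have aff c c' v cv := @cau_affine c c' v cv.
have := cauD c4 (cauD (aff (- r) 0 _ (cau_slab c0)) (cauD (aff 0 (- (pl k ^+ 2 / 2)) _ (cau_slab c2))
 (cauD (aff (- (pr k * pl k * ps k)) 0 _ c5) (cauD (aff (- (ps k ^+ 2 / 2)) 0 _ c6)
 (cauD (aff (- pc k) (- pd k) _ (cau_slab c1)) (aff (- pa k) (pb k) _ (cau_slab c3))))))).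
congr cau; apply/funext => n; do 3![apply/funext => ?].
rewrite -[ev (heatr _ _ _) _ _ _]/(ev (heat k (U n)) _ _ _ + r * ev (U n) _ _ _) ev_heat /hop /V; by field.
Qed.

End cauchy_derivatives.

Lemma cau_sub (K K' : R -> set (R * R * R)) V : (forall X, 0 < X -> K X `<=` K' X) -> cau K' V -> cau K V.
move=> KK c X e X0 e0; have [N HN] := c X e X0 e0; exists N => n m Nn Nm t x y /(KK X X0).
exact: HN.
Qed.

Lemma has_der_eq_on (I : set R) f g x a : (forall z, I z -> f z = g z) -> I x -> has_der I f x a -> has_der I g x a.
by move=> fg Ix H e /H[d d0 Hd]; exists d => // z Iz; rewrite -!fg//; apply: Hd. Qed.

Lemma has_der_dx g x y a : has_der setT (fun z => g z y) x a -> ex_dx g x y /\ dx g x y = a.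
move=> /is_deriveP h; split; first exact: ex_derive.
by rewrite /dx derive1E; exact: derive_val.
Qed.

Lemma has_der_dy g (x y a : R) : 0 <= y -> has_der `[0, +oo[ (g x) y a -> ex_dy g x y /\ dy g x y = a.
move=> y0; apply: has_der_on => d d0; exists (y + d); split.
- by rewrite /= in_itv /= andbT addr_ge0 ?(ltW d0).
- by rewrite -subr_eq0 addrAC subrr add0r gt_eqF.
- by rewrite addrAC subrr add0r ger0_norm ?(ltW d0).
Qed.

Lemma has_der_dt (T : R) u (t x y a : R) : 0 <= t < T ->
 has_der `[0, T[ (fun s => u s x y) t a -> ex_dt T u t x y /\ Dt T u t x y = a.
move=> /andP[t0 tT]; apply: has_der_on => d d0.
have p : 0 < Num.min d ((T - t) / 2) by rewrite lt_min d0 divr_gt0 ?subr_gt0.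
exists (t + Num.min d ((T - t) / 2)); split.
- rewrite /= in_itv /= addr_ge0 ?(ltW p)//=.
 have : Num.min d ((T - t) / 2) <= (T - t) / 2 by rewrite ge_min lexx orbT. by move: tT; clear; lra.
- by rewrite -subr_eq0 addrAC subrr add0r gt_eqF.
- by rewrite addrAC subrr add0r ger0_norm ?(ltW p)// ge_min lexx.
Qed.

Lemma cont3_eq_on (D : set (R * R * R)) u v :
 (forall t x y, D (t, x, y) -> u t x y = v t x y) -> continuous3_on D u -> continuous3_on D v.
move=> uv /cont3P H; apply/cont3P => t x y Dp e e0; have [d d0 Hd] := H t x y Dp e e0.
by exists d => // s z w Dq; rewrite -!uv//; apply: Hd.
Qed.

Lemma cont3_subset (D D' : set (R * R * R)) (u : fun3) : D `<=` D' -> continuous3_on D' u -> continuous3_on D u.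
move=> DD /cont3P H; apply/cont3P => t x y /DD Dp e e0; have [d d0 Hd] := H t x y Dp e e0.
by exists d => // s z w /DD; apply: Hd.
Qed.

Section limit_solution.
Variables (k : prm) (T r : R) (f : R -> R -> R) (h : fun3) (U : nat -> expr).
Let V D n := ev (D (U n)).
Hypotheses (T0 : 0 < T) (c0 : cau (Kclos T) (V id)) (c1 : cau (Kclos T) (V Ex))
 (c2 : cau (Kclos T) (V (fun e => Ex (Ex e)))) (c3 : cau (Kclos T) (V Ey))
 (c12 : cau (Kopen T) (V (fun e => Ex (Ey e)))) (c33 : cau (Kopen T) (V (fun e => Ey (Ey e)))) (ct : cau (Kslab T) (V Et))
 (terminal : forall x y, 0 <= y -> ev (U n) T x y @[n --> \oo] --> f x y) (source : forall t x y, 0 <= t < T -> 0 <= y ->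
   ev (heatr k r (U n)) t x y @[n --> \oo] --> h t x y).

Lemma open_slab_sub X : 0 < X -> Kopen T X `<=` Kslab T X.
move=> X0 [[t x] y] [/= tX xX /andP[yX yX']]; split => //=; rewrite yX' andbT.
by apply: le_trans yX; rewrite invr_ge0 ltW.
Qed.

Let cs v : cau (Kclos T) v -> cau (Kslab T) v := @cau_slab T v.
Let co v : cau (Kslab T) v -> cau (Kopen T) v := cau_sub open_slab_sub.

Let convT : forall a b z : R, [set: R] a -> [set: R] b -> a <= z <= b -> [set: R] z.
by []. Qed.

Let convY : forall a b z : R, [set` `[0, +oo[] a -> [set` `[0, +oo[] b -> a <= z <= b -> [set` `[0, +oo[] z.
by move=> a b z; rewrite /= !in_itv /= !andbT => a0 _ /andP[az _]; exact: le_trans az. Qed.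

Let convS : forall a b z : R, [set` `[0, T[] a -> [set` `[0, T[] b -> a <= z <= b -> [set` `[0, T[] z.
move=> a b z; rewrite /= !in_itv /= => /andP[a0 _] /andP[_ bT] /andP[az zb].
by rewrite (le_trans a0 az) (le_lt_trans zb bT).
Qed.

Lemma limit_x D D' K S t x y : exhausts K S -> cau K (V D) -> cau K (V D') ->
 (forall e t x y, ev (D' e) t x y = ev (Ex (D e)) t x y) -> (forall z, S (t, z, y)) ->
 has_der setT (fun z => vlim (V D) t z y) x (vlim (V D') t x y).
move=> ex c c' DD St; have [X [d [X0 d0 H]]] := ex t x y (St x).
apply: (@lim_der K (V D) (V D') setT X x d (fun _ => t) id (fun _ => y) convT X0 d0 I c c').
 by move=> z _ zx; apply: H; rewrite ?subrr ?normr0 ?(ltW d0)//; exact: St.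
by move=> n z _; rewrite /V DD; exact: ev_has_derx.
Qed.

Lemma limit_y D D' K S t x y d' : exhausts K S -> cau K (V D) -> cau K (V D') -> 0 < d' -> 0 <= y ->
 (forall e t x y, ev (D' e) t x y = ev (Ey (D e)) t x y) -> (forall w, 0 <= w -> `|w - y| <= d' -> S (t, x, w)) ->
 has_der `[0, +oo[ (vlim (V D) t x) y (vlim (V D') t x y).
move=> ex c c' d'0 y0 DD St.
have [|X [d [X0 d0 H]]] := ex t x y; first by apply: St; rewrite // subrr normr0 ltW.
apply: (@lim_der K (V D) (V D') _ X y (Num.min d d') (fun _ => t) (fun _ => x) id convY X0 _ _ c c').
- by rewrite lt_min d0.
- by rewrite /= in_itv /= y0.
- move=> w; rewrite /= in_itv /= andbT le_min => w0 /andP[wd wd'].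
 by apply: H; rewrite ?subrr ?normr0 ?(ltW d0)//; exact: St.
- by move=> n w _; rewrite /V DD; exact: ev_has_dery.
Qed.

Lemma limit_t t x y : slab T (t, x, y) -> has_der `[0, T[ (fun s => vlim (V id) s x y) t (vlim (V Et) t x y).
move=> /[dup] [[/= tT y0]] St; have [X [d [X0 d0 H]]] := exhausts_slab St.
apply: (@lim_der (Kslab T) (V id) (V Et) _ X t d id (fun _ => x) (fun _ => y) convS X0 d0 _ (cs c0) ct).
- by rewrite /= in_itv.
- move=> s; rewrite /= in_itv /= => sT st.
 by apply: H; rewrite ?subrr ?normr0 ?(ltW d0).
- by move=> n s _; exact: ev_has_dert.
Qed.

Variable u : fun3.
Hypothesis uE : forall t x y, 0 <= t <= T -> 0 <= y -> u t x y = vlim (V id) t x y.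

Lemma DxE (t x y : R) : 0 <= t <= T -> 0 <= y -> ex_dx (u t) x y /\ Dx u t x y = vlim (V Ex) t x y.
move=> tT y0; apply: has_der_dx.
apply: (@has_der_eq_on _ (fun z => vlim (V id) t z y)) => // [z _|]; first by rewrite uE.
exact: (@limit_x id Ex _ _ t x y (@exhausts_closed T) c0 c1 (fun _ _ _ _ => erefl) (fun _ => conj tT y0)).
Qed.

Lemma DyE (t x y : R) : 0 <= t <= T -> 0 <= y -> ex_dy (u t) x y /\ Dy u t x y = vlim (V Ey) t x y.
move=> tT y0; apply: has_der_dy => //.
apply: (@has_der_eq_on _ (vlim (V id) t x)) => [w||].
- by rewrite /= in_itv /= andbT => w0; rewrite uE.
- by rewrite /= in_itv /= y0.
- by apply: (limit_y (@exhausts_closed T) c0 c3 ltr01).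
Qed.

Lemma DtE (t x y : R) : 0 <= t < T -> 0 <= y -> ex_dt T u t x y /\ Dt T u t x y = vlim (V Et) t x y.
move=> tT y0; apply: has_der_dt => //.
apply: (@has_der_eq_on _ (fun s => vlim (V id) s x y)) => [s||].
- by rewrite /= in_itv /= => /andP[s0 sT]; rewrite uE// s0 ltW.
- by rewrite /= in_itv /=.
- by apply: limit_t.
Qed.

Lemma DxDxE (t x y : R) : 0 <= t <= T -> 0 <= y -> ex_dx (Dx u t) x y /\ Dx (Dx u) t x y = vlim (V (fun e => Ex (Ex e))) t x y.
move=> tT y0; apply: has_der_dx.
apply: (@has_der_eq_on _ (fun z => vlim (V Ex) t z y)) => // [z _|]; first by case: (DxE z tT y0).
exact: (@limit_x Ex _ _ _ t x y (@exhausts_closed T) c1 c2 (fun _ _ _ _ => erefl) (fun _ => conj tT y0)).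
Qed.

Let half (y : R) : 0 < y -> 0 < y / 2 /\ forall w, `|w - y| <= y / 2 -> 0 < w.
by move=> y0; split; [rewrite divr_gt0|move=> w; rewrite ler_norml; move: y0; lra]. Qed.

Lemma DyDxE (t x y : R) : 0 <= t < T -> 0 < y -> ex_dy (Dx u t) x y /\ Dy (Dx u) t x y = vlim (V (fun e => Ex (Ey e))) t x y.
move=> tT y0; apply: has_der_dy; first exact: ltW.
have tT' : 0 <= t <= T by case/andP: tT => -> /ltW.
apply: (@has_der_eq_on _ (vlim (V Ex) t x)) => [w||].
- by rewrite /= in_itv /= andbT => w0; case: (DxE x tT' w0).
- by rewrite /= in_itv /= ltW.
have [d0 H] := half y0.
apply: (limit_y (@exhausts_open T) (co (cs c1)) c12 d0 (ltW y0)).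
 by move=> e s z w; rewrite Dv_comm.
by move=> w w0 /H.
Qed.

Lemma DxDyE (t x y : R) : 0 <= t < T -> 0 < y -> ex_dx (Dy u t) x y /\ Dx (Dy u) t x y = vlim (V (fun e => Ex (Ey e))) t x y.
move=> tT y0; apply: has_der_dx; have tT' : 0 <= t <= T by case/andP: tT => -> /ltW.
apply: (@has_der_eq_on _ (fun z => vlim (V Ey) t z y)) => // [z _|].
 by case: (DyE z tT' (ltW y0)).
exact: (@limit_x Ey _ _ _ t x y (@exhausts_open T) (co (cs c3)) c12 (fun _ _ _ _ => erefl) (fun _ => conj tT y0)).
Qed.

Lemma DyDyE (t x y : R) : 0 <= t < T -> 0 < y -> ex_dy (Dy u t) x y /\ Dy (Dy u) t x y = vlim (V (fun e => Ey (Ey e))) t x y.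
move=> tT y0; apply: has_der_dy; first exact: ltW.
have tT' : 0 <= t <= T by case/andP: tT => -> /ltW.
apply: (@has_der_eq_on _ (vlim (V Ey) t x)) => [w||].
- by rewrite /= in_itv /= andbT => w0; case: (DyE x tT' w0).
- by rewrite /= in_itv /= ltW.
have [d0 H] := half y0.
by apply: (limit_y (@exhausts_open T) (co (cs c3)) c33 d0 (ltW y0)) => // w w0 /H.
Qed.

Lemma limit_classical : classical_solution T (pa k) (pb k) (pc k) (pd k) r (pl k) (ps k) (pr k) f h u.
have vC D S K : exhausts K S -> cau K (V D) -> continuous3_on S (vlim (V D)).
 by move=> ex c; apply: (cau_cont ex c) => n; exact: ev_cont3.
have os : open_slab T `<=` slab T by move=> [[t x] y] [/= tT y0]; split => //=; exact: ltW.
have sc : slab T `<=` closed_slab T by move=> [[t x] y] [/= /andP[t0 tT] y0]; split => //=; rewrite t0 ltW.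
have C0 : continuous3_on (closed_slab T) u.
 apply: (@cont3_eq_on _ (vlim (V id))) (vC id _ _ (@exhausts_closed T) c0). by move=> t x y [/= tT y0]; rewrite uE.
have C1 : continuous3_on (slab T) (Dx u).
 apply: (@cont3_eq_on _ (vlim (V Ex))) (vC Ex _ _ (@exhausts_slab T) (cs c1)). by move=> t x y /sc[/= tT y0]; case: (DxE x tT y0).
have C3 : continuous3_on (slab T) (Dy u).
 apply: (@cont3_eq_on _ (vlim (V Ey))) (vC Ey _ _ (@exhausts_slab T) (cs c3)). by move=> t x y /sc[/= tT y0]; case: (DyE x tT y0).
have Ct : continuous3_on (slab T) (Dt T u).
 apply: (@cont3_eq_on _ (vlim (V Et))) (vC Et _ _ (@exhausts_slab T) ct). by move=> t x y [/= tT y0]; case: (DtE x tT y0).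
split; [| |exact: C0| |].
- split; first exact: (cont3_subset os (cont3_subset sc C0)).
 have exd t x y : open_slab T (t, x, y) -> [/\ 0 <= t < T, 0 < y, 0 <= t <= T & 0 <= y].
  by move=> [/= /andP[t0 tT] y0]; split; rewrite ?t0 ?(ltW tT)// ltW.
 split.
 + by move=> t x y /exd[tT y0 tT' y0']; split; [exact: (DxE x tT' y0').1|exact: (DyE x tT' y0').1].
 + split; first exact: cont3_subset os C1.
  split; [| | |exact: I].
  * by move=> t x y /exd[tT y0 tT' y0']; split; [exact: (DxDxE x tT' y0').1|exact: (DyDxE x tT y0).1].
  * split; [|exact: I]; apply: (@cont3_eq_on _ (vlim (V (fun e => Ex (Ex e))))) (vC _ _ _ (@exhausts_open T) (co (cs c2))).
   by move=> t x y /exd[tT y0 tT' y0']; case: (DxDxE x tT' y0').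
  * split; [|exact: I]; apply: (@cont3_eq_on _ (vlim (V (fun e => Ex (Ey e))))) (vC _ _ _ (@exhausts_open T) c12).
   by move=> t x y /exd[tT y0 tT' y0']; case: (DyDxE x tT y0).
 + split; first exact: cont3_subset os C3.
  split; [| | |exact: I].
  * by move=> t x y /exd[tT y0 tT' y0']; split; [exact: (DxDyE x tT y0).1|exact: (DyDyE x tT y0).1].
  * split; [|exact: I]; apply: (@cont3_eq_on _ (vlim (V (fun e => Ex (Ey e))))) (vC _ _ _ (@exhausts_open T) c12).
   by move=> t x y /exd[tT y0 tT' y0']; case: (DxDyE x tT y0).
  * split; [|exact: I]; apply: (@cont3_eq_on _ (vlim (V (fun e => Ey (Ey e))))) (vC _ _ _ (@exhausts_open T) c33).
   by move=> t x y /exd[tT y0 tT' y0']; case: (DyDyE x tT y0).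
 + split; first by move=> t x y /exd[tT y0 tT' y0']; exact: (DtE x tT y0').1.
  by split => //; exact: cont3_subset os Ct.
- split => //; first exact: cont3_subset sc C0.
 move=> t x y [/= tT y0]; have tT' : 0 <= t <= T by case/andP: tT => -> /ltW.
 by split; [exact: (DtE x tT y0).1|exact: (DxE x tT' y0).1|exact: (DyE x tT' y0).1].
- move=> t x y tT y0; have tT' : 0 <= t <= T by case/andP: tT => -> /ltW.
 have [X [d [X0 d0 H]]] := exhausts_slab (t := t) (x := x) (y := y) (conj tT y0).
 have KX : Kslab T X (t, x, y) by apply: H; rewrite ?subrr ?normr0 ?(ltW d0).
 have l0 := cau_cvg X0 (cs c0) KX; have l1 := cau_cvg X0 (cs c1) KX.
 have l2 := cau_cvg X0 (cs c2) KX; have l3 := cau_cvg X0 (cs c3) KX; have lt := cau_cvg X0 ct KX.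
 pose A n := y / 2 * (pl k ^+ 2 * ev (Ex (Ex (U n))) t x y + 2 * pr k * pl k * ps k * ev (Ex (Ey (U n))) t x y
  + ps k ^+ 2 * ev (Ey (Ey (U n))) t x y).
 have lA : A n @[n --> \oo] --> y / 2 * (pl k ^+ 2 * Dx (Dx u) t x y + 2 * pr k * pl k * ps k * Dx (Dy u) t x y
  + ps k ^+ 2 * Dy (Dy u) t x y).
  have [yp|y0'] := ltP 0 y; last first.
   have y00 : y = 0 by apply/eqP; rewrite eq_le y0 y0'. have -> : A = (fun _ => 0) by apply/funext => n; rewrite /A y00 !mul0r.
   by rewrite y00 !mul0r; exact: cvg_cst.
  have [X' [d' [X'0 d'0 H']]] := exhausts_open (t := t) (x := x) (y := y) (conj tT yp).
  have KX' : Kopen T X' (t, x, y) by apply: H'; rewrite ?subrr ?normr0 ?(ltW d'0).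
  have l12 := cau_cvg X'0 c12 KX'; have l33 := cau_cvg X'0 c33 KX'.
  rewrite (DxDxE x tT' y0).2 (DxDyE x tT yp).2 (DyDyE x tT yp).2.
  by apply: cvgM; [exact: cvg_cst|apply: cvgD; [apply: cvgD|]; apply: cvgM => //; exact: cvg_cst].
 have L : ev (heatr k r (U n)) t x y @[n --> \oo] --> Dt T u t x y + generator (pa k) (pb k) (pc k) (pd k)
   (pl k) (ps k) (pr k) u t x y + r * u t x y.
  rewrite /generator (DtE x tT y0).2 (DxE x tT' y0).2 (DyE x tT' y0).2 (uE x tT' y0).
  have -> : (fun n => ev (heatr k r (U n)) t x y) = (fun n => V Et n t x y + (A n + (pc k + pd k * y) * V Ex n t x y
    + (pa k - pb k * y) * V Ey n t x y) + r * V id n t x y).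
   apply/funext => n; rewrite -[LHS]/(ev (heat k (U n)) t x y + r * ev (U n) t x y) ev_heat /hop. by rewrite /V /A.
  apply: cvgD; last by apply: cvgM => //; exact: cvg_cst.
  apply: cvgD => //; apply: cvgD; last by apply: cvgM => //; exact: cvg_cst.
  by apply: cvgD => //; apply: cvgM => //; exact: cvg_cst.
 by rewrite -(cvg_lim _ L)//; apply: cvg_lim => //; exact: source.
- move=> x y y0; have TT : 0 <= T <= T by rewrite lexx ltW.
 by rewrite uE//; apply: cvg_lim => //; exact: terminal.
Qed.

End limit_solution.

(** The rate is lowered so that it fits [small_rate] after the multiplications by [gain]. The
    conclusion is stated for every u that agrees with the limit on the closed slab, since the
    expectation has unrelated values elsewhere; the polynomials are returned because the
    probabilistic part passes to the limit along them. *)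
Theorem analytic_solution (T a b c d r lam sig rho alpha e : R) (f : R -> R -> R) (h : fun3) : let k := Prm a b c d lam sig rho in
 admissible k -> 0 < T -> regular_data T alpha f h -> 0 < e -> exists (U : nat -> expr) (C : R) (w : fun3),
 [/\ 0 < C /\ (forall n, is_poly (U n)), (forall n x y, 0 <= y -> `|ev (U n) T x y - f x y| <= n.+1%:R^-1 * wt e x y),
  (forall n t x y, 0 <= t < T -> 0 <= y -> `|ev (heatr k r (U n)) t x y - h t x y|
    <= (n.+1%:R^-1 + (if t <= tcut T n then 0 else C)) * wt e x y),
  (forall t x y, 0 <= t <= T -> 0 <= y -> ev (U n) t x y @[n --> \oo] --> w t x y) &
  forall u, (forall t x y, 0 <= t <= T -> 0 <= y -> u t x y = w t x y) -> classical_solution T a b c d r lam sig rho f h u].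
move=> k ak T0 rd e0.
have sr := small_rate_gt0 T ak; have G1 := gain_ge1 k (ltW T0).
set G := gain k T in G1 *; have G0 : 0 < G by exact: lt_le_trans G1.
have GG : G <= G ^+ 2 by rewrite expr2 ler_peMr ?(ltW G0).
pose e' := Num.min e (small_rate k T / (2 * G ^+ 2)).
have e'0 : 0 < e' by rewrite lt_min e0 divr_gt0// mulr_gt0// exprn_gt0.
have e'G : e' * G ^+ 2 <= small_rate k T / 2.
 apply: (@le_trans _ _ (small_rate k T / (2 * G ^+ 2) * G ^+ 2)).
  by rewrite ler_wpM2r ?exprn_ge0 ?(ltW G0)// ge_min lexx orbT.
 by apply: eq_leW; field; rewrite gt_eqF.
have e'e : e' <= e by rewrite ge_min lexx.
have es : e' * gain k T <= small_rate k T.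
 have : e' * G <= e' * G ^+ 2 by rewrite ler_pM2l. by move: e'G sr; rewrite -/G; clear; lra.
have [U [C [[C0 pU term src] cauchy]]] := approximants r ak T0 rd e'0 es.
have small X eta : 0 < X -> 0 < eta -> exists N, forall n m, (N <= n)%N -> (N <= m)%N ->
  (forall t x y, Kclos T X (t, x, y) -> bd4 (Minus (U n) (U m)) t x y eta) /\
  forall t x y, Kslab T X (t, x, y) -> bd4 (heatr k r (Minus (U n) (U m))) t x y eta.
 move=> X0 eta0; pose E := expR (e' * G ^+ 2 * (X + X)); have E0 : 0 < E := expR_gt0 _.
 have CE : 0 < (C + 2) * E by rewrite mulr_gt0// addr_gt0.
 have [N1 h1] := @inv_le (eta / ((C + 2) * E)) ltac:(by rewrite divr_gt0).
 have [N2 h2] := @inv_le (X^-1 / T) ltac:(by rewrite divr_gt0// invr_gt0).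
 exists (maxn N1 N2) => n m Nn Nm; have [H1 H2] := cauchy _ n m Nn Nm.
 have {}h1 := h1 _ (leq_maxl N1 N2); have {}h2 := h2 _ (leq_maxr N1 N2).
 move: (maxn _ _) h1 h2 H1 H2 => N h1 h2 H1 H2; set i := N.+1%:R^-1 in h1 h2 H1 H2. have i0 : 0 <= i by rewrite invr_ge0.
 have le (c1 v : R) x y : 0 <= c1 <= C + 2 -> `|x| <= X -> 0 <= y <= X -> wt v x y <= wt (e' * G ^+ 2) x y ->
   c1 * i * wt v x y <= eta.
  move=> /andP[c10 c1C] xX /andP[y0 yX] wv; rewrite ler_pdivlMr// in h1; apply: le_trans h1.
  rewrite [leRHS]mulrCA -mulrA; apply: ler_pM => //; first by rewrite mulr_ge0// ltW// wt_gt0.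
  rewrite ler_wpM2l//; apply: le_trans wv _. by rewrite ler_expR ler_wpM2l ?mulr_ge0 ?exprn_ge0 ?(ltW e'0) ?(ltW G0)// lerD.
 split=> t x y [/= tT xX yX]; have y0 : 0 <= y by case/andP: yX.
  apply: bd4_le (H1 t x y tT y0); apply: (le C (e' * G ^+ 2)) => //. by rewrite (ltW C0) lerDl ler0n.
 apply: bd4_le (H2 t x y _ y0).
  apply: (le 2 e') => //; first by rewrite ler0n lerDr ltW. by apply: le_wt => //; rewrite ler_peMr ?(ltW e'0)// (le_trans G1 GG).
 case/andP: tT => -> /le_trans; apply; rewrite /tcut lerD2l lerN2. by rewrite -ler_pdivlMl// mulrC.
pose V (D : expr -> expr) n := ev (D (U n)).
have [[c0 c1 c2 c3] _] := cau_first small; have ct := cau_time ak small.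
have [/cau_open c12 /cau_open c33] := cau_degenerate ak small.
have iN n : 0 <= n.+1%:R^-1 :> R by rewrite invr_ge0.
have to0 (u : nat -> R) (l W : R) : (forall n, `|u n - l| <= n.+1%:R^-1 * W) -> u n @[n --> \oo] --> l.
 move=> H; apply/cvgrPdist_le => eps eps0; have W1 : 0 < `|W| + 1 by rewrite ltr_wpDl.
 have [N HN] := @inv_le (eps / (`|W| + 1)) ltac:(by rewrite divr_gt0).
 exists N => // n /HN h1; rewrite distrC; apply: (le_trans (H n)); rewrite ler_pdivlMr// in h1.
 by apply: le_trans h1; rewrite ler_wpM2l// (le_trans (ler_norm _))// lerDl.
have lterm x y : 0 <= y -> ev (U n) T x y @[n --> \oo] --> f x y.
 by move=> y0; apply: (to0 _ _ (wt e' x y)) => n; exact: term.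
have lsrc t x y : 0 <= t < T -> 0 <= y -> ev (heatr k r (U n)) t x y @[n --> \oo] --> h t x y.
 move=> tT y0; have Tt : 0 < T - t by rewrite subr_gt0; case/andP: tT.
 have [N HN] := @inv_le ((T - t) / T) ltac:(by rewrite divr_gt0). rewrite -(cvg_shiftn N); apply: (to0 _ _ (wt e' x y)) => n /=.
 have tc : t <= tcut T (n + N)%N.
  by rewrite /tcut lerBrDr addrC -lerBrDr -ler_pdivlMl// mulrC HN// leq_addl.
 apply: (le_trans (src (n + N)%N t x y tT y0)); rewrite tc addr0 ler_wpM2r ?(ltW (wt_gt0 _ _ _))//.
 by rewrite lef_pV2 ?posrE ?ltr0n// ler_nat ltnS leq_addr.
have ww x y : 0 <= y -> wt e' x y <= wt e x y by exact: le_wt.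
exists U, C, (vlim (V id)); split => //.
- by move=> n x y y0; apply: (le_trans (term n x y y0)); rewrite ler_wpM2l// ww.
- move=> n t x y tT y0; apply: (le_trans (src n t x y tT y0)); rewrite ler_wpM2l ?ww//.
 by apply: addr_ge0 => //; case: ifP => // _; exact: ltW.
- move=> t x y tT y0; have [X [d' [X0 d0 H]]] := exhausts_closed (t := t) (x := x) (y := y) (conj tT y0).
 by apply: (cau_cvg X0 c0); apply: H; rewrite ?subrr ?normr0 ?(ltW d0).
by move=> u uE; have := limit_classical T0 c0 c1 c2 c3 c12 c33 ct lterm lsrc uE.
Qed.

(** * Gaussian increments, independence and expectations *)

Section density.
Local Open Scope ereal_scope.
Context d (T : measurableType d).
Variables (m m' : {measure set T -> \bar R}) (g : T -> R).
Hypotheses (mg : mfun g) (g0 : forall x, (0 <= g x)%R) (m'E : forall A, measurable A -> m' A = \int[m]_(x in A) (g x)%:E).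
Import HBNNSimple.

Let density_nnsfun (h : {nnsfun T >-> R}) : \int[m']_x (h x)%:E = \int[m]_x ((h x)%:E * (g x)%:E).
under [LHS]eq_integral do rewrite fimfunE -fsumEFin//.
rewrite [LHS]ge0_integral_fsum//; last 2 first.
 - by move=> r; exact/measurable_EFinP/measurableT_comp.
 - by move=> n x _; rewrite EFinM nnfun_muleindic_ge0.
under [RHS]eq_integral.
 move=> x xD; rewrite fimfunE -fsumEFin// muleC ge0_mule_fsumr; last first.
  by move=> r; rewrite EFinM nnfun_muleindic_ge0.
 over.
rewrite [RHS]ge0_integral_fsum//; last 2 first.
 - move=> r; apply/measurable_EFinP/measurable_funM => //.
  by do 2 apply/measurableT_comp => //.
 - by move=> n x _; apply: mule_ge0; [rewrite lee_fin|rewrite EFinM nnfun_muleindic_ge0].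
apply: eq_fsbigr => r _.
have mA : measurable (h @^-1` [set r]) by [].
rewrite integralZl_indic_nnsfun// integral_indic// setIT m'E//.
have [r0|r0] := ltP r 0%R.
 have -> : h @^-1` [set r] = set0.
  by apply/seteqP; split => // x /= hx; move: r0; rewrite -hx ltNge => /negP[]; exact: fun_ge0.
 by rewrite integral_set0 mule0 integral0_eq// => x _; rewrite indicE in_set0 mulr0 mule0.
rewrite -ge0_integralZl//; last 2 first.
- exact/measurable_EFinP/measurable_funTS.
- by move=> x _; rewrite lee_fin.
rewrite integral_mkcond; apply: eq_integral => x _; rewrite /patch indicE.
by case: ifP => _; rewrite ?mulr1 ?mulr0 ?mule0// muleC.
Qed.

Lemma ge0_integral_density (f : T -> \bar R) : mfun f -> (forall x, 0 <= f x) -> \int[m']_x f x = \int[m]_x (f x * (g x)%:E).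
move=> mf f0; pose f_ := nnsfun_approx measurableT mf.
transitivity (limn (fun n => \int[m']_x (f_ n x)%:E)).
 rewrite -monotone_convergence//=.
 - by apply: eq_integral => x _; apply/esym/cvg_lim => //=; exact: cvg_nnsfun_approx.
 - by move=> n; exact/measurable_EFinP.
 - by move=> n x _; rewrite lee_fin.
 - by move=> x _ a b ab; rewrite lee_fin//; exact/lefP/nd_nnsfun_approx.
under eq_fun do rewrite density_nnsfun.
rewrite -monotone_convergence//=.
- apply: eq_integral => x _; apply/cvg_lim => //=.
 by apply: cvgeZr => //; exact: cvg_nnsfun_approx.
- by move=> n; apply: emeasurable_funM; exact/measurable_EFinP.
- by move=> n x _; rewrite mule_ge0 ?lee_fin.
- by move=> x _ a b ab; rewrite lee_wpmul2r ?lee_fin//; exact/lefP/nd_nnsfun_approx.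
Qed.

End density.

(** Completing the square: the weighted density is the normal density of mean u s^2. *)
Lemma normal_mgf (s u : R) : 0 < s -> (\int[normal_prob 0 s]_x (expR (u * x - u ^+ 2 * s ^+ 2 / 2))%:E = 1)%E.
move=> s0; have sn : s != 0 by rewrite gt_eqF.
rewrite (@ge0_integral_density _ _ leb _ (normal_pdf 0 s)) //; first last.
- apply/measurable_EFinP/measurableT_comp => //; apply: measurable_funB => //.
- exact: normal_pdf_ge0.
- exact: measurable_normal_pdf.
rewrite -(integral_normal_pdf (u * s ^+ 2) s); apply: eq_integral => x _.
rewrite !normal_pdfE// /normal_fun -EFinM mulrCA -expRD; congr (_ * expR _)%:E.
by rewrite mulr2n; field; rewrite sn.
Qed.

Definition mean (disp : measure_display) (Omega : measurableType disp)
  (P : probability Omega R) (phi : Omega -> R) : \bar R := (\int[P]_w (phi w)%:E)%E.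
Notation EE P phi := (mean P phi%R).

Section gauss.
Context (disp : measure_display) (Omega : measurableType disp).
Variables (P : probability Omega R) (G : set (set Omega)) (s : R) (xi eta : Omega -> R).
Hypotheses (sG : sigma_algebra setT G) (Gm : G `<=` measurable) (s0 : 0 < s) (mxi : mfun xi) (meta : mfun eta)
 (ind : forall (A : set Omega) (U V : set R), G A -> measurable U -> measurable V ->
   (P (A `&` xi @^-1` U `&` eta @^-1` V) = P A * normal_prob 0 s U * normal_prob 0 s V)%E).

(** The sample space with G as its sigma-algebra: measurability with respect to G becomes ordinary
    measurability, and independence becomes a property of the joint law with the identity map. *)
Let OG := g_sigma_algebraType G.
Let idG (w : Omega) : OG := w.

Lemma measurable_GE (A : set Omega) : (measurable : set (set OG)) A <-> G A.
by rewrite -[X in _ <-> X A](sigma_algebra_id sG). Qed.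

Lemma measurable_wrtP Z : measurable_wrt G Z <-> mfun (Z : OG -> R).
split=> [h _ U mU|h U mU]; first by rewrite setTI; apply/measurable_GE; exact: h.
by have := h measurableT U mU; rewrite setTI => /measurable_GE.
Qed.

Let midG : mfun idG.
by move=> _ A /measurable_GE /Gm mA; rewrite setTI. Qed.

Lemma measurable_wrt_fun (Z : Omega -> R) : measurable_wrt G Z -> mfun Z.
by move=> /measurable_wrtP h; exact: (measurableT_comp h midG). Qed.

Let RM := measurableTypeR R.
Let N : probability RM R := normal_prob 0 s.
Let idGm : {mfun Omega >-> OG} := HB.pack idG (isMeasurableFun.Build _ _ _ _ _ midG).
Let PG : probability OG R := distribution P idGm.

Let phi1 (w : Omega) : OG * RM := (idG w, xi w).
Let mphi1 : mfun phi1.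
exact: measurable_fun_pair. Qed.

Let phi2 (w : Omega) : OG * RM * RM := (phi1 w, eta w).
Let mphi2 : mfun phi2.
exact: measurable_fun_pair. Qed.
Let phi2m : {mfun Omega >-> (OG * RM * RM)%type} := HB.pack phi2 (isMeasurableFun.Build _ _ _ _ _ mphi2).

Section level.
Variables (V : set R) (mV : measurable V).
Let mVe : measurable (eta @^-1` V).
by rewrite -[X in measurable X]setTI; exact: meta. Qed.
Let mu := pushforward (mrestr P mVe) phi1.
Let mu0 : mu set0 = 0%E. exact: measure0. Qed.
Let mu_ge0 A : (0 <= mu A)%E. exact: measure_ge0. Qed.
Let mu_sigma : semi_sigma_additive mu. exact: measure_semi_sigma_additive. Qed.
HB.instance Definition _ := isMeasure.Build _ _ _ mu mu0 mu_ge0 mu_sigma.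
Let muM : {measure set (OG * RM)%type -> \bar R} := mu.

(** With the event on eta fixed, both sides are finite measures in C that agree on rectangles; the
    factor N V is carried by the first marginal so that uniqueness of product measures applies. *)
Lemma level_indep (C : set (OG * RM)) : measurable C -> (P (phi1 @^-1` C `&` eta @^-1` V) = (PG \x N) C * N V)%E.
move=> mC; have k0 : 0 <= fine (N V) by rewrite fine_ge0.
have NV : (fine (N V))%:E = N V by rewrite fineK// fin_num_measure.
pose k : {nonneg R} := NngNum k0.
have h1 := @product_measure_unique _ _ _ _ R (mscale k PG) N muM _ C mC.
have h2 := @product_measure_unique _ _ _ _ R (mscale k PG) N (mscale k (PG \x N)%E) _ C mC.
rewrite -[LHS]/(muM C) -h1; last first.
 move=> A B mA mB. have -> : (muM (A `*` B) = P (idG @^-1` A `&` xi @^-1` B `&` eta @^-1` V))%E by [].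
 rewrite ind//; last by have /measurable_GE := mA. transitivity ((fine (N V))%:E * P (idG @^-1` A) * N B)%E; last by [].
 by rewrite NV muleC muleA.
rewrite h2; last first.
 move=> A B mA mB; rewrite -[LHS]/((k%:num)%:E * (PG \x N) (A `*` B))%E. by rewrite product_measure1E// muleA.
by rewrite -[LHS]/((fine (N V))%:E * (PG \x N) C)%E NV muleC.
Qed.
End level.

Let PGN : probability (OG * RM)%type R := (PG \x N)%E.

(** A second use of uniqueness of product measures makes the joint law of the identity, xi and eta a
    product; Tonelli's theorem then integrates the Gaussian variables with the G-part fixed. *)
Lemma independent_integral (Phi : OG * RM * RM -> \bar R) : mfun Phi -> (forall z, 0 <= Phi z)%E ->
 (\int[P]_w Phi (idG w, xi w, eta w) = \int[PG]_w \int[N]_u \int[N]_v Phi (w, u, v))%E.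
move=> mPhi Phi0.
transitivity (\int[distribution P phi2m]_z Phi z)%E.
 by rewrite ge0_integral_distribution.
transitivity (\int[PGN \x N]_z Phi z)%E.
 apply: eq_measure_integral => A mA _. have h := @product_measure_unique _ _ _ _ R PGN N (distribution P phi2m) _ A mA.
 rewrite -[RHS]/((PGN \x N)%E A) h; first by []. move=> C V mC mV; exact: (level_indep mV mC).
rewrite (@fubini_tonelli1 _ _ _ _ R PGN N Phi mPhi Phi0).
rewrite (@fubini_tonelli1 _ _ _ _ R PG N (fubini_F N Phi)); first by [].
- exact: (@measurable_fun_fubini_tonelli_F _ _ _ _ R N Phi mPhi Phi0).
- by move=> z; apply: integral_ge0.
Qed.

(* Conditionally on G the increments are centred Gaussian variables, so the
  exponential factors have conditional expectation one. *)
Lemma gauss_step (Z U V : Omega -> R) : (forall w, 0 <= Z w) -> measurable_wrt G Z -> measurable_wrt G U -> measurable_wrt G V ->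
 EE P (fun w => Z w * expR (U w * xi w + V w * eta w - (U w ^+ 2 + V w ^+ 2) * s ^+ 2 / 2)) = EE P Z.
move=> Z0 /measurable_wrtP mZ /measurable_wrtP mU /measurable_wrtP mV.
pose Phi (z : OG * RM * RM) : \bar R := ((Z z.1.1 * expR (U z.1.1 * z.1.2 - U z.1.1 ^+ 2 * s ^+ 2 / 2))
  * expR (V z.1.1 * z.2 - V z.1.1 ^+ 2 * s ^+ 2 / 2))%:E.
have m11 (f : Omega -> R) : mfun (f : OG -> R) -> mfun (fun z : OG * RM * RM => f z.1.1).
 by move=> mf; apply: (measurableT_comp mf); apply: measurableT_comp.
have m12 : mfun (fun z : OG * RM * RM => z.1.2) by apply: measurableT_comp.
have mPhi : mfun Phi.
 apply/measurable_EFinP; apply: measurable_funM.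
  apply: measurable_funM; first exact: m11.
  apply: measurableT_comp => //; apply: measurable_funB; first by apply: measurable_funM; [exact: m11|].
  by apply: measurable_funM => //; apply: measurable_funM => //; apply: measurable_funX; exact: m11.
 apply: measurableT_comp => //; apply: measurable_funB; first by apply: measurable_funM; [exact: m11|].
 by apply: measurable_funM => //; apply: measurable_funM => //; apply: measurable_funX; exact: m11.
have -> : EE P (fun w => Z w * expR (U w * xi w + V w * eta w - (U w ^+ 2 + V w ^+ 2) * s ^+ 2 / 2))
  = (\int[P]_w Phi (idG w, xi w, eta w))%E.
 apply: eq_integral => w _; congr (_%:E); rewrite -[RHS]mulrA -expRD; congr (_ * expR _) => /=; ring.
rewrite independent_integral//; last by move=> z; rewrite lee_fin !mulr_ge0 ?expR_ge0.
have mexp (u : R) : mfun (fun x : R => (expR (u * x - u ^+ 2 * s ^+ 2 / 2))%:E).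
 by apply/measurable_EFinP; apply: measurableT_comp => //; apply: measurable_funB => //; exact: measurable_funM.
have inner (w : OG) u : (\int[N]_v Phi (w, u, v) = (Z w)%:E * (expR (U w * u - U w ^+ 2 * s ^+ 2 / 2))%:E)%E.
 rewrite /Phi /=; under eq_integral do rewrite EFinM. rewrite ge0_integralZl//; last 2 first.
 - exact: mexp.
 - by rewrite lee_fin mulr_ge0 ?expR_ge0.
 by rewrite normal_mgf// mule1 EFinM.
rewrite /mean -[RHS](@ge0_integral_distribution _ _ _ _ _ P idGm (fun w => (Z w)%:E)) //; last exact/measurable_EFinP.
apply: eq_integral => w _.
under eq_integral do rewrite inner.
rewrite ge0_integralZl//; last 2 first.
- exact: mexp.
- by rewrite lee_fin.
by rewrite normal_mgf// mule1.
Qed.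

End gauss.

Section expectation.
Context (disp : measure_display) (Omega : measurableType disp) (P : probability Omega R).
Implicit Types (f g : Omega -> R).

Lemma EE_ge0 f : (forall w, 0 <= f w) -> (0 <= EE P f)%E.
by move=> f0; apply: integral_ge0 => w _; rewrite lee_fin. Qed.

Lemma EE_le f g : mfun f -> mfun g -> (forall w, 0 <= f w) -> (forall w, f w <= g w) -> (EE P f <= EE P g)%E.
move=> mf mg f0 fg; apply: ge0_le_integral => //; try by move=> w _; rewrite lee_fin.
- exact/measurable_EFinP.
- exact/measurable_EFinP.
Qed.

Lemma EE_D f g : mfun f -> mfun g -> (forall w, 0 <= f w) ->
 (forall w, 0 <= g w) -> EE P (fun w => f w + g w) = (EE P f + EE P g)%E.
move=> mf mg f0 g0; rewrite /mean; under eq_integral do rewrite EFinD.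
by rewrite ge0_integralD//; try (by move=> w _; rewrite lee_fin); exact/measurable_EFinP.
Qed.

Lemma EE_Z (k : R) f : 0 <= k -> mfun f -> (forall w, 0 <= f w) -> EE P (fun w => k * f w) = (k%:E * EE P f)%E.
move=> k0 mf f0; rewrite /mean; under eq_integral do rewrite EFinM.
by rewrite ge0_integralZl//; [exact/measurable_EFinP|move=> w _; rewrite lee_fin].
Qed.

Lemma EE_cst k : EE P (fun=> k) = k%:E.
by rewrite /mean integral_cst// [X in (_ * X)%E]probability_setT mule1. Qed.

Lemma EE_indic (A : set Omega) : measurable A -> EE P \1_A = P A.
by move=> mA; rewrite /mean integral_indic// setIT. Qed.

Lemma EE_ae f g : mfun f -> mfun g -> {ae P, forall w, f w = g w} -> EE P f = EE P g.
move=> mf mg fg; apply: ae_eq_integral => //; try exact/measurable_EFinP.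
by apply: filterS fg => w /= ->.
Qed.

Lemma EE_fatou (fn : nat -> Omega -> R) f (C : \bar R) : (forall n, mfun (fn n)) ->
 (forall n w, 0 <= fn n w) -> (forall w, fn n w @[n --> \oo] --> f w) -> (forall n, EE P (fn n) <= C)%E -> (EE P f <= C)%E.
move=> mf f0 fnf fC.
have -> : EE P f = (\int[P]_w limn_einf (fun n => (fn n w)%:E))%E.
 apply: eq_integral => w _; have [-> //] : ((limn_einf (fun n => (fn n w)%:E) = (f w)%:E) * (limn_esup (fun n => (fn n w)%:E) = (f w)%:E))%type.
 by apply: cvg_limn_einf_sup; apply: cvg_EFin; [exact: nearW|exact: fnf].
apply: le_trans (fatou _ _ _ _) _ => //.
- by move=> n; exact/measurable_EFinP.
- by move=> n w _; rewrite lee_fin.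
rewrite limn_einf_lim; apply: lime_le; first exact: is_cvg_einfs.
apply: nearW => n; apply: le_trans (fC n); apply: ereal_inf_lbound; exists n => //=.
Qed.

Lemma prob_U_le (A B : set Omega) (a b : R) : measurable A -> measurable B ->
 (P A <= a%:E)%E -> (P B <= b%:E)%E -> (P (A `|` B) <= (a + b)%:E)%E.
move=> mA mB ha hb; apply: le_trans (measureU2 _ mA mB) _.
by rewrite EFinD leeD.
Qed.

End expectation.
Arguments EE_fatou {disp Omega P} fn [f C].

(* A family of measurable functions with continuous paths is the pointwise
  limit of its discretizations in time. *)
Section joint_measurability.
Context (disp : measure_display) (Omega : measurableType disp).
Variables (u v : R) (K : R -> Omega -> R).
Hypotheses (uv : u <= v) (mK : forall s, u <= s <= v -> mfun (K s)) (cK : forall w, {within `[u, v], continuous (K ^~ w)}).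

Definition clamp (s : R) : R := Num.max u (Num.min s v).

Lemma clamp_itv s : u <= clamp s <= v.
rewrite /clamp le_max lexx /= ge_max uv /= ge_min lexx orbT //.
Qed.

Lemma clamp_id s : u <= s <= v -> clamp s = s.
by move=> /andP[us sv]; rewrite /clamp min_l// max_r. Qed.

Lemma continuous_clamp : continuous clamp.
move=> s; apply: (@continuous_max _ _ (cst u) (fun s => Num.min s v)); first exact: cst_continuous.
by apply: (@continuous_min _ _ id (cst v)); [exact: id|exact: cst_continuous].
Qed.

Lemma continuous_clamped w : continuous (fun s => K (clamp s) w).
move=> s; have cs : `[u, v]%classic (clamp s) by rewrite /= in_itv /= clamp_itv.
have h := @cK w (clamp s).
have {}h : K^~ w @ within `[u, v]%classic (nbhs (clamp s)) --> K (clamp s) w by rewrite nbhs_subspace_in.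
apply: cvg_trans h; move=> A /= hA; have := continuous_clamp hA.
by apply: (@filterS _ (nbhs s)) => z /= H; apply: H; rewrite /= in_itv /= clamp_itv.
Qed.

Let disc (n : nat) (s : R) : R := (Num.floor (s * n.+1%:R))%:~R / n.+1%:R.

Let disc_cvg s : disc n s @[n --> \oo] --> s.
apply/cvgrPdist_le => e e0.
have := @cvgr_dist_le _ _ _ _ _ (@harmonic R) 0 (@cvg_harmonic R) e e0.
move=> H; near=> n.
have : `|0 - harmonic n| <= e by near: n; exact: H.
rewrite sub0r normrN /harmonic /= ger0_norm// => he.
apply: le_trans he; rewrite /disc -[X in X - _](mulfK (_ : n.+1%:R != 0))//.
rewrite -mulrBl normrM [`|_^-1|]ger0_norm// -[leRHS]mul1r ler_pM2r ?invr_gt0 ?ltr0n//.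
have /andP[h1 h2] := mem_rg1_floor (s * n.+1%:R).
by rewrite ger0_norm ?subr_ge0// lerBlDl ltW.
Unshelve. all: by end_near. Qed.

Lemma measurable_clamped : mfun (fun z : R * Omega => K (clamp z.1) z.2).
pose Kn n (z : R * Omega) := K (clamp (disc n z.1)) z.2.
apply: (@measurable_fun_cvg _ _ _ setT Kn) => //; last first.
 move=> z _; apply: (@cvg_comp _ _ _ (fun n => disc n z.1) (fun s => K (clamp s) z.2)); first exact: disc_cvg.
 exact: continuous_clamped.
move=> n _ U mU; rewrite setTI.
have -> : Kn n @^-1` U = \bigcup_(k : int) ((fun s : R => Num.floor (s * n.+1%:R)) @^-1` [set k] `*`
  (K (clamp (k%:~R / n.+1%:R)) @^-1` U)).
 apply/seteqP; split=> [[s w] h|[s w] [k _ [/= <- h]]] //=. by exists (Num.floor (s * n.+1%:R)).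
apply: countable_bigcupT_measurable => // k; apply: measurableX.
 have -> : (fun s : R => Num.floor (s * n.+1%:R)) @^-1` [set k] = (fun s : R => s * n.+1%:R) @^-1` `[k%:~R, (k + 1)%:~R[.
  by apply/seteqP; split=> s /=; rewrite in_itv /= -floor_eq => /eqP.
 rewrite -[X in measurable X]setTI. have mm : mfun (fun s : R => s * n.+1%:R) by exact: measurable_funM. exact: mm.
rewrite -[X in measurable X]setTI; exact: (mK (clamp_itv _)).
Qed.

End joint_measurability.

(** * Exponential martingales of discrete integrals *)

Section exponential_martingale.
Context (disp : measure_display) (Omega : measurableType disp) (P : probability Omega R).
Variables (F : R -> set (set Omega)) (W B : R -> Omega -> R).
Hypotheses (hF : filtration F) (hWB : brownian_motion2 P F W B).

Lemma filtration_sigma s : 0 <= s -> sigma_algebra setT (F s).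
by have [h _ _] := hF; exact: h. Qed.

Lemma filtration_wrt r s (Z : Omega -> R) : 0 <= r -> r <= s -> measurable_wrt (F r) Z -> measurable_wrt (F s) Z.
by have [_ _ h] := hF => r0 rs mZ U mU; apply: (h _ _ r0 rs); exact: mZ. Qed.

Lemma filtration_fun s (Z : Omega -> R) : 0 <= s -> measurable_wrt (F s) Z -> mfun Z.
by have [h1 h2 _] := hF => s0; apply: measurable_wrt_fun; [exact: h1|exact: h2]. Qed.

Let brownian_wrt s : 0 <= s -> measurable_wrt (F s) (W s) /\ measurable_wrt (F s) (B s).
by have [_ _ h _] := hWB; exact: h. Qed.

Variables (tau : nat -> R).
Hypotheses (tau0 : 0 <= tau 0) (tauS : forall i, tau i <= tau i.+1).

Let tau_ge0 i : 0 <= tau i.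
by elim: i => // i h; exact: le_trans h (tauS i). Qed.

Definition disc_int (U V : nat -> Omega -> R) n w : R :=
 \sum_(i < n) (U i w * (W (tau i.+1) w - W (tau i) w) + V i w * (B (tau i.+1) w - B (tau i) w)).
Definition disc_var (U V : nat -> Omega -> R) n w : R := \sum_(i < n) ((U i w ^+ 2 + V i w ^+ 2) * (tau i.+1 - tau i)).

Lemma disc_intS U V n w : disc_int U V n.+1 w = disc_int U V n w +
 (U n w * (W (tau n.+1) w - W (tau n) w) + V n w * (B (tau n.+1) w - B (tau n) w)).
by rewrite /disc_int big_ord_recr. Qed.

Lemma disc_varS U V n w : disc_var U V n.+1 w = disc_var U V n w + (U n w ^+ 2 + V n w ^+ 2) * (tau n.+1 - tau n).
by rewrite /disc_var big_ord_recr. Qed.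

Lemma disc_var_le U V n w : disc_var U V n w <= disc_var U V n.+1 w.
by rewrite disc_varS lerDl mulr_ge0 ?subr_ge0// addr_ge0// sqr_ge0.
Qed.

Section predictable.
Variables (U V : nat -> Omega -> R).
Hypotheses (mU : forall i, measurable_wrt (F (tau i)) (U i)) (mV : forall i, measurable_wrt (F (tau i)) (V i)).

Let Fs i := filtration_sigma (tau_ge0 i).

(** The coefficients of a step are known when it begins, so the variance that includes the step
    after tau n is already measurable at tau n. *)
Lemma disc_var_wrt n : measurable_wrt (F (tau n)) (disc_var U V n.+1).
elim: n => [|n IH].
 apply/(measurable_wrtP (Fs 0)). have /(measurable_wrtP (Fs 0)) m1 := mU 0; have /(measurable_wrtP (Fs 0)) m2 := mV 0.
 have -> : disc_var U V 1 = fun w => (U 0 w ^+ 2 + V 0 w ^+ 2) * (tau 1 - tau 0).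
  by apply/funext => w; rewrite /disc_var big_ord1.
 by apply: measurable_funM => //; apply: measurable_funD; exact: measurable_funX.
have -> : disc_var U V n.+2 = fun w => disc_var U V n.+1 w + (U n.+1 w ^+ 2 + V n.+1 w ^+ 2) * (tau n.+2 - tau n.+1).
 by apply/funext => w; rewrite /disc_var big_ord_recr.
apply/(measurable_wrtP (Fs n.+1)).
have /(measurable_wrtP (Fs n.+1)) m1 := mU n.+1; have /(measurable_wrtP (Fs n.+1)) m2 := mV n.+1.
have /(measurable_wrtP (Fs n.+1)) m3 := filtration_wrt (tau_ge0 n) (tauS n) IH.
by apply: measurable_funD => //; apply: measurable_funM => //; apply: measurable_funD; exact: measurable_funX.
Qed.

Lemma disc_int_wrt n : measurable_wrt (F (tau n)) (disc_int U V n).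
elim: n => [|n IH]; apply/(measurable_wrtP (Fs _)).
 by rewrite (_ : disc_int U V 0 = cst 0)//; apply/funext => w; rewrite /disc_int big_ord0.
have -> : disc_int U V n.+1 = fun w => disc_int U V n w +
  (U n w * (W (tau n.+1) w - W (tau n) w) + V n w * (B (tau n.+1) w - B (tau n) w)).
 by apply/funext => w; rewrite /disc_int big_ord_recr.
have up Z : measurable_wrt (F (tau n)) Z -> mfun (Z : g_sigma_algebraType (F (tau n.+1)) -> R).
 by move=> mZ; apply/(measurable_wrtP (Fs _)); exact: filtration_wrt (tauS n) mZ.
have [mW mB] := brownian_wrt (tau_ge0 n); have [mW' mB'] := brownian_wrt (tau_ge0 n.+1).
move/(measurable_wrtP (Fs _)) : mW' => mW'; move/(measurable_wrtP (Fs _)) : mB' => mB'.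
apply: measurable_funD; first exact: up.
apply: measurable_funD; apply: measurable_funM; try exact: up.
- by apply: measurable_funB => //; exact: up.
- by apply: measurable_funB => //; exact: up.
Qed.

Lemma measurable_disc n : mfun (disc_int U V n) /\ mfun (disc_var U V n).
split; first exact: (filtration_fun (tau_ge0 n) (disc_int_wrt n)).
case: n => [|k]; last exact: (filtration_fun (tau_ge0 k) (disc_var_wrt k)).
by rewrite (_ : disc_var U V 0 = cst 0)//; apply/funext => w; rewrite /disc_var big_ord0.
Qed.

(** One application of [gauss_step] per increment; equal consecutive times are set apart because the
    normal law needs a positive variance. *)
Lemma exp_mart xi n : measurable_wrt (F (tau 0)) xi -> (forall w, 0 <= xi w) ->
 EE P (fun w => xi w * expR (disc_int U V n w - disc_var U V n w / 2)) = EE P xi.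
move=> mxi xi0; elim: n => [|n IH].
 by apply: eq_integral => w _; rewrite /disc_int /disc_var !big_ord0 mul0r subr0 expR0 mulr1.
have [e|lt] := eqVneq (tau n) (tau n.+1).
 rewrite -IH; apply: eq_integral => w _; rewrite /disc_int /disc_var !big_ord_recr /=. by rewrite -e !subrr !mulr0 !addr0.
have {}lt : tau n < tau n.+1 by rewrite lt_neqAle lt tauS.
pose s := Num.sqrt (tau n.+1 - tau n).
have s0 : 0 < s by rewrite sqrtr_gt0 subr_gt0.
have s2 : s ^+ 2 = tau n.+1 - tau n by rewrite sqr_sqrtr// subr_ge0 ltW.
have [_ _ _ ind] := hWB; have [_ Fm _] := hF.
have [mW mB] := brownian_wrt (tau_ge0 n); have [mW' mB'] := brownian_wrt (tau_ge0 n.+1).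
rewrite -IH -[RHS](gauss_step (Fs n) (Fm _ (tau_ge0 n)) s0 (xi := fun w => W (tau n.+1) w - W (tau n) w)
 (eta := fun w => B (tau n.+1) w - B (tau n) w) _ _ _ _ _ (mU n) (mV n)); first last.
- apply/(measurable_wrtP (Fs _)).
 have up Z k : (k <= n)%N -> measurable_wrt (F (tau k)) Z -> mfun (Z : g_sigma_algebraType (F (tau n)) -> R).
  move=> kn mZ; apply/(measurable_wrtP (Fs _)); apply: filtration_wrt mZ => //. by have /nondecreasing_seqP := tauS; apply.
 apply: measurable_funM; first exact: (up _ 0%N (leq0n n) mxi).
 apply: measurableT_comp => //; apply: measurable_funB; first exact: (up _ n (leqnn n) (disc_int_wrt n)).
 apply: measurable_funM => //; case: (n) up => [|k] up.
  by rewrite (_ : disc_var U V 0 = cst 0)//; apply/funext => w; rewrite /disc_var big_ord0.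
 exact: (up _ k (leqnSn k) (disc_var_wrt k)).
- by move=> w; rewrite mulr_ge0 ?expR_ge0.
- by move=> A C D FA mC mD; exact: ind.
- by apply: measurable_funB; [exact: filtration_fun (tau_ge0 n.+1) _|exact: filtration_fun (tau_ge0 n) _].
- by apply: measurable_funB; [exact: filtration_fun (tau_ge0 n.+1) _|exact: filtration_fun (tau_ge0 n) _].
apply: eq_integral => w _; rewrite -mulrA -expRD; congr (xi w * expR _)%:E.
by rewrite disc_intS disc_varS s2; lra.
Qed.

End predictable.

(* Stopping the coefficients before the variance exceeds m keeps them
  predictable, since the variance at the next time is already known. *)
Lemma stopped_exp_mart U V (m : R) n :
 (forall i, measurable_wrt (F (tau i)) (U i)) -> (forall i, measurable_wrt (F (tau i)) (V i)) -> 0 <= m ->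
 exists M Q : Omega -> R, [/\ mfun M /\ mfun Q, (forall w, Q w <= m),
    (forall w, disc_var U V n w <= m -> M w = disc_int U V n w /\ Q w = disc_var U V n w) &
    forall xi : Omega -> R, measurable_wrt (F (tau 0)) xi -> (forall w, 0 <= xi w) ->
     EE P (fun w => xi w * expR (M w - Q w / 2)) = EE P xi /\ EE P (fun w => xi w * expR (2 * M w - 2 * Q w)) = EE P xi].
move=> mU mV m0.
pose st (Z : nat -> Omega -> R) i w := if disc_var U V i.+1 w <= m then Z i w else 0.
have Fs i := filtration_sigma (tau_ge0 i).
have mst Z : (forall i, measurable_wrt (F (tau i)) (Z i)) -> forall i, measurable_wrt (F (tau i)) (st Z i).
 move=> mZ i; apply/(measurable_wrtP (Fs i)).
 have /(measurable_wrtP (Fs i)) m1 := mZ i; have /(measurable_wrtP (Fs i)) m2 := disc_var_wrt mU mV i.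
 by apply: measurable_fun_ifT => //; exact: measurable_fun_ler.
have m2 (Z : nat -> Omega -> R) : (forall i, measurable_wrt (F (tau i)) (Z i)) -> forall i, measurable_wrt (F (tau i)) (fun w => 2 * Z i w).
 move=> mZ i; apply/(measurable_wrtP (Fs i)). have /(measurable_wrtP (Fs i)) m1 := mZ i; exact: measurable_funM.
exists (disc_int (st U) (st V) n), (disc_var (st U) (st V) n); split.
- exact: (measurable_disc (mst _ mU) (mst _ mV) n).
- move=> w; suff [//] : disc_var (st U) (st V) n w <= m /\
  (disc_var U V n w <= m -> disc_var (st U) (st V) n w = disc_var U V n w).
 elim: n => [|n [IH1 IH2]]; first by rewrite /disc_var !big_ord0. have dU := disc_var_le U V n w.
 have [h|h] := leP (disc_var U V n.+1 w) m.
  have e : disc_var (st U) (st V) n.+1 w = disc_var U V n.+1 w.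
   by rewrite disc_varS IH2 ?(le_trans dU)// [RHS]disc_varS /st h.
  by rewrite e.
 split=> //. have st0 Z : st Z n w = 0 by rewrite /st leNgt h. by rewrite disc_varS !st0 expr0n /= addr0 mul0r addr0.
- move=> w; elim: n => [|n IH] h; first by rewrite /disc_int /disc_var !big_ord0.
 have dU := le_trans (disc_var_le U V n w) h. have [i1 i2] := IH dU. by rewrite !disc_intS 2!disc_varS i1 i2 /st h.
- move=> xi mxi xi0; split; first exact: (exp_mart (mst _ mU) (mst _ mV)).
 rewrite -[RHS](exp_mart (m2 _ (mst _ mU)) (m2 _ (mst _ mV)) n mxi xi0). apply: eq_integral => w _; congr (_ * expR _)%:E.
 rewrite /disc_int /disc_var !big_distrr mulr_suml -!sumrB; apply: eq_bigr => i _ /=; by field.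
Qed.

End exponential_martingale.

(** A common grid for several simple processes. Repetitions are allowed and the sequence stays at v
    after its end, so neither distinctness nor a bound on indices has to be carried along. *)
Lemma merge_times (u v : R) (s : seq R) : u <= v -> (forall z, z \in s -> u <= z <= v) ->
 exists (tau : nat -> R) n, [/\ tau 0 = u, (forall i, tau i <= tau i.+1), tau n = v,
  (forall i, tau i <= v) & forall z, z \in s -> exists p, tau p = z].
move=> uv sI; pose l := sort <=%R [:: u, v & s].
have lI z : z \in l -> u <= z <= v.
 by rewrite mem_sort !inE => /orP[/eqP ->|/orP[/eqP ->|/sI//]]; rewrite lexx uv.
have tv i : nth v l i <= v.
 by have [h|h] := ltnP i (size l); [have /andP[] := lI _ (mem_nth v h)|rewrite nth_default].
have tS i : nth v l i <= nth v l i.+1.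
 have [h|h] := ltnP i.+1 (size l); last by rewrite [leRHS]nth_default.
 by have := sort_sorted (@le_total _ R) [:: u, v & s] => /(sortedP v)/(_ i h).
exists (fun i => nth v l i), (size l); split => //; last 2 first.
- by rewrite nth_default.
- by move=> z zs; exists (index z l); rewrite nth_index// mem_sort !inE zs !orbT.
apply/eqP; rewrite eq_le; apply/andP; split; last first.
 have h : (0 < size l)%N by rewrite size_sort. by have /andP[] := lI _ (mem_nth v h).
have ul : u \in l by rewrite mem_sort inE eqxx.
rewrite -[leRHS](nth_index v ul).
by have /nondecreasing_seqP := tS; apply.
Qed.

(** * Simple integrands on a common grid *)

Section step_integral.
Variables (tau : nat -> R).
Hypotheses (tauS : forall i, tau i <= tau i.+1).

Lemma step_integral (f : R -> R) n : (forall r, 0 <= f r) -> mfun f ->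
 (forall i r, tau i < r <= tau i.+1 -> f r = f (tau i.+1)) -> (\int[leb]_(r in `]tau 0%N, tau n]) (f r)%:E)%E =
 (\sum_(i < n) f (tau i.+1) * (tau i.+1 - tau i))%:E.
move=> f0 mf fE; elim: n => [|n IH].
 by rewrite big_ord0 set_itv_ge ?integral_set0// bnd_simp ltxx.
have t0 : tau 0 <= tau n by have /nondecreasing_seqP := tauS; apply.
have split_itv : `]tau 0%N, tau n.+1]%classic = `]tau 0%N, tau n] `|` `]tau n, tau n.+1].
 by rewrite -itv_bndbnd_setU ?bnd_simp.
rewrite split_itv ge0_integral_setU//=; last 3 first.
- by apply/measurable_EFinP; exact: measurable_funTS.
- by move=> r _; rewrite lee_fin.
- apply/disj_setPS => r /=; rewrite !in_itv /= => -[/andP[_ h1] /andP[h2 _]].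
 by move: h2; rewrite ltNge h1.
rewrite IH big_ord_recr /= EFinD; congr (_ + _)%E.
rewrite (eq_integral (cst (f (tau n.+1))%:E)); last first.
 by move=> r; rewrite inE /= in_itv /= => h; rewrite (fE n).
rewrite integral_cst//= lebesgue_measure_itv /= lte_fin; case: ltP => h; first by rewrite -EFinD -EFinM.
have -> : tau n.+1 = tau n by apply/eqP; rewrite eq_le h tauS.
by rewrite subrr mule0 mulr0.
Qed.

End step_integral.

Section merged_simple.
Context (disp : measure_display) (Omega : measurableType disp) (P : probability Omega R).
Variables (F : R -> set (set Omega)) (hF : filtration F) (t T u v : R) (S : simple_process (R := R) (Omega := Omega)).
Hypotheses (t0 : 0 <= t) (tu : t <= u) (uv : u <= v) (hS : is_simple F t T S).
Variables (tau : nat -> R) (n : nat).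
Hypotheses (tau0 : tau 0 = u) (tauS : forall i, tau i <= tau i.+1) (taun : tau n = v) (tauv : forall i, tau i <= v)
 (tauz : forall j, (j <= sp_size S)%N -> exists p, tau p = clamp u v (sp_time S j)).

Let tau_le i j : (i <= j)%N -> tau i <= tau j.
by move=> ij; have /nondecreasing_seqP := tauS; apply. Qed.

(** The jump times clamped to [u, v] belong to the grid, so none lies strictly inside a cell. *)
Lemma cell_lt j i r : (j <= sp_size S)%N -> tau i < r <= tau i.+1 -> (sp_time S j < r) = (sp_time S j < tau i.+1).
move=> hj /andP[ir ri]; apply/idP/idP => h; first exact: lt_le_trans ri.
rewrite ltNge; apply/negP => rz; have [p] := tauz hj.
have ui : u <= tau i by rewrite -tau0 tau_le.
rewrite clamp_id; last first.
 by rewrite (le_trans ui (le_trans (ltW ir) rz)) /= (le_trans (ltW h)).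
move=> hp; have [pi|ip] := leqP p i.
 by have := tau_le pi; rewrite hp leNgt (lt_le_trans ir rz).
by have := tau_le ip; rewrite hp leNgt h.
Qed.

Lemma sp_eval_cell i r w : tau i < r <= tau i.+1 -> sp_eval S r w = sp_eval S (tau i.+1) w.
move=> hr; apply: eq_bigr => j _; congr (_ * _); rewrite !indicE; congr ((_ : bool)%:R).
have h1 := cell_lt (ltnW (ltn_ord j)) hr; have h2 := cell_lt (ltn_ord j) hr.
by apply/idP/idP; rewrite !inE /= !in_itv /= h1 (leNgt r) (leNgt (tau _)) h2.
Qed.

Lemma measurable_sp_eval w : mfun (fun r => sp_eval S r w).
rewrite /sp_eval; by apply: measurable_sum => j; apply: measurable_funM.
Qed.

(** The value on a cell is read at its right end, but the intervals of simple processes are open on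
    the left: the coefficients concerned start no later than tau i, and the integrand is
    predictable. *)
Lemma sp_eval_wrt i : measurable_wrt (F (tau i)) (sp_eval S (tau i.+1)).
have [h1 h2 h3 _] := hS.
have i0 : 0 <= tau i by rewrite (le_trans _ (tau_le (leq0n i)))// tau0 (le_trans t0).
have sF := filtration_sigma hF i0.
apply/(measurable_wrtP sF); rewrite /sp_eval; apply: measurable_sum => j.
have [hz|hz] := boolP (tau i.+1 \in `]sp_time S j, sp_time S j.+1]%classic); last first.
 by rewrite indicE (negbTE hz); under eq_fun do rewrite mulr0; exact: measurable_cst.
apply: measurable_funM => //; apply/(measurable_wrtP sF).
move: hz; rewrite inE /= in_itv /= => /andP[hz _].
have /andP[tz _] := h1 j (ltnW (ltn_ord j)).
apply: filtration_wrt (h3 j (ltn_ord j)) => //; first exact: le_trans tz.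
rewrite leNgt; apply/negP => iz.
have := @cell_lt j i (sp_time S j) (ltnW (ltn_ord j)).
by rewrite iz (ltW hz) ltxx hz => /(_ isT).
Qed.

Lemma sp_integral_merged g w : sp_integral S g v w - sp_integral S g u w =
 \sum_(i < n) sp_eval S (tau i.+1) w * (g (tau i.+1) w - g (tau i) w).
have [_ h2 _ _] := hS.
have tel j : (j <= sp_size S)%N -> g (Num.min (sp_time S j) v) w - g (Num.min (sp_time S j) u) w =
  \sum_(i < n) (tau i.+1 <= sp_time S j)%R%:R * (g (tau i.+1) w - g (tau i) w).
 move=> hj; rewrite -taun -tau0; elim: n => [|k IH]; first by rewrite big_ord0 subrr.
 rewrite big_ord_recr /= -IH; have [h|h] := leP (tau k.+1) (sp_time S j).
  by rewrite (min_r (le_trans (tauS k) h)) /=; ring.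
 have h' : sp_time S j <= tau k.
  rewrite leNgt; apply/negP => iz; have := @cell_lt j k (sp_time S j) hj. by rewrite iz (ltW h) ltxx h => /(_ isT).
 by rewrite (min_l h') /=; ring.
rewrite /sp_integral -sumrB /sp_eval; under [RHS]eq_bigr do rewrite mulr_suml.
rewrite exchange_big /=; apply: eq_bigr => j _.
have -> : forall p q r s x : R, x * (p - q) - x * (r - s) = x * ((p - r) - (q - s)) by move=> *; ring.
rewrite (tel _ (ltn_ord j)) (tel _ (ltnW (ltn_ord j))) -sumrB mulr_sumr; apply: eq_bigr => i _.
rewrite -mulrA -mulrBl; congr (_ * (_ * _)).
rewrite indicE; have := h2 _ (ltn_ord j) => h.
have -> : (tau i.+1 \in `]sp_time S j, sp_time S j.+1]%classic) = (sp_time S j < tau i.+1 <= sp_time S j.+1).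
 by apply/idP/idP; rewrite inE /= in_itv.
have [h3|h3] := leP (tau i.+1) (sp_time S j); last by rewrite subr0.
by rewrite (le_trans h3 h) /= subrr.
Qed.

Lemma sp_square_merged w : (\int[leb]_(r in `]u, v]) ((sp_eval S r w) ^+ 2)%:E)%E =
 (\sum_(i < n) sp_eval S (tau i.+1) w ^+ 2 * (tau i.+1 - tau i))%:E.
rewrite -taun -tau0 (step_integral tauS)//.
- by move=> r; exact: sqr_ge0.
- by apply: measurable_funX; exact: measurable_sp_eval.
- by move=> i r /sp_eval_cell ->.
Qed.

End merged_simple.

(** * Integrals along paths and approximation of Ito integrals *)

Section path_integral.
Variables (t T : R) (y : R -> R).
Hypothesis cy : {within `[t, T], continuous y}.

Lemma path_integrable u v : t <= u -> v <= T -> leb.-integrable `[u, v] (EFin \o y).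
move=> tu vT; apply: continuous_compact_integrable; first exact: segment_compact.
apply: continuous_subspaceW cy => z /=; rewrite !in_itv /= => /andP[h1 h2].
by rewrite (le_trans tu h1) (le_trans h2 vT).
Qed.

Lemma path_integrable_oc u v : t <= u -> v <= T -> leb.-integrable `]u, v] (EFin \o y).
move=> tu vT; apply: integrableS (path_integrable tu vT) => //.
by move=> z /=; rewrite !in_itv /= => /andP[/ltW -> ->].
Qed.

Lemma path_integralB u v : t <= u -> u <= v -> v <= T ->
 \int[leb]_(r in `[t, v]) y r - \int[leb]_(r in `[t, u]) y r = \int[leb]_(r in `]u, v]) y r.
move=> tu uv vT; apply: Rintegral_itvB; first exact: path_integrable.
- by rewrite bnd_simp.
- by rewrite bnd_simp.
Qed.

Hypothesis y0 : forall r, t <= r <= T -> 0 <= y r.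

(* From [|s^2 - y| <= eta y + (1 + 1/eta) (s - sqrt y)^2]. *)
Lemma square_close (s : R -> R) (u v q eta del : R) : t <= u -> u <= v -> v <= T -> mfun s -> 0 < eta ->
 (\int[leb]_(r in `]u, v]) (s r ^+ 2)%:E)%E = q%:E -> (\int[leb]_(r in `[t, T]) ((s r - Num.sqrt (y r)) ^+ 2)%:E <= del%:E)%E ->
 `|q - \int[leb]_(r in `]u, v]) y r| <= eta * (\int[leb]_(r in `]u, v]) y r) + (1 + eta^-1) * del.
move=> tu uv vT ms eta0 qE dle; set A := \int[leb]_(r in _) _.
have AE : (\int[leb]_(r in `]u, v]) (y r)%:E = A%:E)%E.
 by rewrite /A /Rintegral fineK//; apply: integrable_fin_num => //; exact: path_integrable_oc.
have sub r : `]u, v]%classic r -> t <= r <= T.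
 by rewrite /= in_itv /= => /andP[h1 h2]; rewrite (le_trans tu (ltW h1)) (le_trans h2 vT).
have my : measurable_fun `]u, v] (fun r => (y r)%:E) by have /integrableP[] := path_integrable_oc tu vT.
have myT : measurable_fun `[t, T] y.
 by have /integrableP[/measurable_EFinP] := path_integrable (lexx t) (lexx T).
have ms2 : measurable_fun `]u, v] (fun r => (s r ^+ 2)%:E).
 by apply/measurable_EFinP/measurable_funTS; exact: measurable_funX.
have md : measurable_fun `[t, T] (fun r => ((s r - Num.sqrt (y r)) ^+ 2)%:E).
 apply/measurable_EFinP; apply: measurable_funX; apply: measurable_funB; first exact: measurable_funTS.
 by apply: measurableT_comp => //; apply: continuous_measurable_fun; exact: sqrt_continuous.
have subs : `]u, v]%classic `<=` `[t, T]%classic by move=> r /sub; rewrite /= in_itv.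
have md' : measurable_fun `]u, v] (fun r => ((s r - Num.sqrt (y r)) ^+ 2)%:E).
 by apply: measurable_funS md.
have D_le : (\int[leb]_(r in `]u, v]) ((s r - Num.sqrt (y r)) ^+ 2)%:E <= del%:E)%E.
 apply: le_trans dle; apply: ge0_subset_integral => //. by move=> r _; rewrite lee_fin sqr_ge0.
set c := 1 + eta^-1; have c0 : 0 <= c by rewrite addr_ge0 // invr_ge0 ltW.
have cD : (\int[leb]_(r in `]u, v]) (c%:E * ((s r - Num.sqrt (y r)) ^+ 2)%:E) <= (c * del)%:E)%E.
 rewrite ge0_integralZl//; last by move=> r _; rewrite lee_fin sqr_ge0. by rewrite EFinM lee_wpmul2l.
have eA : (\int[leb]_(r in `]u, v]) (eta%:E * (y r)%:E) = (eta * A)%:E)%E.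
 rewrite ge0_integralZl//; [by rewrite AE|by move=> r /sub /y0; rewrite lee_fin|by rewrite lee_fin ltW].
have key (a b : R) : 0 <= b -> `|a ^+ 2 - b ^+ 2| <= eta * b ^+ 2 + c * (a - b) ^+ 2.
 move=> b0; rewrite /c. have h1 : 0 <= (eta * b - (a - b)) ^+ 2 / eta by rewrite divr_ge0 ?sqr_ge0 ?ltW.
 have h2 : 0 <= (eta * b + (a - b)) ^+ 2 / eta by rewrite divr_ge0 ?sqr_ge0 ?ltW.
 have e1 : (eta * b - (a - b)) ^+ 2 / eta = eta * b ^+ 2 - 2 * b * (a - b) + eta^-1 * (a - b) ^+ 2 by field; lra.
 have e2 : (eta * b + (a - b)) ^+ 2 / eta = eta * b ^+ 2 + 2 * b * (a - b) + eta^-1 * (a - b) ^+ 2 by field; lra.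
 rewrite e1 in h1; rewrite e2 in h2. have h3 := sqr_ge0 (a - b). by rewrite ler_norml; apply/andP; split; nra.
have me : measurable_fun `]u, v] (fun r => (eta%:E * (y r)%:E)%E) by exact: measurable_funeM.
have mc : measurable_fun `]u, v] (fun r => (c%:E * ((s r - Num.sqrt (y r)) ^+ 2)%:E)%E) by exact: measurable_funeM.
have e0 r : `]u, v]%classic r -> (0 <= eta%:E * (y r)%:E)%E.
 by move=> /sub /y0 h; rewrite -EFinM lee_fin mulr_ge0 // ltW.
have c0' r : `]u, v]%classic r -> (0 <= c%:E * ((s r - Num.sqrt (y r)) ^+ 2)%:E)%E.
 by move=> _; rewrite -EFinM lee_fin mulr_ge0 // sqr_ge0.
have up : q <= A + (eta * A + c * del).
 rewrite -lee_fin -qE !EFinD -AE -eA; apply: le_trans (leeD2l _ (leeD2l _ cD)).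
 rewrite -ge0_integralD// -ge0_integralD//; first last.
 - exact: emeasurable_funD.
 - by move=> r hr; rewrite adde_ge0// ?e0 ?c0'.
 - by move=> r /sub /y0; rewrite lee_fin.
 apply: ge0_le_integral => //.
 - by move=> r _; rewrite lee_fin sqr_ge0.
 - by apply: emeasurable_funD => //; exact: emeasurable_funD.
 - move=> r /sub hr; have := key (s r) _ (sqrtr_ge0 (y r)).
  by rewrite -!EFinM -!EFinD lee_fin sqr_sqrtr ?y0// ler_norml => /andP[_]; lra.
have dn : A <= q + (eta * A + c * del).
 rewrite -lee_fin !EFinD -qE -AE -eA; apply: le_trans (leeD2l _ (leeD2l _ cD)).
 rewrite -ge0_integralD// -ge0_integralD//; first last.
 - exact: emeasurable_funD.
 - by move=> r hr; rewrite adde_ge0// ?e0 ?c0'.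
 - by move=> r _; rewrite lee_fin sqr_ge0.
 apply: ge0_le_integral => //.
 - by move=> r /sub /y0; rewrite lee_fin.
 - by apply: emeasurable_funD => //; exact: emeasurable_funD.
 - move=> r /sub hr; have := key (s r) _ (sqrtr_ge0 (y r)).
  by rewrite -!EFinM -!EFinD lee_fin sqr_sqrtr ?y0// ler_norml => /andP[+ _]; lra.
by rewrite ler_norml; apply/andP; split; lra.
Qed.

End path_integral.

Section tightness.
Context (disp : measure_display) (Omega : measurableType disp) (P : probability Omega R).

Lemma tight (f : Omega -> R) (del : R) : mfun f -> 0 < del -> exists K : R, 0 < K /\ (P [set w | (K <= f w)%R] <= del%:E)%E.
move=> mf d0; pose E (n : nat) := [set w | n.+1%:R <= f w].
have mE n : measurable (E n).
 have -> : E n = f @^-1` `[n.+1%:R, +oo[ by apply/seteqP; split=> w; rewrite /E /= in_itv /= andbT.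
 by rewrite -[X in measurable X]setTI; exact: mf.
have h : P (E n) @[n --> \oo] --> P (\bigcap_n E n).
 apply: nonincreasing_cvg_mu => //.
 - by rewrite -ge0_fin_numE// fin_num_measure.
 - exact: bigcap_measurable.
 - by apply/nonincreasing_seqP => n; apply/subsetPset => w /=; apply: le_trans; rewrite ler_nat.
have E0 : \bigcap_n E n = set0.
 apply/seteqP; split=> // w /= hw; have := hw (Num.truncn (f w)) I. by rewrite /E /= leNgt truncnS_gt.
rewrite E0 measure0 in h.
have [n _ /(_ n (leqnn n)) hn] : \forall n \near \oo, (P (E n) < del%:E)%E.
 by apply: (h [set x : \bar R | (x < del%:E)%E]); apply: open_nbhs_nbhs; split; [exact: open_ereal_lt_ereal|rewrite /= lte_fin].
by exists n.+1%:R; split => //; exact: ltW.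
Qed.

Lemma cvg_in_probability0_near Z (eps del : R) : cvg_in_probability0 P Z ->
 0 < eps -> 0 < del -> \forall n \near \oo, (P [set w | (eps%:E <= Z n w)%E] <= del%:E)%E.
move=> hZ e0 d0; have h := hZ _ e0; apply: (@filterS _ _ _ (fun n => (P [set w | (eps%:E <= Z n w)%E] < del%:E)%E)).
 by move=> n /ltW.
by apply: (h [set x : \bar R | (x < del%:E)%E]); apply: open_nbhs_nbhs; split; [exact: open_ereal_lt_ereal|rewrite /= lte_fin].
Qed.

(* The fine part is taken of a finite integral when K has continuous paths. *)
Lemma measurable_path_integral (t s : R) (K : R -> Omega -> R) : t <= s ->
 (forall r, t <= r <= s -> mfun (K r)) -> (forall w, {within `[t, s], continuous (K ^~ w)}) ->
 (forall r w, t <= r <= s -> 0 <= K r w) -> mfun (fun w => \int[leb]_(r in `[t, s]) K r w).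
move=> ts mK cK K0.
pose Phi (z : R * Omega) := ((K (clamp t s z.1) z.2) * \1_`[t, s] z.1)%:E.
have mPhi : mfun Phi.
 apply/measurable_EFinP; apply: measurable_funM; first exact: measurable_clamped.
 by apply: (@measurableT_comp _ _ _ _ _ _ (\1_`[t, s]%classic : R -> R)).
have Phi0 z : (0 <= Phi z)%E.
 by rewrite lee_fin mulr_ge0// K0// clamp_itv.
have := measurable_fun_fubini_tonelli_G (m1 := leb) Phi mPhi Phi0.
move=> mG.
have -> : (fun w => \int[leb]_(r in `[t, s]) K r w) = fine \o (fubini_G leb Phi).
 apply/funext => w; rewrite /Rintegral /= /fubini_G [in LHS]integral_mkcond; congr fine; apply: eq_integral => r _.
 rewrite /Phi /= /patch indicE; case: ifPn => hr; last by rewrite mulr0.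
 by rewrite mulr1 clamp_id//; move: hr; rewrite inE /= in_itv.
exact: measurableT_comp.
Qed.

End tightness.

Section ito_approximation.
Context (disp : measure_display) (Omega : measurableType disp) (P : probability Omega R).
Variables (F : R -> set (set Omega)) (W B : R -> Omega -> R) (t T : R) (Y IW IB : R -> Omega -> R).
Hypotheses (hF : filtration F) (hWB : brownian_motion2 P F W B) (t0 : 0 <= t) (tT : t <= T).
Hypotheses (mY : forall s, t <= s <= T -> measurable_wrt (F s) (Y s)) (cY : forall w, {within `[t, T], continuous (Y ^~ w)})
 (Y0 : forall s w, t <= s <= T -> 0 <= Y s w) (hIW : ito_integral P F W t T (fun s w => Num.sqrt (Y s w)) IW)
 (hIB : ito_integral P F B t T (fun s w => Num.sqrt (Y s w)) IB).

Definition area s w : R := \int[leb]_(r in `[t, s]) Y r w.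

Lemma measurable_Y s : t <= s <= T -> mfun (Y s).
by move=> /[dup] h /andP[h1 _]; apply: (filtration_fun hF (le_trans t0 h1)); exact: mY.
Qed.

Lemma area_wrt s : t <= s <= T -> measurable_wrt (F s) (area s).
move=> /[dup] h /andP[ts sT]; have s0 := le_trans t0 ts.
have sF := filtration_sigma hF s0; apply/(measurable_wrtP sF).
apply: (@measurable_path_integral _ (g_sigma_algebraType (F s)) t s Y) => //.
- move=> r /andP[tr rs]; apply/(measurable_wrtP sF).
 by apply: (filtration_wrt hF (le_trans t0 tr) rs); apply: mY; rewrite tr (le_trans rs).
- move=> w; apply: continuous_subspaceW (@cY w) => z /=; rewrite !in_itv /= => /andP[-> h2].
 exact: le_trans h2 sT.
- by move=> r w /andP[tr rs]; apply: Y0; rewrite tr (le_trans rs).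
Qed.

Lemma measurable_area s : t <= s <= T -> mfun (area s).
by move=> /[dup] h /andP[h1 _]; apply: (filtration_fun hF (le_trans t0 h1)); exact: area_wrt. Qed.

Lemma areaB u v w : t <= u -> u <= v -> v <= T -> area v w - area u w = \int[leb]_(r in `]u, v]) Y r w.
exact: path_integralB. Qed.

Lemma area_le u v w : t <= u -> u <= v -> v <= T -> area u w <= area v w.
move=> tu uv vT; rewrite -subr_ge0 areaB//; apply: Rintegral_ge0 => r /=; rewrite in_itv /= => /andP[h1 h2].
by apply: Y0; rewrite (le_trans tu (ltW h1)) (le_trans h2).
Qed.

Lemma area_t w : area t w = 0.
by rewrite /area set_itv1 Rintegral_set1. Qed.

Lemma area_ge0 s w : t <= s <= T -> 0 <= area s w.
by move=> /andP[h1 h2]; rewrite -(area_t w) area_le. Qed.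

Lemma measurable_square_dist S : is_simple F t T S ->
 mfun (fun w => (\int[leb]_(r in `[t, T]) ((sp_eval S r w - Num.sqrt (Y r w)) ^+ 2)%:E)%E).
move=> [h1 _ h3 _].
pose Phi (z : R * Omega) := (((sp_eval S z.1 z.2 - Num.sqrt (Y (clamp t T z.1) z.2)) ^+ 2) * \1_`[t, T] z.1)%:E.
have mPhi : mfun Phi.
 apply/measurable_EFinP; apply: measurable_funM; last first.
  by apply: (@measurableT_comp _ _ _ _ _ _ (\1_`[t, T]%classic : R -> R)).
 apply: measurable_funX; apply: measurable_funB; last first.
  apply: (@measurableT_comp _ _ _ _ _ _ (@Num.sqrt R)).
   by apply: continuous_measurable_fun; exact: sqrt_continuous.
  by apply: measurable_clamped => // s; exact: measurable_Y.
 rewrite /sp_eval; apply: measurable_sum => j; apply: measurable_funM.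
  have /andP[tz _] := h1 j (ltnW (ltn_ord j)). apply: (@measurableT_comp _ _ _ _ _ _ (sp_coef S j)) => //.
  exact: (filtration_fun hF (le_trans t0 tz) (h3 j (ltn_ord j))).
 by apply: (@measurableT_comp _ _ _ _ _ _ (\1_`]sp_time S j, sp_time S j.+1]%classic : R -> R)).
have Phi0 z : (0 <= Phi z)%E by rewrite lee_fin mulr_ge0// sqr_ge0.
have mG := measurable_fun_fubini_tonelli_G (m1 := leb) Phi mPhi Phi0.
suff -> : (fun w => (\int[leb]_(r in `[t, T]) ((sp_eval S r w - Num.sqrt (Y r w)) ^+ 2)%:E)%E) = fubini_G leb Phi by [].
apply/funext => w; rewrite /fubini_G [in LHS]integral_mkcond; apply: eq_integral => r _.
rewrite /Phi /= /patch indicE; case: ifPn => hr; last by rewrite mulr0.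
by rewrite mulr1 clamp_id//; move: hr; rewrite inE /= in_itv.
Qed.

(** Convergence in probability provides, off a rare event, discrete integrals that are close to the
    Ito integrals together with their variances, for W and B on the same grid. The stochastic
    exponentials are accessed only through this approximation. *)
Lemma approx_system (u v al be eps del : R) : t <= u -> u <= v -> v <= T -> 0 < eps -> 0 < del ->
 exists (tau : nat -> R) U V n (E : set Omega), [/\ tau 0 = u, (forall i, tau i <= tau i.+1),
    (forall i, measurable_wrt (F (tau i)) (U i) /\ measurable_wrt (F (tau i)) (V i)), measurable E /\ (P E <= del%:E)%E &
    forall w, ~ E w -> `|disc_int W B tau U V n w - (al * (IW v w - IW u w) + be * (IB v w - IB u w))| <= eps /\
     `|disc_var tau U V n w - (al ^+ 2 + be ^+ 2) * (area v w - area u w)| <= eps].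
move=> tu uv vT e0 d0.
have uI : t <= u <= T by rewrite tu (le_trans uv).
have vI : t <= v <= T by rewrite (le_trans tu uv).
(* There are seven exceptional events: two for the distances of the integrands, four for the
   integrals at u and v, and one where the area is large. *)
have d7 : 0 < del / 7 by rewrite divr_gt0.
have mA : mfun (fun w => area v w - area u w) by apply: measurable_funB; exact: measurable_area.
have [K [K0 hK]] := tight P mA d7.
pose k := al ^+ 2 + be ^+ 2; have k0 : 0 <= k by rewrite addr_ge0 ?sqr_ge0.
(* With this eta and the following dl, both terms of [square_close] are at most eps / (2 (k + 1)) as
   long as the area is below K. *)
pose eta := eps / (2 * (k + 1) * K).
have kK : 0 < 2 * (k + 1) * K by rewrite !mulr_gt0// ltr_wpDl.
have eta0 : 0 < eta by rewrite divr_gt0.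
pose dl := eps / (2 * (k + 1) * (1 + eta^-1)).
have ke : 0 < 2 * (k + 1) * (1 + eta^-1) by apply: mulr_gt0; [rewrite mulr_gt0// ltr_wpDl|rewrite addr_gt0// invr_gt0].
have dl0 : 0 < dl by rewrite divr_gt0.
pose e1 := eps / (2 * (`|al| + `|be| + 1)).
have ab : 0 < 2 * (`|al| + `|be| + 1) by rewrite mulr_gt0// ltr_wpDl// addr_ge0.
have e10 : 0 < e1 by rewrite divr_gt0.
have [mIW _ [SW [sW dW cW]]] := hIW; have [mIB _ [SB [sB dB cB]]] := hIB.
have near1 := cvg_in_probability0_near dW dl0 d7.
have near2 := cvg_in_probability0_near dB dl0 d7.
have near3 := cvg_in_probability0_near (cW u uI) e10 d7.
have near4 := cvg_in_probability0_near (cW v vI) e10 d7.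
have near5 := cvg_in_probability0_near (cB u uI) e10 d7.
have near6 := cvg_in_probability0_near (cB v vI) e10 d7.
have [m [[[p1 p2] [p3 p4]] [p5 p6]]] := @filter_ex _ (\oo : set_system nat) _ _
 (filterI (filterI (filterI near1 near2) (filterI near3 near4)) (filterI near5 near6)).
move: p1 p2 p3 p4 p5 p6 => /=.
set E1 := [set w | _]; set E2 := [set w | _]; set E3 := [set w | _]; set E4 := [set w | _];
 set E5 := [set w | _]; set E6 := [set w | _] => p1 p2 p3 p4 p5 p6.
pose E7 := [set w | K <= area v w - area u w].
have [S hS] : exists S, S = SW m by exists (SW m).
have [S' hS'] : exists S, S = SB m by exists (SB m).
have sS : is_simple F t T S by rewrite hS.
have sS' : is_simple F t T S' by rewrite hS'.
pose s := [seq clamp u v (sp_time S j) | j <- iota 0 (sp_size S).+1] ++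
     [seq clamp u v (sp_time S' j) | j <- iota 0 (sp_size S').+1].
have sI z : z \in s -> u <= z <= v.
 by rewrite mem_cat => /orP[] /mapP[j _ ->]; exact: clamp_itv.
have [tau [n [tau0 tauS taun tauv tauz]]] := merge_times uv sI.
have tz j : (j <= sp_size S)%N -> exists p, tau p = clamp u v (sp_time S j).
 by move=> hj; apply: tauz; rewrite mem_cat; apply/orP; left; apply/mapP; exists j; rewrite ?mem_iota.
have tz' j : (j <= sp_size S')%N -> exists p, tau p = clamp u v (sp_time S' j).
 by move=> hj; apply: tauz; rewrite mem_cat; apply/orP; right; apply/mapP; exists j; rewrite ?mem_iota.
exists tau, (fun i w => al * sp_eval S (tau i.+1) w), (fun i w => be * sp_eval S' (tau i.+1) w), n.
exists (E1 `|` E2 `|` (E3 `|` E4) `|` (E5 `|` E6) `|` E7); split => //.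
- move=> i; have i0 : 0 <= tau i by rewrite (le_trans (le_trans t0 tu))// -tau0; have /nondecreasing_seqP := tauS; apply.
 have sF := filtration_sigma hF i0. have m1 := sp_eval_wrt hF t0 tu sS tau0 tauS tauv tz i.
 have m2 := sp_eval_wrt hF t0 tu sS' tau0 tauS tauv tz' i.
 by split; apply/(measurable_wrtP sF); apply: measurable_funM => //; apply/(measurable_wrtP sF).
- have ge_meas (f : Omega -> \bar R) (z : R) : mfun f -> measurable [set w | (z%:E <= f w)%E].
  by move=> mf; have := emeasurable_fun_c_infty measurableT mf z%:E; rewrite setTI.
 have msp (g : R -> Omega -> R) S0 z : is_simple F t T S0 -> t <= z -> (forall r, 0 <= r -> mfun (g r)) ->
   mfun (sp_integral S0 g z).
  move=> [h1 _ h3 _] tz0 mg; rewrite /sp_integral; apply: measurable_sum => j; apply: measurable_funM.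
   have /andP[tzj _] := h1 j (ltnW (ltn_ord j)). exact: (filtration_fun hF (le_trans t0 tzj) (h3 j (ltn_ord j))).
  by apply: measurable_funB; apply: mg; rewrite le_min (le_trans t0 tz0) andbT;
   have [/andP[q1 _] /andP[q2 _]] := (h1 _ (ltnW (ltn_ord j)), h1 _ (ltn_ord j)); exact: le_trans t0 _.
 have mE1 : measurable E1 by apply: ge_meas; exact: measurable_square_dist.
 have mE2 : measurable E2 by apply: ge_meas; exact: measurable_square_dist. have [_ _ mWB _] := hWB.
 have mW r : 0 <= r -> mfun (W r) by move=> r0; exact: (filtration_fun hF r0 (mWB r r0).1).
 have mB r : 0 <= r -> mfun (B r) by move=> r0; exact: (filtration_fun hF r0 (mWB r r0).2).
 have meas3 (f g : Omega -> R) : mfun f -> mfun g -> measurable [set w | (e1%:E <= `|f w - g w|%:E)%E].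
  move=> mf mg; apply: ge_meas; apply/measurable_EFinP; apply: measurableT_comp => //. exact: measurable_funB.
 have mE3 : measurable E3 by apply: meas3; [exact: msp|exact: mIW].
 have mE4 : measurable E4 by apply: meas3; [apply: msp => //; exact: le_trans uv|exact: mIW].
 have mE5 : measurable E5 by apply: meas3; [exact: msp|exact: mIB].
 have mE6 : measurable E6 by apply: meas3; [apply: msp => //; exact: le_trans uv|exact: mIB]. have mE7 : measurable E7.
  have -> : E7 = [set w | (K%:E <= (area v w - area u w)%:E)%E] by apply/seteqP; split=> w; rewrite /= lee_fin.
  by apply: ge_meas; exact/measurable_EFinP.
 have P12 := prob_U_le mE1 mE2 p1 p2; have P34 := prob_U_le mE3 mE4 p3 p4; have P56 := prob_U_le mE5 mE6 p5 p6.
 have mE12 := measurableU _ _ mE1 mE2; have mE34 := measurableU _ _ mE3 mE4; have mE56 := measurableU _ _ mE5 mE6.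
 have P14 := prob_U_le mE12 mE34 P12 P34; have mE14 := measurableU _ _ mE12 mE34.
 have P16 := prob_U_le mE14 mE56 P14 P56; have mE16 := measurableU _ _ mE14 mE56. have P17 := prob_U_le mE16 mE7 P16 hK.
 split; first exact: measurableU. by apply: le_trans P17 _; rewrite lee_fin; apply: eq_leW; field.
move=> w nE.
have n1 : ~ E1 w by move=> h; apply: nE; do 4 left.
have n2 : ~ E2 w by move=> h; apply: nE; do 3 left; right.
have n3 : ~ E3 w by move=> h; apply: nE; do 2 left; right; left.
have n4 : ~ E4 w by move=> h; apply: nE; do 2 left; right; right.
have n5 : ~ E5 w by move=> h; apply: nE; left; right; left.
have n6 : ~ E6 w by move=> h; apply: nE; left; right; right.
have n7 : ~ E7 w by move=> h; apply: nE; right.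
split.
- have -> : disc_int W B tau (fun i w => al * sp_eval S (tau i.+1) w) (fun i w => be * sp_eval S' (tau i.+1) w) n w =
   al * (sp_integral S W v w - sp_integral S W u w) + be * (sp_integral S' B v w - sp_integral S' B u w).
  rewrite (sp_integral_merged sS tau0 tauS taun tauv tz) (sp_integral_merged sS' tau0 tauS taun tauv tz').
  rewrite !mulr_sumr -big_split /=; apply: eq_bigr => i _; ring.
 have b (z z' : R) : ~ (e1%:E <= `|z - z'|%:E)%E -> `|z - z'| <= e1.
  by rewrite lee_fin => /negP; rewrite -ltNge => /ltW.
 have b3 := b _ _ n3; have b4 := b _ _ n4; have b5 := b _ _ n5; have b6 := b _ _ n6. rewrite -hS in b3 b4; rewrite -hS' in b5 b6.
 set zv := sp_integral S W v w in b4 *; set zu := sp_integral S W u w in b3 *.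
 set yv := sp_integral S' B v w in b6 *; set yu := sp_integral S' B u w in b5 *.
 have -> : al * (zv - zu) + be * (yv - yu) - (al * (IW v w - IW u w) + be * (IB v w - IB u w)) =
   al * ((zv - IW v w) - (zu - IW u w)) + be * ((yv - IB v w) - (yu - IB u w)) by ring.
 apply: le_trans (ler_normD _ _) _; rewrite !normrM.
 have c1 := le_trans (ler_normB _ _) (lerD b4 b3); have c2 := le_trans (ler_normB _ _) (lerD b6 b5).
 apply: le_trans (lerD (ler_wpM2l (normr_ge0 al) c1) (ler_wpM2l (normr_ge0 be) c2)) _.
 have -> : `|al| * (e1 + e1) + `|be| * (e1 + e1) = (`|al| + `|be|) * (2 * e1) by ring.
 have -> : 2 * e1 = eps / (`|al| + `|be| + 1) by rewrite /e1; field; rewrite gt_eqF// ltr_wpDl// addr_ge0.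
 by rewrite mulrCA ler_piMr ?(ltW e0)// ler_pdivrMr ?mul1r ?lerDl// ltr_wpDl// addr_ge0.
have A_K : area v w - area u w <= K by apply/ltW; rewrite ltNge; apply/negP.
have cl (S0 : simple_process) : (\int[leb]_(r in `[t, T]) ((sp_eval S0 r w - Num.sqrt (Y r w)) ^+ 2)%:E <= dl%:E)%E ->
  (forall j, (j <= sp_size S0)%N -> exists p, tau p = clamp u v (sp_time S0 j)) ->
  `|\sum_(i < n) sp_eval S0 (tau i.+1) w ^+ 2 * (tau i.+1 - tau i) - (area v w - area u w)| <= eps / (k + 1).
 move=> hD htz; rewrite areaB//.
 apply: le_trans (square_close (@cY w) (fun r => Y0 w (s := r)) tu uv vT (measurable_sp_eval S0 w) eta0
  (sp_square_merged tau0 tauS taun tauv htz w) hD) _.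
 rewrite -areaB//. have -> : eps / (k + 1) = eta * K + (1 + eta^-1) * dl.
  rewrite /dl -[in RHS](mulrC (eps / _)) invfM mulrA mulfVK ?gt_eqF ?addr_gt0 ?invr_gt0// /eta.
  by field; rewrite !gt_eqF// ltr_wpDl.
 by rewrite lerD2r ler_wpM2l// ltW.
have le_dl (x : \bar R) : ~ (dl%:E <= x)%E -> (x <= dl%:E)%E by move=> /negP; rewrite -ltNge => /ltW.
have h1 : `|_ - _| <= _ := cl S _ tz; have h2 : `|_ - _| <= _ := cl S' _ tz'.
have {}h1 := h1 ltac:(rewrite hS; exact: le_dl n1); have {}h2 := h2 ltac:(rewrite hS'; exact: le_dl n2).
set q1 := \sum_(i < n) _ in h1; set q2 := \sum_(i < n) _ in h2.
set A := area v w - area u w in h1 h2 *.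
have -> : disc_var tau (fun i w => al * sp_eval S (tau i.+1) w) (fun i w => be * sp_eval S' (tau i.+1) w) n w =
  al ^+ 2 * q1 + be ^+ 2 * q2.
 rewrite /q1 /q2 !mulr_sumr -big_split /=; apply: eq_bigr => i _; ring.
have -> : al ^+ 2 * q1 + be ^+ 2 * q2 - (al ^+ 2 + be ^+ 2) * A = al ^+ 2 * (q1 - A) + be ^+ 2 * (q2 - A) by ring.
apply: le_trans (ler_normD _ _) _; rewrite (normrM (al ^+ 2)) (normrM (be ^+ 2)) !(ger0_norm (sqr_ge0 _)).
apply: le_trans (lerD (ler_wpM2l (sqr_ge0 al) h1) (ler_wpM2l (sqr_ge0 be) h2)) _.
by rewrite -mulrDl mulrCA ler_piMr ?(ltW e0)// ler_pdivrMr -/k ?mul1r ?lerDl// ltr_wpDl.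
Qed.

(** * The martingale property of stochastic exponentials *)

Variables (u v al be : R).
Hypotheses (tu : t <= u) (uv : u <= v) (vT : v <= T).

Definition qvar w : R := (al ^+ 2 + be ^+ 2) * (area v w - area u w).
Definition log_exp w : R := al * (IW v w - IW u w) + be * (IB v w - IB u w) - qvar w / 2.

Let uI : t <= u <= T. by rewrite tu (le_trans uv). Qed.
Let vI : t <= v <= T. by rewrite (le_trans tu uv). Qed.
Let u0 : 0 <= u. exact: le_trans tu. Qed.

Lemma measurable_qvar : mfun qvar.
apply: measurable_funM => //; apply: measurable_funB; exact: (measurable_area).
Qed.

Lemma measurable_log_exp : mfun log_exp.
have [mW _ _] := hIW; have [mB _ _] := hIB; have mq := measurable_qvar.
apply: measurable_funB; last exact: measurable_funM.
by apply: measurable_funD; apply: measurable_funM => //; apply: measurable_funB; (apply: mW || apply: mB).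
Qed.

Lemma measurable_exp_fun (f : Omega -> R) : mfun f -> mfun (fun w => expR (f w)).
by move=> mf; exact: measurableT_comp. Qed.

Section bounded.
Variables (xi : Omega -> R) (K : R).
Hypotheses (mxi : measurable_wrt (F u) xi) (xi0 : forall w, 0 <= xi w) (xiK : forall w, xi w <= K) (K0 : 0 < K).

Let mx : mfun xi. exact: (filtration_fun hF u0 mxi). Qed.

Let EEK : (EE P xi <= K%:E)%E.
by rewrite -(EE_cst P K); apply: EE_le. Qed.

(** Off the exceptional event the stochastic exponential is at most e^eps times the discrete one,
    whose expectation against xi is known; on the event the truncation bounds the integrand by
    K^2. *)
Lemma exp_le_trunc : (EE P (fun w => xi w * Num.min (expR (log_exp w)) K) <= EE P xi)%E.
apply/lee_addgt0Pr => e e0.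
(* The factor e^eps costs at most e / 2 because the mean of xi is at most K; the exceptional event
   costs the other e / 2. *)
pose eps := ln (1 + e / (2 * K)).
have eK : 0 < e / (2 * K) by rewrite divr_gt0// mulr_gt0.
have eps0 : 0 < eps by rewrite ln_gt0// ltrDl.
have Eeps : expR eps = 1 + e / (2 * K) by rewrite lnK// posrE addr_gt0.
have d0 : 0 < e / (2 * K ^+ 2) by rewrite divr_gt0// mulr_gt0// exprn_gt0.
have [tau [U [V [n [E [tau0 tauS mUV [mE PE] close]]]]]] := approx_system al be tu uv vT (divr_gt0 eps0 (ltr0n _ 2)) d0.
have tau00 : 0 <= tau 0 by rewrite tau0.
pose M := disc_int W B tau U V n; pose q := disc_var tau U V n.
have mU i := (mUV i).1; have mV i := (mUV i).2.
have [mM mq] : mfun M /\ mfun q := measurable_disc hF hWB tau00 tauS mU mV n.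
have mexp : mfun (fun w => xi w * expR (M w - q w / 2)).
 apply: measurable_funM => //; apply: measurable_exp_fun; apply: measurable_funB => //. exact: measurable_funM.
have mmin : mfun (fun w => xi w * Num.min (expR (log_exp w)) K).
 apply: measurable_funM => //; apply: measurable_minr => //. exact: measurable_exp_fun measurable_log_exp.
have le1 w : xi w * Num.min (expR (log_exp w)) K <= expR eps * (xi w * expR (M w - q w / 2)) + K ^+ 2 * \1_E w.
 have [hE|hE] := pselect (E w).
  rewrite indicE mem_set// mulr1; apply: le_trans (_ : K ^+ 2 <= _).
   by rewrite expr2 ler_pM// ?le_min ?expR_ge0 ?(ltW K0) ?ge_min ?lexx ?orbT.
  by rewrite lerDr !mulr_ge0 ?expR_ge0.
 rewrite indicE memNset// mulr0 addr0 mulrCA; apply: ler_wpM2l => //. rewrite ge_min -expRD ler_expR; apply/orP; left.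
 have [h1 h2] := close w hE; rewrite /log_exp /qvar. move: h1 h2; rewrite -/(M w) -/(q w) !ler_norml => /andP[h1 _] /andP[_ h2].
 by move: h1 h2 eps0; lra.
apply: le_trans (EE_le P mmin _ _ le1) _.
- apply: measurable_funD; first exact: measurable_funM.
 by apply: measurable_funM.
- by move=> w; rewrite mulr_ge0// le_min expR_ge0 ltW.
rewrite EE_D//; first last.
- by move=> w; rewrite mulr_ge0 ?sqr_ge0.
- by move=> w; rewrite !mulr_ge0 ?expR_ge0.
- by apply: measurable_funM.
- exact: measurable_funM.
rewrite EE_Z ?expR_ge0//; last by move=> w; rewrite mulr_ge0 ?expR_ge0.
rewrite EE_Z ?sqr_ge0// EE_indic//.
rewrite (exp_mart hF hWB tau00 tauS mU mV n) ?tau0//.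
have Efin : EE P xi = (fine (EE P xi))%:E.
 by rewrite fineK// ge0_fin_numE ?EE_ge0// (le_lt_trans EEK)// ltry.
move: EEK; rewrite Efin lee_fin => hK; have hge : 0 <= fine (EE P xi) by rewrite fine_ge0// EE_ge0.
apply: le_trans (leeD2l _ (lee_wpmul2l _ PE)) _; first by rewrite lee_fin sqr_ge0.
rewrite -!EFinM -!EFinD lee_fin Eeps mulrDl mul1r -addrA lerD2l.
have -> : K ^+ 2 * (e / (2 * K ^+ 2)) = e / 2 by field; rewrite gt_eqF.
have : e / (2 * K) * fine (EE P xi) <= e / (2 * K) * K by rewrite ler_pM2l.
have -> : e / (2 * K) * K = e / 2 by field; rewrite gt_eqF.
by move=> h; lra.
Qed.

End bounded.

(** Fatou's lemma removes both truncations and leaves the supermartingale inequality. *)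
Lemma exp_le xi : measurable_wrt (F u) xi -> (forall w, 0 <= xi w) -> (EE P (fun w => xi w * expR (log_exp w)) <= EE P xi)%E.
move=> mxi xi0; have sF := filtration_sigma hF u0.
have mx := filtration_fun hF u0 mxi.
pose xn (n : nat) w := Num.min (xi w) n.+1%:R.
have mxn n : measurable_wrt (F u) (xn n).
 by apply/(measurable_wrtP sF); apply: measurable_minr => //; exact/(measurable_wrtP sF).
have xn0 n w : 0 <= xn n w by rewrite le_min xi0 ler0n.
have mxn' n := filtration_fun hF u0 (mxn n).
have min_cvg (r : R) : (Num.min r n.+1%:R : R) @[n --> \oo] --> r.
 apply: cvg_near_cst; near=> n; rewrite min_l//.
 apply: le_trans (ltW (truncnS_gt r)) _; rewrite ler_nat ltnS; near: n; exact: nbhs_infty_ge.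
apply: (EE_fatou (fun n w => xn n w * Num.min (expR (log_exp w)) n.+1%:R)).
- move=> n; apply: measurable_funM; first exact: mxn'.
 by apply: measurable_minr => //; exact: measurable_exp_fun measurable_log_exp.
- by move=> n w; rewrite mulr_ge0// le_min expR_ge0 ler0n.
- by move=> w; apply: cvgM; exact: min_cvg.
move=> n; apply: le_trans (exp_le_trunc (mxn n) (xn0 n) _ (ltr0Sn _ n)) _.
 by move=> w; rewrite ge_min lexx orbT.
by apply: EE_le => // w; rewrite ge_min lexx.
Unshelve. all: by end_near. Qed.

(* The martingale property needs uniform integrability: the variances of the
  discrete integrals are stopped at m, which bounds their second moments by
  e^m, while the fourth exponential moment makes the stopped event rare. *)
Lemma exp_ge xi (C : R) : measurable_wrt (F u) xi -> (forall w, 0 <= xi w) -> (EE P (fun w => expR (4 * qvar w)) <= C%:E)%E ->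
 (EE P xi <= EE P (fun w => xi w * expR (log_exp w)))%E.
move=> mxi xi0 hC; have sF := filtration_sigma hF u0.
have mx := filtration_fun hF u0 mxi.
pose xn (n : nat) w := Num.min (xi w) n.+1%:R.
have mxn n : measurable_wrt (F u) (xn n).
 by apply/(measurable_wrtP sF); apply: measurable_minr => //; exact/(measurable_wrtP sF).
have xn0 n w : 0 <= xn n w by rewrite le_min xi0 ler0n.
have mxn' n := filtration_fun hF u0 (mxn n).
have mE := measurable_exp_fun measurable_log_exp.
apply: (EE_fatou xn) => //.
 move=> w; apply: cvg_near_cst; near=> n; rewrite /xn min_l//.
 apply: le_trans (ltW (truncnS_gt (xi w))) _; rewrite ler_nat ltnS; near: n; exact: nbhs_infty_ge.
move=> n; apply: (@le_trans _ _ (EE P (fun w => xn n w * expR (log_exp w)))); last first.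
 apply: EE_le; first exact: measurable_funM.
 - exact: measurable_funM.
 - by move=> w; rewrite mulr_ge0 ?expR_ge0.
 - by move=> w; rewrite ler_wpM2r ?expR_ge0// ge_min lexx.
have xnK w : xn n w <= n.+1%:R by rewrite ge_min lexx orbT.
have K0 : 0 < n.+1%:R :> R := ltr0Sn _ n.
move: (xn n) (mxn n) (xn0 n) (mxn' n) xnK => x mxw x0 mx' xK; move: (n.+1%:R : R) K0 xK => K K0 xK.
have C0 : 0 <= C.
 by rewrite -lee_fin; apply: le_trans hC; apply: EE_ge0 => w; exact: expR_ge0.
have EK : (EE P x <= K%:E)%E by rewrite -(EE_cst P K); apply: EE_le.
have EtK := le_trans (exp_le mxw x0) EK.
have EtE : EE P (fun w => x w * expR (log_exp w)) = (fine (EE P (fun w => x w * expR (log_exp w))))%:E.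
 rewrite fineK// ge0_fin_numE ?(le_lt_trans EtK) ?ltry//; apply: EE_ge0 => w. by rewrite mulr_ge0 ?expR_ge0.
apply/lee_addgt0Pr => e e0.
(* The contribution of the rare events will be at most e^(- m) K1, and m is chosen to make this at
   most e / 2. *)
pose K1 := K * (1 + C * expR 4); have K10 : 0 < K1 by rewrite mulr_gt0// ltr_pwDl// mulr_ge0 ?expR_ge0.
pose m := ln (1 + 2 * K1 / e).
have m0 : 0 <= m by apply: ln_ge0; rewrite lerDl divr_ge0 ?(ltW e0)// mulr_ge0// ltW.
have Em : expR m = 1 + 2 * K1 / e by rewrite lnK// posrE addr_gt0// divr_gt0// mulr_gt0.
pose eps := Num.min 1 (ln (1 + e / (2 * K))).
have eK : 0 < e / (2 * K) by rewrite divr_gt0// mulr_gt0.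
have eps0 : 0 < eps by rewrite lt_min ltr01 ln_gt0// ltrDl.
have Eeps : expR eps <= 1 + e / (2 * K).
 apply: (@le_trans _ _ (expR (ln (1 + e / (2 * K))))); first by rewrite ler_expR ge_min lexx orbT.
 by rewrite lnK// posrE addr_gt0.
have [tau [U [V [k [E [tau0 tauS mUV [mEv PE] close]]]]]] :=
 approx_system al be tu uv vT (divr_gt0 eps0 (ltr0n _ 2)) (expR_gt0 (- 3 * m)).
have tau00 : 0 <= tau 0 by rewrite tau0.
have mU i := (mUV i).1; have mV i := (mUV i).2.
have [M [q [[mM mq] qm Mq stop]]] := stopped_exp_mart hF hWB tau00 tauS k mU mV m0.
have [s1 s2] := stop x ltac:(by rewrite tau0) x0.
pose G := [set w | m - 1 <= qvar w].
have mG : measurable G.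
 have -> : G = qvar @^-1` `[m - 1, +oo[ by apply/seteqP; split=> w; rewrite /G /= in_itv /= andbT.
 by rewrite -[X in measurable X]setTI; exact: measurable_qvar.
have PG : (P G <= (expR (- 4 * (m - 1)) * C)%:E)%E.
 rewrite -EE_indic//; apply: (@le_trans _ _ (EE P (fun w => expR (- 4 * (m - 1)) * expR (4 * qvar w)))).
  apply: EE_le => //.
  - apply: measurable_funM => //; apply: measurable_exp_fun; apply: measurable_funM => //; exact: measurable_qvar.
  - move=> w; rewrite indicE; have [/set_mem h|_] := boolP (w \in G); last by rewrite mulr_ge0 ?expR_ge0.
   have -> : (true%:R : R) = expR 0 by rewrite expR0. by rewrite -expRD ler_expR; move: h; rewrite /G /=; lra.
 rewrite EE_Z ?expR_ge0//; last first.
  by apply: measurable_exp_fun; apply: measurable_funM => //; exact: measurable_qvar.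
 by rewrite EFinM lee_wpmul2l// lee_fin expR_ge0.
(* On the rare events the discrete exponential V1 is bounded by V1^2 / (2 L) + L / 2. Its second
   moment against x is at most e^m K and the events have probability of order e^(- 3 m), so for this
   L both terms are of order e^(- m). *)
pose L := expR (2 * m).
have PEG := prob_U_le mEv mG PE PG.
have mEG := measurableU _ _ mEv mG.
have le1 w : x w * expR (M w - q w / 2) <= expR eps * (x w * expR (log_exp w)) +
  (expR m / (2 * L) * (x w * expR (2 * M w - 2 * q w)) + L * K / 2 * \1_(E `|` G) w).
 have r0 : 0 <= expR eps * (x w * expR (log_exp w)) by rewrite !mulr_ge0 ?expR_ge0.
 have r1 : 0 <= expR m / (2 * L) * (x w * expR (2 * M w - 2 * q w)).
  by rewrite !mulr_ge0 ?invr_ge0 ?expR_ge0// mulr_ge0 ?expR_ge0.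
 have [hE|hE] := pselect ((E `|` G) w).
  rewrite indicE mem_set// mulr1; set V1 := expR (M w - q w / 2). have V2 : V1 ^+ 2 <= expR m * expR (2 * M w - 2 * q w).
   by rewrite /V1 expr2 -!expRD ler_expR; have := qm w; lra.
  have am : V1 <= V1 ^+ 2 / (2 * L) + L / 2.
   have : 0 <= (V1 - L) ^+ 2 / (2 * L) by rewrite divr_ge0 ?sqr_ge0 ?mulr_ge0 ?expR_ge0.
   have -> : (V1 - L) ^+ 2 / (2 * L) = V1 ^+ 2 / (2 * L) + L / 2 - V1 by field; rewrite gt_eqF ?expR_gt0. by rewrite subr_ge0.
  have h1 : x w * V1 <= x w * (expR m * expR (2 * M w - 2 * q w) / (2 * L) + L / 2).
   rewrite ler_wpM2l//; apply: le_trans am _; rewrite lerD2r ler_wpM2r// invr_ge0 mulr_ge0 ?expR_ge0//.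
  have h2 : x w * (L / 2) <= K * (L / 2) by rewrite ler_wpM2r ?xK// divr_ge0 ?expR_ge0.
  have e1 : x w * (expR m * expR (2 * M w - 2 * q w) / (2 * L) + L / 2) =
   expR m / (2 * L) * (x w * expR (2 * M w - 2 * q w)) + x w * (L / 2) by field; rewrite gt_eqF ?expR_gt0.
  rewrite e1 in h1; move: h1 h2 r0; lra.
 have [c1 c2] := close w (fun h => hE (or_introl h)).
 have nG : qvar w < m - 1 by rewrite ltNge; apply/negP => h; apply: hE; right. have e1 : eps <= 1 by rewrite ge_min lexx.
 have [|-> ->] := Mq w.
  by move: c2 nG e1; rewrite -/(qvar w) ler_norml => /andP[_]; lra.
 rewrite indicE memNset// mulr0 addr0; apply: le_trans (_ : expR eps * (x w * expR (log_exp w)) <= _); last first.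
  rewrite lerDl; apply: mulr_ge0; first by rewrite divr_ge0 ?mulr_ge0 ?expR_ge0. by rewrite mulr_ge0 ?expR_ge0.
 rewrite mulrCA ler_wpM2l// -expRD ler_expR /log_exp; move: c1 c2; rewrite -/(qvar w).
 by rewrite !ler_norml => /andP[_ h1] /andP[h2 _]; move: h1 h2 eps0; lra.
have mexp (f : Omega -> R) : mfun f -> mfun (fun w => x w * expR (f w)).
 by move=> mf; apply: measurable_funM => //; exact: measurable_exp_fun.
have mf1 : mfun (fun w => x w * expR (M w - q w / 2)).
 by apply: mexp; apply: measurable_funB => //; exact: measurable_funM.
have mf2 : mfun (fun w => x w * expR (2 * M w - 2 * q w)).
 by apply: mexp; apply: measurable_funB; exact: measurable_funM.
have mf3 := mexp _ measurable_log_exp.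
have mI : mfun (fun w => L * K / 2 * \1_(E `|` G) w : R) by exact: measurable_funM.
have xe0 (f : Omega -> R) w : 0 <= x w * expR (f w) by rewrite mulr_ge0 ?expR_ge0.
have k1 : 0 <= expR m / (2 * L) by rewrite divr_ge0 ?mulr_ge0 ?expR_ge0.
have k2 : 0 <= L * K / 2 by rewrite divr_ge0 ?mulr_ge0 ?expR_ge0 ?(ltW K0).
rewrite -s1; apply: le_trans (EE_le P mf1 _ (xe0 _) le1) _.
 apply: measurable_funD; first exact: measurable_funM. by apply: measurable_funD => //; exact: measurable_funM.
have g1 w : 0 <= expR eps * (x w * expR (log_exp w)) by rewrite mulr_ge0 ?expR_ge0.
have g2 w : 0 <= expR m / (2 * L) * (x w * expR (2 * M w - 2 * q w)) by exact: (mulr_ge0 k1 (xe0 (fun w => 2 * M w - 2 * q w) w)).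
have g3 w : 0 <= L * K / 2 * \1_(E `|` G) w :> R by rewrite mulr_ge0.
have mm1 : mfun (fun w => expR eps * (x w * expR (log_exp w))) by exact: measurable_funM.
have mm2 : mfun (fun w => expR m / (2 * L) * (x w * expR (2 * M w - 2 * q w))) by exact: measurable_funM.
rewrite (EE_D P mm1 (measurable_funD mm2 mI) g1 (fun w => addr_ge0 (g2 w) (g3 w))) (EE_D P mm2 mI g2 g3).
rewrite (EE_Z P (expR_ge0 _) mf3 (xe0 _)) (EE_Z P k1 mf2 (xe0 _)) (EE_Z P k2)// s2 EE_indic//.
rewrite EtE in EtK *.
set Et := fine _ in EtK *; rewrite lee_fin in EtK.
have Et0 : 0 <= Et by apply: fine_ge0; apply: EE_ge0 => w; exact: xe0.
apply: le_trans (leeD2l _ (leeD (lee_wpmul2l _ EK) (lee_wpmul2l _ PEG))) _; rewrite ?lee_fin//.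
have h1 : expR eps * Et <= Et + e / 2.
 apply: le_trans (ler_wpM2r Et0 Eeps) _; rewrite mulrDl mul1r lerD2l. apply: le_trans (ler_wpM2l (ltW eK) EtK) _.
 by apply: eq_leW; field; rewrite gt_eqF.
have E1 : expR m / (2 * L) = expR (- m) / 2.
 by rewrite invfM mulrA -[L^-1]expRN mulrAC -expRD; congr (expR _ / 2); ring.
have E2 : L * K / 2 * (expR (- 3 * m) + expR (- 4 * (m - 1)) * C) = K / 2 * (expR (- m) + expR (- 2 * m + 4) * C).
 have -> : L * K / 2 * (expR (- 3 * m) + expR (- 4 * (m - 1)) * C) =
  K / 2 * ((expR (2 * m) * expR (- 3 * m)) + (expR (2 * m) * expR (- 4 * (m - 1))) * C) by rewrite /L; ring.
 by rewrite -!expRD; congr (_ * (expR _ + expR _ * _)); ring.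
have h2 : expR (- 2 * m + 4) <= expR (- m) * expR 4 by rewrite -expRD ler_expR; lra.
have h3 : expR (- m) * K1 <= e / 2.
 rewrite expRN Em mulrC ler_pdivrMr; last by rewrite addr_gt0// divr_gt0// mulr_gt0.
 have -> : e / 2 * (1 + 2 * K1 / e) = e / 2 + K1 by field; rewrite gt_eqF. by rewrite lerDr divr_ge0 ?(ltW e0).
rewrite E1 E2; have h4 := ler_wpM2r C0 h2.
have h5 := ler_wpM2l (ltW K0) h4.
have h6 : expR (- m) * K1 = K * expR (- m) + K * (expR (- m) * expR 4 * C) by rewrite /K1; ring.
rewrite h6 in h3.
have h7 : 0 <= K * (expR (- m) * expR 4 * C) by rewrite !mulr_ge0 ?expR_ge0 ?(ltW K0).
have e8 : expR (- m) / 2 * K + K / 2 * (expR (- m) + expR (- 2 * m + 4) * C) =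
 K * expR (- m) + K * (expR (- 2 * m + 4) * C) / 2 by field.
by rewrite e8; move: h1 h3 h5 h7; lra.
Unshelve. all: by end_near. Qed.

End ito_approximation.

(** * Calculus along paths and exponential expressions *)

Lemma path_modulus (t T : R) (y : R -> R) : 0 <= t -> t <= T ->
 {within `[t, T], continuous y} -> forall e : R, 0 < e -> exists2 c : R, 0 <= c &
  forall r s, t <= r <= T -> t <= s <= T -> `|y s - y r| <= e + c * (s - r) ^+ 2.
move=> t0 tT cy e e0.
have cyw : continuous (fun s => y (clamp t T s)).
 by have := @continuous_clamped _ R t T (fun s (_ : R) => y s) tT (fun=> cy) 0.
have [c c0 hc] := @unif_modulus T 0 (fun s _ _ => y (clamp t T s)) (le_trans t0 tT) (lexx 0)
 (continuous_subspaceT (fun P => (continuous_comp (continuous_comp cvg_fst cvg_fst) (cyw _)))) e e0.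
exists c => // r s /[dup] hr /andP[tr rT] /[dup] hs /andP[ts sT].
have bx z : t <= z <= T -> box T 0 (z, 0, 0).
 by move=> /andP[h1 h2]; split => /=; rewrite ?normr0 ?lexx// (le_trans t0 h1) h2.
have := hc r 0 0 s 0 0 (bx r hr) (bx s hs).
by rewrite !clamp_id// /sqd subrr expr0n /= !addr0.
Qed.

(* With q decreasing geometrically in time the term [K del q' y'] compensates
  the integral of the volatility over the cell. *)
Lemma cell_bound (p q q' a b c d k K eps e1 del m y y' dA dX : R) :
 0 < eps -> 0 <= del -> 0 <= m -> 0 <= K -> eps <= q' -> q' <= e1 -> q <= e1 -> 0 <= q -> `|p| <= eps -> q = q' + K * del * q' ->
 p * d - q * b + k + eps <= K * q' -> 0 <= dA -> dA <= del * (y' + m) ->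
 p * dX + (q' * y' - q * y) + eps * dA - (eps * `|c| + e1 * `|a|) * del - K * e1 * del * m <=
 p * dX + q * (y' - y) - (p * c + q * a) * del - (p * d - q * b + k) * dA.
move=> eps0 del0 m0 K0 hq1 hq2 hq3 q0 hp qE hK dA0 hdA.
have h1 : p * c <= eps * `|c|.
 by apply: le_trans (ler_norm _) _; rewrite normrM ler_wpM2r.
have h2 : q * a <= e1 * `|a|.
 by apply: le_trans (ler_wpM2l q0 (ler_norm a)) _; rewrite ler_wpM2r.
have h3 : (p * c + q * a) * del <= (eps * `|c| + e1 * `|a|) * del by rewrite ler_wpM2r// lerD.
have h4 := ler_wpM2r dA0 hK.
have q'0 : 0 <= q' by rewrite (le_trans (ltW eps0)).
have h5 := ler_wpM2l (mulr_ge0 K0 q'0) hdA.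
have h6 : K * q' * (del * m) <= K * e1 * (del * m) by rewrite ler_wpM2r ?mulr_ge0// ler_wpM2l.
have e : q * y' = q' * y' + K * del * q' * y' by rewrite qE; ring.
move: h3 h4 h5 h6 e; move: ((p * c + q * a) * del) ((eps * `|c| + e1 * `|a|) * del) => u v; nra.
Qed.

(** The exponent depends on time through s and the integral of a continuous path, hence it is
    continuously differentiable and ordinary calculus suffices. *)
Lemma exp_ftc (t T al be kap : R) (y : R -> R) : t <= T -> {within `[t, T], continuous y} ->
 let g s := al + be * s + kap * \int[leb]_(r in `[t, s]) y r in
 (\int[leb]_(s in `[t, T]) ((be + kap * y s) * expR (g s))%:E = (expR (g T) - expR (g t))%:E)%E.
rewrite le_eqVlt => /predU1P[<- _|tT cy] g; first by rewrite set_itv1 integral_set1 subrr.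
have iy := path_integrable cy (lexx t) (lexx T).
have cA : {within `[t, T], continuous (fun s => \int[leb]_(r in `[t, s]) y r)}.
 exact: (parameterized_integral_continuous (ltW tT) iy).
have cg : {within `[t, T], continuous g}.
 move=> s; apply: cvgD; last by apply: cvgM; [exact: cvg_cst|exact: cA].
 by apply: (continuous_subspaceT (f := fun s => al + be * s)) => z; apply: cvgD; [exact: cvg_cst|apply: cvgM; [exact: cvg_cst|exact: cvg_id]].
have cE : {within `[t, T], continuous (expR \o g)}.
 by move=> s; apply: (@continuous_comp _ _ _ (g : subspace `[t, T] -> R) expR s); [exact: cg|exact: continuous_expR].
have dg s : s \in `]t, T[ -> is_derive s 1 (expR \o g) ((be + kap * y s) * expR (g s)).
 rewrite in_itv /= => /andP[ts sT]. have cys : {for s, continuous y}.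
  have /(continuous_within_itvP _ tT) [h _ _] := cy. by apply: h; rewrite in_itv /= ts.
 have [d1 d2] := continuous_FTC1_closed sT (path_integrable cy (lexx t) (lexx T)) ts cys.
 have dA : is_derive s 1 (fun s => \int[leb]_(r in `[t, s]) y r) (y s).
  by apply: DeriveDef; [exact: d1|rewrite -derive1E].
 have dgs : is_derive s 1 g (be + kap * y s).
  have dB : is_derive s 1 (fun s => kap * \int[leb]_(r in `[t, s]) y r) (kap * y s) := is_deriveZ kap dA.
  have dC : is_derive s 1 (fun s : R => be * s) (be * 1) := is_deriveZ be (is_derive_id s 1).
  have := is_deriveD (is_deriveD (is_derive_cst al s 1) dC) dB. by rewrite add0r mulr1.
 have := is_derive1_comp (is_derive_expR (g s)) dgs. by rewrite mulrC.
rewrite EFinB -[in RHS]/((expR \o g) T) -[in RHS]/((expR \o g) t); apply: continuous_FTC2 => //.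
- move=> s; apply: cvgM; last exact: cE.
 by apply: cvgD; [exact: cvg_cst|apply: cvgM; [exact: cvg_cst|exact: cy]].
- have /(continuous_within_itvP _ tT) [_ h2 h3] := cE.
 split; [|exact: h2|exact: h3] => s hs; exact: (@ex_derive _ _ _ _ _ _ _ (dg s hs)).
- move=> s; rewrite in_itv /= derive1E => hs; exact: (@derive_val _ _ _ _ _ _ _ (dg s _)).
Qed.

Lemma Rintegral_dct d0 (S : measurableType d0) (mu : {measure set S -> \bar R})
  (fn : nat -> S -> R) (f g : S -> R) : (forall n, mfun (fn n)) -> mfun f ->
 (forall z, fn n z @[n --> \oo] --> f z) -> mu.-integrable setT (EFin \o g) -> (forall n z, `|fn n z| <= g z) ->
 \int[mu]_z fn n z @[n --> \oo] --> \int[mu]_z f z.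
move=> mfn mf cv ig le.
have ce z : [set: S] z -> (fun n => (fn n z)%:E) @ \oo --> (f z)%:E.
 by move=> _; apply: cvg_EFin; [exact: nearW|exact: cv].
have [h1 _ h2] := @dominated_convergence _ S R mu setT measurableT (fun n => EFin \o fn n) (EFin \o f) (EFin \o g)
 (fun n => (measurable_EFinP _ _).2 (mfn n)) ((measurable_EFinP _ _).2 mf) (aeW mu ce) ig (aeW mu (fun z n _ => le n z)).
by apply: fine_cvg; rewrite fineK //; exact: integrable_fin_num.
Qed.

Definition lin_expr lt lx ly : expr := Add (Mul (Cst lt) Vt) (Add (Mul (Cst lx) Vx) (Mul (Cst ly) Vy)).
Definition exp_expr om p q : expr := Exp (lin_expr om p q).
(** The difference quotient at 0 of h -> e^(h L). It converges to the linear form L and stands for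
    multiplication by L. *)
Definition quot_expr (h lt lx ly : R) : expr := Mul (Cst h^-1) (Add (Exp (Mul (Cst h) (lin_expr lt lx ly))) (Cst (-1))).

(** What the operator on a product u L contains besides L times the operator on u: the drift of L
    times u, and the covariation of u and L. *)
Definition cross_expr k u lt lx ly : expr := Add (Mul (Add (Cst lt) (Add (Mul (Cst lx) (Add (Cst (pc k)) (Mul (Cst (pd k)) Vy)))
               (Mul (Cst ly) (Add (Cst (pa k)) (Mul (Cst (- pb k)) Vy))))) u)
   (Mul Vy (Add (Mul (Cst (pl k ^+ 2 * lx + pr k * pl k * ps k * ly)) (Ex u))
          (Mul (Cst (pr k * pl k * ps k * lx + ps k ^+ 2 * ly)) (Ey u)))).
Definition second_expr (k : prm) (u : expr) (lx ly : R) : expr :=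
 Mul (Mul Vy (Cst ((pl k ^+ 2 * lx ^+ 2 + 2 * pr k * pl k * ps k * (lx * ly) + ps k ^+ 2 * ly ^+ 2) / 2))) u.

Lemma ev_heat_quot (k : prm) (u : expr) (h lt lx ly s z y : R) : h != 0 -> let E := expR (h * ev (lin_expr lt lx ly) s z y) in
 ev (heat k (Mul u (quot_expr h lt lx ly))) s z y = ev (quot_expr h lt lx ly) s z y * ev (heat k u) s z y
  + E * ev (cross_expr k u lt lx ly) s z y + h * E * ev (second_expr k u lx ly) s z y.
move=> h0 E; rewrite /E !ev_heat /hop /= ; move: (expR _) => {}E; by field.
Qed.

Lemma ev_heat_lin (k : prm) (u : expr) (lt lx ly s z y : R) :
 ev (heat k (Mul u (lin_expr lt lx ly))) s z y = ev (lin_expr lt lx ly) s z y * ev (heat k u) s z y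
  + ev (cross_expr k u lt lx ly) s z y.
rewrite !ev_heat /hop /=; by field. Qed.

Lemma quot_itv (h L : R) : 0 < h -> L <= h^-1 * (expR (h * L) + -1) <= L * expR (h * L).
move=> h0; apply/andP; split.
 by rewrite mulrC ler_pdivlMr// mulrC; have := expR_ge1Dx (h * L); lra.
rewrite mulrC ler_pdivrMr//; have := ler_wpM2l (expR_ge0 (h * L)) (expR_ge1Dx (- (h * L))).
by rewrite -expRD subrr expR0 => h1; move: h1; set E := expR _; lra.
Qed.

Lemma quot_cvg (hn : nat -> R) (L : R) : (forall n, 0 < hn n) -> hn n @[n --> \oo] --> (0 : R) ->
 expR (hn n * L) @[n --> \oo] --> (1 : R) /\ (hn n)^-1 * (expR (hn n * L) + -1) @[n --> \oo] --> L.
move=> h0 hc.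
have c1 : expR (hn n * L) @[n --> \oo] --> (1 : R).
 rewrite -expR0 -(mul0r L); apply: continuous_cvg; first exact: continuous_expR. by apply: cvgM => //; exact: cvg_cst.
split => //; apply: (@squeeze_cvgr _ _ _ _ (fun=> L) (fun n => L * expR (hn n * L))).
- by apply: nearW => n; exact: quot_itv.
- exact: cvg_cst.
- by rewrite -[X in _ --> X]mulr1; apply: cvgM => //; exact: cvg_cst.
Qed.

(* The expressions of the form (polynomial) * exp (om t + p x + q y). *)
Definition poly_exp om p q e := exists g, is_poly g /\ forall s z y, ev e s z y = ev (Mul g (exp_expr om p q)) s z y.

Lemma poly_exp_Dv om p q a b c e : poly_exp om p q e -> poly_exp om p q (Dv a b c e).
move=> [g [pg hg]]; exists (Add (Dv a b c g) (Mul g (Cst (a * om + b * p + c * q)))).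
split; first by do !split => //; exact: poly_Dv.
by move=> s z y; rewrite (Dv_ext _ _ _ hg) /=; ring.
Qed.

Lemma poly_exp_D om p q e e' : poly_exp om p q e -> poly_exp om p q e' -> poly_exp om p q (Add e e').
move=> [g [pg hg]] [g' [pg' hg']]; exists (Add g g'); split => // s z y.
by rewrite [LHS]/= hg hg' /=; ring.
Qed.

Lemma poly_exp_M om p q f e : is_poly f -> poly_exp om p q e -> poly_exp om p q (Mul f e).
by move=> pf [g [pg hg]]; exists (Mul f g); split => // s z y; rewrite [LHS]/= hg /=; ring.
Qed.

Lemma poly_exp_heat om p q k e : poly_exp om p q e -> poly_exp om p q (heat k e).
by move=> pe; do ?[apply: poly_exp_D|apply: poly_exp_M => //|apply: poly_exp_Dv]. Qed.

Lemma poly_exp_cross om p q k u lt lx ly : poly_exp om p q u -> poly_exp om p q (cross_expr k u lt lx ly).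
by move=> pu; do ?[apply: poly_exp_D|apply: poly_exp_M => //|apply: poly_exp_Dv]. Qed.

Lemma wt_split (e z y : R) : wt e z y = wt (e / 2) z y * (wt (e / 4) z y * wt (e / 4) z y).
by rewrite -wtD -wtD; congr (wt _ z y); field. Qed.

(** * Exponential martingales and moments of the process *)

Section heston.
Context (disp : measure_display) (Omega : measurableType disp) (P : probability Omega R).
Variables (F : R -> set (set Omega)) (W B : R -> Omega -> R) (T a b c d lam sig rho t x y : R) (X Y : R -> Omega -> R).
Hypotheses (hF : filtration F) (hWB : brownian_motion2 P F W B) (t0 : 0 <= t) (tT : t <= T)
 (hXY : heston_solution P F W B T a b c d lam sig rho t x y X Y).

Let mY s : t <= s <= T -> measurable_wrt (F s) (Y s).
by have [h _ _ _] := hXY => hs; exact: (h s hs).2. Qed.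
Let mX s : t <= s <= T -> measurable_wrt (F s) (X s).
by have [h _ _ _] := hXY => hs; exact: (h s hs).1. Qed.
Let cY w : {within `[t, T], continuous (Y ^~ w)}.
by have [_ h _ _] := hXY; exact: (h w).2. Qed.
Let Y0 s w : t <= s <= T -> 0 <= Y s w.
by have [_ _ h _] := hXY; exact: h. Qed.

Lemma measurable_X s : t <= s <= T -> mfun (X s).
by move=> /[dup] h /andP[h1 _]; apply: (filtration_fun hF (le_trans t0 h1)); exact: mX. Qed.

(** The coefficients of sqrt(Y) dW and sqrt(Y) dB in p X + q Y; [noise2] is the growth of the
    quadratic variation per unit of [area]. *)
Definition noise_W (p q : R) := p * lam * rho + q * sig.
Definition noise_B (p : R) := p * lam * Num.sqrt (1 - rho ^+ 2).
Definition noise2 p q := noise_W p q ^+ 2 + noise_B p ^+ 2.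
(* The logarithm of the exponential martingale of p X + q Y over [u, v]. *)
Definition log_mart (p q u v : R) w : R := p * (X v w - X u w) + q * (Y v w - Y u w)
 - (p * c + q * a) * (v - u) - (p * d - q * b + noise2 p q / 2) * (area t Y v w - area t Y u w).

Lemma affine_integral (k1 k2 s : R) w : t <= s <= T ->
 \int[leb]_(r in `[t, s]) (k1 + k2 * Y r w) = k1 * (s - t) + k2 * area t Y s w.
move=> /andP[ts sT].
have iY := path_integrable (@cY w) (lexx t) sT.
have i1 : leb.-integrable `[t, s] (EFin \o (cst k1 : R -> R)).
 apply: continuous_compact_integrable; first exact: segment_compact. by apply: continuous_subspaceT => z; exact: cst_continuous.
have i2 : leb.-integrable `[t, s] (EFin \o (fun r => k2 * Y r w)).
 by rewrite (_ : EFin \o _ = fun r => (k2%:E * (EFin \o Y^~ w) r)%E); [exact: integrableZl|apply/funext].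
rewrite RintegralD// RintegralZl// Rintegral_cst//= lebesgue_measure_itv /= lte_fin.
case: ltP => h; first by rewrite -EFinD.
have -> : s = t by apply/eqP; rewrite eq_le h ts.
by rewrite subrr mulr0.
Qed.

Lemma log_mart_ae p q u v IW IB : t <= u -> u <= v -> v <= T -> {ae P, forall w, forall s, t <= s <= T ->
   X s w = x + \int[leb]_(r in `[t, s]) (c + d * Y r w)
        + lam * (rho * IW s w + Num.sqrt (1 - rho ^+ 2) * IB s w) /\
   Y s w = y + \int[leb]_(r in `[t, s]) (a - b * Y r w) + sig * IW s w} ->
 {ae P, forall w, log_mart p q u v w = log_exp t Y IW IB u v (noise_W p q) (noise_B p) w}.
move=> tu uv vT; apply: filterS => w h.
have uI : t <= u <= T by rewrite tu (le_trans uv).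
have vI : t <= v <= T by rewrite (le_trans tu uv).
have [hX hY] := h u uI; have [hX' hY'] := h v vI.
have e s : t <= s <= T -> \int[leb]_(r in `[t, s]) (a - b * Y r w) = a * (s - t) - b * area t Y s w.
 by move=> hs; rewrite -mulNr -affine_integral//; apply: eq_Rintegral => r _; rewrite mulNr.
rewrite e// in hY; rewrite e// in hY'; rewrite affine_integral// in hX; rewrite affine_integral// in hX'.
rewrite /log_mart hX hY hX' hY' /log_exp /qvar /noise2 /noise_W /noise_B; by field.
Qed.

Lemma log_mart_wrt p q u v : t <= u -> u <= v -> v <= T -> measurable_wrt (F v) (log_mart p q u v).
move=> tu uv vT; have u0 := le_trans t0 tu.
have uI : t <= u <= T by rewrite tu (le_trans uv).
have vI : t <= v <= T by rewrite (le_trans tu uv).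
have sF := filtration_sigma hF (le_trans u0 uv); apply/(measurable_wrtP sF).
have up (Z : R -> Omega -> R) : (forall s, t <= s <= T -> measurable_wrt (F s) (Z s)) ->
  mfun (Z u : g_sigma_algebraType (F v) -> R) /\ mfun (Z v : g_sigma_algebraType (F v) -> R).
 move=> hZ; split; apply/(measurable_wrtP sF); last exact: hZ. by apply: (filtration_wrt hF u0 uv); exact: hZ.
have [mX1 mX2] := up X mX; have [mY1 mY2] := up Y mY.
have [mA1 mA2] := up (area t Y) (fun s => area_wrt hF t0 mY cY Y0 (s := s)).
apply: measurable_funB; last by apply: measurable_funM => //; exact: measurable_funB.
by apply: measurable_funB => //; apply: measurable_funD; apply: measurable_funM => //; exact: measurable_funB.
Qed.

Lemma measurable_log_mart p q u v : t <= u -> u <= v -> v <= T -> mfun (log_mart p q u v).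
move=> tu uv vT; apply: (filtration_fun hF (le_trans (le_trans t0 tu) uv)); exact: log_mart_wrt.
Qed.

Section supermartingale.
Variables (p q u v : R) (xi : Omega -> R).
Hypotheses (tu : t <= u) (uv : u <= v) (vT : v <= T) (mxi : measurable_wrt (F u) xi) (xi0 : forall w, 0 <= xi w).

Let mean_ae IW IB : ito_integral P F W t T (fun s w => Num.sqrt (Y s w)) IW ->
 ito_integral P F B t T (fun s w => Num.sqrt (Y s w)) IB ->
 {ae P, forall w, log_mart p q u v w = log_exp t Y IW IB u v (noise_W p q) (noise_B p) w} ->
 EE P (fun w => xi w * expR (log_mart p q u v w)) =
 EE P (fun w => xi w * expR (log_exp t Y IW IB u v (noise_W p q) (noise_B p) w)).
move=> hIW hIB hae; have mx := filtration_fun hF (le_trans t0 tu) mxi.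
apply: EE_ae; last by apply: filterS hae => w ->.
- by apply: measurable_funM => //; apply: measurable_exp_fun; exact: measurable_log_mart.
- apply: measurable_funM => //; apply: measurable_exp_fun.
 exact: (measurable_log_exp hF t0 mY cY Y0 hIW hIB _ _ tu uv vT).
Qed.

Lemma heston_le : (EE P (fun w => xi w * expR (log_mart p q u v w)) <= EE P xi)%E.
have [_ _ _ [IW [IB [hIW hIB hae]]]] := hXY.
rewrite (mean_ae hIW hIB (log_mart_ae _ _ tu uv vT hae)).
exact: (exp_le hF hWB t0 tT mY cY Y0 hIW hIB _ _ tu uv vT mxi xi0).
Qed.

(** The quadratic variation over [u, v] is dominated through the area over all of [t, T], so one
    moment condition serves for all u and v. *)
Lemma heston_eq (C : R) : (EE P (fun w => expR (4 * noise2 p q * area t Y T w)) <= C%:E)%E ->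
 EE P (fun w => xi w * expR (log_mart p q u v w)) = EE P xi.
move=> hC; apply/eqP; rewrite eq_le heston_le /=.
have [_ _ _ [IW [IB [hIW hIB hae]]]] := hXY.
rewrite (mean_ae hIW hIB (log_mart_ae _ _ tu uv vT hae)).
apply: (exp_ge hF hWB t0 tT mY cY Y0 hIW hIB tu uv vT mxi xi0 (C := C)).
apply: le_trans hC; apply: EE_le.
- apply: measurable_exp_fun; apply: measurable_funM => //.
 exact: (measurable_qvar hF t0 mY cY Y0).
- apply: measurable_exp_fun; apply: measurable_funM => //.
 by apply: (measurable_area hF t0 mY cY Y0); rewrite tT lexx.
- by move=> w; exact: expR_ge0.
move=> w; rewrite ler_expR /qvar mulrA; apply: ler_wpM2l; first by rewrite mulr_ge0// addr_ge0 ?sqr_ge0.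
have h1 : area t Y v w <= area t Y T w by apply: (area_le cY Y0) => //; exact: le_trans uv.
have h2 : 0 <= area t Y u w by apply: (area_ge0 cY Y0) => //; rewrite tu (le_trans uv).
by rewrite lerBlDr (le_trans h1)// lerDl.
Qed.

End supermartingale.

(** The initial values are contained in the integral equations at time t: the Ito integrals vanish
    there almost surely, as limits of integrals of simple processes that vanish. *)
Lemma start_ae : {ae P, forall w, X t w = x /\ Y t w = y}.
have [_ _ _ [IW [IB [hIW hIB hae]]]] := hXY.
have tI : t <= t <= T by rewrite lexx.
have zero (g : R -> Omega -> R) I : ito_integral P F g t T (fun s w => Num.sqrt (Y s w)) I -> {ae P, forall w, I t w = 0}.
 move=> [mI _ [S [hS _ /(_ t tI) cv]]]. pose E (n : nat) := [set w | ((n.+1%:R^-1 : R)%:E <= `|I t w|%:E)%E].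
 have mE n : measurable (E n).
  have mf : mfun (fun w => `|I t w|%:E).
   by apply/measurable_EFinP; apply: measurableT_comp => //; exact: mI.
  by have := emeasurable_fun_c_infty measurableT mf (n.+1%:R^-1)%:E; rewrite setTI.
 apply: (@negligibleS _ _ _ P (\bigcup_n E n)); last first.
  apply: negligible_bigcup => n; apply/negligibleP => //; apply/eqP; rewrite eq_le measure_ge0 andbT.
  apply/lee_addgt0Pr => e e0; rewrite add0e. have n0 : 0 < n.+1%:R^-1 :> R by rewrite invr_gt0.
  have [m hm] := @filter_ex _ (\oo : set_system nat) _ _ (cvg_in_probability0_near cv n0 e0).
  apply: le_trans hm; rewrite /E; apply: eq_leW; congr (P _). have [h1 _ _ _] := hS m.
  apply/funext => w /=; have -> : sp_integral (S m) g t w = 0.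
   rewrite /sp_integral big1// => i _. by have /andP[r1 _] := h1 _ (ltnW (ltn_ord i)); have /andP[r2 _] := h1 _ (ltn_ord i);
    rewrite !min_r// subrr mulr0.
  by rewrite sub0r normrN.
 move=> w /= hw; have I0 : 0 < `|I t w| by rewrite normr_gt0; apply/eqP.
 exists (Num.truncn (`|I t w|^-1)) => //; rewrite /E /= lee_fin invf_ple ?posrE//. by apply: ltW; exact: truncnS_gt.
apply: filterS3 hae (zero _ _ hIW) (zero _ _ hIB) => w /(_ t tI)[-> ->] -> ->.
by rewrite !set_itv1 !Rintegral_set1 !mulr0 !addr0 mulr0 addr0.
Qed.

Section exponential_moments.
Hypotheses (lam0 : 0 <= lam) (sig0 : 0 <= sig) (rho1 : -1 < rho < 1).

Let mYf s : t <= s <= T -> mfun (Y s).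
exact: (measurable_Y hF t0 mY). Qed.
Let mAf s : t <= s <= T -> mfun (area t Y s).
exact: (measurable_area hF t0 mY cY Y0). Qed.

Local Notation lmart := log_mart.
Local Notation noise := noise2.

Lemma noise2_le (p q Q : R) : `|p| <= Q -> `|q| <= Q -> noise p q <= Q ^+ 2 * ((lam + sig) ^+ 2 + lam ^+ 2).
move=> hp hq; have Q0 := le_trans (normr_ge0 p) hp.
have r1 : `|rho| <= 1 by rewrite ler_norml; move/andP : rho1 => [/ltW -> /ltW ->].
have r2 : `|Num.sqrt (1 - rho ^+ 2)| <= 1.
 by rewrite ger0_norm ?sqrtr_ge0// -[leRHS]sqrtr1 ler_sqrt// lerBlDr lerDl sqr_ge0.
have h1 : `|noise_W p q| <= Q * (lam + sig).
 rewrite /noise_W mulrDr; apply: le_trans (ler_normD _ _) _; apply: lerD.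
  rewrite !normrM -[leRHS]mulr1 (ger0_norm lam0). by rewrite ler_pM// ?mulr_ge0// ler_wpM2r.
 by rewrite normrM (ger0_norm sig0) ler_wpM2r.
have h2 : `|noise_B p| <= Q * lam.
 rewrite /noise_B !normrM -[leRHS]mulr1 (ger0_norm lam0). by rewrite ler_pM// ?mulr_ge0// ler_wpM2r.
have sq (z Z : R) : `|z| <= Z -> z ^+ 2 <= Z ^+ 2.
 by move=> hz; rewrite -real_normK ?num_real// ler_sqr ?nnegrE// (le_trans _ hz).
by rewrite /noise2 mulrDr -!exprMn; apply: lerD; exact: sq.
Qed.

Variables (eps : R).
(** The rate at which exponents grow backwards in time: |d| and 2 |b| cover the drift, 1 covers the
    quadratic variation, and the last 1 leaves room for eps times the area. *)
Let K := `|d| + 2 * `|b| + 2.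
Hypotheses (eps0 : 0 < eps) (epsK : eps * expR (K * T) * ((2 * lam + 2 * sig) ^+ 2 + (2 * lam) ^+ 2) <= 1).
Let e1 := eps * expR (K * T).
Let K0 : 0 <= K. by rewrite !addr_ge0 ?mulr_ge0. Qed.
Let T0 : 0 <= T. exact: le_trans tT. Qed.

Section fixed_time.
Variables (p s : R).
Hypotheses (hp : `|p| <= eps) (ts : t <= s) (sT : s <= T).

(** What the sums of logarithmic martingales dominate in the limit of a fine mesh; the expectation
    of its exponential is therefore at most 1. *)
Let target w := p * (X s w - X t w) + eps * Y s w - e1 * Y t w + eps * area t Y s w - (eps * `|c| + e1 * `|a|) * T.
Let del n := (s - t) / n.+1%:R.
Let si n i := t + i%:R * del n.
(** The coefficients of Y grow geometrically backwards from eps at time s, a discrete supersolution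
    of the Riccati equation. Being constant on each cell, they call for nothing but [heston_le]. *)
Let qq n i := eps * (1 + K * del n) ^+ (n.+1 - i).
Let En n k w := \sum_(i < k) lmart p (qq n i) (si n i) (si n i.+1) w.

Let del0 n : 0 <= del n. by rewrite divr_ge0 ?subr_ge0. Qed.
Let siS n i : si n i <= si n i.+1.
by rewrite lerD2l ler_wpM2r// ler_nat. Qed.
Let si_t n i : t <= si n i.
by rewrite lerDl mulr_ge0. Qed.
Let si_n n : si n n.+1 = s.
by rewrite /si /del mulrC divfK ?pnatr_eq0//; ring. Qed.
Let si_s n i : (i <= n.+1)%N -> si n i <= s.
by move=> hi; rewrite -(si_n n) lerD2l ler_wpM2r// ler_nat. Qed.
Let siD n i : si n i.+1 - si n i = del n.
by rewrite /si -(natr1 i); ring. Qed.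

Let En_wrt n k : (k <= n.+1)%N -> measurable_wrt (F (si n k)) (En n k).
elim: k => [|k IH] hk; have sF k' := filtration_sigma hF (le_trans t0 (si_t n k')); apply/(measurable_wrtP (sF _)).
 by rewrite (_ : En n 0 = cst 0)//; apply/funext => w; rewrite /En big_ord0.
have -> : En n k.+1 = fun w => En n k w + lmart p (qq n k) (si n k) (si n k.+1) w.
 by apply/funext => w; rewrite /En big_ord_recr.
apply: measurable_funD; apply/(measurable_wrtP (sF _)).
 by apply: (filtration_wrt hF _ (siS n k)); [exact: le_trans (si_t n k)|apply: IH; exact: ltnW].
by apply: (log_mart_wrt) => //; exact: le_trans (si_s hk) sT.
Qed.

Let En_le n k : (k <= n.+1)%N -> (EE P (fun w => expR (En n k w)) <= 1)%E.
elim: k => [|k IH] hk.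
 rewrite (_ : (fun w => _) = cst 1); first by rewrite EE_cst. by apply/funext => w; rewrite /En big_ord0 expR0.
apply: le_trans (IH (ltnW hk)).
rewrite (_ : (fun w => expR (En n k.+1 w)) = fun w => expR (En n k w) * expR (lmart p (qq n k) (si n k) (si n k.+1) w)).
 apply: (heston_le) => //; first exact: le_trans (si_s hk) sT. have sF := filtration_sigma hF (le_trans t0 (si_t n k)).
 apply/(measurable_wrtP sF); apply: measurableT_comp => //. by apply/(measurable_wrtP sF); apply: En_wrt; exact: ltnW.
by apply/funext => w; rewrite /En big_ord_recr /= expRD.
Qed.

Let qq_ge n i : eps <= qq n i.
by rewrite /qq ler_peMr ?(ltW eps0)// exprn_ege1// lerDl mulr_ge0. Qed.
Let qq_le n i : qq n i <= e1.
rewrite /qq /e1 ler_wpM2l ?(ltW eps0)//.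
apply: (@le_trans _ _ (expR (K * del n) ^+ (n.+1 - i))).
 have k1 : 0 <= K * del n := mulr_ge0 K0 (del0 n).
 by apply: lerXn2r; [rewrite nnegrE addr_ge0|rewrite nnegrE expR_ge0|exact: expR_ge1Dx].
rewrite -expRM_natl ler_expR mulrCA ler_wpM2l//.
apply: (@le_trans _ _ (n.+1%:R * del n)); first by rewrite ler_wpM2r// ler_nat leq_subr.
by rewrite /del mulrC divfK ?pnatr_eq0// lerBlDr (le_trans sT)// lerDl.
Qed.

(** Summation by parts: [cell_bound] turns each increment into a telescoping term plus eps times the
    area, up to the oscillation m of the path of Y over a cell. *)
Let En_ge n m w : K * del n <= 1 -> 0 <= m ->
 (forall r r', t <= r <= T -> t <= r' <= T -> `|r - r'| <= del n -> `|Y r w - Y r' w| <= m) ->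
 target w - K * e1 * T * m <= En n n.+1 w.
move=> Kd m0 hm; have e10 : 0 <= e1 by rewrite mulr_ge0 ?expR_ge0 ?(ltW eps0).
have tele k : (k <= n.+1)%N -> p * (X (si n k) w - X t w) + (qq n k * Y (si n k) w - qq n 0 * Y t w) +
  eps * area t Y (si n k) w - (eps * `|c| + e1 * `|a|) * (k%:R * del n) - K * e1 * (k%:R * del n) * m <= En n k w.
 elim: k => [|k IH] hk.
  have st : si n 0 = t by rewrite /si mul0r addr0. by rewrite /En big_ord0 st area_t !subrr !(mulr0, mul0r) !subr0 !addr0.
 rewrite /En big_ord_recr /= -/(En n k w); apply: le_trans (lerD (IH (ltnW hk)) (lexx _)).
 have skT : si n k.+1 <= T by exact: le_trans (si_s hk) sT. have qE : qq n k = qq n k.+1 + K * del n * qq n k.+1.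
  by rewrite /qq subSn// exprS; ring.
 have [q1 q2 q3 q4] := And4 (qq_ge n k.+1) (qq_le n k.+1) (qq_ge n k) (qq_le n k). have q'0 := le_trans (ltW eps0) q1.
 have q2q : qq n k <= 2 * qq n k.+1.
  by rewrite qE; have := ler_wpM2r q'0 Kd; lra.
 have noise_le : noise p (qq n k) / 2 <= qq n k.+1.
  have n1 : `|p| <= 2 * qq n k.+1 by apply: le_trans hp _; lra.
  have n2 : `|qq n k| <= 2 * qq n k.+1 by rewrite ger0_norm// (le_trans (ltW eps0)). have := noise2_le n1 n2.
  have -> : (2 * qq n k.+1) ^+ 2 * ((lam + sig) ^+ 2 + lam ^+ 2) =
   qq n k.+1 * (qq n k.+1 * ((2 * lam + 2 * sig) ^+ 2 + (2 * lam) ^+ 2)) by ring.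
  move=> h; apply: le_trans (_ : noise p (qq n k) <= _); first by rewrite ler_piMr ?invf_le1 ?ler1n// addr_ge0 ?sqr_ge0.
  apply: le_trans h _; rewrite ler_piMr//; apply: le_trans epsK; rewrite ler_wpM2r//. by rewrite addr_ge0 ?sqr_ge0.
 have hK : p * d - qq n k * b + noise p (qq n k) / 2 + eps <= K * qq n k.+1.
  have h1 : p * d <= qq n k.+1 * `|d|.
   by apply: le_trans (ler_norm _) _; rewrite normrM ler_wpM2r// (le_trans hp).
  have h2 : - (qq n k * b) <= 2 * qq n k.+1 * `|b|.
   apply: le_trans (ler_norm _) _; rewrite normrN normrM ler_wpM2r// ger0_norm// (le_trans (ltW eps0))//.
  by rewrite /K; move: h1 h2 noise_le q1; lra.
 have dA0 : 0 <= area t Y (si n k.+1) w - area t Y (si n k) w by rewrite subr_ge0; apply: (area_le cY Y0).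
 have dA : area t Y (si n k.+1) w - area t Y (si n k) w <= del n * (Y (si n k.+1) w + m).
  rewrite (areaB cY)//; set z := Y (si n k.+1) w + m. apply: le_trans (_ : \int[leb]_(r in `]si n k, si n k.+1]) z <= _).
   apply: le_Rintegral => //.
   - exact: (path_integrable_oc (@cY w)).
   - have ic : leb.-integrable `[si n k, si n k.+1] (EFin \o (cst z : R -> R)).
     apply: continuous_compact_integrable; first exact: segment_compact.
     by apply: continuous_subspaceT => r; exact: cst_continuous.
    by apply: integrableS ic => // r /=; rewrite !in_itv /= => /andP[/ltW -> ->].
   - move=> r /=; rewrite in_itv /= => /andP[/ltW r1 r2].
    have rI : t <= r <= T by rewrite (le_trans (si_t n k) r1) (le_trans r2). have rI' : t <= si n k.+1 <= T by rewrite si_t skT.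
    have := hm r (si n k.+1) rI rI'; rewrite ler0_norm ?subr_le0// => /(_ _)/(le_trans (ler_norm _)).
    rewrite /z -lerBlDl; apply; rewrite opprB -(siD n k) lerD2l lerN2//.
  rewrite Rintegral_cst//= lebesgue_measure_itv /= lte_fin -(siD n k) mulrC. case: ltP => h; first by rewrite -EFinD.
  have -> : si n k.+1 = si n k by apply/eqP; rewrite eq_le h siS. by rewrite subrr.
 have := @cell_bound p (qq n k) (qq n k.+1) a b c d (noise p (qq n k) / 2) K eps e1 (del n) m
  (Y (si n k) w) (Y (si n k.+1) w) _ (X (si n k.+1) w - X (si n k) w) eps0 (del0 n) m0 K0 q1 q2 q4
  (le_trans (ltW eps0) q3) hp qE hK dA0 dA.
 move=> H; rewrite [lmart _ _ _ _ _]/log_mart siD; apply: le_trans (lerD (lexx _) H); apply: eq_leW. by rewrite -(natr1 k); ring.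
apply: le_trans (tele n.+1 (leqnn _)); rewrite si_n.
have -> : n.+1%:R * del n = s - t by rewrite /del mulrC divfK ?pnatr_eq0.
have qn : qq n n.+1 = eps by rewrite /qq subnn expr0 mulr1.
have stT : s - t <= T by rewrite lerBlDr (le_trans sT)// lerDl.
have tI : t <= t <= T by rewrite lexx.
have h1 := ler_wpM2r (Y0 w tI) (qq_le n 0).
have h2 : (eps * `|c| + e1 * `|a|) * (s - t) <= (eps * `|c| + e1 * `|a|) * T.
 by rewrite ler_wpM2l// addr_ge0// mulr_ge0// ltW.
have h3 : K * e1 * (s - t) * m <= K * e1 * T * m by rewrite ler_wpM2r// ler_wpM2l// mulr_ge0.
by rewrite /target qn; move: h1 h2 h3; lra.
Qed.

Let del_cvg : del n @[n --> \oo] --> (0 : R).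
by rewrite -(mulr0 (s - t)); apply: cvgMr; exact: cvg_harmonic. Qed.

Lemma exp_target_le : (EE P (fun w => expR (target w)) <= 1)%E.
have tI : t <= t <= T by rewrite lexx.
have sI : t <= s <= T by rewrite ts.
have mt : mfun target.
 apply: measurable_funB => //; apply: measurable_funD; last by apply: measurable_funM => //; exact: mAf.
 apply: measurable_funB; last by apply: measurable_funM => //; exact: mYf.
 apply: measurable_funD; last by apply: measurable_funM => //; exact: mYf.
 by apply: measurable_funM => //; apply: measurable_funB; exact: measurable_X.
have mEn n : mfun (En n n.+1).
 by apply: (filtration_fun hF (le_trans t0 (si_t n n.+1))); exact: En_wrt.
(* The minimum tends to the exponential of [target], because the sums eventually exceed [target]
   minus any error, and its expectation is at most 1. *)
apply: (EE_fatou (fun n w => Num.min (expR (target w)) (expR (En n n.+1 w)))).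
- by move=> n; apply: measurable_minr; exact: measurable_exp_fun.
- by move=> n w; rewrite le_min !expR_ge0.
- move=> w; apply/cvgrPdist_le => z z0.
 pose G := expR (target w); have G0 : 0 < G := expR_gt0 _. pose eta := z / G; have eta0 : 0 < eta by rewrite divr_gt0.
 have kk : 0 < 2 * (K * e1 * T + 1).
  by rewrite mulr_gt0// ltr_wpDl// !mulr_ge0 ?expR_ge0 ?(ltW eps0).
 pose m := eta / (K * e1 * T + 1). have kk' : 0 < K * e1 * T + 1 by lra. have m0 : 0 < m by rewrite divr_gt0.
 have [k k0 hk] := path_modulus t0 tT (@cY w) (divr_gt0 m0 (ltr0n _ 2)).
 have near1 : \forall n \near \oo, `|0 - del n| <= (K + 1)^-1.
  by apply: cvgr_dist_le del_cvg _ _; rewrite invr_gt0 ltr_wpDl.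
 have near2 : \forall n \near \oo, `|0 - k * (del n * del n)| <= m / 2.
  have cv : k * (del n * del n) @[n --> \oo] --> (0 : R).
   by rewrite -(mulr0 k) -(mulr0 (0 : R)); apply: cvgMr; apply: cvgM; exact: del_cvg.
  by apply: cvgr_dist_le cv _ _; rewrite divr_gt0.
 near=> n. have d1 : del n <= (K + 1)^-1.
  have : `|0 - del n| <= (K + 1)^-1 by near: n. by rewrite sub0r normrN ger0_norm.
 have d2 : k * (del n * del n) <= m / 2.
  have : `|0 - k * (del n * del n)| <= m / 2 by near: n.
  by rewrite sub0r normrN ger0_norm ?(mulr_ge0 k0 (mulr_ge0 (del0 n) (del0 n))).
 have Kd : K * del n <= 1.
  apply: le_trans (ler_wpM2l K0 d1) _; rewrite ler_pdivrMr ?mul1r ?lerDl// ltr_wpDl//.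
 have hm r r' : t <= r <= T -> t <= r' <= T -> `|r - r'| <= del n -> `|Y r w - Y r' w| <= m.
  move=> hr hr' rr; apply: le_trans (hk r' r hr' hr) _.
  rewrite [leRHS](splitr m) lerD2l; apply: le_trans d2; rewrite ler_wpM2l// -real_normK ?num_real//. by rewrite expr2 ler_pM.
 have hE := En_ge Kd (ltW m0) hm. have hE' : target w - eta <= En n n.+1 w.
  apply: le_trans hE; rewrite lerD2l lerN2 /m mulrCA ler_piMr ?(ltW eta0)// ler_pdivrMr//. by rewrite mul1r lerDl.
 rewrite ger0_norm ?subr_ge0 ?ge_min ?lexx// minEle; case: ifP => _; first by rewrite subrr ltW.
 have : expR (target w) * (1 - eta) <= expR (En n n.+1 w).
  apply: (@le_trans _ _ (expR (target w - eta))); last by rewrite ler_expR.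
  by rewrite [leRHS]expRD ler_wpM2l ?expR_ge0// expR_ge1Dx.
 rewrite mulrBr mulr1 -/G (_ : G * eta = z); first lra. by rewrite /eta; field; rewrite gt_eqF.
- move=> n; apply: le_trans (En_le (leqnn n.+1)); apply: EE_le.
 + by apply: measurable_minr; exact: measurable_exp_fun.
 + exact: measurable_exp_fun.
 + by move=> w; rewrite le_min !expR_ge0.
 + by move=> w; rewrite ge_min lexx orbT.
Unshelve. all: by end_near. Qed.

Lemma exp_moment_signed : (EE P (fun w => expR (p * X s w + eps * Y s w + eps * area t Y s w)) <=
  (expR (p * x + e1 * y + (eps * `|c| + e1 * `|a|) * T))%:E)%E.
have tI : t <= t <= T by rewrite lexx.
have sI : t <= s <= T by rewrite ts.
have mt : mfun target.
 apply: measurable_funB => //; apply: measurable_funD; last by apply: measurable_funM => //; exact: mAf.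
 apply: measurable_funB; last by apply: measurable_funM => //; exact: mYf.
 apply: measurable_funD; last by apply: measurable_funM => //; exact: mYf.
 by apply: measurable_funM => //; apply: measurable_funB; exact: measurable_X.
set k := p * x + _ + _.
rewrite (@EE_ae _ _ P _ (fun w => expR k * expR (target w))); first last.
- apply: filterS (start_ae) => w [Xt Yt].
 by rewrite -expRD /target Xt Yt; congr expR; rewrite /k; ring.
- by apply: measurable_funM => //; exact: measurable_exp_fun.
- apply: measurable_exp_fun; apply: measurable_funD; last by apply: measurable_funM => //; exact: mAf.
 by apply: measurable_funD; apply: measurable_funM => //; [exact: measurable_X|exact: mYf].
rewrite EE_Z ?expR_ge0//; last exact: measurable_exp_fun.
by rewrite -[leRHS]mule1 lee_wpmul2l ?lee_fin ?expR_ge0// exp_target_le.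
Qed.

End fixed_time.

(** The bounds for p = eps and p = - eps are added to reach |X|, and p = 0 gives the area. *)
Lemma exp_moment : let C := 3 * expR (eps * `|x| + e1 * y + (eps * `|c| + e1 * `|a|) * T) in
 (EE P (fun w => expR (eps * area t Y T w)) <= C%:E)%E /\
 forall s, t <= s <= T -> (EE P (fun w => expR (eps * (`|X s w| + Y s w))) <= C%:E)%E.
move=> C; pose C1 := expR (eps * `|x| + e1 * y + (eps * `|c| + e1 * `|a|) * T).
have c1 : 0 <= C1 := expR_ge0 _.
have ms p s : `|p| <= eps -> t <= s <= T -> (EE P (fun w => expR (p * X s w + eps * Y s w + eps * area t Y s w)) <= C1%:E)%E.
 move=> hp /andP[ts sT]; apply: le_trans (exp_moment_signed hp ts sT) _.
 rewrite lee_fin ler_expR !lerD2r; apply: le_trans (ler_norm _) _. by rewrite normrM ler_wpM2r.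
have h1 : `|eps| <= eps by rewrite gtr0_norm.
have h2 : `|- eps| <= eps by rewrite normrN gtr0_norm.
split.
- have TI : t <= T <= T by rewrite tT lexx.
 apply: (@le_trans _ _ C1%:E); last by rewrite lee_fin /C -/C1; lra. have h0 : `|0 : R| <= eps by rewrite normr0 ltW.
 apply: le_trans (ms 0 T h0 TI); apply: EE_le.
 + by apply: measurable_exp_fun; apply: measurable_funM => //; exact: mAf.
 + apply: measurable_exp_fun; apply: measurable_funD; last by apply: measurable_funM => //; exact: mAf.
  by apply: measurable_funD; apply: measurable_funM => //; [exact: measurable_X|exact: mYf].
 + by move=> w; exact: expR_ge0.
 + by move=> w; rewrite ler_expR mul0r add0r lerDr mulr_ge0 ?(ltW eps0)// Y0.
move=> s sI.
have mf q : mfun (fun w => expR (q * X s w + eps * Y s w + eps * area t Y s w)).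
 apply: measurable_exp_fun; apply: measurable_funD; last by apply: measurable_funM => //; exact: mAf.
 by apply: measurable_funD; apply: measurable_funM => //; [exact: measurable_X|exact: mYf].
apply: (@le_trans _ _ (C1 + C1)%:E); last by rewrite lee_fin /C -/C1; lra.
rewrite EFinD; apply: le_trans (leeD (ms _ _ h1 sI) (ms _ _ h2 sI)).
rewrite -EE_D//; try (by move=> w; exact: expR_ge0); try exact: mf.
apply: EE_le.
- apply: measurable_exp_fun; apply: measurable_funM => //; apply: measurable_funD; last exact: mYf.
 by apply: measurableT_comp => //; exact: measurable_X.
- by apply: measurable_funD; exact: mf.
- by move=> w; exact: expR_ge0.
move=> w; have A0 : 0 <= eps * area t Y s w by rewrite mulr_ge0 ?(ltW eps0)// (area_ge0 cY Y0).
have [h|h] := leP 0 (X s w).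
 apply: (@le_trans _ _ (expR (eps * X s w + eps * Y s w + eps * area t Y s w))); last by rewrite lerDl expR_ge0.
 by rewrite ler_expR (ger0_norm h) mulrDr lerDl.
apply: (@le_trans _ _ (expR (- eps * X s w + eps * Y s w + eps * area t Y s w))); last by rewrite lerDr expR_ge0.
by rewrite ler_expR (ltr0_norm h) mulrDr mulrN -mulNr lerDl.
Qed.

End exponential_moments.

(** * Dynkin's formula for exponentials and polynomials *)

Section dynkin.
Hypothesis rho1 : -1 < rho < 1.
Variables (eps C : R).
Hypotheses (eps0 : 0 < eps) (hA : (EE P (fun w => expR (eps * area t Y T w)) <= C%:E)%E)
 (hM : forall s, t <= s <= T -> (EE P (fun w => expR (eps * (`|X s w| + Y s w))) <= C%:E)%E).

Let cX w : {within `[t, T], continuous (X ^~ w)}.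
by have [_ h _ _] := hXY; exact: (h w).1. Qed.
Let TI : t <= T <= T. by rewrite tT lexx. Qed.
Let tI : t <= t <= T. by rewrite tT lexx. Qed.

Definition time_of (z : R * Omega) : R := clamp t T z.1.
(* The process and its time on [t, T] x Omega, extended by 0 to the whole product. *)
Definition along (phi : fun3) (z : R * Omega) : R := phi (time_of z) (X (time_of z) z.2) (Y (time_of z) z.2) * \1_`[t, T] z.1.

Let measurable_time : mfun time_of.
apply: (@measurableT_comp _ _ _ _ _ _ (clamp t T)) => //.
by apply: continuous_measurable_fun; exact: continuous_clamp.
Qed.

Let measurable_along_proc (K : R -> Omega -> R) : (forall s, t <= s <= T -> mfun (K s)) ->
 (forall w, {within `[t, T], continuous (K ^~ w)}) -> mfun (fun z : R * Omega => K (time_of z) z.2).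
exact: measurable_clamped. Qed.

Let measurable_XY : mfun (fun z => X (time_of z) z.2) /\ mfun (fun z => Y (time_of z) z.2).
split; apply: measurable_along_proc => // s hs; first exact: (measurable_X).
exact: (measurable_Y hF t0 mY).
Qed.

Lemma measurable_fun_ev d0 (S : measurableType d0) e (f g h : S -> R) : mfun f ->
 mfun g -> mfun h -> mfun (fun z => ev e (f z) (g z) (h z)).
move=> mf mg mh; elim: e => [k||||e1 h1 e2 h2|e1 h1 e2 h2|e1 h1|e1 h1|e1 h1] //=.
- exact: measurable_funD.
- exact: measurable_funM.
- exact: measurableT_comp.
- by apply: measurableT_comp => //; apply: continuous_measurable_fun; exact: continuous_sin.
- by apply: measurableT_comp => //; apply: continuous_measurable_fun; exact: continuous_cos.
Qed.

Let measurable_ind : mfun (fun z : R * Omega => \1_`[t, T] z.1 : R).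
by apply: (@measurableT_comp _ _ _ _ _ _ (\1_`[t, T]%classic : R -> R)). Qed.

Lemma measurable_along e : mfun (along (ev e)).
by have [h1 h2] := measurable_XY; apply: measurable_funM => //; exact: measurable_fun_ev. Qed.

Let time_itv z : t <= time_of z <= T. exact: clamp_itv. Qed.

Let along_E phi s w : t <= s <= T -> along phi (s, w) = phi s (X s w) (Y s w).
by move=> hs; rewrite /along /time_of /= clamp_id// indicE mem_set ?mulr1//= in_itv.
Qed.
Let along_out phi s w : ~~ (t <= s <= T) -> along phi (s, w) = 0.
by move=> hs; rewrite /along indicE memNset ?mulr0//= in_itv /=; apply/negP.
Qed.

Local Notation LP := (@lebesgue_measure R \x P)%E.

Let int_along phi (K : R) : 0 <= K -> mfun (along phi) -> (forall z, 0 <= along phi z) ->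
 (forall s, t <= s <= T -> (EE P (fun w => phi s (X s w) (Y s w)) <= K%:E)%E) ->
 (\int[LP]_z (along phi z)%:E <= (K * (T - t))%:E)%E.
move=> K0 mphi phi0 hK; rewrite fubini_tonelli1//; last exact/measurable_EFinP.
have h s : (fubini_F P (EFin \o along phi) s <= (K * \1_`[t, T] s)%:E)%E.
 rewrite /fubini_F /=; have [hs|hs] := boolP (t <= s <= T).
  rewrite indicE mem_set /= ?in_itv// mulr1; apply: le_trans (hK s hs); apply: eq_leW.
  by apply: eq_integral => w _; rewrite along_E.
 rewrite indicE memNset ?mulr0; last by rewrite /= in_itv /=; apply/negP. by rewrite integral0_eq// => w _; rewrite along_out.
apply: (@le_trans _ _ (\int[leb]_s (K * \1_`[t, T] s)%:E)%E).
 apply: ge0_le_integral => //.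
 - by move=> s _; apply: integral_ge0 => w _; rewrite lee_fin.
 - apply: measurable_fun_fubini_tonelli_F; [exact/measurable_EFinP|by move=> z; rewrite lee_fin].
 - by apply/measurable_EFinP; apply: measurable_funM.
 - by move=> s _; exact: h.
under eq_integral do rewrite EFinM.
rewrite ge0_integralZl//; last exact/measurable_EFinP.
rewrite integral_indic// setIT [X in (_ * X)%E]lebesgue_measure_itv /= lte_fin EFinM.
case: ltP => h'; rewrite ?EFinD// mule0 -EFinM lee_fin mulr_ge0// subr_ge0//.
Qed.

Let C0 : 0 <= C.
by rewrite -lee_fin; apply: le_trans hA; apply: EE_ge0 => w; exact: expR_ge0. Qed.

Let measurable_wt_along : mfun (along (fun _ => wt eps)).
have [h1 h2] := measurable_XY; apply: measurable_funM => //; apply: measurableT_comp => //.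
by apply: measurable_funM => //; apply: measurable_funD => //; exact: measurableT_comp.
Qed.

Let along_wt_ge0 z : 0 <= along (fun _ => wt eps) z.
by rewrite mulr_ge0// ltW ?wt_gt0. Qed.

Lemma integrable_wt : LP.-integrable setT (EFin \o along (fun _ => wt eps)).
apply/integrableP; split; first exact/measurable_EFinP.
under eq_integral do rewrite /= ger0_norm//.
by apply: le_lt_trans (int_along C0 measurable_wt_along along_wt_ge0 hM) _; rewrite ltry.
Qed.

Definition dominated (phi : fun3) (K : R) := forall s z y', 0 <= s <= T -> 0 <= y' -> `|phi s z y'| <= K * wt eps z y'.

Lemma along_le phi K z : dominated phi K -> `|along phi z| <= K * along (fun _ => wt eps) z.
move=> hd; rewrite /along normrM (ger0_norm (_ : 0 <= \1__ _))// mulrA ler_wpM2r//.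
have /andP[h1 h2] := time_itv z.
by apply: hd; [rewrite (le_trans t0)|exact: Y0].
Qed.

Lemma integrable_wtK K : LP.-integrable setT (EFin \o (fun z => K * along (fun _ => wt eps) z)).
rewrite (_ : EFin \o _ = fun z => (K%:E * (EFin \o along (fun _ => wt eps)) z)%E); last exact/funext.
by apply: integrableZl => //; exact: integrable_wt.
Qed.

Lemma integrable_along phi K : mfun (along phi) -> dominated phi K -> LP.-integrable setT (EFin \o along phi).
move=> mphi hd; apply: le_integrable (integrable_wtK K) => //; first exact/measurable_EFinP.
by move=> z _ /=; rewrite lee_fin (le_trans (along_le z hd))// ler_norm.
Qed.

Lemma integrable_wt_end K : P.-integrable setT (EFin \o (fun w => K * wt eps (X T w) (Y T w))).
rewrite (_ : EFin \o _ = fun w => (K%:E * (EFin \o (fun w => wt eps (X T w) (Y T w))) w)%E); last exact/funext.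
apply: integrableZl => //; apply/integrableP; split.
 apply/measurable_EFinP; apply: measurableT_comp => //; apply: measurable_funM => //.
 apply: measurable_funD; last exact: (measurable_Y hF t0 mY). by apply: measurableT_comp => //; exact: (measurable_X).
under eq_integral do rewrite /= ger0_norm ?(ltW (wt_gt0 _ _ _))//.
by apply: le_lt_trans (hM TI) _; rewrite ltry.
Qed.

Lemma integrable_end (phi : R -> R -> R) K : mfun (fun w => phi (X T w) (Y T w)) ->
 (forall z y', 0 <= y' -> `|phi z y'| <= K * wt eps z y') -> P.-integrable setT (EFin \o (fun w => phi (X T w) (Y T w))).
move=> mphi hd; apply: le_integrable (integrable_wt_end K) => //; first exact/measurable_EFinP.
move=> w _ /=; rewrite lee_fin; apply: le_trans (hd _ _ (Y0 _ TI)) _.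
by rewrite ler_norm.
Qed.

Lemma along_bound phi K : 0 <= K -> mfun (along phi) -> dominated phi K -> `|\int[LP]_z along phi z| <= K * (C * (T - t)).
move=> K0 mphi hd; have ip := integrable_along mphi hd.
apply: le_trans (le_normr_Rintegral measurableT ip) _.
apply: (@le_trans _ _ (\int[LP]_z (K * along (fun _ => wt eps) z))).
 apply: le_Rintegral; [exact: measurableT|exact: integrable_norm|exact: integrable_wtK|]. by move=> z _; exact: along_le.
rewrite RintegralZl//; last exact: integrable_wt.
rewrite ler_wpM2l// -lee_fin /Rintegral fineK; last exact: (integrable_fin_num measurableT integrable_wt).
exact: int_along C0 measurable_wt_along along_wt_ge0 hM.
Qed.

Lemma end_bound (phi : R -> R -> R) K : 0 <= K -> mfun (fun w => phi (X T w) (Y T w)) ->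
 (forall z y', 0 <= y' -> `|phi z y'| <= K * wt eps z y') -> `|\int[P]_w phi (X T w) (Y T w)| <= K * C.
move=> K0 mphi hd; have ip := integrable_end mphi hd; have i1 := integrable_wt_end 1.
apply: le_trans (le_normr_Rintegral measurableT ip) _.
apply: (@le_trans _ _ (\int[P]_w (K * (1 * wt eps (X T w) (Y T w))))).
 apply: le_Rintegral; [exact: measurableT|exact: integrable_norm| |].
  by have := integrable_wt_end K; apply: eq_integrable => // w _; rewrite /= mul1r.
 by move=> w _; rewrite mul1r; apply: hd; exact: Y0.
rewrite RintegralZl// ler_wpM2l// -lee_fin /Rintegral fineK; last exact: (integrable_fin_num measurableT i1).
by apply: le_trans (hM TI); under eq_integral do rewrite mul1r.
Qed.

Let k := Prm a b c d lam sig rho.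

(** The time integral and the expectation are one integral for the product measure, so that a single
    dominated convergence passes to the limit. *)
Definition dynkin (e : expr) : Prop := \int[P]_w ev e T (X T w) (Y T w) - ev e t x y = \int[LP]_z along (ev (heat k e)) z.

Lemma exp_expr_le r om p q s z y' : `|p| <= r -> `|q| <= r -> 0 <= s <= T -> 0 <= y' ->
 ev (exp_expr om p q) s z y' <= expR (`|om| * T) * wt r z y'.
move=> hp hq /andP[s0 sT] y0; rewrite /= /wt -expRD ler_expR; apply: lerD.
 apply: le_trans (ler_norm _) _; rewrite normrM; apply: ler_pM => //; rewrite ger0_norm//.
rewrite mulrDr; apply: lerD; apply: le_trans (ler_norm _) _; rewrite normrM.
 exact: ler_wpM2r.
by rewrite (ger0_norm y0) ler_wpM2r.
Qed.

Let noise := noise2.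

Lemma noise2E p q : noise p q = lam ^+ 2 * p ^+ 2 + 2 * rho * lam * sig * (p * q) + sig ^+ 2 * q ^+ 2.
have r0 : 0 <= 1 - rho ^+ 2 by move/andP : rho1 => [h1 h2]; nra.
by rewrite /noise /noise2 /noise_W /noise_B !exprMn sqr_sqrtr//; ring.
Qed.

Section exponential.
Variables (om p q : R).
Hypotheses (hp : `|p| <= eps / 2) (hq : `|q| <= eps / 2) (hn : 4 * noise p q <= eps).
Local Notation lmart := (log_mart p q).

Let LM z := expR (lmart (time_of z) T z.2).

Let LM_E s w : t <= s <= T -> LM (s, w) = expR (lmart s T w).
by move=> hs; rewrite /LM /time_of clamp_id. Qed.

Let measurable_LM : mfun LM.
apply: measurableT_comp => //; have [h1 h2] := measurable_XY.
have m2 (f : Omega -> R) : mfun f -> mfun (fun z : R * Omega => f z.2).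
 by move=> mf; exact: measurableT_comp.
have mX' := m2 _ (measurable_X TI); have mY' := m2 _ (measurable_Y hF t0 mY TI).
have mA' := m2 _ (measurable_area hF t0 mY cY Y0 TI).
have mA : mfun (fun z : R * Omega => area t Y (time_of z) z.2).
 apply: measurable_along_proc; first exact: (measurable_area hF t0 mY cY Y0).
 by move=> w; apply: (parameterized_integral_continuous tT); exact: (path_integrable (@cY w)).
apply: measurable_funB; last by apply: measurable_funM => //; exact: measurable_funB.
apply: measurable_funB; last by apply: measurable_funM => //; exact: measurable_funB.
by apply: measurable_funD; apply: measurable_funM => //; exact: measurable_funB.
Qed.

Let area_moment : (EE P (fun w => expR (4 * noise p q * area t Y T w)) <= C%:E)%E.
apply: le_trans hA; apply: EE_le; try by apply: measurable_exp_fun; apply: measurable_funM => //; exact: (measurable_area hF t0 mY cY Y0).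
 by move=> w; exact: expR_ge0.
by move=> w; rewrite ler_expR ler_wpM2r// (area_ge0 cY Y0).
Qed.

(** At each time s the factor [LM] has conditional expectation one given the past, by [heston_eq],
    and disappears under the expectation. *)
Let martingale_along (e : expr) K : (forall s z y', 0 <= s <= T -> 0 <= y' -> 0 <= ev e s z y' <= K * wt eps z y') ->
 LP.-integrable setT (EFin \o (fun z => along (ev e) z * LM z)) /\ \int[LP]_z (along (ev e) z * LM z) = \int[LP]_z along (ev e) z.
move=> he; have me := measurable_along e.
have e0 z : 0 <= along (ev e) z.
 have /andP[h1 h2] := time_itv z; rewrite mulr_ge0//.
 by have /andP[] := he (time_of z) (X (time_of z) z.2) (Y (time_of z) z.2) ltac:(by rewrite (le_trans t0)) (Y0 _ (time_itv z)).
have mL : mfun (fun z => along (ev e) z * LM z) by exact: measurable_funM.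
have eq : (\int[LP]_z (along (ev e) z * LM z)%:E = \int[LP]_z (along (ev e) z)%:E)%E.
 rewrite !fubini_tonelli1//; try exact/measurable_EFinP; last by move=> z; rewrite lee_fin mulr_ge0 ?expR_ge0.
 apply: eq_integral => s _; rewrite /fubini_F. have [hs|hs] := boolP (t <= s <= T); last first.
  by apply: eq_integral => w _; rewrite along_out// mul0r.
 have /andP[ts sT] := hs; have s0 := le_trans t0 ts; have sF := filtration_sigma hF s0. pose xi w := ev e s (X s w) (Y s w).
 have mxi : measurable_wrt (F s) xi.
  apply/(measurable_wrtP sF); apply: measurable_fun_ev => //; apply/(measurable_wrtP sF); [exact: mX|exact: mY].
 have xi0 w : 0 <= xi w by have /andP[] := he s (X s w) (Y s w) ltac:(by rewrite s0) (Y0 w hs).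
 have := heston_eq ts sT (lexx T) mxi xi0 area_moment; rewrite /mean => E.
 transitivity (\int[P]_w (xi w * expR (lmart s T w))%:E)%E.
  by apply: eq_integral => w _; rewrite (along_E _ _ hs) (LM_E _ hs).
 by rewrite E; apply: eq_integral => w _; rewrite along_E.
have ie : LP.-integrable setT (EFin \o along (ev e)).
 apply: (@integrable_along _ K) => // s z y' hs hy; have /andP[h1 h2] := he s z y' hs hy. by rewrite ger0_norm.
split; last by rewrite /Rintegral eq.
have /integrableP[_] := ie; under eq_integral do rewrite /= ger0_norm//.
rewrite -eq => fin; apply/integrableP; split; first exact/measurable_EFinP.
under eq_integral do rewrite /= ger0_norm ?(mulr_ge0 (e0 _) (expR_ge0 _))//.
exact: fin.
Qed.

Let be := om + (p * c + q * a).
Let kap := p * d - q * b + noise p q / 2.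
Let e0 := exp_expr om p q.
Let e1 : expr := Mul Vy e0.

Let e0_bound s z y' : 0 <= s <= T -> 0 <= y' -> 0 <= ev e0 s z y' <= expR (`|om| * T) * wt eps z y'.
move=> hs hy; rewrite expR_ge0 /=; apply: le_trans (exp_expr_le _ _ hp hq hs hy) _.
by apply: ler_wpM2l; [exact: expR_ge0|apply: le_wt => //; rewrite ler_pdivrMr// ler_peMr ?(ltW eps0)// ler1n].
Qed.

Let e1_bound s z y' : 0 <= s <= T -> 0 <= y' -> 0 <= ev e1 s z y' <= (2 / eps * expR (`|om| * T)) * wt eps z y'.
move=> hs hy; rewrite -[ev e1 _ _ _]/(y' * ev e0 s z y') mulr_ge0 ?expR_ge0//=.
have hy2 : y' <= 2 / eps * expR (eps / 2 * y').
 have h := le_trans (ltW (ltr01)) (lexx 1) ; have := expR_ge1Dx (eps / 2 * y'). have e2 : 0 < 2 / eps by rewrite divr_gt0.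
 move=> h1; have := ler_wpM2l (ltW e2) h1; rewrite mulrDr mulr1 mulrA. have -> : 2 / eps * (eps / 2) = 1 by field; rewrite gt_eqF.
 by rewrite mul1r; lra.
apply: le_trans (ler_pM hy (expR_ge0 _) hy2 (exp_expr_le _ _ hp hq hs hy)) _.
rewrite mulrACA; apply: ler_wpM2l; first by rewrite mulr_ge0 ?divr_ge0 ?expR_ge0 ?(ltW eps0).
rewrite /wt -expRD ler_expR.
have -> : eps / 2 * y' + eps / 2 * (`|z| + y') = eps * (`|z| + y') - eps / 2 * `|z| by field.
by rewrite gerBl mulr_ge0// divr_ge0// ltW.
Qed.

(** Multiplying e^(om s + p X_s + q Y_s) by the exponential martingale over [s, T] cancels X_s and
    Y_s in the exponent: the rest depends on s only through s and the area. The fundamental theorem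
    of calculus applies along each path, and taking expectations removes the martingale factor
    again. *)
Lemma dynkin_exp : dynkin e0.
have [i0 E0] := martingale_along e0_bound; have [i1 E1] := martingale_along e1_bound.
pose f z := be * (along (ev e0) z * LM z) + kap * (along (ev e1) z * LM z).
have intZ (kk : R) (g : R * Omega -> R) : LP.-integrable setT (EFin \o g) -> LP.-integrable setT (EFin \o (fun z => kk * g z)).
 by move=> ig; rewrite (_ : EFin \o _ = fun z => (kk%:E * (EFin \o g) z)%E); [exact: integrableZl|exact/funext].
have jf : LP.-integrable setT (EFin \o f).
 rewrite (_ : EFin \o f = (EFin \o (fun z => be * (along (ev e0) z * LM z))) \+ (EFin \o (fun z => kap * (along (ev e1) z * LM z)))).
  by apply: integrableD => //; exact: intZ.
 exact/funext.
have a0 : LP.-integrable setT (EFin \o along (ev e0)).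
 apply: (@integrable_along _ (expR (`|om| * T))); first exact: measurable_along.
 by move=> s z y' hs hy; have /andP[h1 h2] := e0_bound z hs hy; rewrite ger0_norm.
have a1 : LP.-integrable setT (EFin \o along (ev e1)).
 apply: (@integrable_along _ (2 / eps * expR (`|om| * T))); first exact: measurable_along.
 by move=> s z y' hs hy; have /andP[h1 h2] := e1_bound z hs hy; rewrite ger0_norm.
have Ef : \int[LP]_z f z = \int[LP]_z along (ev (heat k e0)) z.
 have -> : along (ev (heat k e0)) = fun z => be * along (ev e0) z + kap * along (ev e1) z.
  apply/funext => z; rewrite /along ev_heat /hop /be /kap noise2E /=; move: (\1__ _) (expR _) => i E; by field.
 rewrite /f !RintegralD//; try exact: intZ. by rewrite !RintegralZl// E0 E1.
pose G s w := p * X T w + q * Y T w - (p * c + q * a) * T - kap * area t Y T w + be * s + kap * area t Y s w.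
have GE s w : G s w = om * s + (p * X s w + q * Y s w) + lmart s T w.
 by rewrite /G /log_mart /be /kap /noise; ring.
have path w : ((ev e0 T (X T w) (Y T w))%:E - (ev e0 t (X t w) (Y t w) * expR (lmart t T w))%:E =
  \int[leb]_s (EFin \o f) (s, w))%E.
 have -> : ev e0 T (X T w) (Y T w) = expR (G T w).
  by rewrite GE /log_mart !subrr !mulr0 !subr0 !addr0.
 have -> : ev e0 t (X t w) (Y t w) * expR (lmart t T w) = expR (G t w) by rewrite GE [RHS]expRD.
 rewrite -EFinB -(exp_ftc _ _ _ tT (@cY w)) integral_mkcond; apply: eq_integral => s _. rewrite /patch; case: ifPn => hs.
  have {}hs : t <= s <= T by move: hs; rewrite inE /= in_itv. rewrite [RHS]/= /f !(along_E _ _ hs) !(LM_E _ hs) -/(area t Y s w).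
  have -> : p * X T w + q * Y T w - (p * c + q * a) * T - kap * area t Y T w + be * s + kap * area t Y s w = G s w by [].
  by rewrite GE [expR (_ + lmart s T w)]expRD /=; congr EFin; ring.
 have {}hs : ~~ (t <= s <= T) by apply: contra hs => h; rewrite inE /= in_itv. by rewrite /f /= !along_out// !mul0r !mulr0 addr0.
rewrite /dynkin -Ef /Rintegral -(integral21_prod_meas1 jf) /fubini_G.
have mt : mfun (fun w => ev e0 t (X t w) (Y t w)).
 by apply: measurable_fun_ev => //; [exact: (measurable_X)|exact: (measurable_Y hF t0 mY)].
have mT : mfun (fun w => ev e0 T (X T w) (Y T w)).
 by apply: measurable_fun_ev => //; [exact: (measurable_X)|exact: (measurable_Y hF t0 mY)].
have ml := measurable_exp_fun (measurable_log_mart p q (lexx t) tT (lexx T)).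
have start : (\int[P]_w (ev e0 t (X t w) (Y t w) * expR (lmart t T w))%:E = (ev e0 t x y)%:E)%E.
 have mxi : measurable_wrt (F t) (fun w => ev e0 t (X t w) (Y t w)).
  have sF := filtration_sigma hF t0; apply/(measurable_wrtP sF).
  by apply: measurable_fun_ev => //; apply/(measurable_wrtP sF); [exact: mX|exact: mY].
 have := heston_eq (lexx t) tT (lexx T) mxi (fun w => expR_ge0 _) area_moment.
 rewrite /mean => ->; rewrite -(EE_cst P (ev e0 t x y)); apply: EE_ae => //. by apply: filterS (start_ae) => w [-> ->].
have iT : P.-integrable setT (EFin \o (fun w => ev e0 T (X T w) (Y T w))).
 apply: (@integrable_end (ev e0 T) (expR (`|om| * T))) => //= z y' hy. have TT : 0 <= T <= T by rewrite (le_trans t0 tT) lexx.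
 by have /andP[h1 h2] := e0_bound z TT hy; rewrite ger0_norm.
have it : P.-integrable setT (EFin \o (fun w => ev e0 t (X t w) (Y t w) * expR (lmart t T w))).
 apply/integrableP; split; first by apply/measurable_EFinP; exact: measurable_funM.
 under eq_integral do rewrite /= ger0_norm ?mulr_ge0 ?expR_ge0//. by rewrite start ltry.
have -> : (\int[P]_w \int[leb]_s (EFin \o f) (s, w) =
  \int[P]_w (EFin \o (fun w => ev e0 T (X T w) (Y T w))) w - \int[P]_w (EFin \o (fun w => (ev e0 t (X t w) (Y t w) * expR (lmart t T w))%R)) w)%E.
 by rewrite -integralB//; apply: eq_integral => w _; rewrite -path.
rewrite (fineB (integrable_fin_num measurableT iT) (integrable_fin_num measurableT it)).
by congr (_ - _); have := congr1 fine start => /= ->.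
Qed.

End exponential.

Let bounded_exp e := exists K, dominated (ev e) K /\ dominated (ev (heat k e)) K.

Let measurable_end e : mfun (fun w => ev e T (X T w) (Y T w)).
by apply: measurable_fun_ev => //; [exact: (measurable_X)|exact: (measurable_Y hF t0 mY)].
Qed.

Let TT : 0 <= T <= T. by rewrite (le_trans t0 tT) lexx. Qed.

Lemma integrable_end_ev e K : dominated (ev e) K -> P.-integrable setT (EFin \o (fun w => ev e T (X T w) (Y T w))).
by move=> hd; apply: (@integrable_end (ev e T) K) => // z y' hy; exact: hd. Qed.

Lemma dynkin_ext e e' : (forall s z y', ev e s z y' = ev e' s z y') -> dynkin e -> dynkin e'.
move=> h; have hT : (fun w => ev e T (X T w) (Y T w)) = (fun w => ev e' T (X T w) (Y T w)) by apply/funext => w; exact: h.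
rewrite /dynkin hT h => ->; apply: eq_Rintegral => z _; by rewrite /along (heat_ext k h).
Qed.

Lemma dynkin_lin e1 e2 cc : bounded_exp e1 /\ dynkin e1 -> bounded_exp e2 /\ dynkin e2 ->
 bounded_exp (Add e1 (Mul (Cst cc) e2)) /\ dynkin (Add e1 (Mul (Cst cc) e2)).
move=> [[K1 [d1 d1']] h1] [[K2 [d2 d2']] h2].
have he s z y' : ev (heat k (Add e1 (Mul (Cst cc) e2))) s z y' = ev (heat k e1) s z y' + cc * ev (heat k e2) s z y'.
 by rewrite !ev_heat /hop /=; ring.
split.
 have le (p1 p2 b1 b2 v : R) : `|p1| <= b1 * v -> `|p2| <= b2 * v -> `|p1 + cc * p2| <= (b1 + `|cc| * b2) * v.
  move=> l1 l2; apply: le_trans (ler_normD _ _) _; rewrite mulrDl normrM -mulrA; apply: lerD => //. exact: ler_wpM2l.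
 exists (K1 + `|cc| * K2); split=> s z y' hs hy; last by rewrite he; apply: le; [exact: d1'|exact: d2'].
 by apply: le; [exact: d1|exact: d2].
move: h1 h2; rewrite /dynkin => h1 h2.
have i1 := integrable_along (measurable_along _) d1'; have i2 := integrable_along (measurable_along _) d2'.
have j1 := integrable_end_ev d1; have j2 := integrable_end_ev d2.
have intZ d0 (S : measurableType d0) (mu : {measure set S -> \bar R}) (g : S -> R) :
  mu.-integrable setT (EFin \o g) -> mu.-integrable setT (EFin \o (fun z => cc * g z)).
 by move=> ig; rewrite (_ : EFin \o _ = fun z => (cc%:E * (EFin \o g) z)%E); [exact: integrableZl|exact/funext].
rewrite [X in X - _ = _]RintegralD//; last exact: intZ.
rewrite RintegralZl//= -/(ev e1 _ _ _).
have -> : along (ev (heat k (Add e1 (Mul (Cst cc) e2)))) = fun z => along (ev (heat k e1)) z + cc * along (ev (heat k e2)) z.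
 by apply/funext => z; rewrite /along he; ring.
by rewrite RintegralD//; [rewrite RintegralZl// -h1 -h2; ring|exact: intZ].
Qed.

Lemma dynkin_lim en e K : (forall n, dominated (ev (en n)) K /\ dominated (ev (heat k (en n))) K) ->
 (forall s z y', ev (en n) s z y' @[n --> \oo] --> ev e s z y') ->
 (forall s z y', ev (heat k (en n)) s z y' @[n --> \oo] --> ev (heat k e) s z y') -> (forall n, dynkin (en n)) -> dynkin e.
move=> hd hc hc' de.
have l1 : \int[P]_w ev (en n) T (X T w) (Y T w) @[n --> \oo] --> \int[P]_w ev e T (X T w) (Y T w).
 apply: (Rintegral_dct _ _ _ (integrable_wt_end K)) => // n w. by apply: (hd n).1 => //; exact: Y0.
have l2 : \int[LP]_z along (ev (heat k (en n))) z @[n --> \oo] --> \int[LP]_z along (ev (heat k e)) z.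
 apply: (Rintegral_dct _ _ _ (integrable_wtK K)); try by [move=> *; exact: measurable_along|exact: measurable_along].
  by move=> z; apply: cvgM; [exact: hc'|exact: cvg_cst].
 by move=> n z; apply: along_le; exact: (hd n).2.
have l3 : \int[P]_w ev (en n) T (X T w) (Y T w) - ev (en n) t x y @[n --> \oo] -->
 \int[P]_w ev e T (X T w) (Y T w) - ev e t x y by apply: cvgB => //; exact: hc.
have E : (fun n => \int[P]_w ev (en n) T (X T w) (Y T w) - ev (en n) t x y) = fun n => \int[LP]_z along (ev (heat k (en n))) z.
 by apply/funext => n; exact: de.
by rewrite E in l3; exact: (cvg_unique _ l3 l2).
Qed.

Section polynomials.
Variable r0 : R.
Hypotheses (r00 : 0 < r0) (r04 : r0 <= eps / 4) (rn : forall p q, `|p| <= r0 -> `|q| <= r0 -> 4 * noise p q <= eps).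

Lemma poly_exp_le om p q e : poly_exp om p q e -> `|p| <= r0 -> `|q| <= r0 ->
 exists2 K, 0 <= K & forall s z y', 0 <= s <= T -> 0 <= y' -> `|ev e s z y'| <= K * wt (eps / 2) z y'.
move=> [g [pg hg]] hp hq.
have [K K0 hK] := poly_subexp T pg (divr_gt0 eps0 (ltr0n _ 4)).
exists (K * expR (`|om| * T)); first by rewrite mulr_ge0 ?expR_ge0 ?ltW.
move=> s z y' hs hy; rewrite hg [ev _ _ _ _]/= normrM.
have := exp_expr_le om z (le_trans hp r04) (le_trans hq r04) hs hy.
rewrite -[X in X <= _]gtr0_norm ?expR_gt0// => h.
apply: le_trans (ler_pM _ _ (hK s z y' hs hy) h) _ => //.
by rewrite mulrACA -wtD (_ : eps / 4 + eps / 4 = eps / 2)//; field.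
Qed.

Lemma poly_exp_bounded om p q e : poly_exp om p q e -> `|p| <= r0 -> `|q| <= r0 -> bounded_exp e.
move=> pe hp hq; have [K1 k1 h1] := poly_exp_le pe hp hq.
have [K2 k2 h2] := poly_exp_le (poly_exp_heat k pe) hp hq.
have hw z y' : 0 <= y' -> wt (eps / 2) z y' <= wt eps z y'.
 by move=> hy; apply: le_wt => //; rewrite ler_pdivrMr// ler_peMr ?(ltW eps0)// ler1n.
exists (K1 + K2); split=> s z y' hs hy.
 by apply: le_trans (h1 s z y' hs hy) _; apply: ler_pM => //; rewrite ?(ltW (wt_gt0 _ _ _)) ?lerDl ?hw.
by apply: le_trans (h2 s z y' hs hy) _; apply: ler_pM => //; rewrite ?(ltW (wt_gt0 _ _ _)) ?lerDr ?hw.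
Qed.

(** Exponents range over an open set, which makes the property stable under differentiation in
    them. *)
Let Q G := forall om p q, `|p| < r0 -> `|q| < r0 -> dynkin (Mul G (exp_expr om p q)).

(** A linear factor is a derivative of the exponential in its exponents: the difference quotients
    are combinations of exponentials with shifted exponents, and [dynkin_lim] passes to the
    limit. *)
Lemma dynkin_linear_factor G lt lx ly : is_poly G -> `|lt| <= 1 -> `|lx| <= 1 -> `|ly| <= 1 ->
 Q G -> Q (Mul G (lin_expr lt lx ly)).
move=> pG ht hx hy QG om p q hp hq.
(* The shifted exponents must stay below r0, so the step h is kept below the room that is left. *)
pose m := Num.min (r0 - `|p|) (r0 - `|q|).
have m0 : 0 < m by rewrite lt_min !subr_gt0 hp.
have me : m <= eps / 4 by rewrite (le_trans _ r04)// ge_min lerBlDr lerDl normr_ge0.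
pose hn (n : nat) := m / 2 * n.+1%:R^-1.
have hn0 n : 0 < hn n by rewrite !mulr_gt0 ?invr_gt0.
have hnm n : hn n < m.
 apply: (@le_lt_trans _ _ (m / 2)); last by lra. by rewrite ler_piMr ?divr_ge0 ?(ltW m0)// invf_le1 ?ltr0n// ler1n.
have hnc : hn n @[n --> \oo] --> (0 : R).
 by rewrite -(mulr0 (m / 2)); apply: cvgMr; exact: cvg_harmonic.
have shift n (p' l : R) : `|l| <= 1 -> m <= r0 - `|p'| -> `|p' + hn n * l| < r0.
 move=> hl hm; apply: le_lt_trans (ler_normD _ _) _; rewrite normrM (gtr0_norm (hn0 n)).
 have := ler_wpM2l (ltW (hn0 n)) hl; have := hnm n; lra.
have sp n := shift n p lx hx ltac:(by rewrite ge_min lexx).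
have sq n := shift n q ly hy ltac:(by rewrite ge_min lexx orbT).
pose u := Mul G (exp_expr om p q).
have pu : poly_exp om p q u by exists G.
pose L := lin_expr lt lx ly.
pose en n := Mul u (quot_expr (hn n) lt lx ly).
have den n : dynkin (en n).
 have b0 : bounded_exp u /\ dynkin u by split; [apply: (poly_exp_bounded pu); exact: ltW|exact: QG].
 pose u1 := Mul G (exp_expr (om + hn n * lt) (p + hn n * lx) (q + hn n * ly)). have b1 : bounded_exp u1 /\ dynkin u1.
  split; last by apply: QG; [exact: sp|exact: sq].
  by apply: (@poly_exp_bounded (om + hn n * lt) (p + hn n * lx) (q + hn n * ly)); [exists G|exact/ltW/sp|exact/ltW/sq].
 have b2 := dynkin_lin (-1) b1 b0; have [_] := dynkin_lin ((hn n)^-1 - 1) b2 b2.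
 apply: dynkin_ext => s z y'; rewrite /en /u /u1 /=.
 set z1 := om * s + _; set z2 := hn n * (lt * s + _); rewrite (_ : _ * s + (_ + _) = z1 + z2); last by rewrite /z1 /z2; ring.
 by rewrite (expRD z1 z2); ring.
have [K1 k1 h1] := poly_exp_le pu (ltW hp) (ltW hq).
have [K2 k2 h2] := poly_exp_le (poly_exp_heat k pu) (ltW hp) (ltW hq).
have pc := poly_exp_cross k lt lx ly pu.
have [K3 k3 h3] := poly_exp_le pc (ltW hp) (ltW hq).
have ps : poly_exp om p q (second_expr k u lx ly) by apply: poly_exp_M.
have [K4 k4 h4] := poly_exp_le ps (ltW hp) (ltW hq).
have pL : is_poly L by do !split.
have [K5 k5 h5] := poly_subexp T pL (divr_gt0 eps0 (ltr0n _ 4)).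
pose c0 := expR (eps / 4 * T); pose V := K1 + K2 + K3 + K4.
have c00 : 0 <= c0 := expR_ge0 _.
have KV0 : [/\ K1 <= V, K2 <= V, K3 <= V & K4 <= V] by rewrite /V; split; lra.
have [v1 v2 v3 v4] := KV0; have V0 : 0 <= V := le_trans k1 v1.
pose K := V * (K5 * (1 + c0) + (1 + eps) * c0).
(* Bounds uniform in the step: half of the rate eps is reserved for [u], and a quarter each for the
   linear form and for e^(h L). *)
have bound n s z y' : 0 <= s <= T -> 0 <= y' -> let l := ev L s z y' in
 `|(hn n)^-1 * (expR (hn n * l) + -1)| <= K5 * (1 + c0) * (wt (eps / 4) z y' * wt (eps / 4) z y') /\
 expR (hn n * l) <= c0 * (wt (eps / 4) z y' * wt (eps / 4) z y'). move=> hs hy' l; set w4 := wt (eps / 4) z y'.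
 have w1 : 1 <= w4 by apply: wt_ge1 => //; rewrite divr_ge0 ?(ltW eps0). have w0 : 0 <= w4 := le_trans ler01 w1.
 have ll : `|l| <= T + (`|z| + y').
  move/andP: hs => [s0 sT]; rewrite /l /=; apply: le_trans (ler_normD _ _) _; apply: lerD.
   by rewrite normrM (ger0_norm s0) -[T]mul1r ler_pM.
  apply: le_trans (ler_normD _ _) _; rewrite !normrM (ger0_norm hy'). by apply: lerD; rewrite -[leRHS]mul1r ler_pM.
 have E4 : expR (hn n * l) <= c0 * w4.
  rewrite /c0 /w4 /wt -expRD ler_expR -mulrDr; apply: le_trans (ler_norm _) _.
  by rewrite normrM (gtr0_norm (hn0 n)) ler_pM ?(ltW (hn0 n))// (le_trans (ltW (hnm n))).
 split; last by apply: le_trans E4 _; rewrite ler_wpM2l// ler_peMl. have /andP[q1 q2] := quot_itv l (hn0 n).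
 have l5 : `|l| <= K5 * w4 := h5 s z y' hs hy'. apply: (@le_trans _ _ (`|l| * (1 + expR (hn n * l)))).
  have ln := ler_norm l; have ln' := ler_norm (- l); rewrite normrN in ln'.
  have p1 := mulr_ge0 (normr_ge0 l) (expR_ge0 (hn n * l)). have p2 := ler_wpM2r (expR_ge0 (hn n * l)) ln.
  by rewrite [leRHS]mulrDr mulr1 ler_norml; apply/andP; split; lra.
 have l6 : 1 + expR (hn n * l) <= (1 + c0) * w4 by rewrite mulrDl mul1r lerD.
 apply: le_trans (ler_pM (normr_ge0 l) (addr_ge0 ler01 (expR_ge0 _)) l5 l6) _. by apply: eq_leW; ring.
have up s z y' (f : expr) (Kf : R) : Kf <= V -> `|ev f s z y'| <= Kf * wt (eps / 2) z y' -> `|ev f s z y'| <= V * wt (eps / 2) z y'.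
 by move=> hf h; apply: le_trans h _; rewrite ler_wpM2r// ltW ?wt_gt0.
apply: (@dynkin_ext (Mul u L)); first by move=> s z y' /=; ring.
apply: (@dynkin_lim en _ K) => //.
- move=> n; split=> s z y' hs hy'; have [B1 B2] := bound n s z y' hs hy'; rewrite wt_split;
  set w2 := wt (eps / 2) z y'; set w4 := wt (eps / 4) z y' * _ in B1 B2 *.
  rewrite -[ev (en n) s z y']/(ev u s z y' * ((hn n)^-1 * (expR (hn n * ev L s z y') + -1))) normrM.
  have u1 := up _ _ _ _ _ v1 (h1 s z y' hs hy'); rewrite -/w2 in u1. apply: le_trans (ler_pM (normr_ge0 _) (normr_ge0 _) u1 B1) _.
  rewrite (_ : V * w2 * (K5 * (1 + c0) * w4) = V * (K5 * (1 + c0)) * (w2 * w4)); last by ring.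
  by rewrite ler_wpM2r ?mulr_ge0 ?(ltW (wt_gt0 _ _ _))// ler_wpM2l// lerDl mulr_ge0// addr_ge0// ltW.
 rewrite (ev_heat_quot k u lt lx ly s z y' (lt0r_neq0 (hn0 n))).
 have u2 := up _ _ _ _ _ v2 (h2 s z y' hs hy'); have u3 := up _ _ _ _ _ v3 (h3 s z y' hs hy').
 have u4 := up _ _ _ _ _ v4 (h4 s z y' hs hy'). rewrite -/w2 in u2 u3 u4; set E := expR _ in B2 *; have E0 : 0 <= E := expR_ge0 _.
 rewrite -[ev (quot_expr _ _ _ _) s z y']/((hn n)^-1 * (expR (hn n * ev L s z y') + -1)).
 move: (_ * (_ + -1)) (ev (heat k u) s z y') (ev (cross_expr _ _ _ _ _) s z y') (ev (second_expr _ _ _ _) s z y') B1 u2 u3 u4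
  => A C1 C2 C3 B1 u2 u3 u4.
 have hE : hn n * E <= eps * (c0 * w4).
  by apply: ler_pM => //; [exact: ltW|rewrite (le_trans (ltW (hnm n)))// (le_trans me)// ler_pdivrMr// ler_peMr ?(ltW eps0)// ler1n].
 apply: le_trans (ler_normD _ _) _; apply: le_trans (lerD (ler_normD _ _) (lexx _)) _.
 rewrite (normrM A) (normrM E) (normrM (hn n * E)) (ger0_norm E0) (ger0_norm (mulr_ge0 (ltW (hn0 n)) E0)).
 have m1 := ler_pM (normr_ge0 _) (normr_ge0 _) B1 u2. have m2 := ler_pM E0 (normr_ge0 _) B2 u3.
 have m3 := ler_pM (mulr_ge0 (ltW (hn0 n)) E0) (normr_ge0 _) hE u4. apply: le_trans (lerD (lerD m1 m2) m3) _; apply: eq_leW.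
 by rewrite /K; ring.
- move=> s z y'; have [_ q2] := quot_cvg (ev L s z y') hn0 hnc.
 by apply: cvgM; [exact: cvg_cst|exact: q2].
- move=> s z y'; have [q1 q2] := quot_cvg (ev L s z y') hn0 hnc.
 rewrite (_ : (fun n => _) = fun n => ev (quot_expr (hn n) lt lx ly) s z y' * ev (heat k u) s z y'
  + expR (hn n * ev L s z y') * ev (cross_expr k u lt lx ly) s z y' + hn n * expR (hn n * ev L s z y') * ev (second_expr k u lx ly) s z y'); last first.
  by apply/funext => n; rewrite (ev_heat_quot k u lt lx ly s z y' (lt0r_neq0 (hn0 n))).
 rewrite (_ : ev (heat k (Mul u L)) s z y' = ev L s z y' * ev (heat k u) s z y' + 1 * ev (cross_expr k u lt lx ly) s z y' + 0 * 1 * ev (second_expr k u lx ly) s z y').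
  apply: cvgD; last by apply: cvgM; [exact: cvgM|exact: cvg_cst].
  by apply: cvgD; apply: cvgM; by [exact: q1|exact: q2|exact: cvg_cst].
 by rewrite mul1r !mul0r addr0; exact: ev_heat_lin.
Qed.

(** Induction on the polynomial, its variables being linear forms. The exponential in time carries
    the zero-order term of the equation. *)
Lemma dynkin_poly H r : is_poly H -> dynkin (Mul H (exp_expr r 0 0)).
move=> pH; have n0 : `|0 : R| < r0 by rewrite normr0.
have Q1 : Q (Cst 1).
 move=> om p q hp hq; apply: (dynkin_ext (e := exp_expr om p q)).
  by move=> s z y' /=; ring.
 have le2 (z : R) : `|z| < r0 -> `|z| <= eps / 2 by move=> h; rewrite (le_trans (ltW h))// (le_trans r04)// ler_pM2l// lef_pV2 ?posrE// ler_nat.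
 by apply: dynkin_exp; [exact: le2|exact: le2|exact: rn (ltW hp) (ltW hq)].
have Qlin G G' (cc : R) : is_poly G -> is_poly G' -> Q G -> Q G' -> Q (Add G (Mul (Cst cc) G')).
 move=> pG pG' QG QG' om p q hp hq.
 have de f : is_poly f -> Q f -> bounded_exp (Mul f (exp_expr om p q)) /\ dynkin (Mul f (exp_expr om p q)).
  by move=> pf Qf; split; [apply: (@poly_exp_bounded om p q); [exists f|exact: ltW|exact: ltW]|exact: Qf].
 have [_] := dynkin_lin cc (de G pG QG) (de G' pG' QG'). by apply: dynkin_ext => s z y' /=; ring.
have Qext G G' : (forall s z y', ev G s z y' = ev G' s z y') -> Q G -> Q G'.
 move=> h QG om p q hp hq; apply: (dynkin_ext _ (QG om p q hp hq)) => s z y'. by rewrite [LHS]/= h.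
suff h : forall G, is_poly G -> Q G -> Q (Mul G H).
 by apply: (dynkin_ext _ (h (Cst 1) I Q1 r 0 0 n0 n0)) => s z y' /=; ring.
have o1 : `|1 : R| <= 1 by rewrite normr1.
have o0 : `|0 : R| <= 1 by rewrite normr0.
elim: H pH => //= [cc||||e1 h1 e2 h2|e1 h1 e2 h2].
- move=> _ G pG QG; apply: (Qext (Add G (Mul (Cst (cc - 1)) G))); last exact: Qlin.
 by move=> s z y' /=; ring.
- move=> _ G pG QG; apply: (Qext (Mul G (lin_expr 1 0 0))); last exact: dynkin_linear_factor.
 by move=> s z y' /=; ring.
- move=> _ G pG QG; apply: (Qext (Mul G (lin_expr 0 1 0))); last exact: dynkin_linear_factor.
 by move=> s z y' /=; ring.
- move=> _ G pG QG; apply: (Qext (Mul G (lin_expr 0 0 1))); last exact: dynkin_linear_factor.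
 by move=> s z y' /=; ring.
- move=> [p1 p2] G pG QG; apply: (Qext (Add (Mul G e1) (Mul (Cst 1) (Mul G e2)))).
  by move=> s z y' /=; ring.
 by apply: Qlin => //; [exact: h1|exact: h2].
- move=> [p1 p2] G pG QG; apply: (Qext (Mul (Mul G e1) e2)).
  by move=> s z y' /=; ring.
 by apply: h2 => //; exact: h1.
Qed.

(** * The representation of the limit as an expectation *)

Section feynman_kac.
Variables (r : R) (f : R -> R -> R) (h : fun3) (U : nat -> expr) (C1 wl : R).
Hypotheses (T0 : 0 < T) (C10 : 0 <= C1) (pU : forall n, is_poly (U n))
 (Uf : forall n z y', 0 <= y' -> `|ev (U n) T z y' - f z y'| <= n.+1%:R^-1 * wt eps z y')
 (Uh : forall n s z y', 0 <= s < T -> 0 <= y' -> `|ev (heatr k r (U n)) s z y' - h s z y'| <=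
   (n.+1%:R^-1 + (if s <= tcut T n then 0 else C1)) * wt eps z y')
 (Uw : ev (U n) t x y @[n --> \oo] --> wl).

(** The factor e^(r s) turns the operator with zero-order term r into the one without it. *)
Let en n := Mul (U n) (exp_expr r 0 0).

Let heat_en n s z y' : ev (heat k (en n)) s z y' = expR (r * s) * ev (heatr k r (U n)) s z y'.
rewrite [ev (heatr _ _ _) _ _ _]/= -/(ev (heat k (U n)) s z y') !ev_heat /hop /= !mul0r !addr0; ring.
Qed.

(* At time T the source is not controlled by the hypotheses. *)
Let before (phi : fun3) s z y' := if s < T then phi s z y' else 0.
Let src s z y' := expR (r * s) * h s z y'.

Let inv_le1 n : n.+1%:R^-1 <= 1 :> R. by rewrite invf_le1// ler1n. Qed.

Let wt0 z y' : 0 <= wt eps z y'. exact/ltW/wt_gt0. Qed.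

Let f_bound : exists2 K, 0 <= K & forall z y', 0 <= y' -> `|f z y'| <= K * wt eps z y' /\
 forall n, `|ev (U n) T z y'| <= K * wt eps z y'.
have [K K0 hK] := poly_subexp T (pU 0) eps0; exists (K + 1 + 1); first by rewrite !addr_ge0 ?ltW.
move=> z y' hy; have f1 : `|f z y'| <= (K + 1) * wt eps z y'.
 rewrite (_ : f z y' = ev (U 0) T z y' - (ev (U 0) T z y' - f z y')); last by ring.
 rewrite mulrDl; apply: le_trans (ler_normB _ _) (lerD (hK _ _ _ TT hy) _). by apply: le_trans (Uf 0 z hy) _; rewrite ler_wpM2r.
split; first by apply: le_trans f1 _; rewrite ler_wpM2r// lerDl.
move=> n; rewrite (_ : ev (U n) T z y' = f z y' + (ev (U n) T z y' - f z y')); last by ring.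
rewrite [(K + 1 + 1) * _]mulrDl; apply: le_trans (ler_normD _ _) (lerD f1 _).
by apply: le_trans (Uf n z hy) _; rewrite ler_wpM2r.
Qed.

Let h_bound : exists2 K, 0 <= K & dominated (before src) K /\ forall n, dominated (before (ev (heat k (en n)))) K.
have [K K0 hK] := poly_subexp T (poly_heat k (pU 0)) eps0.
have [K' K'0 hK'] := poly_subexp T (pU 0) eps0.
pose E := expR (`|r| * T); pose K2 := K + `|r| * K' + (1 + C1).
have K20 : 0 <= K2 by rewrite !addr_ge0 ?mulr_ge0 ?(ltW K0) ?(ltW K'0).
have er n s z y' : 0 <= s < T -> 0 <= y' -> `|ev (heatr k r (U n)) s z y' - h s z y'| <= (1 + C1) * wt eps z y'.
 move=> hs hy; apply: le_trans (Uh n z hs hy) _; rewrite ler_wpM2r// lerD//. by case: ifP.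
have hh s z y' : 0 <= s < T -> 0 <= y' -> `|h s z y'| <= K2 * wt eps z y'.
 move=> hs hy; have hs' : 0 <= s <= T by move/andP: hs => [-> /ltW].
 rewrite (_ : h s z y' = ev (heatr k r (U 0)) s z y' - (ev (heatr k r (U 0)) s z y' - h s z y')); last by ring.
 rewrite mulrDl; apply: le_trans (ler_normB _ _) (lerD _ (er 0%N _ _ _ hs hy)).
 rewrite mulrDl -mulrA; apply: le_trans (ler_normD _ _) (lerD (hK _ _ _ hs' hy) _). by rewrite normrM ler_wpM2l//; exact: hK'.
have Es s : 0 <= s <= T -> expR (r * s) <= E.
 move=> /andP[s0 sT]; rewrite ler_expR; apply: le_trans (ler_norm _) _. by rewrite normrM (ger0_norm s0) ler_wpM2l.
have E0 : 0 <= E := expR_ge0 _.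
have KE : 0 <= E * (K2 + (1 + C1)) by rewrite mulr_ge0// addr_ge0// addr_ge0.
exists (E * (K2 + (1 + C1))) => //.
have KK : K2 <= K2 + (1 + C1) by rewrite lerDl addr_ge0.
split=> [s z y' hs hy|n s z y' hs hy]; rewrite /before; case: ltP => sT; rewrite ?normr0; try by rewrite mulr_ge0.
 have hs' : 0 <= s < T by move/andP: hs => [-> _].
 rewrite /src normrM ger0_norm ?expR_ge0// -mulrA; apply: (ler_pM (expR_ge0 _) (normr_ge0 _) (Es s hs)).
 by apply: le_trans (hh s z y' hs' hy) _; rewrite ler_wpM2r.
have hs' : 0 <= s < T by move/andP: hs => [-> _].
rewrite heat_en normrM ger0_norm ?expR_ge0// -mulrA; apply: (ler_pM (expR_ge0 _) (normr_ge0 _) (Es s hs)).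
rewrite (_ : ev (heatr k r (U n)) s z y' = h s z y' + (ev (heatr k r (U n)) s z y' - h s z y')); last by ring.
by rewrite mulrDl; apply: le_trans (ler_normD _ _) (lerD (hh _ _ _ hs' hy) (er n _ _ _ hs' hy)).
Qed.

Let src_cvg s z y' : 0 <= s <= T -> 0 <= y' -> before (ev (heat k (en n))) s z y' @[n --> \oo] --> before src s z y'.
move=> hs hy; rewrite /before; case: ltP => sT; last exact: cvg_cst.
have hs' : 0 <= s < T by move/andP: hs => [-> _].
rewrite (_ : (fun n => _) = fun n => expR (r * s) * ev (heatr k r (U n)) s z y'); last by apply/funext => n; exact: heat_en.
apply: cvgM; first exact: cvg_cst.
apply/cvgrPdist_le => e e0; have w0 := wt_gt0 eps z y'.
have e1 : 0 < e / wt eps z y' by rewrite divr_gt0.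
have e2 : 0 < (T - s) / T by rewrite divr_gt0// subr_gt0.
have hm := @cvg_harmonic R; have n1 := @cvgr_dist_le _ _ _ _ _ _ 0 hm _ e1; have n2 := @cvgr_dist_le _ _ _ _ _ _ 0 hm _ e2.
near=> n.
have a1 : `|0 - harmonic n : R| <= e / wt eps z y' by near: n; exact: n1.
have a2 : `|0 - harmonic n : R| <= (T - s) / T by near: n; exact: n2.
rewrite sub0r normrN /harmonic /= gtr0_norm// in a1; rewrite sub0r normrN /harmonic /= gtr0_norm// in a2.
rewrite distrC; apply: le_trans (Uh n z hs' hy) _; rewrite ifT; first by rewrite addr0 -ler_pdivlMr.
rewrite /tcut lerBrDr -lerBrDl; apply: le_trans (_ : T * ((T - s) / T) <= _); first by rewrite ler_pM2l.
by rewrite mulrC divfK// gt_eqF.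
Unshelve. all: by end_near. Qed.

Let measurable_before e : mfun (along (before (ev e))).
have -> : along (before (ev e)) = fun z => along (ev e) z * \1_`]-oo, T[ z.1.
 apply/funext => z; rewrite /along /before indicE.
 rewrite !indicE; have [hz|hz] := boolP (z.1 \in `[t, T]%classic); last by rewrite !mulr0 mul0r.
 have -> : time_of z = z.1 by rewrite /time_of clamp_id//; move: hz; rewrite inE /= in_itv.
 have -> : (z.1 \in `]-oo, T[%classic) = (z.1 < T) by apply/idP/idP; rewrite inE /= in_itv.
 by case: ltP => _; rewrite ?mulr1 ?mulr0 ?mul0r.
apply: measurable_funM; first exact: measurable_along.
by apply: (@measurableT_comp _ _ _ _ _ _ (\1_`]-oo, T[%classic : R -> R)).
Qed.

Let along_src_cvg z : along (before (ev (heat k (en n)))) z @[n --> \oo] --> along (before src) z.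
have /andP[h1 h2] := time_itv z.
by apply: cvgM; [apply: src_cvg; [rewrite (le_trans t0)|exact: Y0]|exact: cvg_cst].
Qed.

Let measurable_src : mfun (along (before src)).
by apply: (@measurable_fun_cvg _ _ _ setT (fun n => along (before (ev (heat k (en n)))))) => [n|z _]; [exact: measurable_before|exact: along_src_cvg].
Qed.

(** The section at time T is negligible for the product measure. *)
Let along_before_ae e : \int[LP]_z along (ev e) z = \int[LP]_z along (before (ev e)) z.
congr fine; apply: ae_eq_integral; [exact: measurableT|apply/measurable_EFinP; exact: measurable_along|apply/measurable_EFinP; exact: measurable_before|].
exists ([set T] `*` [set: Omega]); split; first exact: measurableX.
 transitivity (leb [set T] * P [set: Omega])%E; first exact: product_measure1E. by rewrite lebesgue_measure_set1 mul0e.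
move=> [s w] /= hn; split => //=; apply: contrapT => sT; apply: hn => _.
congr EFin; have [hz|hz] := boolP (t <= s <= T); last by rewrite !along_out.
rewrite !along_E// /before ifT// lt_neqAle; move/andP: hz => [_ ->]; rewrite andbT.
exact/eqP.
Qed.

Let f_cvg w : ev (U n) T (X T w) (Y T w) @[n --> \oo] --> f (X T w) (Y T w).
have [z0] : exists z, z = X T w by exists (X T w).
have y0 := Y0 w TI; move: (X T w) (Y T w) y0 => z y' y0 _.
apply/cvgrPdist_le => e e0; have w0 := wt_gt0 eps z y'.
have e1 : 0 < e / wt eps z y' by rewrite divr_gt0.
have n1 := @cvgr_dist_le _ _ _ _ _ _ 0 (@cvg_harmonic R) _ e1.
near=> n.
have a1 : `|0 - harmonic n : R| <= e / wt eps z y' by near: n; exact: n1.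
rewrite sub0r normrN /harmonic /= gtr0_norm// in a1.
by rewrite distrC; apply: le_trans (Uf n z y0) _; rewrite -ler_pdivlMr.
Unshelve. all: by end_near. Qed.

Let measurable_f : mfun (fun w => f (X T w) (Y T w)).
by apply: (@measurable_fun_cvg _ _ _ setT (fun n w => ev (U n) T (X T w) (Y T w))) => // w _; exact: f_cvg.
Qed.

(** Dynkin's formula for the approximating polynomials; both sides converge by domination with the
    exponential weight. *)
Let limit_identity : \int[P]_w (expR (r * T) * f (X T w) (Y T w)) - expR (r * t) * wl = \int[LP]_z along (before src) z.
have [K K0 hK] := f_bound; have [K' K'0 [d1 d2]] := h_bound.
have eE (v : R) : expR (r * v + (0 * 0 + 0 * 0)) = expR (r * v) by congr expR; ring.
have enE n s z y' : ev (en n) s z y' = expR (r * s) * ev (U n) s z y'.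
 by rewrite /= !mul0r !addr0 mulrC.
have l1 : \int[P]_w ev (en n) T (X T w) (Y T w) @[n --> \oo] --> \int[P]_w (expR (r * T) * f (X T w) (Y T w)).
 apply: (Rintegral_dct _ _ _ (integrable_wt_end (expR (r * T) * K))) => //.
 - exact: measurable_funM.
 - move=> w; rewrite (_ : (fun n => _) = fun n => expR (r * T) * ev (U n) T (X T w) (Y T w)).
   by apply: cvgM; [exact: cvg_cst|exact: f_cvg].
  by apply/funext => n; exact: enE.
 - move=> n w; rewrite enE normrM ger0_norm ?expR_ge0// -mulrA ler_wpM2l ?expR_ge0//.
  by have [_] := hK (X T w) _ (Y0 w TI); apply.
have l2 : ev (en n) t x y @[n --> \oo] --> expR (r * t) * wl.
 rewrite (_ : (fun n => _) = fun n => expR (r * t) * ev (U n) t x y); last by apply/funext => n; exact: enE.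
 by apply: cvgM; [exact: cvg_cst|exact: Uw].
have l3 : \int[LP]_z along (before (ev (heat k (en n)))) z @[n --> \oo] --> \int[LP]_z along (before src) z.
 apply: (Rintegral_dct _ _ _ (integrable_wtK K')) => [n|//|//|n z]; first exact: measurable_before. by apply: along_le; exact: d2.
have E : (fun n => \int[P]_w ev (en n) T (X T w) (Y T w) - ev (en n) t x y) =
  fun n => \int[LP]_z along (before (ev (heat k (en n)))) z.
 by apply/funext => n; rewrite -along_before_ae; exact: (dynkin_poly r (pU n)).
have l4 : \int[P]_w ev (en n) T (X T w) (Y T w) - ev (en n) t x y @[n --> \oo] -->
 \int[P]_w (expR (r * T) * f (X T w) (Y T w)) - expR (r * t) * wl by exact: cvgB.
by rewrite E in l4; exact: (cvg_unique _ l4 l3).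
Qed.

Let src_path w : (fun s => along (before src) (s, w)) = (fun s => expR (r * s) * h s (X s w) (Y s w)) \_ `[t, T[.
apply/funext => s; rewrite /patch; case: ifPn => hs.
 move: hs; rewrite inE /= in_itv /= => /andP[h1 h2]; rewrite along_E ?h1 ?(ltW h2)//. by rewrite /before h2.
have [hz|hz] := boolP (t <= s <= T); last by rewrite along_out.
rewrite along_E// /before ifF//; apply/negP => sT; move/negP: hs; apply.
by rewrite inE /= in_itv /= sT; move/andP: hz => [->].
Qed.

(** Besides the value of the expectation, the identity that gives it is returned in integrated form,
    from which its growth is estimated later. *)
Lemma feynman_kac : [/\ {ae P, forall w, leb.-integrable `[t, T] (fun s => (expR (r * (s - t)) * h s (X s w) (Y s w))%:E)},
 P.-integrable setT (fun w => (payoff T r f h t X Y w)%:E), fine ('E_P[payoff T r f h t X Y])%E = wl,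
 mfun (fun w => f (X T w) (Y T w)) /\ mfun (along (before src)) &
 \int[P]_w (expR (r * T) * f (X T w) (Y T w)) - expR (r * t) * wl = \int[LP]_z along (before src) z].
have [K K0 hK] := f_bound; have [K' K'0 [d1 _]] := h_bound.
have isrc := integrable_along measurable_src d1.
pose G w s := expR (r * (s - t)) * h s (X s w) (Y s w).
pose S w s := along (before src) (s, w).
have mS w : mfun (S w).
 by apply: (measurableT_comp measurable_src); exact: measurable_fun_pair.
have GE w s : `[t, T[%classic s -> G w s = expR (- (r * t)) * S w s.
 move=> hs; rewrite /S (congr1 (fun g => g s) (src_path w)) /patch mem_set// /G mulrA -expRD; congr (expR _ * _); ring.
have mG w : measurable_fun `[t, T[ (G w).
 apply: (eq_measurable_fun (fun s => expR (- (r * t)) * S w s)).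
  by move=> s; rewrite inE => hs; rewrite GE.
 by apply: measurable_funTS; exact: measurable_funM.
(* The source is controlled before T only; adding the single point T affects neither measurability
   nor integrals. *)
have mGT w : measurable_fun `[t, T] (G w).
 rewrite -(@setUitv1 _ _ (BLeft t) T true) ?bnd_simp//. by apply/measurable_funU => //; split => //; exact: measurable_fun_set1.
have SP w : (fun s => (S w s)%:E) \_ `[t, T[ = fun s => (S w s)%:E.
 apply/funext => s; rewrite /patch; case: ifPn => // hs; rewrite /S (congr1 (fun g => g s) (src_path w)) /patch.
 by rewrite (negbTE hs).
have iS w : leb.-integrable setT (EFin \o S w).
 have ci : {within `[t, T], continuous (fun s => K' * wt eps (X s w) (Y s w))}.
  move=> s; apply: cvgM; first exact: cvg_cst.
  apply: (@continuous_comp _ _ _ (fun s : subspace `[t, T] => eps * (`|X s w| + Y s w)) expR s); last exact: continuous_expR.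
  apply: cvgM; first exact: cvg_cst. apply: cvgD; last exact: cY. by apply: cvg_norm; exact: cX.
 have := path_integrable ci (lexx t) (lexx T); rewrite integrable_mkcond// => iw.
 apply: (le_integrable measurableT _ _ iw); first by apply/measurable_EFinP; exact: mS.
 move=> s _; rewrite patchE; have le := along_le (s, w) d1; have [hs|hs] := boolP (t <= s <= T).
  rewrite mem_set ?in_itv//= lee_fin /S; apply: le_trans le _. by rewrite along_E// ler_norm.
 by rewrite memNset /= ?in_itv /= ?/S ?along_out ?normr0 ?lee_fin//; exact/negP.
have iG w : leb.-integrable `[t, T[ (EFin \o G w).
 have iS' : leb.-integrable `[t, T[ (EFin \o S w) by exact: integrableS (iS w).
 have : leb.-integrable `[t, T[ (fun s => ((expR (- (r * t)))%:E * (EFin \o S w) s)%E) by exact: integrableZl.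
 apply: eq_integrable => // s; rewrite inE => hs. by rewrite /= GE.
have iGT w : leb.-integrable `[t, T] (EFin \o G w).
 have /integrableP[_ h1] := iG w. apply/integrableP; split; first by apply/measurable_EFinP; exact: mGT.
 rewrite -(@integral_itv_bndo_bndc _ (BLeft t) T (fun s => `|(EFin \o G w) s|%E))//.
 by apply: measurableT_comp => //; by apply/measurable_EFinP; exact: mG.
have intG w : \int[leb]_(s in `[t, T]) G w s = expR (- (r * t)) * \int[leb]_s S w s.
 rewrite /Rintegral -(@integral_itv_bndo_bndc _ (BLeft t) T (fun s => (G w s)%:E)); last by apply/measurable_EFinP; exact: mG.
 have -> : (\int[leb]_(s in `[t, T[) (G w s)%:E = \int[leb]_(s in `[t, T[) ((expR (- (r * t)))%:E * (S w s)%:E))%E.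
  by apply: eq_integral => s; rewrite inE => hs; rewrite GE.
 have iS' : leb.-integrable `[t, T[ (EFin \o S w) by exact: integrableS (iS w).
 rewrite integralZl// fineM//; last exact: integrable_fin_num. by rewrite integral_mkcond SP.
have pay w : payoff T r f h t X Y w = expR (r * (T - t)) * f (X T w) (Y T w) - expR (- (r * t)) * \int[leb]_s S w s.
 by rewrite -intG.
have i1 : P.-integrable setT (EFin \o (fun w => f (X T w) (Y T w))).
 by apply: (integrable_end measurable_f) => z y' hy; exact: (hK z y' hy).1.
have SE w : (\int[leb]_s S w s)%:E = fubini_G leb (EFin \o along (before src)) w.
 by rewrite /fubini_G /Rintegral fineK//; exact: (integrable_fin_num measurableT (iS w)).
have i2 : P.-integrable setT (EFin \o (fun w => \int[leb]_s S w s)).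
 have mS2 := measurable_int _ isrc. rewrite (_ : EFin \o _ = fubini_G leb (EFin \o along (before src))); last by apply/funext.
 apply/integrableP; split; first exact: (measurable_fubini_G isrc).
 have fin := (integrable21ltyP _ _ mS2).1 isrc; apply: le_lt_trans fin; apply: ge0_le_integral => //.
 - by apply: measurableT_comp => //; exact: (measurable_fubini_G isrc).
 - have ma := measurableT_comp (@abse_measurable R setT) mS2.
  exact: (measurable_fun_fubini_tonelli_G _ ma (fun z => abse_ge0 _)).
 - by move=> w _; apply: le_abse_integral => //; apply/measurable_EFinP; exact: mS.
have i1' := integrableZl measurableT (expR (r * (T - t))) i1.
have i2' := integrableZl measurableT (expR (- (r * t))) i2.
have E2 : \int[P]_w \int[leb]_s S w s = \int[LP]_z along (before src) z.
 congr fine; rewrite -(integral21_prod_meas1 isrc); apply: eq_integral => w _; exact: SE.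
have payE : (fun w => (payoff T r f h t X Y w)%:E) = EFin \o ((fun w => expR (r * (T - t)) * f (X T w) (Y T w)) \- (fun w => expR (- (r * t)) * \int[leb]_s S w s)).
 by apply/funext => w; rewrite pay.
split; [by apply: aeW => w; exact: iGT| | |by split|exact: limit_identity].
 rewrite payE; have := integrableB measurableT i1' i2'; exact.
rewrite unlock payE.
rewrite -[LHS]/(\int[P]_w ((expR (r * (T - t)) * f (X T w) (Y T w)) - (expR (- (r * t)) * \int[leb]_s S w s))).
rewrite RintegralB// !RintegralZl// E2 -limit_identity RintegralZl//.
have -> : expR (r * (T - t)) = expR (- (r * t)) * expR (r * T) by rewrite -expRD; congr expR; ring.
have e1 : expR (- (r * t)) * expR (r * t) = 1 by rewrite -expRD addNr expR0.
by rewrite mulrBr !mulrA e1 mul1r subKr.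
Qed.

End feynman_kac.

End polynomials.

End dynkin.

End heston.
End proof.
Theorem proposition2p7 (R : realType) (T a b c d varrho lam sig rho : R)
  (hT : 0 < T) (ha : 0 < a) (hlam : 0 < lam) (hsig : 0 < sig)
  (hrho : -1 < rho < 1)
  (f : R -> R -> R) (h : R -> R -> R -> R) :
  (forall u v : R -> R -> R -> R,
     classical_solution T a b c d varrho lam sig rho f h u -> poly_growth T u ->
     classical_solution T a b c d varrho lam sig rho f h v -> poly_growth T v ->
     forall t x y : R, 0 <= t <= T -> 0 <= y -> u t x y = v t x y) /\
  (forall alpha : R, 0 < alpha < 1 -> regular_data T alpha f h ->
   forall (disp : measure_display) (Omega : measurableType disp)
     (P : probability Omega R) (F : R -> set (set Omega))
     (W B : R -> Omega -> R)
     (X : R -> R -> R -> R -> Omega -> R) (Y : R -> R -> R -> Omega -> R),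
     filtration F -> brownian_motion2 P F W B ->
     (forall t x y : R, 0 <= t <= T -> 0 <= y ->
        heston_solution P F W B T a b c d lam sig rho t x y (X t x y) (Y t y)) ->
     let Z := fun t x y : R => payoff T varrho f h t (X t x y) (Y t y) in
     let u := fun t x y : R => fine ('E_P[Z t x y])%E in
     [/\ (forall t x y : R, 0 <= t <= T -> 0 <= y ->
            {ae P, forall w, lebesgue_measure.-integrable `[t, T]
               (fun s => (expR (varrho * (s - t)) *
                          h s (X t x y s w) (Y t y s w))%:E)} /\
            P.-integrable setT (fun w => (Z t x y w)%:E)),
         classical_solution T a b c d varrho lam sig rho f h u,
         poly_growth T u &
         forall v : R -> R -> R -> R,
           classical_solution T a b c d varrho lam sig rho f h v ->
           poly_growth T v ->
           forall t x y : R, 0 <= t <= T -> 0 <= y -> v t x y = u t x y]).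
Proof.
have ak : admissible (Prm a b c d lam sig rho) by split.
split=> [u v su gu sv gv t x y ht hy|alpha _ rd disp Omega P F W B X Y hF hWB hXY Z u].
 by apply/le_anti; rewrite (classical_le hT ak su gu sv gv)// (classical_le hT ak sv gv su gu).
pose E := expR ((`|d| + 2 * `|b| + 2) * T); pose D := (2 * lam + 2 * sig) ^+ 2 + (2 * lam) ^+ 2.
have E1 : 1 <= E.
 by rewrite -expR0 ler_expR mulr_ge0 ?(ltW hT)// addr_ge0// addr_ge0// mulr_ge0.
have E0 : 0 < E := lt_le_trans ltr01 E1.
have D0 : 0 < D by apply: ltr_pwDl; [apply: exprn_gt0; lra|exact: sqr_ge0].
pose eps := (E * D)^-1; have eps0 : 0 < eps by rewrite invr_gt0 mulr_gt0.
have epsD : eps * E * D = 1 by rewrite -mulrA mulVf// gt_eqF// mulr_gt0.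
have eps1 : eps * D <= 1.
 by rewrite -epsD ler_pM2r// ler_peMr// ltW.
have r00 : 0 < eps / 4 by rewrite divr_gt0.
have rn p q : `|p| <= eps / 4 -> `|q| <= eps / 4 -> 4 * noise2 lam sig rho p q <= eps.
 move=> hp hq; have := noise2_le (ltW hlam) (ltW hsig) hrho hp hq.
 have -> : (eps / 4) ^+ 2 * ((lam + sig) ^+ 2 + lam ^+ 2) = eps * (eps * D) / 64.
  by rewrite /D; field.
 have := ler_wpM2l (ltW eps0) eps1; rewrite mulr1; lra.
have [U [C [w [[C0 pU] Uf Uh Uw fin]]]] := @analytic_solution R T a b c d varrho lam sig rho alpha eps f h ak hT rd eps0.
(* The source extended by 0 at time T, in the form in which [feynman_kac] returns it. *)
pose hT' s z y' := if s < T then expR (varrho * s) * h s z y' else 0.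
have fk t x y : 0 <= t <= T -> 0 <= y -> [/\ {ae P, forall w, lebesgue_measure.-integrable `[t, T]
    (fun s => (expR (varrho * (s - t)) * h s (X t x y s w) (Y t y s w))%:E)},
  P.-integrable setT (fun w => (Z t x y w)%:E), u t x y = w t x y,
  measurable_fun setT (fun w => f (X t x y T w) (Y t y T w)) /\ measurable_fun setT (along T t (X t x y) (Y t y) hT') &
  \int[P]_w (expR (varrho * T) * f (X t x y T w) (Y t y T w)) - expR (varrho * t) * w t x y =
   \int[(lebesgue_measure \x P)%E]_z along T t (X t x y) (Y t y) hT' z].
 move=> ht hy; have /andP[t0 tT] := ht; have sol := hXY t x y ht hy. have epsK : eps * E * D <= 1 by rewrite epsD.
 have [hA hM] := exp_moment hF hWB t0 tT sol (ltW hlam) (ltW hsig) hrho eps0 epsK.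
 exact: (feynman_kac hF hWB t0 tT sol hrho eps0 hA hM r00 (lexx _) rn hT (ltW C0) pU Uf Uh (Uw t x y ht hy)).
have cs := fin u (fun t x y ht hy => let: And5 _ _ e _ _ := fk t x y ht hy in e).
(* The weight of rate eps would give exponential growth only. For each starting point the moments
   are taken instead at the rate e2 = eps / (1 + |x| + y): they are bounded independently of the
   point, and [weight_rescale] leaves a polynomial factor. *)
have pg : poly_growth T u.
 have [_ [Cf [Lf [Cf0 Lf0 gf]]]] := regular_terminal rd. have [_ [_ [Ch [Lh [Ch0 Lh0 gh]]]]] := regular_source rd.
 pose L := Lf + Lh; have L0 : 0 < L by exact: addr_gt0.
 pose b1 := 1 + 2 * (3 * L / eps) `^ L; have b10 : 0 < b1 by rewrite ltr_pwDl// mulr_ge0// powR_ge0.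
 pose M := 3 * expR (eps + eps * E + (eps * `|c| + eps * E * `|a|) * T).
 pose E2 := expR (`|varrho| * T); have E20 : 0 < E2 := expR_gt0 _. have M0 : 0 < M by rewrite mulr_gt0// expR_gt0.
 have q0 : 0 < 3 * Cf + 3 * Ch * T by rewrite addr_gt0// !mulr_gt0.
 exists (E2 * E2 * (b1 * M * (3 * Cf + 3 * Ch * T))), L; split => //; first by do ?[apply: mulr_gt0 => //].
 move=> t x y ht hy; have /andP[t0 tT] := ht; have sol := hXY t x y ht hy.
 have S1 : 1 <= 1 + `|x| + y by rewrite -addrA lerDl addr_ge0. have S0 := lt_le_trans ltr01 S1.
 pose e2 := eps / (1 + `|x| + y); have e20 : 0 < e2 by rewrite divr_gt0.
 have e2S : e2 * (1 + `|x| + y) = eps by rewrite divfK// gt_eqF. have e2e : e2 <= eps by rewrite -e2S ler_peMr// ltW.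
 have epsK : e2 * E * D <= 1 by rewrite -epsD !ler_pM2r.
 have [hA hM] := exp_moment hF hWB t0 tT sol (ltW hlam) (ltW hsig) hrho e20 epsK. set C2 := 3 * _ in hA hM; have C2M : C2 <= M.
  rewrite /C2 /M ler_pM2l// ler_expR -/E; apply: lerD; [apply: lerD|apply: ler_wpM2r; [exact: ltW|apply: lerD]].
  - by rewrite -[leRHS]e2S ler_wpM2l ?(ltW e20)//; lra.
  - by rewrite mulrAC ler_pM2r// -[leRHS]e2S ler_wpM2l ?(ltW e20)//; have := normr_ge0 x; lra.
  - by rewrite ler_wpM2r.
  - by rewrite ler_wpM2r// ler_pM2r.
 have [_ _ uw [mf mh] id] := fk t x y ht hy.
 pose V := b1 * weight L x y; have W0 : 0 <= weight L x y by rewrite /weight !addr_ge0 ?powR_ge0.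
 have V0 : 0 <= V by rewrite mulr_ge0// ltW.
 have up K L' z y' : 0 < K -> 0 < L' -> L' <= L -> 0 <= y' -> K * weight L' z y' <= 3 * K * V * wt e2 z y'.
  move=> K0 L'0 LL y'0; have := weight_le z L'0 LL y'0. have := weight_rescale x z L0 eps0 hy y'0; rewrite -/b1 -/V -/e2 => h1 h2.
  by have := ler_wpM2l (ltW K0) (le_trans h2 (ler_wpM2l (ler0n _ 3) h1)); rewrite !mulrA [K * 3]mulrC.
 have bf z y' : 0 <= y' -> `|f z y'| <= 3 * Cf * V * wt e2 z y'.
  by move=> y'0; have [q _ _ _] := gf 0 z y' I y'0; apply: (le_trans q); apply: up; rewrite // lerDl ltW.
 have El s : 0 <= s <= T -> expR (varrho * s) <= E2 /\ expR (- (varrho * s)) <= E2.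
  move=> /andP[s0 sT]; rewrite !ler_expR -mulNr; split; apply: le_trans (ler_norm _) _;
   by rewrite normrM ?normrN (ger0_norm s0) ler_wpM2l.
 have bh : dominated T e2 hT' (E2 * (3 * Ch * V)).
  move=> s z y' /[dup] hs /andP[s0 _] y'0; rewrite /hT'; case: ltP => sT; last first.
   by rewrite normr0 !mulr_ge0 ?expR_ge0 ?(ltW Ch0)// ltW// wt_gt0.
  rewrite normrM ger0_norm ?expR_ge0// -mulrA; apply: ler_pM; rewrite ?expR_ge0//; first exact: (El s hs).1.
  have hs' : 0 <= s < T by rewrite s0.
  by have [q _ _ _] := gh s z y' hs' y'0; apply: (le_trans q); apply: up; rewrite // lerDr ltW.
 have k1 : 0 <= E2 * (3 * Cf * V) by rewrite !mulr_ge0// ltW. have k2 : 0 <= E2 * (3 * Ch * V) by rewrite !mulr_ge0// ltW.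
 have TT : 0 <= T <= T by rewrite lexx ltW.
 have bf' z y' : 0 <= y' -> `|expR (varrho * T) * f z y'| <= E2 * (3 * Cf * V) * wt e2 z y'.
  move=> y'0; rewrite normrM ger0_norm ?expR_ge0// -mulrA; apply: ler_pM; rewrite ?expR_ge0 ?bf//; exact: (El T TT).1.
 have mf' := measurable_funM (measurable_cst (expR (varrho * T))) mf.
 have n1 := end_bound (phi := fun z y' => expR (varrho * T) * f z y') hF t0 tT sol hM k1 mf' bf'.
 have n2 := along_bound hF t0 tT sol hA hM k2 mh bh. have C20 : 0 <= C2 by rewrite mulr_ge0 ?expR_ge0.
 rewrite uw; move: id n1 n2; set J1 := Rintegral _ _ _; set J2 := Rintegral _ _ _ => id n1 n2.
 have -> : w t x y = expR (- (varrho * t)) * (J1 - J2).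
  by rewrite -id subKr mulrA -expRD addNr expR0 mul1r.
 rewrite normrM ger0_norm ?expR_ge0//.
 apply: le_trans (ler_pM (expR_ge0 _) (normr_ge0 _) (El t ht).2 (le_trans (ler_normB _ _) (lerD n1 n2))) _.
 have -> : E2 * (E2 * (3 * Cf * V) * C2 + E2 * (3 * Ch * V) * (C2 * (T - t))) =
  E2 * E2 * (V * (C2 * (3 * Cf + 3 * Ch * (T - t)))) by ring.
 rewrite -[leRHS]mulrA ler_wpM2l ?mulr_ge0 ?(ltW E20)//.
 have -> : b1 * M * (3 * Cf + 3 * Ch * T) * weight L x y = V * (M * (3 * Cf + 3 * Ch * T)) by rewrite /V; ring.
 rewrite ler_wpM2l// ler_pM ?addr_ge0 ?mulr_ge0 ?subr_ge0 ?(ltW Cf0) ?(ltW Ch0)//.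
 by rewrite lerD2l ler_wpM2l ?mulr_ge0 ?(ltW Ch0)// gerBl.
split=> // [t x y ht hy|v sv gv t x y ht hy]; first by have [] := fk t x y ht hy.
by apply/le_anti; rewrite (classical_le hT ak sv gv cs pg)// (classical_le hT ak cs pg sv gv).
Qed.
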